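(* Let $(X_t)_{t\ge 0}$ be a regular jump Lévy process in $\mathbf{R}^d$ and let $V$ be a confining $X$-Kato class potential, with Feynman--Kac semigroup $\{T_t: t\ge 0\}$ (all terms as defined in the context). (1) If $\varphi$ is a bounded (possibly negative) function for which there exists $\lambda>0$ such that $e^{\lambda t}T_t\varphi(x)=\varphi(x)$ for every $t>0$ and $x\in\mathbf{R}^d$, then there are a constant $C_5=C_5(X,V,\lambda)$ and $R=R(X,V,\lambda)>0$ such that $$|\varphi(x)|\le C_5\,\|\varphi\|_\infty\,G^V_{B(x,1)}\mathbf{1}(x)\,\nu(x),\qquad |x|\ge R.$$ (2) If $\varphi$ is a strictly positive function for which there exists $\lambda>0$ such that $e^{\lambda t}T_t\varphi(x)=\varphi(x)$ for every $t>0$ and $x\in\mathbf{R}^d$, then there are a constant $C_6=C_6(X,\varphi)$ and $R=R(X,V,\lambda)>0$ such that $$\varphi(x)\ge C_6\,G^V_{B(x,1)}\mathbf{1}(x)\,\nu(x),\qquad |x|\ge R.$$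
   Context: Conventions. $(X_t)_{t\ge0}$ is a Lévy process in $\mathbf{R}^d$, $d\ge1$; $\mathbf{P}^x,\mathbf{E}^x$ refer to the process started at $x$. $B(x,r)$ is the open ball; $\mathbf{1}$ is the function identically $1$. $C, C_i$ denote positive constants; $C(X,a,\dots)$ depends only on the process (and the dimension $d$) and on the listed parameters, and similarly for radii. $f\asymp Cg$ means $C^{-1}g\le f\le Cg$. Regular jump Lévy process: a Lévy process satisfying (A1)--(A3). (A1) $(X_t)$ is symmetric, its Lévy measure is absolutely continuous with a strictly positive density $\nu$, and: (1) for every $0<r\le 1/2$ there is $C_1=C_1(X,r)\ge1$ with $\nu(x)\asymp C_1\nu(y)$ for $r\le|y|\le|x|\le|y|+1$; (2) there is $C_2=C_2(X)\ge1$ with $\nu(x)\le C_2\nu(y)$ for $1/2\le|y|\le|x|$; (3) there is $C_3=C_3(X)\ge1$ with $\int_{|z-x|>1/2,\,|z-y|>1/2}\nu(x-z)\nu(z-y)\,dz\le C_3\nu(x-y)$ for $|y-x|\ge1$. (A2) $(X_t)$ is strong Feller, equivalently it has transition densities $p(t,x,y)=p(t,y-x)$ for $t>0$; moreover there are $t_b>0$ and a constant $C(X,t_b)$ with $0<p(t_b,x)\le C(X,t_b)$ for all $x\in\mathbf{R}^d$. (A3) For all $0<p<q<R\le1$, $\sup_{x\in B(0,p)}\sup_{y\in B(0,q)^c}G_{B(0,R)}(x,y)<\infty$, where for a bounded open set $D$, $G_D(x,y)=\int_0^\infty p_D(t,x,y)\,dt$ for $x,y\in D$ (and $0$ otherwise),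 and $p_D$ is the transition density of the process killed upon exiting $D$. Potentials. A Borel function $V:\mathbf{R}^d\to\mathbf{R}$ belongs to $\mathcal{K}^X$ if $\lim_{t\to0}\sup_x\mathbf{E}^x[\int_0^t|V(X_s)|ds]=0$, and to $\mathcal{K}^X_{\mathrm{loc}}$ if $V\mathbf{1}_B\in\mathcal{K}^X$ for every ball $B$. $V$ is an $X$-Kato class potential if $V_-\in\mathcal{K}^X$ and $V_+\in\mathcal{K}^X_{\mathrm{loc}}$. It is confining if also $V(x)\to\infty$ as $|x|\to\infty$. Feynman--Kac semigroup: $T_tf(x)=\mathbf{E}^x[e^{-\int_0^tV(X_s)ds}f(X_t)]$, $t>0$ (for $f\in L^2(\mathbf{R}^d)$, or $f$ bounded or nonnegative Borel). $V$-Green operator: for an open set $D$ with first exit time $\tau_D=\inf\{t\ge0:X_t\notin D\}$ and $f$ bounded or nonnegative Borel, $G^V_Df(x)=\mathbf{E}^x\big[\int_0^{\tau_D}e^{-\int_0^tV(X_s)ds}f(X_t)\,dt\big]$, $x\in D$. *)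

(* Defs.v *)
From HB Require Import structures.
From mathcomp Require Import all_boot all_order all_algebra.
From mathcomp Require Import all_classical all_reals all_analysis.

Set Implicit Arguments.
Unset Strict Implicit.
Unset Printing Implicit Defensive.

Import Order.TTheory GRing.Theory Num.Theory.
Import numFieldNormedType.Exports.

Local Open Scope classical_set_scope.
Local Open Scope ring_scope.

(* R^d is the type 'rV[R]_d of row vectors, with the sigma-algebra generated by
   the coordinates, which is the Borel one. *)
Definition rV_display : measure_display.
Proof. exact: default_measure_display. Qed.

Section measurable_rV.
Context (R : realType) (n : nat).

Let coors : 'I_n -> 'rV[R]_n -> R := fun i x => x ord0 i.

Let rV_set0 : g_sigma_preimage coors set0.
Proof. exact: sigma_algebra0. Qed.

Let rV_setC A : g_sigma_preimage coors A -> g_sigma_preimage coors (~` A).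
Proof. exact: sigma_algebraC. Qed.

Let rV_bigcup (F : (set 'rV[R]_n)^nat) :
  (forall i, g_sigma_preimage coors (F i)) ->
  g_sigma_preimage coors (\bigcup_i (F i)).
Proof. exact: sigma_algebra_bigcup. Qed.

HB.instance Definition _ := @isMeasurable.Build rV_display
  'rV[R]_n (g_sigma_preimage coors) rV_set0 rV_setC rV_bigcup.

End measurable_rV.

Lemma measurable_coord (R : realType) n (i : 'I_n) :
  measurable_fun [set: 'rV[R]_n] (fun x : 'rV[R]_n => x ord0 i).
Proof.
move=> _ Y mY; rewrite setTI; apply: sub_sigma_algebra => /=.
rewrite -bigcup_seq/=; exists i => /=; first by rewrite mem_index_enum.
by exists Y => //; rewrite setTI.
Qed.

Lemma measurable_fun_coordP d (T : measurableType d) (R : realType) n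
    (f : T -> 'rV[R]_n) :
  measurable_fun [set: T] f <->
  forall i, measurable_fun [set: T] (fun x => f x ord0 i).
Proof.
split=> [mf i|mf]; first exact: (measurableT_comp (measurable_coord i) mf).
apply: (@measurability _ _ _ _ setT f
  (\big[setU/set0]_(i < n)
     preimage_set_system setT (fun x : 'rV[R]_n => x ord0 i) measurable)) => //.
move=> _ [B + <-]; rewrite -bigcup_seq => -[i _ [C mC <-]].
by rewrite setTI; exact: mf.
Qed.

Fixpoint lebesgue_rV (R : realType) (n : nat) : set 'rV[R]_n -> \bar R :=
  match n with
  | 0 => fun A => \d_(0 : 'rV[R]_0) A
  | m.+1 => fun A => (\int[lebesgue_measure]_x
      lebesgue_rV [set v : 'rV[R]_m | A (row_mx (x%:M : 'rV[R]_1) v)])%E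
  end.

Section pack_sigma_finite.
Context d (T : measurableType d) (R : realType).
Variable mu : {measure set T -> \bar R}.
Hypothesis sf_mu : sigma_finite setT mu.

Definition pack_sigma_finite of sigma_finite setT mu : set T -> \bar R := mu.

Let m := pack_sigma_finite sf_mu.

HB.instance Definition _ := Measure.copy m mu.

Let sfinite_mu : sfinite_measure m.
Proof. exact: (@sfinite_measure_sigma_finite _ _ _ mu). Qed.

HB.instance Definition _ := @isSFinite.Build _ _ _ m sfinite_mu.

HB.instance Definition _ := @isSigmaFinite.Build _ _ _ m sf_mu.

End pack_sigma_finite.

Section lebesgue_rV_measure.
Local Open Scope ereal_scope.
Context (R : realType).

Let glue n (u : R * 'rV[R]_n) : 'rV[R]_(1 + n) := row_mx (u.1)%:M u.2.

Let unglue n (v : 'rV[R]_(1 + n)) : R * 'rV[R]_n := (v ord0 ord0, rsubmx v).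

Let glueK n : cancel (@glue n) (@unglue n).
Proof.
move=> [x v]; rewrite /glue /unglue row_mxKr/=; congr pair.
have -> : (ord0 : 'I_(1 + n)) = lshift n ord0 by exact/val_inj.
by rewrite row_mxEl mxE.
Qed.

Let measurable_glue n : measurable_fun setT (@glue n).
Proof.
apply/measurable_fun_coordP => i.
rewrite -(splitK i); case: (fintype.split i) => j /=.
  rewrite (_ : (fun x => _) = fst)//; apply/funext => u.
  by rewrite row_mxEl (ord1 j) mxE.
rewrite (_ : (fun x => _) = (fun v : 'rV[R]_n => v ord0 j) \o snd); last first.
  by apply/funext => u; rewrite row_mxEr.
by apply: measurableT_comp => //; exact: measurable_coord.
Qed.

Let measurable_unglue n : measurable_fun setT (@unglue n).
Proof.
apply/measurable_fun_pair; first exact: measurable_coord.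
apply/measurable_fun_coordP => i.
rewrite (_ : (fun x => _) =
  (fun v : 'rV[R]_(1 + n) => v ord0 (rshift 1 i))); last first.
  by apply/funext => v; rewrite mxE.
exact: measurable_coord.
Qed.

Let lebesgue_rV_sfm n : exists m : {sigma_finite_measure set 'rV[R]_n -> \bar R},
  @lebesgue_rV R n = m :> (set 'rV[R]_n -> \bar R).
Proof.
elim: n => [|n [m mE]]; first by exists \d_(0%R : 'rV[R]_0).
pose mu := @lebesgue_measure R \x m.
have sf_mu : sigma_finite setT mu.
  have /sigma_finiteP[F [TF ndF Foo]] := sigma_finiteT (@lebesgue_measure R).
  have /sigma_finiteP[G [TG ndG Goo]] := sigma_finiteT m.
  exists (fun k => F k `*` G k).
    rewrite -setXTT TF TG predeqE => -[x y]; split.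
      move=> [/= [k _ Fkx] [l _ Gly]]; exists (maxn k l) => //; split.
      - by move: x Fkx; exact/subsetPset/ndF/leq_maxl.
      - by move: y Gly; exact/subsetPset/ndG/leq_maxr.
    by move=> [k _ []/= ? ?]; split; exists k.
  move=> k; have [? ?] := Foo k; have [? ?] := Goo k.
  split; first exact: measurableX.
  by rewrite /mu product_measure1E// lte_mul_pinfty// ge0_fin_numE.
have [nu nuE] : exists nu : {measure set 'rV[R]_(1 + n) -> \bar R},
    nu = pushforward mu (@glue n) :> (set 'rV[R]_(1 + n) -> \bar R).
  by unshelve eexists (pushforward mu (@glue n)); [exact: measurable_glue|].
have sf : sigma_finite setT nu.
  have [F UF Foo] := sf_mu.
  exists (fun k => @unglue n @^-1` F k).
    by rewrite -preimage_bigcup -UF preimage_setT.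
  move=> k; split.
    rewrite -[X in measurable X]setTI; apply: measurable_unglue => //.
    by case: (Foo k).
  rewrite nuE /pushforward -comp_preimage.
  rewrite (_ : _ \o _ = id); last by apply/funext => u; rewrite /= glueK.
  by rewrite preimage_id; case: (Foo k).
exists (pack_sigma_finite sf); apply/funext => A; rewrite /pack_sigma_finite nuE.
rewrite /pushforward /mu /product_measure1/=.
apply: eq_integral => x _; rewrite mE /=; congr (m _).
by apply/seteqP; split => v; rewrite /xsection/= inE.
Qed.

Context (n : nat).

Let lebesgue_rV0 : @lebesgue_rV R n set0 = 0.
Proof. by have [m ->] := lebesgue_rV_sfm n. Qed.

Let lebesgue_rV_ge0 A : 0 <= @lebesgue_rV R n A.
Proof. by have [m ->] := lebesgue_rV_sfm n. Qed.

Let lebesgue_rV_sigma_additive : semi_sigma_additive (@lebesgue_rV R n).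
Proof.
by have [m ->] := lebesgue_rV_sfm n; exact: measure_semi_sigma_additive.
Qed.

HB.instance Definition _ := isMeasure.Build _ _ _ (@lebesgue_rV R n)
  lebesgue_rV0 lebesgue_rV_ge0 lebesgue_rV_sigma_additive.

Let lebesgue_rV_sigma_finite : sigma_finite setT (@lebesgue_rV R n).
Proof. by have [m ->] := lebesgue_rV_sfm n; exact: sigma_finiteT. Qed.

Let lebesgue_rV_sfinite : sfinite_measure (@lebesgue_rV R n).
Proof. exact/sfinite_measure_sigma_finite. Qed.

HB.instance Definition _ :=
  @isSFinite.Build _ _ _ (@lebesgue_rV R n) lebesgue_rV_sfinite.

HB.instance Definition _ :=
  @isSigmaFinite.Build _ _ _ (@lebesgue_rV R n) lebesgue_rV_sigma_finite.

End lebesgue_rV_measure.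

Arguments lebesgue_rV R n A : clear implicits.

Section euclidean.
Context {R : realType} {d : nat}.
Implicit Types x y : 'rV[R]_d.

Definition dotp x y : R := \sum_i x ord0 i * y ord0 i.

(* The library norm of 'rV[R]_d is the sup norm. *)
Definition enorm x : R := Num.sqrt (dotp x x).

Definition eball x (r : R) : set 'rV[R]_d := [set y | enorm (y - x) < r].

End euclidean.

Section levy_process.
Context {R : realType} {dO : measure_display} {Omega : measurableType dO}.
Context {d : nat}.
Variables (P : probability Omega R) (X : R -> Omega -> 'rV[R]_d).

(* Paths are functions on R of which only the values at times t >= 0 matter. *)
Definition cadlag (w : R -> 'rV[R]_d) : Prop :=
  (forall t : R, 0 <= t -> w s @[s --> t^'+] --> w t) /\
  (forall t : R, 0 < t -> cvg (w s @[s --> t^'-])).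

Record levy_process : Prop := LevyProcess {
  levy_measurable : forall t : R, 0 <= t -> measurable_fun setT (X t) ;
  levy_start : {ae P, forall w, X 0 w = 0} ;
  levy_cadlag : {ae P, forall w, cadlag (X ^~ w)} ;
  levy_stationary : forall (s t : R) (A : set 'rV[R]_d),
    0 <= s -> s <= t -> measurable A ->
    P [set w | A (X t w - X s w)] = P [set w | A (X (t - s) w)] ;
  levy_independent : forall (n : nat) (t : nat -> R) (A : nat -> set 'rV[R]_d),
    0 <= t 0 -> (forall i, (i < n)%N -> t i <= t i.+1) ->
    (forall i, measurable (A i)) ->
    P [set w | forall i, (i < n)%N -> A i (X (t i.+1) w - X (t i) w)] =
    (\prod_(i < n) P [set w | A i (X (t i.+1) w - X (t i) w)%R])%E }.

(* E^x[F(X)]: under P^x the process is x + X. *)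
Definition levyE (x : 'rV[R]_d) (F : (R -> 'rV[R]_d) -> \bar R) : \bar R :=
  (\int[P]_w F (fun t => x + X t w)%R)%E.

Definition levy_symmetric : Prop :=
  forall (t : R) (A : set 'rV[R]_d), 0 <= t -> measurable A ->
    P [set w | A (- X t w)] = P [set w | A (X t w)].

(* The Levy-Khintchine formula, with the two integrals below being the real and
   the imaginary part of the jump part of the characteristic exponent. *)
Definition is_levy_measure (mu : {measure set 'rV[R]_d -> \bar R}) : Prop :=
  [/\ mu [set 0] = 0%E,
      (\int[mu]_z (Num.min 1 (enorm z ^+ 2))%:E < +oo)%E &
      exists (b : 'rV[R]_d) (Q : 'M[R]_d),
        [/\ Q^T = Q,
            forall u : 'rV[R]_d, 0 <= dotp (u *m Q) u &
            forall (t : R) (u : 'rV[R]_d), 0 <= t ->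
              let re := - (dotp (u *m Q) u / 2)
                        + \int[mu]_z (cos (dotp u z) - 1) in
              let im := dotp u b
                        + \int[mu]_z (sin (dotp u z)
                                      - dotp u z * \1_(eball 0 1) z) in
              'E_P[fun w => cos (dotp u (X t w))]%E
                = (expR (t * re) * cos (t * im))%:E /\
              'E_P[fun w => sin (dotp u (X t w))]%E
                = (expR (t * re) * sin (t * im))%:E]].

Definition levy_density (nu : 'rV[R]_d -> R) : Prop :=
  measurable_fun setT nu /\
  exists mu : {measure set 'rV[R]_d -> \bar R}, is_levy_measure mu /\
    forall A, measurable A ->
      mu A = (\int[lebesgue_rV R d]_(z in A) (nu z)%:E)%E.

(* The value of nu at the origin plays no role. *)
Definition assumption_A1 (nu : 'rV[R]_d -> R) : Prop :=
  [/\ levy_symmetric, levy_density nu, (forall x : 'rV[R]_d, x != 0 -> 0 < nu x) &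
  [/\ (forall r : R, 0 < r -> r <= 2^-1 ->
         exists C1 : R, 1 <= C1 /\
           forall x y, r <= enorm y -> enorm y <= enorm x ->
             enorm x <= enorm y + 1 ->
             C1^-1 * nu y <= nu x /\ nu x <= C1 * nu y),
      (exists C2 : R, 1 <= C2 /\
         forall x y, 2^-1 <= enorm y -> enorm y <= enorm x ->
           nu x <= C2 * nu y) &
      (exists C3 : R, 1 <= C3 /\
         forall x y : 'rV[R]_d, 1 <= enorm (y - x) ->
           (\int[lebesgue_rV R d]_(z in [set z | (2^-1 < enorm (z - x))%R /\
                                                (2^-1 < enorm (z - y))%R])
              (nu (x - z) * nu (z - y))%:E <= (C3 * nu (x - y))%:E)%E)]].

Definition strong_feller : Prop :=
  forall (t : R) (f : 'rV[R]_d -> R), 0 < t -> measurable_fun setT f ->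
    (exists M : R, forall x, `|f x| <= M) ->
    continuous (fun x => levyE x (fun w => (f (w t))%:E)).

Definition transition_density (p : R -> 'rV[R]_d -> R) : Prop :=
  forall t : R, 0 < t ->
    [/\ measurable_fun setT (p t), (forall x, 0 <= p t x) &
        forall A, measurable A ->
          P [set w | A (X t w)] = (\int[lebesgue_rV R d]_(y in A) (p t y)%:E)%E].

Definition assumption_A2 : Prop :=
  strong_feller /\
  exists p, transition_density p /\
    exists tb C : R, 0 < tb /\ forall x, 0 < p tb x /\ p tb x <= C.

Definition exit_time (D : set 'rV[R]_d) (w : R -> 'rV[R]_d) : \bar R :=
  ereal_inf [set t%:E | t in [set t : R | 0 <= t /\ ~ D (w t)]].

(* The left-hand side of the last clause is P^x(X_t \in A, t < tau_D), written
   as an expectation because the event need only be measurable up to a null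
   set. *)
Definition killed_density (D : set 'rV[R]_d)
    (pD : R -> 'rV[R]_d -> 'rV[R]_d -> R) : Prop :=
  [/\ measurable_fun setT
        (fun u : R * 'rV[R]_d * 'rV[R]_d => pD u.1.1 u.1.2 u.2),
      (forall t x y, 0 <= pD t x y) &
      forall (t : R) x A, 0 < t -> D x -> measurable A ->
        levyE x (fun w =>
          (\1_[set w' | A (w' t) /\ (t%:E < exit_time D w')%E] w)%:E)
        = (\int[lebesgue_rV R d]_(y in A `&` D) (pD t x y)%:E)%E].

Definition green_function (D : set 'rV[R]_d)
    (pD : R -> 'rV[R]_d -> 'rV[R]_d -> R) (x y : 'rV[R]_d) : \bar R :=
  if (x \in D) && (y \in D)
  then (\int[lebesgue_measure]_(t in `]0%R, +oo[) (pD t x y)%:E)%E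
  else 0%E.

(* The transition density of the killed process is determined up to null sets
   only; the supremum is required to be finite for one version of it. *)
Definition assumption_A3 : Prop :=
  forall r : R, 0 < r -> r <= 1 ->
    exists pD, killed_density (eball 0 r) pD /\
      forall p q : R, 0 < p -> p < q -> q < r ->
        (ereal_sup [set green_function (eball 0 r) pD x y
                   | x in eball 0%R p & y in ~` eball 0%R q] < +oo)%E.

Definition regular_jump_levy (nu : 'rV[R]_d -> R) : Prop :=
  [/\ levy_process, assumption_A1 nu, assumption_A2 & assumption_A3].

Definition path_integral (U : 'rV[R]_d -> R) (t : R) (w : R -> 'rV[R]_d)
    : \bar R :=
  (\int[lebesgue_measure]_(s in `[0%R, t]) (U (w s))%:E)%E.

Definition kato (U : 'rV[R]_d -> R) : Prop :=
  measurable_fun setT U /\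
  ereal_sup (range (fun x => levyE x (path_integral (fun y => `|U y|) t)))
    @[t --> 0^'+] --> 0%E.

Definition kato_loc (U : 'rV[R]_d -> R) : Prop :=
  measurable_fun setT U /\
  forall (c : 'rV[R]_d) (r : R), 0 < r ->
    kato (fun x => U x * \1_(eball c r) x).

Definition kato_potential (V : 'rV[R]_d -> R) : Prop :=
  [/\ measurable_fun setT V, kato V^\- & kato_loc V^\+].

Definition confining (V : 'rV[R]_d -> R) : Prop :=
  forall M : R, exists r : R, forall x, r <= enorm x -> M <= V x.

Definition feynman_kac (V : 'rV[R]_d -> R) (t : R) (f : 'rV[R]_d -> R)
    (x : 'rV[R]_d) : \bar R :=
  levyE x (fun w => expeR (- path_integral V t w) * (f (w t))%:E)%E.

Definition V_green (V : 'rV[R]_d -> R) (D : set 'rV[R]_d)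
    (f : 'rV[R]_d -> R) (x : 'rV[R]_d) : \bar R :=
  levyE x (fun w =>
    \int[lebesgue_measure]_(t in [set t : R | (0 <= t)%R /\
                                             (t%:E < exit_time D w)%E])
      (expeR (- path_integral V t w) * (f (w t))%:E))%E.

Definition eigenfunction (V : 'rV[R]_d -> R) (lambda : R)
    (phi : 'rV[R]_d -> R) : Prop :=
  measurable_fun setT phi /\
  forall (t : R) (x : 'rV[R]_d), 0 < t ->
    ((expR (lambda * t))%:E * feynman_kac V t phi x)%E = (phi x)%:E.

End levy_process.

Definition sup_norm (R : realType) (d : nat) (f : 'rV[R]_d -> R) : R :=
  sup (range (fun x => `|f x|)).

(* Main.v *)
(* Let [g] be [nu] outside the unit ball and [1] inside, and let [w] be the
   convolution of [g] with a Gaussian, so that [w] is comparable to [g]. Applied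
   to a Gaussian, the generator of [X] is read off the Levy-Khintchine formula by
   Fourier inversion and is at most of order [g]; the convolution bound (3) of
   (A1) passes this to [w]. Hence [E w(x + X_t) <= e^(K t) w(x)], while suitable
   combinations of Gaussians give [P(x + X_t in B) >= c t nu(x)] for small [t]
   and a fixed ball [B].

   Upper bound. As [V] tends to infinity, Khasminskii's lemma applied to the
   negative part of [V] and to the region where [V - lambda] is small gives the
   crude bound [|phi| <= C |phi|_sup w]. The eigenfunction equation is then
   iterated along a dyadic grid of mesh [delta] while the path stays in a ball
   around [x] of radius less than 1. The barrier [w0 (1 - bump)] vanishes at [x]
   and dominates [g] off that ball, so that each step costs at most
   [C delta nu(x)], and the sum of these costs is [C nu(x) G^V 1(x)].

   Lower bound. At each grid time before leaving [B(x, 1)] the path jumps into a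
   fixed ball with probability at least [c delta nu(x)]; there [phi] is bounded
   below by a positive constant, by the strong Feller property and compactness.

   All this is done for a right-continuous modification starting at 0, for which
   the Markov property is only needed at dyadic times. *)
Require Import Defs.
From mathcomp Require Import all_boot all_order all_algebra.
From mathcomp Require Import all_classical all_reals all_analysis.
From mathcomp Require Import measurable_realfun ring lra.
Import Order.TTheory GRing.Theory Num.Theory.
Import numFieldNormedType.Exports.
Set Implicit Arguments.
Unset Strict Implicit.
Unset Printing Implicit Defensive.
Local Open Scope classical_set_scope.
Local Open Scope ring_scope.

(** * Euclidean norm and integration on row vectors *)

(** In the upper bound the path is followed for a time of order 1/nu(x), so a loss O(delta) per
    step, uniform in x, would not do: it has to be O(delta nu(x)). The obstacle is the potential,
    which is controlled only through expected time integrals. For a potential living in a bounded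
    set, a path started far away must first jump there; [occ_far] makes this quantitative without
    stopping times.

    Gaussians serve twice. Their expectations along the process are Fourier integrals of exp(-t
    Psi), so Taylor's formula in time replaces the theory of the domain of the generator. And a
    product of two Gaussians is a Gaussian, so cutoffs 1 - bump, which force a function to vanish at
    a point, keep it a combination or superposition of bumps.

    Exit times enter through one-sided comparisons. Survival at grid times in a smaller closed ball
    decreases under refinement to something below survival in the open ball; conversely, a grid of
    any fixed mesh already overestimates the Green operator.

    The constant of the lower bound may depend on phi but not on V or lambda: it is a process
    constant times the infimum of phi on a fixed ball, and V affects only the radius and the
    mesh. *)

Section euclid.
Context {R : realType} {d : nat}.
Implicit Types x y z u v : 'rV[R]_d.

Lemma dotpC x y : dotp x y = dotp y x.
Proof. by apply: eq_bigr => i _; rewrite mulrC. Qed.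

Lemma dotpDl x y z : dotp (x + y) z = dotp x z + dotp y z.
Proof. by rewrite -big_split; apply: eq_bigr => i _; rewrite mxE mulrDl. Qed.

Lemma dotpDr x y z : dotp z (x + y) = dotp z x + dotp z y.
Proof. by rewrite dotpC dotpDl !(dotpC z). Qed.

Lemma dotpZl (a : R) x y : dotp (a *: x) y = a * dotp x y.
Proof. by rewrite mulr_sumr; apply: eq_bigr => i _; rewrite mxE mulrA. Qed.

Lemma dotpZr (a : R) x y : dotp x (a *: y) = a * dotp x y.
Proof. by rewrite dotpC dotpZl dotpC. Qed.

Lemma dotpNl x y : dotp (- x) y = - dotp x y.
Proof. by rewrite -scaleN1r dotpZl mulN1r. Qed.

Lemma dotpNr x y : dotp x (- y) = - dotp x y.
Proof. by rewrite dotpC dotpNl dotpC. Qed.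

Lemma dotp0l x : dotp 0 x = 0.
Proof. by rewrite -(scale0r (0 : 'rV[R]_d)) dotpZl mul0r. Qed.

Lemma dotp_ge0 x : 0 <= dotp x x.
Proof. by apply: sumr_ge0 => i _; rewrite -expr2 sqr_ge0. Qed.

Lemma enorm_ge0 x : 0 <= enorm x.
Proof. exact: sqrtr_ge0. Qed.

Lemma sqr_enorm x : enorm x ^+ 2 = dotp x x.
Proof. by rewrite sqr_sqrtr// dotp_ge0. Qed.

Lemma enormN x : enorm (- x) = enorm x.
Proof. by rewrite /enorm dotpNl dotpNr opprK. Qed.

Lemma enorm0 : enorm (0 : 'rV[R]_d) = 0.
Proof. by rewrite /enorm dotp0l sqrtr0. Qed.

Lemma enormZ (a : R) x : enorm (a *: x) = `|a| * enorm x.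
Proof.
by rewrite /enorm dotpZl dotpZr mulrA -expr2 sqrtrM ?sqr_ge0// sqrtr_sqr.
Qed.

(** Cauchy-Schwarz, from |a x - b y|^2 >= 0 with [a = dotp y y] and [b = dotp x y], divided by
    [dotp y y]. *)
Lemma dotp_sqr_le x y : dotp x y ^+ 2 <= dotp x x * dotp y y.
Proof.
have h (a b : R) :
    0 <= a ^+ 2 * dotp x x - 2 * (a * b) * dotp x y + b ^+ 2 * dotp y y.
  have := dotp_ge0 (a *: x - b *: y).
  rewrite dotpDl !dotpDr !dotpNr !dotpNl !dotpZl !dotpZr (dotpC y x).
  by move=> /le_trans -> //; rewrite le_eqVlt; apply/orP; left; apply/eqP; ring.
have xx := dotp_ge0 x; have yy := dotp_ge0 y.
have [y0|y0] := eqVneq (dotp y y) 0.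
  (* With [dotp y y = 0] this choice reads -p^2 (X + 2) >= 0, so [dotp x y] vanishes. *)
  have := h (dotp x y) (dotp x x + 1); rewrite y0.
  set p := dotp x y; set X := dotp x x in xx *; nra.
have {}yy : 0 < dotp y y by rewrite lt_def y0.
have := h (dotp y y) (dotp x y).
rewrite -(subr_ge0 (dotp x y ^+ 2)) -[in X in _ -> X](pmulr_rge0 _ yy).
by move=> /le_trans -> //; rewrite le_eqVlt; apply/orP; left; apply/eqP; ring.
Qed.

Lemma normr_dotp x y : `|dotp x y| <= enorm x * enorm y.
Proof.
rewrite -ler_sqr ?nnegrE ?mulr_ge0 ?enorm_ge0//.
by rewrite (real_normK (num_real _)) exprMn !sqr_enorm dotp_sqr_le.
Qed.

Lemma ler_enormD x y : enorm (x + y) <= enorm x + enorm y.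
Proof.
rewrite -ler_sqr ?nnegrE ?addr_ge0 ?enorm_ge0//.
rewrite sqr_enorm sqrrD !sqr_enorm dotpDl !dotpDr (dotpC y x).
have := normr_dotp x y; have := ler_norm (dotp x y); lra.
Qed.

Lemma ler_enormB x y : enorm (x - y) <= enorm x + enorm y.
Proof. by rewrite (le_trans (ler_enormD _ _))// enormN. Qed.

Lemma enormC x y : enorm (x - y) = enorm (y - x).
Proof. by rewrite -enormN opprB. Qed.

Lemma ler_dist_enorm x y : `|enorm x - enorm y| <= enorm (x - y).
Proof.
rewrite ler_norml; apply/andP; split.
  have := ler_enormB x (x - y); rewrite opprB addrC subrK; lra.
have := ler_enormD (x - y) y; rewrite subrK; lra.
Qed.

Lemma enorm_eq0 x : enorm x = 0 -> x = 0.
Proof.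
move=> x0; apply/rowP => i; rewrite mxE.
have : dotp x x = 0 by rewrite -sqr_enorm x0 expr0n.
move=> /eqP; rewrite psumr_eq0; last by move=> j _; rewrite -expr2 sqr_ge0.
by move=> /allP /(_ i); rewrite mem_index_enum => /(_ isT)/= /eqP/eqP;
  rewrite mulf_eq0 orbb => /eqP.
Qed.

Lemma coord_le_enorm x i : `|x ord0 i| <= enorm x.
Proof.
rewrite -ler_sqr ?nnegrE ?enorm_ge0// sqr_enorm (real_normK (num_real _)) /dotp (bigD1 i)//=.
rewrite -expr2 lerDl; apply: sumr_ge0 => j _; rewrite -expr2 sqr_ge0//.
Qed.

Lemma enorm_le_coord x (c : R) : 0 <= c -> (forall i, `|x ord0 i| <= c) ->
  enorm x <= d%:R * c.
Proof.
move=> c0 xc; rewrite -ler_sqr ?nnegrE ?enorm_ge0 ?mulr_ge0// sqr_enorm.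
apply: (@le_trans _ _ (\sum_(i < d) c ^+ 2)).
  by apply: ler_sum => i _; rewrite -expr2 -(real_normK (num_real _)) ler_sqr ?nnegrE.
rewrite sumr_const card_ord -[leLHS]mulr_natl exprMn ler_wpM2r ?sqr_ge0//.
case: (d) => [|n]; first by rewrite expr0n.
by rewrite expr2 ler_peMr// ler1n.
Qed.

Lemma measurable_dotp : measurable_fun [set: 'rV[R]_d * 'rV[R]_d]
  (fun p => dotp p.1 p.2).
Proof.
apply: measurable_sum => i.
apply: measurable_funM; apply: (measurableT_comp (measurable_coord i));
  [exact: measurable_fst|exact: measurable_snd].
Qed.

Lemma measurable_addrV : measurable_fun [set: 'rV[R]_d * 'rV[R]_d]
  (fun p => p.1 + p.2).
Proof.
apply/measurable_fun_coordP => i.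
apply: (eq_measurable_fun (fun p : 'rV[R]_d * 'rV[R]_d => p.1 ord0 i + p.2 ord0 i)).
  by move=> p _; rewrite mxE.
by apply: measurable_funD; apply: (measurableT_comp (measurable_coord i));
    [exact: measurable_fst|exact: measurable_snd].
Qed.

Lemma measurable_scalerV (c : R) : measurable_fun [set: 'rV[R]_d] (fun x => c *: x).
Proof.
apply/measurable_fun_coordP => i.
rewrite (_ : (fun x => _) = fun p : 'rV[R]_d => c * p ord0 i); last first.
  by apply/funext => p; rewrite mxE.
by apply: measurable_funM => //; exact: measurable_coord.
Qed.

Context {d0} {T : measurableType d0}.
Implicit Types f g : T -> 'rV[R]_d.

Lemma measurable_fun_dotp f g : measurable_fun setT f -> measurable_fun setT g ->
  measurable_fun setT (fun w => dotp (f w) (g w)).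
Proof.
by move=> mf mg; have := measurableT_comp measurable_dotp (measurable_fun_pair mf mg).
Qed.

Lemma measurable_fun_addrV f g : measurable_fun setT f -> measurable_fun setT g ->
  measurable_fun setT (fun w => f w + g w).
Proof.
by move=> mf mg; have := measurableT_comp measurable_addrV (measurable_fun_pair mf mg).
Qed.

Lemma measurable_fun_scalerV (c : R) f : measurable_fun setT f ->
  measurable_fun setT (fun w => c *: f w).
Proof. exact: (measurableT_comp (measurable_scalerV c)). Qed.

Lemma measurable_fun_opprV f : measurable_fun setT f ->
  measurable_fun setT (fun w => - f w).
Proof.
move=> mf; rewrite (_ : (fun w => _) = fun w => (-1) *: f w).
  exact: measurable_fun_scalerV.
by apply/funext => w; rewrite scaleN1r.
Qed.

Lemma measurable_fun_subrV f g : measurable_fun setT f -> measurable_fun setT g ->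
  measurable_fun setT (fun w => f w - g w).
Proof.
by move=> mf mg; apply: measurable_fun_addrV => //; exact: measurable_fun_opprV.
Qed.

Lemma measurable_fun_enorm f : measurable_fun setT f ->
  measurable_fun setT (fun w => enorm (f w)).
Proof.
move=> mf; apply: (measurableT_comp (f := @Num.sqrt R)).
  by apply: continuous_measurable_fun; exact: sqrt_continuous.
exact: measurable_fun_dotp.
Qed.

End euclid.

Section eball.
Context {R : realType} {d : nat}.

Lemma measurable_eball (c : 'rV[R]_d) r : measurable (eball c r).
Proof.
rewrite (_ : eball c r = (fun y => enorm (y - c)) @^-1` `]-oo, r[); last first.
  by apply/seteqP; split => x; rewrite /= in_itv.
rewrite -[X in measurable X]setTI.
have : measurable_fun [set: 'rV[R]_d] (fun y => enorm (y - c)).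
  by apply: measurable_fun_enorm; apply: measurable_fun_subrV.
by apply.
Qed.

Lemma measurable_ecball (c : 'rV[R]_d) r : measurable [set y | enorm (y - c) <= r].
Proof.
rewrite (_ : mkset _ = (fun y => enorm (y - c)) @^-1` `]-oo, r]); last first.
  by apply/seteqP; split => x; rewrite /= in_itv.
rewrite -[X in measurable X]setTI.
have : measurable_fun [set: 'rV[R]_d] (fun y => enorm (y - c)).
  by apply: measurable_fun_enorm; apply: measurable_fun_subrV.
by apply.
Qed.

Lemma continuous_enorm : continuous (@enorm R d).
Proof.
move=> x; apply/(@cvgrPdist_le _ _ _ (nbhs x) (nbhs_filter x)) => e e0; near=> y.
apply: (le_trans (ler_dist_enorm _ _)).
have dp : 0 < (d%:R + 1 : R) by rewrite ltr_wpDl.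
apply: (@le_trans _ _ (d%:R * (e / (d%:R + 1)))).
  apply: enorm_le_coord; first by rewrite divr_ge0// ltW.
  move=> i; apply: (@le_trans _ _ `|x - y|).
    rewrite {2}/Num.norm/= mx_normrE.
    exact: (le_trans _ (le_bigmax _ _ (ord0, i))).
  near: y; apply: cvgr_dist_le; [exact: cvg_id|exact: divr_gt0].
rewrite mulrCA ger_pMr// ler_pdivrMr// mul1r lerDl//.
Unshelve. all: by end_near. Qed.

End eball.

(** * Integrals of functions that may fail to be measurable, and Tonelli *)

Section integral_extra.
Context d (T : measurableType d) (R : realType) (mu : {measure set T -> \bar R}).
Local Open Scope ereal_scope.

(* Neither function need be measurable: the integral of a nonnegative function
   is a supremum over the simple functions below it. *)
Lemma ge0_le_lower_integral (D : set T) (f g : T -> \bar R) :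
  (forall x, D x -> 0 <= f x) -> (forall x, D x -> f x <= g x) ->
  \int[mu]_(x in D) f x <= \int[mu]_(x in D) g x.
Proof.
move=> f0 fg.
have g0 x : D x -> 0 <= g x by move=> Dx; exact: le_trans (f0 _ Dx) (fg _ Dx).
rewrite !ge0_integralE//; apply: le_ereal_sup => _ [h hf <-]; exists h => //.
move=> x; apply: le_trans (hf x) _; rewrite /patch; case: ifPn => // /set_mem Dx.
exact: fg.
Qed.

Lemma ge0_intZl (k : R) (f : T -> \bar R) : (0 <= k)%R ->
  measurable_fun setT f -> (forall x, 0 <= f x) ->
  \int[mu]_x (k%:E * f x) = k%:E * \int[mu]_x f x.
Proof. by move=> k0 mf f0; apply: ge0_integralZl_EFin. Qed.

Lemma ge0_intD (f g : T -> \bar R) :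
  measurable_fun setT f -> (forall x, 0 <= f x) ->
  measurable_fun setT g -> (forall x, 0 <= g x) ->
  \int[mu]_x (f x + g x) = \int[mu]_x f x + \int[mu]_x g x.
Proof. by move=> mf f0 mg g0; apply: ge0_integralD. Qed.

Import HBNNSimple.

(** [levyE] is applied to arbitrary path functionals, among them exit times, whose measurability is
    not at hand. Changing paths on a null set must still leave the integral unchanged: a simple
    function below [f] can be cut to 0 on [N] at no cost, and is then below [g]. *)
Lemma ge0_negligible_lower_integral (N : set T) (f g : T -> \bar R) :
  measurable N -> mu N = 0 ->
  (forall x, 0 <= f x) -> (forall x, 0 <= g x) -> (forall x, ~ N x -> f x <= g x) ->
  \int[mu]_x f x <= \int[mu]_x g x.
Proof.
move=> mN N0 f0 g0 fg; rewrite [leLHS]ge0_integralTE//.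
apply: ge_ereal_sup => _ [h hf <-]; rewrite -integralT_nnsfun.
rewrite (ge0_negligible_integral mN)//=; last first.
- by move=> x _; rewrite lee_fin.
- exact/measurable_EFinP.
rewrite setTD integral_mkcond; apply: ge0_le_lower_integral => x _.
  by rewrite patchE; case: ifP => //; rewrite lee_fin.
rewrite patchE; case: ifPn => [|_]; last exact: g0.
by move=> /set_mem Nx; apply: le_trans (hf x) _; exact: fg.
Qed.

Lemma ge0_negligible_lower_integral_eq (N : set T) (f g : T -> \bar R) :
  measurable N -> mu N = 0 ->
  (forall x, 0 <= f x) -> (forall x, 0 <= g x) -> (forall x, ~ N x -> f x = g x) ->
  \int[mu]_x f x = \int[mu]_x g x.
Proof.
move=> mN N0 f0 g0 fg; apply/eqP; rewrite eq_le; apply/andP; split;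
  apply: (ge0_negligible_lower_integral mN) => // x Nx; rewrite fg//.
Qed.

Lemma negligible_lower_integral_eq (N : set T) (f g : T -> \bar R) :
  measurable N -> mu N = 0 -> (forall x, ~ N x -> f x = g x) ->
  \int[mu]_x f x = \int[mu]_x g x.
Proof.
move=> mN N0 fg; rewrite integralE [RHS]integralE; congr (_ - _);
  apply: (ge0_negligible_lower_integral_eq mN) => // x Nx;
  by rewrite ?funeposE ?funenegE fg.
Qed.

End integral_extra.

Section tonelli.
Context d1 d2 (T1 : measurableType d1) (T2 : measurableType d2) (R : realType).
Variables (m1 : {sigma_finite_measure set T1 -> \bar R})
          (m2 : {sigma_finite_measure set T2 -> \bar R}).
Variable f : T1 -> T2 -> \bar R.
Hypothesis mf : measurable_fun setT (fun p : T1 * T2 => f p.1 p.2).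
Hypothesis f0 : forall x y, (0 <= f x y)%E.

Lemma tonelli :
  (\int[m1]_x \int[m2]_y f x y = \int[m2]_y \int[m1]_x f x y)%E.
Proof. exact: (@fubini_tonelli _ _ _ _ _ m1 m2 (fun p => f p.1 p.2)). Qed.

Lemma measurable_fun_intr : measurable_fun setT (fun x => \int[m2]_y f x y)%E.
Proof. exact: (@measurable_fun_fubini_tonelli_F _ _ _ _ _ m2 (fun p => f p.1 p.2)). Qed.

Lemma measurable_fun_intl : measurable_fun setT (fun y => \int[m1]_x f x y)%E.
Proof. exact: (@measurable_fun_fubini_tonelli_G _ _ _ _ _ m1 (fun p => f p.1 p.2)). Qed.

End tonelli.

(** * Lebesgue measure on row vectors: splitting off a coordinate, translations *)

Section rV_integral.
Context {R : realType}.
Local Open Scope ereal_scope.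
Local Notation leb := (@lebesgue_measure R).

Definition consrV n (u : R * 'rV[R]_n) : 'rV[R]_(n.+1) := row_mx (u.1)%:M u.2 : 'rV[R]_(1 + n).

Lemma consrV0 n u : @consrV n u ord0 ord0 = u.1.
Proof.
rewrite /consrV; have -> : (ord0 : 'I_(n.+1)) = lshift n (ord0 : 'I_1) by exact/val_inj.
by apply: etrans (@row_mxEl R 1 1 n _ _ _ _) _; rewrite mxE.
Qed.

Lemma consrVS n u (i : 'I_n) : @consrV n u ord0 (lift ord0 i) = u.2 ord0 i.
Proof.
rewrite /consrV; have -> : (lift ord0 i : 'I_(n.+1)) = rshift 1 i by exact/val_inj.
exact: etrans (@row_mxEr R 1 1 n _ _ _ _) _.
Qed.

Lemma measurable_consrV n : measurable_fun setT (@consrV n).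
Proof.
apply/measurable_fun_coordP => i; case: (unliftP ord0 i) => [j|] ->.
  rewrite (_ : (fun x => _) = (fun v : 'rV[R]_n => v ord0 j) \o snd); last first.
    by apply/funext => u; rewrite consrVS.
  by apply: measurableT_comp => //; exact: measurable_coord.
by rewrite (_ : (fun x => _) = fst)//; apply/funext => u; rewrite consrV0.
Qed.

Lemma lebesgue_rVS n (A : set 'rV[R]_n.+1) :
  lebesgue_rV R n.+1 A =
  pushforward (leb \x lebesgue_rV R n) (@consrV n) A.
Proof.
rewrite /pushforward/= /product_measure1/=.
apply: eq_integral => x _ /=; congr (lebesgue_rV R n _).
by apply/seteqP; split => v; rewrite /xsection/= inE.
Qed.

Lemma ge0_integral_rVS n (f : 'rV[R]_n.+1 -> \bar R) :
  measurable_fun setT f -> (forall x, 0 <= f x) ->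
  \int[lebesgue_rV R n.+1]_v f v =
  \int[leb]_x \int[lebesgue_rV R n]_v f (consrV (x, v)).
Proof.
move=> mf f0.
transitivity (\int[pushforward (leb \x lebesgue_rV R n) (@consrV n)]_v f v).
  apply: eq_measure_integral; first exact: measurable_consrV.
  by move=> ? A mA _; exact: lebesgue_rVS.
rewrite ge0_integral_pushforward//; last exact: measurable_consrV.
rewrite preimage_setT fubini_tonelli1//=.
by apply: measurableT_comp => //; exact: measurable_consrV.
Qed.

Lemma integral_rVS n (f : 'rV[R]_n.+1 -> \bar R) :
  (lebesgue_rV R n.+1).-integrable setT f ->
  \int[lebesgue_rV R n.+1]_v f v =
  \int[leb]_x \int[lebesgue_rV R n]_v f (consrV (x, v)).
Proof.
move=> intf.
have mf := measurable_int _ intf.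
have if2 : (leb \x lebesgue_rV R n).-integrable setT (f \o @consrV n).
  apply/integrableP; split.
    by apply: measurableT_comp => //; exact: measurable_consrV.
  move: intf => /integrableP[_].
  rewrite ge0_integral_rVS//; last by apply: measurableT_comp.
  rewrite fubini_tonelli1//=.
  apply: measurableT_comp => //; apply: measurableT_comp => //.
  exact: measurable_consrV.
transitivity (\int[pushforward (leb \x lebesgue_rV R n) (@consrV n)]_v f v).
  apply: eq_measure_integral; first exact: measurable_consrV.
  by move=> ? A mA _; exact: lebesgue_rVS.
rewrite integral_pushforward//; last exact: measurable_consrV.
by rewrite -integral12_prod_meas1.
Qed.

Lemma integral_rV0 (f : 'rV[R]_0 -> \bar R) : \int[lebesgue_rV R 0]_v f v = f 0%R.
Proof.
transitivity (\int[\d_(0%R : 'rV[R]_0)]_v f v); first exact: eq_measure_integral.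
rewrite integral_dirac// ?diracT ?mul1e//.
rewrite (_ : f = cst (f 0%R))//; apply/funext => x; congr f.
by apply/rowP => -[].
Qed.

Lemma lebesgue_measureD (a : R) (A : set R) : measurable A ->
  pushforward leb (fun x => (x + a)%R : measurableTypeR R) A = leb A.
Proof.
move=> mA; apply/esym/lebesgue_measure_unique => //=; first exact: measurable_funD.
move=> ? _ [[u v]] _ <-.
rewrite /pushforward/=.
rewrite (_ : _ @^-1` _ = `](u - a)%R, (v - a)%R]%classic); last first.
  by apply/seteqP; split => x/=; rewrite !in_itv/= ltrBlDr lerBrDr.
by rewrite !lebesgue_measure_itv/= !lte_fin ltrD2r -!EFinB opprB addrA subrK.
Qed.

Lemma ge0_integralDr (a : R) (f : R -> \bar R) :
  measurable_fun setT f -> (forall x, 0 <= f x) ->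
  \int[leb]_x f (x + a)%R = \int[leb]_x f x.
Proof.
move=> mf f0; transitivity (\int[pushforward leb (fun x => (x + a)%R : measurableTypeR R)]_x f x).
  rewrite ge0_integral_pushforward ?preimage_setT//.
  exact: measurable_funD.
apply: eq_measure_integral; first exact: measurable_funD.
by move=> ? A mA _; exact: lebesgue_measureD.
Qed.

Lemma consrVD n x (y : 'rV[R]_n.+1) v :
  (consrV (x, v) + y = consrV (x + y ord0 ord0, v + (\row_i y ord0 (lift ord0 i)))%R)%R.
Proof.
apply/rowP => i; rewrite mxE; case: (unliftP ord0 i) => [j|] ->.
  by rewrite !consrVS/= !mxE.
by rewrite !consrV0.
Qed.

Lemma ge0_integral_rVD n (y : 'rV[R]_n) (f : 'rV[R]_n -> \bar R) :
  measurable_fun setT f -> (forall x, 0 <= f x) ->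
  \int[lebesgue_rV R n]_v f (v + y)%R = \int[lebesgue_rV R n]_v f v.
Proof.
elim: n y f => [|n IH] y f mf f0.
  by rewrite !integral_rV0; congr f; apply/rowP => -[].
rewrite !ge0_integral_rVS//; last first.
  by apply: measurableT_comp => //; apply: measurable_fun_addrV.
transitivity (\int[leb]_x \int[lebesgue_rV R n]_v f (consrV (x + y ord0 ord0, v))%R).
  apply: eq_integral => x _; under eq_integral do rewrite consrVD.
  rewrite (IH _ (fun v => f (consrV (x + y ord0 ord0, v))%R))//.
  apply: measurableT_comp => //.
  have mp : measurable_fun setT (fun v : 'rV[R]_n => ((x + y ord0 ord0)%R, v)).
    exact: measurable_fun_pair.
  exact: (measurableT_comp (@measurable_consrV n) mp).
apply: (@ge0_integralDr (y ord0 ord0) (fun x : R => \int[lebesgue_rV R n]_v f (consrV (x, v)))).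
  apply: (@measurable_fun_fubini_tonelli_F _ _ _ _ _ _ (f \o @consrV n)) => //.
  by apply: measurableT_comp => //; exact: measurable_consrV.
  by move=> ?; exact: f0.
by move=> x; apply: integral_ge0 => v _; exact: f0.
Qed.

Lemma ge0_integral_rVB n (y : 'rV[R]_n) (f : 'rV[R]_n -> \bar R) :
  measurable_fun setT f -> (forall x, 0 <= f x) ->
  \int[lebesgue_rV R n]_v f (v - y)%R = \int[lebesgue_rV R n]_v f v.
Proof. exact: ge0_integral_rVD. Qed.

End rV_integral.

(** * Gaussian integrals and their Fourier transforms *)

Section gauss_line.
Context {R : realType}.
Local Notation leb := (@lebesgue_measure R).

Definition gs (c : R) (x : R) : R := expR (- (c * x ^+ 2)).

Lemma measurable_gs c : measurable_fun setT (gs c).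
Proof.
by apply: measurableT_comp => //; apply: measurable_funN; apply: measurable_funM => //.
Qed.

Lemma integrable_gs (c : R) : 0 < c -> leb.-integrable setT (EFin \o gs c).
Proof.
(* The normal density of variance 1/(2c) is a multiple of [gs c]. *)
move=> c0; pose s := Num.sqrt (2 * c)^-1.
have s0 : s != 0 by rewrite gt_eqF// sqrtr_gt0 invr_gt0 mulr_gt0.
have := integrable_normal_pdf 0 s.
move=> /(integrableZl measurableT (normal_peak s)^-1).
apply: eq_integrable => // x _ /=; rewrite -EFinM; congr EFin.
rewrite normal_pdfE// mulrA mulVf ?mul1r; last first.
  by rewrite gt_eqF// normal_peak_gt0.
rewrite /normal_fun /gs subr0 mulNr; congr (expR (- _)).
rewrite sqr_sqrtr; last by rewrite invr_ge0 mulr_ge0// ltW.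
by field; rewrite gt_eqF.
Qed.

Lemma is_derive_gs (c x : R) : is_derive x (1 : R) (gs c) (- (2 * c * x) * gs c x).
Proof.
rewrite /gs; apply: is_derive_eq.
by rewrite /GRing.scale/=; ring.
Qed.

End gauss_line.

Section gauss_fourier_line.
Context {R : realType}.
Local Notation leb := (@lebesgue_measure R).
Local Notation g := (@gs R 2^-1).

Lemma integrable_bounded_gs (f : R -> R) (c M : R) : 0 < c ->
  measurable_fun setT f -> (forall x, `|f x| <= M * gs c x) ->
  leb.-integrable setT (EFin \o f).
Proof.
move=> c0 mf fM.
apply: (le_integrable _ _ _ (integrableZl measurableT M (integrable_gs c0))) => //.
- exact/measurable_EFinP.
- move=> x _ /=; rewrite lee_fin; apply: le_trans (fM x) _.
  exact: ler_norm.
Qed.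

(** Half of the Gaussian exponent is spent on absorbing the factor |x|. *)
Lemma abs_mul_gs_le (x : R) : `|x| * g x <= 4 * gs 4^-1 x.
Proof.
rewrite /gs (_ : - (2^-1 * x ^+ 2) = - (4^-1 * x ^+ 2) + - (4^-1 * x ^+ 2)); last by field.
rewrite expRD mulrA ler_wpM2r ?expR_ge0//.
rewrite expRN ler_pdivrMr ?expR_gt0//.
have := expR_ge1Dx (4^-1 * x ^+ 2).
have : `|x| <= 1 + x ^+ 2.
  rewrite -[x ^+ 2]real_normK ?num_real//; have := normr_ge0 x; nra.
lra.
Qed.

Lemma normr_cos_le1 (x : R) : `|cos x| <= 1.
Proof. by rewrite ler_norml cos_geN1 cos_le1. Qed.

Lemma normr_sin_le1 (x : R) : `|sin x| <= 1.
Proof. by rewrite ler_norml sin_geN1 sin_le1. Qed.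

Lemma measurable_cosR : measurable_fun setT (@cos R).
Proof. by apply: continuous_measurable_fun; exact: continuous_cos. Qed.

Lemma measurable_sinR : measurable_fun setT (@sin R).
Proof. by apply: continuous_measurable_fun; exact: continuous_sin. Qed.

(** Equal to sqrt(2 pi); its positivity allows the normalisation in [gam], where it cancels. *)
Definition gauss_mass : R := \int[leb]_x (g x).

Lemma gauss_massE : (\int[leb]_x (g x)%:E = gauss_mass%:E)%E.
Proof. by rewrite fineK//; apply: integrable_fin_num => //; exact: integrable_gs. Qed.

Lemma gauss_mass_gt0 : 0 < gauss_mass.
Proof.
have s0 : (1 : R) != 0 by rewrite oner_neq0.
have := @integral_normal_pdf R 0 1.
have -> : (fun x => (normal_pdf 0 1 x)%:E) = (fun x => (normal_peak 1)%:E * (g x)%:E)%E :> (R -> \bar R).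
  apply/funext => x; rewrite -EFinM normal_pdfE// /normal_fun /gs subr0; congr (_ * expR _)%:E.
  by rewrite expr1n; field.
rewrite integralZl//; last exact: integrable_gs.
rewrite gauss_massE -EFinM => -[e].
have := @normal_peak_gt0 R 1 s0.
by move=> p0; rewrite -(pmulr_rgt0 _ p0) e.
Qed.


Lemma integrable_trig_gs (f : R -> R) : measurable_fun setT f ->
  (forall x, `|f x| <= 1) -> leb.-integrable setT (EFin \o (fun y => f y * g y)).
Proof.
move=> mf f1; apply: (@integrable_bounded_gs _ 2^-1 1) => //.
  by apply: measurable_funM => //; exact: measurable_gs.
move=> y; rewrite normrM mul1r [`|g y|]ger0_norm ?expR_ge0// ler_piMl ?expR_ge0//.
Qed.

Lemma Rintegral_shift (f : R -> R) (a : R) :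
  leb.-integrable setT (EFin \o f) ->
  \int[leb]_x f (x + a) = \int[leb]_x f x.
Proof.
move=> If; have mf := measurable_int _ If; rewrite /Rintegral; congr fine.
rewrite integralE [RHS]integralE.
congr (_ - _)%E.
  transitivity (\int[leb]_x (EFin \o f)^\+ (x + a)%R)%E.
    by apply: eq_integral => x _; rewrite !funeposE.
  by apply: (@ge0_integralDr R a (EFin \o f)^\+%E) => //; exact: measurable_funepos.
transitivity (\int[leb]_x (EFin \o f)^\- (x + a)%R)%E.
  by apply: eq_integral => x _; rewrite !funenegE.
by apply: (@ge0_integralDr R a (EFin \o f)^\-%E) => //; exact: measurable_funeneg.
Qed.

Lemma Rintegral_opp (f : R -> R) :
  leb.-integrable setT (EFin \o f) ->
  \int[leb]_x f (- x) = \int[leb]_x f x.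
Proof.
move=> If; have mf := measurable_int _ If.
have H (h : R -> \bar R) : measurable_fun setT h -> (forall x, 0 <= h x)%E ->
    (\int[leb]_x h (- x)%R = \int[leb]_x h x)%E.
  move=> mh h0; transitivity (\int[pushforward leb (-%R : _ -> measurableTypeR R)]_x h x)%E.
    by rewrite ge0_integral_pushforward ?preimage_setT.
  by apply: eq_measure_integral => A mA _; exact: lebesgue_measureN.
rewrite /Rintegral; congr fine.
rewrite integralE [RHS]integralE; congr (_ - _)%E.
  transitivity (\int[leb]_x (EFin \o f)^\+ (- x)%R)%E.
    by apply: eq_integral => x _; rewrite !funeposE.
  by apply: (H (EFin \o f)^\+%E) => //; exact: measurable_funepos.
transitivity (\int[leb]_x (EFin \o f)^\- (- x)%R)%E.
  by apply: eq_integral => x _; rewrite !funenegE.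
by apply: (H (EFin \o f)^\-%E) => //; exact: measurable_funeneg.
Qed.

Lemma measurable_funMsin (x : R) : measurable_fun setT (fun y : R => sin (x * y)).
Proof. by apply: (measurableT_comp measurable_sinR); exact: measurable_funM. Qed.

Lemma measurable_funMcos (x : R) : measurable_fun setT (fun y : R => cos (x * y)).
Proof. by apply: (measurableT_comp measurable_cosR); exact: measurable_funM. Qed.

Lemma gauss_sin0 (x : R) : \int[leb]_y (sin (x * y) * g y) = 0.
Proof.
have If : leb.-integrable setT (EFin \o (fun y => sin (x * y) * g y)).
  by apply: integrable_trig_gs => [|y]; [exact: measurable_funMsin|exact: normr_sin_le1].
have := Rintegral_opp If.
under eq_Rintegral do rewrite mulrN sinN mulNr /gs sqrrN.
have -> : \int[leb]_y (- (sin (x * y) * g y)) = - \int[leb]_y (sin (x * y) * g y).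
  by under eq_Rintegral do rewrite -mulN1r; rewrite RintegralZl// mulN1r.
lra.
Qed.

Lemma integrable_id_gs (f : R -> R) : measurable_fun setT f ->
  (forall x, `|f x| <= 1) -> leb.-integrable setT (EFin \o (fun y => y * f y * g y)).
Proof.
move=> mf f1; apply: (@integrable_bounded_gs _ 4^-1 4) => //.
  by apply: measurable_funM; [exact: measurable_funM|exact: measurable_gs].
move=> y; rewrite !normrM [`|g y|]ger0_norm ?expR_ge0//.
apply: le_trans (abs_mul_gs_le y); rewrite ler_wpM2r ?expR_ge0//.
by rewrite ler_piMr.
Qed.

(* Differentiating [h |-> \int sin (x (y+h)) exp (-(y+h)^2/2) dy], which is
   constant by translation invariance. *)
Lemma gauss_by_parts (x : R) :
  \int[leb]_y (y * sin (x * y) * g y) = x * \int[leb]_y (cos (x * y) * g y).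
Proof.
pose f (h y : R) := sin (x * (y + h)) * g (y + h).
pose df (h y : R) := x * cos (x * (y + h)) * g (y + h) - (y + h) * sin (x * (y + h)) * g (y + h).
have fD h y : is_derive h (1 : R) (f ^~ y) (df h y).
  rewrite /f; have ? := is_derive_gs 2^-1 (y + h).
  by apply: is_derive_eq; rewrite /GRing.scale/= /df; field.
have Icos : leb.-integrable setT (EFin \o (fun y => cos (x * y) * g y)).
  by apply: integrable_trig_gs => [|y]; [exact: measurable_funMcos|exact: normr_cos_le1].
have Isin : leb.-integrable setT (EFin \o (fun y => y * sin (x * y) * g y)).
  by apply: integrable_id_gs => [|y]; [exact: measurable_funMsin|exact: normr_sin_le1].
have If0 : leb.-integrable setT (EFin \o (fun y => sin (x * y) * g y)).
  by apply: integrable_trig_gs => [|y]; [exact: measurable_funMsin|exact: normr_sin_le1].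
(* Dominating functions, uniform over |h| < 1. From (y + 2h)^2 >= 0 one gets (y + h)^2 / 2 >= y^2 /
   4 - h^2 / 2, at the price of a factor e^(1/2) <= 3. *)
have gsh (h y : R) : `|h| < 1 -> g (y + h) <= 3 * gs 4^-1 y.
  move=> h1; have -> : 3 * gs 4^-1 y = 3 * expR (- (4^-1 * y ^+ 2)) by [].
  have e3 : expR 2^-1 <= 3 :> R.
    have := expR_ge1Dx (- 2^-1 : R); rewrite expRN => e1.
    have e0 := expR_gt0 (2^-1 : R).
    rewrite -(ler_pV2) ?inE ?unitfE ?gt_eqF//=; lra.
  apply: (@le_trans _ _ (expR 2^-1 * expR (- (4^-1 * y ^+ 2)))); last by rewrite ler_wpM2r ?expR_ge0.
  rewrite -expRD ler_expR.
  have : h ^+ 2 <= 1 by rewrite -[h ^+ 2]real_normK ?num_real// expr_le1// ltW.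
  have := sqr_ge0 (y + 2 * h); nra.
have gsd (h y : R) : `|h| < 1 -> `|y + h| * g (y + h) <= 4 * (3 * gs 8^-1 y).
  move=> h1; apply: (le_trans (abs_mul_gs_le _)); rewrite ler_wpM2l//.
  have e3 : expR 2^-1 <= 3 :> R.
    have := expR_ge1Dx (- 2^-1 : R); rewrite expRN => e1.
    have e0 := expR_gt0 (2^-1 : R).
    rewrite -(ler_pV2) ?inE ?unitfE ?gt_eqF//=; lra.
  apply: (@le_trans _ _ (expR 2^-1 * expR (- (8^-1 * y ^+ 2)))); last by rewrite ler_wpM2r ?expR_ge0.
  rewrite /gs -expRD ler_expR.
  have : h ^+ 2 <= 1 by rewrite -[h ^+ 2]real_normK ?num_real// expr_le1// ltW.
  have := sqr_ge0 (y + 2 * h); nra.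
pose G (y : R) := `|x| * (3 * gs 4^-1 y) + 4 * (3 * gs 8^-1 y).
have iG : leb.-integrable setT (EFin \o G).
  have -> : EFin \o G = (fun y => (`|x| * 3)%:E * (gs 4^-1 y)%:E + 12%:E * (gs 8^-1 y)%:E)%E.
    apply/funext => y; rewrite /= -!EFinM -EFinD; congr EFin; rewrite /G; ring.
  apply: integrableD => //; apply: integrableZl => //; exact: integrable_gs.
have m1 : (-1 : R) < 1 by rewrite ltrN10 || lra.
have U0 : `]-1, 1[%classic (0 : R) by rewrite /= in_itv/=; apply/andP; split; lra.
have ifx h : `](-1 : R), 1[%classic h -> leb.-integrable setT (EFin \o f h).
  rewrite /= in_itv/= => h1; apply: (@integrable_bounded_gs _ 4^-1 3) => //.
    rewrite /f; apply: measurable_funM.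
      apply: (measurableT_comp measurable_sinR); apply: measurable_funM => //; exact: measurable_funD.
    by apply: (measurableT_comp (measurable_gs _)); exact: measurable_funD.
  move=> y; rewrite /f normrM [`|g _|]ger0_norm ?expR_ge0//.
  apply: le_trans (gsh h y _); first by rewrite ler_piMl ?expR_ge0 ?normr_sin_le1.
  by rewrite ltr_norml.
have := @differentiation_under_integral R _ _ leb f setT measurableT 0 (-1) 1 U0 ifx
  (fun h y _ _ => @ex_derive _ _ _ _ _ _ _ (fD h y)) G _ iG _.
have dE h y : partial1of2 f h y = df h y.
  by rewrite partial1of2E; apply: derive_val.
move=> /(_ _ _) H.
have {H} : (fun h : R => \int[leb]_(y in setT) f h y)^`()%classic 0 = \int[leb]_y df 0 y.
  rewrite H; first by apply: eq_Rintegral => y _; rewrite dE.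
    by move=> y; rewrite addr_ge0// mulr_ge0// mulr_ge0// expR_ge0.
  move=> h y; rewrite /= in_itv/= -ltr_norml => h1 _; rewrite dE /df.
  apply: (le_trans (ler_normB _ _)); apply: lerD.
    rewrite !normrM [`|g _|]ger0_norm ?expR_ge0// -mulrA ler_wpM2l//.
    by apply: le_trans (gsh h y _) => //; rewrite ler_piMl ?expR_ge0 ?normr_cos_le1.
  rewrite !normrM [`|g _|]ger0_norm ?expR_ge0//.
  apply: le_trans (gsd h y _) => //; rewrite -mulrA ler_wpM2l//.
  by rewrite ler_piMl ?expR_ge0 ?normr_sin_le1.
have -> : (fun h : R => \int[leb]_y f h y) = cst (\int[leb]_y (sin (x * y) * g y)).
  by apply/funext => h; rewrite /f (@Rintegral_shift (fun y => sin (x * y) * g y)).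
rewrite derive1_cst /df.
under eq_Rintegral do rewrite addr0 -mulrA.
rewrite RintegralB//; last first.
  have -> : EFin \o (fun y => x * (cos (x * y) * g y)) = (fun y => x%:E * (cos (x * y) * g y)%:E)%E.
    by apply/funext => y; rewrite /= EFinM.
  exact: integrableZl.
rewrite RintegralZl// => /esym/eqP; rewrite subr_eq0 => /eqP ->.
by [].
Qed.

(** The transform [F] satisfies F' = - x F by [gauss_by_parts], so F(x) e^(x^2/2) is constant and
    equal to F(0). *)
Lemma gauss_cos (x : R) :
  \int[leb]_y (cos (x * y) * g y) = gauss_mass * expR (- (2^-1 * x ^+ 2)).
Proof.
pose F (x : R) := \int[leb]_y (cos (x * y) * g y).
have FD z : is_derive z (1 : R) F (- (z * F z)).
  pose f (a y : R) := cos (a * y) * g y.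
  pose df (a y : R) := - (y * sin (a * y) * g y).
  have fD a y : is_derive a (1 : R) (f ^~ y) (df a y).
    rewrite /f; apply: is_derive_eq; rewrite /GRing.scale/= /df; ring.
  have U0 : `](z - 1), (z + 1)[%classic (z : R) by rewrite /= in_itv/=; apply/andP; split; lra.
  have ifx a : `](z - 1), (z + 1)[%classic a -> leb.-integrable setT (EFin \o f a).
    by move=> _; apply: integrable_trig_gs => [|y]; [exact: measurable_funMcos|exact: normr_cos_le1].
  pose G (y : R) := 4 * gs 4^-1 y.
  have G0 y : 0 <= G y by rewrite mulr_ge0// expR_ge0.
  have iG : leb.-integrable setT (EFin \o G).
    have -> : EFin \o G = (fun y => 4%:E * (gs 4^-1 y)%:E)%E by apply/funext => y.
    by apply: integrableZl => //; exact: integrable_gs.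
  have dE a y : partial1of2 f a y = df a y.
    by rewrite partial1of2E; apply: derive_val.
  have dG a y : `](z - 1), (z + 1)[%classic a -> setT y -> `|partial1of2 f a y| <= G y.
    move=> _ _; rewrite dE normrN !normrM [`|g _|]ger0_norm ?expR_ge0//.
    apply: le_trans (abs_mul_gs_le y); rewrite ler_wpM2r ?expR_ge0//.
    by rewrite ler_piMr// normr_sin_le1.
  have H1 := @derivable_under_integral R _ _ leb f setT measurableT z _ _ U0 ifx
    (fun h y _ _ => @ex_derive _ _ _ _ _ _ _ (fD h y)) G G0 iG dG.
  have H2 := @differentiation_under_integral R _ _ leb f setT measurableT z _ _ U0 ifx
    (fun h y _ _ => @ex_derive _ _ _ _ _ _ _ (fD h y)) G G0 iG dG.
  apply: DeriveDef => //; rewrite -derive1E H2.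
  under eq_Rintegral do rewrite dE /df -mulN1r.
  rewrite RintegralZl// ?gauss_by_parts ?mulN1r//.
  by apply: integrable_id_gs => [|y]; [exact: measurable_funMsin|exact: normr_sin_le1].
have E0 a b : F a * expR (2^-1 * a ^+ 2) = F b * expR (2^-1 * b ^+ 2).
  apply: (@is_derive_0_is_cst R (fun x => F x * expR (2^-1 * x ^+ 2))) => z.
  have ? := FD z; by apply: is_derive_eq; rewrite /GRing.scale/=; field.
have := E0 x 0; rewrite expr0n/= mulr0 expR0 mulr1 {2}/F.
under eq_Rintegral do rewrite mul0r cos0 mul1r.
by rewrite -/gauss_mass => <-; rewrite -mulrA -expRD subrr expR0 mulr1.
Qed.

End gauss_fourier_line.

Section gauss_rV.
Context {R : realType}.
Local Notation leb := (@lebesgue_measure R).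

Definition gsV n (c : R) (x : 'rV[R]_n) : R := expR (- (c * dotp x x)).

Lemma gsV_ge0 n c (x : 'rV[R]_n) : 0 <= gsV c x.
Proof. exact: expR_ge0. Qed.

Lemma measurable_gsV n c : measurable_fun setT (@gsV n c).
Proof.
apply: measurableT_comp => //; apply: measurable_funN; apply: measurable_funM => //.
exact: measurable_fun_dotp.
Qed.

Lemma dotp_consrV n (a : R) (v : 'rV[R]_n) (x : 'rV[R]_n.+1) :
  dotp (consrV (a, v)) x = a * x ord0 ord0 + dotp v (\row_i x ord0 (lift ord0 i)).
Proof.
rewrite /dotp big_ord_recl consrV0/=; congr (_ + _).
by apply: eq_bigr => i _; rewrite consrVS/= mxE.
Qed.

Lemma gsV_consrV n c a (v : 'rV[R]_n) : gsV c (consrV (a, v)) = gs c a * gsV c v.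
Proof.
rewrite /gsV /gs -expRD dotp_consrV consrV0/=; congr expR.
have -> : (\row_i consrV (a, v) ord0 (lift ord0 i)) = v.
  by apply/rowP => i; rewrite mxE consrVS.
ring.
Qed.

Lemma integrable_gsV n c : 0 < c ->
  (lebesgue_rV R n).-integrable setT (EFin \o @gsV n c).
Proof.
move=> c0; apply/integrableP; split; first by apply/measurable_EFinP; exact: measurable_gsV.
under eq_integral do rewrite /= ger0_norm ?gsV_ge0//.
elim: n => [|n IH]; first by rewrite integral_rV0 ltry.
have mg m : measurable_fun [set: 'rV[R]_m] (fun v : 'rV[R]_m => (gsV c v)%:E).
  by apply/measurable_EFinP; exact: measurable_gsV.
rewrite ge0_integral_rVS; [|exact: mg|by move=> x; rewrite lee_fin gsV_ge0].
have E x : (\int[lebesgue_rV R n]_v (gsV c (consrV (x, v)))%:E =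
    (gs c x)%:E * \int[lebesgue_rV R n]_v (gsV c v)%:E)%E.
  under eq_integral => v _ do rewrite gsV_consrV EFinM.
  by apply: ge0_intZl; [exact: expR_ge0|exact: mg|move=> v; rewrite lee_fin gsV_ge0].
under eq_integral => x _ do rewrite E.
rewrite ge0_integralZr//; [|by apply/measurable_EFinP; exact: measurable_gs|by move=> v _; rewrite lee_fin expR_ge0|by apply: integral_ge0 => v _; rewrite lee_fin gsV_ge0].
rewrite lte_mul_pinfty//.
- by apply: integral_ge0 => v _; rewrite lee_fin expR_ge0.
- by apply: integrable_fin_num => //; exact: integrable_gs.
Qed.

Lemma integrable_le_gsV n (f : 'rV[R]_n -> R) (c M : R) : 0 < c ->
  measurable_fun setT f -> (forall x, `|f x| <= M * gsV c x) ->
  (lebesgue_rV R n).-integrable setT (EFin \o f).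
Proof.
move=> c0 mf fM.
apply: (le_integrable _ _ _ (integrableZl measurableT M (integrable_gsV n c0))) => //.
- exact/measurable_EFinP.
- move=> x _ /=; rewrite lee_fin; apply: le_trans (fM x) _.
  exact: ler_norm.
Qed.

Lemma integrable_bounded_gsV n (f : 'rV[R]_n -> R) (M : R) :
  measurable_fun setT f -> (forall x, `|f x| <= M) ->
  (lebesgue_rV R n).-integrable setT (EFin \o (fun x => f x * gsV 2^-1 x)).
Proof.
move=> mf fM; apply: (@integrable_le_gsV _ _ 2^-1 M) => //.
  by apply: measurable_funM => //; exact: measurable_gsV.
by move=> x; rewrite normrM [`|gsV _ _|]ger0_norm ?gsV_ge0// ler_wpM2r ?gsV_ge0.
Qed.

Lemma Rintegral_rVS n (f : 'rV[R]_n.+1 -> R) :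
  (lebesgue_rV R n.+1).-integrable setT (EFin \o f) ->
  (forall x, (lebesgue_rV R n).-integrable setT (EFin \o (fun v => f (consrV (x, v))))) ->
  \int[lebesgue_rV R n.+1]_v f v =
  \int[leb]_x \int[lebesgue_rV R n]_v f (consrV (x, v)).
Proof.
move=> If Ifx; rewrite /Rintegral (integral_rVS If); congr fine.
apply: eq_integral => x _; rewrite fineK//.
exact: (integrable_fin_num measurableT (Ifx x)).
Qed.

Lemma measurable_dotpl n (x : 'rV[R]_n) : measurable_fun setT (fun y => dotp y x).
Proof. exact: measurable_fun_dotp. Qed.

(** Cosine and sine go together because the addition formulas mix them when a coordinate is split
    off. *)
Lemma gauss_fourier n (x : 'rV[R]_n) :
  \int[lebesgue_rV R n]_y (cos (dotp y x) * gsV 2^-1 y) = (@gauss_mass R) ^+ n * gsV 2^-1 x /\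
  \int[lebesgue_rV R n]_y (sin (dotp y x) * gsV 2^-1 y) = 0.
Proof.
have mc m (y : 'rV[R]_m) : measurable_fun setT (fun v => cos (dotp v y)).
  exact: (measurableT_comp measurable_cosR (measurable_dotpl y)).
have ms m (y : 'rV[R]_m) : measurable_fun setT (fun v => sin (dotp v y)).
  exact: (measurableT_comp measurable_sinR (measurable_dotpl y)).
elim: n x => [|n IH] x.
  rewrite /Rintegral !integral_rV0/= /gsV (_ : x = 0); last by apply/rowP => -[].
  by rewrite !dotp0l mulr0 oppr0 expR0 cos0 sin0 expr0 !mulr1.
pose t : 'rV[R]_n := \row_i x ord0 (lift ord0 i).
have [Ic Is] := IH t.
have Icos := integrable_bounded_gsV (mc _ t) (fun v => normr_cos_le1 (dotp v t)).
have Isin := integrable_bounded_gsV (ms _ t) (fun v => normr_sin_le1 (dotp v t)).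
have xE (a : R) (v : 'rV[R]_n) : dotp (consrV (a, v)) x = x ord0 ord0 * a + dotp v t.
  by rewrite dotp_consrV mulrC.
have ZE (h : 'rV[R]_n -> R) k : (lebesgue_rV R n).-integrable setT (EFin \o h) ->
    (lebesgue_rV R n).-integrable setT (EFin \o (fun v => k * h v)).
  move=> Ih; have -> : EFin \o (fun v => k * h v) = (fun v => k%:E * (h v)%:E)%E.
    by apply/funext => v; rewrite /= EFinM.
  exact: integrableZl.
have E1 a v : cos (dotp (consrV (a, v)) x) * gsV 2^-1 (consrV (a, v)) =
    (cos (x ord0 ord0 * a) * gs 2^-1 a) * (cos (dotp v t) * gsV 2^-1 v) -
    (sin (x ord0 ord0 * a) * gs 2^-1 a) * (sin (dotp v t) * gsV 2^-1 v).
  rewrite gsV_consrV xE cosD; ring.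
have E2 a v : sin (dotp (consrV (a, v)) x) * gsV 2^-1 (consrV (a, v)) =
    (sin (x ord0 ord0 * a) * gs 2^-1 a) * (cos (dotp v t) * gsV 2^-1 v) +
    (cos (x ord0 ord0 * a) * gs 2^-1 a) * (sin (dotp v t) * gsV 2^-1 v).
  rewrite gsV_consrV xE sinD; ring.
split.
- rewrite Rintegral_rVS; last 2 first.
  + by apply: (integrable_bounded_gsV (M := 1)) => // v; exact: normr_cos_le1.
  + move=> a; under eq_fun do rewrite E1.
    exact: (integrableB measurableT (ZE _ _ Icos) (ZE _ _ Isin)).
  under eq_Rintegral => a _.
    under eq_Rintegral => v _ do rewrite E1.
    rewrite RintegralB ?RintegralZl ?Ic ?Is ?mulr0 ?subr0//; [|exact: ZE|exact: ZE].
    over.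
  rewrite RintegralZr ?gauss_cos//; last first.
    by apply: integrable_trig_gs => [|y]; [exact: measurable_funMcos|exact: normr_cos_le1].
  rewrite (exprS gauss_mass) [in RHS]/gsV.
  have -> : dotp x x = x ord0 ord0 ^+ 2 + dotp t t.
    rewrite /dotp big_ord_recl/= -expr2; congr (_ + _).
    by apply: eq_bigr => i _; rewrite !mxE.
  by rewrite mulrDr opprD expRD /gsV /gs; ring.
- rewrite Rintegral_rVS; last 2 first.
  + by apply: (integrable_bounded_gsV (M := 1)) => // v; exact: normr_sin_le1.
  + move=> a; under eq_fun do rewrite E2.
    exact: (integrableD measurableT (ZE _ _ Icos) (ZE _ _ Isin)).
  under eq_Rintegral => a _.
    under eq_Rintegral => v _ do rewrite E2.
    rewrite RintegralD ?RintegralZl ?Ic ?Is ?mulr0 ?addr0//; [|exact: ZE|exact: ZE].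
    over.
  rewrite RintegralZr ?gauss_sin0 ?mul0r//.
  by apply: integrable_trig_gs => [|y]; [exact: measurable_funMsin|exact: normr_sin_le1].
Qed.

End gauss_rV.

(** * Lebesgue densities and the convolution bound *)

Section density.
Context d (T : measurableType d) (R : realType).
Variables (mu la : {measure set T -> \bar R}) (D : set T) (k : T -> R).
Hypotheses (mD : measurable D) (mk : measurable_fun D k).
Hypothesis k0 : forall x, D x -> 0 <= k x.
Hypothesis muE : forall A, measurable A -> A `<=` D ->
  mu A = (\int[la]_(x in A) (k x)%:E)%E.
Local Open Scope ereal_scope.

Import HBNNSimple.

(** Approximation by simple functions. The density is nonnegative only on [D]; in the application
    [D] is the complement of the origin, where the Levy density is positive. *)
Lemma ge0_integral_density (f : T -> \bar R) :
  measurable_fun setT f -> (forall x, 0 <= f x) ->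
  \int[mu]_(x in D) f x = \int[la]_(x in D) (f x * (k x)%:E).
Proof.
pose h x := (k x)%:E.
have mh : measurable_fun D h by exact/measurable_EFinP.
have h0 x : D x -> 0 <= h x by rewrite lee_fin; exact: k0.
move=> mf f0; have mfD : measurable_fun D f := measurable_funTS mf.
pose f_ := nnsfun_approx mD mfD.
transitivity (limn (fun n => \int[mu]_(x in D) (f_ n x)%:E)).
  rewrite -monotone_convergence//.
  - by apply: eq_integral => x /set_mem Dx; apply/esym/cvg_lim => //; apply: cvg_nnsfun_approx.
  - by move=> n; apply/measurable_EFinP; exact: measurable_funTS.
  - by move=> n x _; rewrite lee_fin.
  - by move=> x _ m n mn; rewrite lee_fin; exact/lefP/nd_nnsfun_approx.
transitivity (limn (fun n => \int[la]_(x in D) ((f_ n x)%:E * h x))); last first.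
  rewrite -monotone_convergence//.
  - apply: eq_integral => x /set_mem Dx; apply/cvg_lim => //.
    by apply: cvgeZr => //; apply: cvg_nnsfun_approx.
  - move=> n; apply: emeasurable_funM => //.
    by apply/measurable_EFinP; exact: measurable_funTS.
  - by move=> n x Dx; apply: mule_ge0; [rewrite lee_fin|exact: h0].
  - move=> x Dx m n mn; rewrite lee_wpmul2r ?h0// lee_fin; exact/lefP/nd_nnsfun_approx.
congr (limn _); apply/funext => n.
under eq_integral do rewrite fimfunE -fsumEFin//.
rewrite ge0_integral_fsum//; last 2 first.
- by move=> y; apply/measurable_EFinP; apply: measurable_funTS; exact: measurable_funM.
- by move=> y x _; rewrite nnfun_muleindic_ge0.
under [RHS]eq_integral => x /set_mem Dx.
  rewrite fimfunE -fsumEFin// ge0_mule_fsuml; last by move=> i; rewrite nnfun_muleindic_ge0.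
  over.
rewrite ge0_integral_fsum//; last 2 first.
- move=> y; apply: emeasurable_funM => //.
  by apply/measurable_EFinP; apply: measurable_funTS; exact: measurable_funM.
- by move=> y x Dx; apply: mule_ge0; [rewrite nnfun_muleindic_ge0|exact: h0].
apply: eq_fsbigr => r rf.
have mr : measurable (f_ n @^-1` [set r] `&` D) by exact: measurableI.
have r0 : (0 <= r)%R by move: rf; rewrite inE => -[x _ <-].
transitivity (r%:E * mu (f_ n @^-1` [set r] `&` D)).
  rewrite integralZl_indic_nnsfun// integral_indic//.
have sD : f_ n @^-1` [set r] `&` D `<=` D by move=> x [].
rewrite (muE mr sD).
rewrite -ge0_integralZl//; last 2 first.
- exact: (measurable_funS mD sD mh).
- by move=> x [_ Dx]; exact: h0.
rewrite [LHS]integral_mkcond [RHS]integral_mkcond; apply: eq_integral => x _.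
rewrite !patchE; case: ifPn => [/set_mem[/= fr Dx]|].
  by rewrite mem_set// indicE mem_set//= mulr1.
rewrite notin_setE => /not_andP nx; case: ifPn => // /set_mem Dx.
case: nx => // /= fr.
by rewrite indicE memNset// mulr0 mul0e.
Qed.

End density.

Section weight.
Context {R : realType} {d : nat}.
Variables (nu : 'rV[R]_d -> R) (C1 C2 C3 : R).
Hypothesis d0 : (0 < d)%N.
Hypothesis nu0 : forall x, x != 0 -> 0 < nu x.
Hypothesis mnu : measurable_fun setT nu.
Hypothesis C11 : 1 <= C1.
Hypothesis nu1 : forall x y, 2^-1 <= enorm y -> enorm y <= enorm x ->
  enorm x <= enorm y + 1 -> C1^-1 * nu y <= nu x /\ nu x <= C1 * nu y.
Hypothesis C21 : 1 <= C2.
Hypothesis nu2 : forall x y, 2^-1 <= enorm y -> enorm y <= enorm x ->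
  nu x <= C2 * nu y.
Hypothesis C31 : 1 <= C3.
Hypothesis nu3 : forall x y : 'rV[R]_d, 1 <= enorm (y - x) ->
  (\int[lebesgue_rV R d]_(z in [set z | (2^-1 < enorm (z - x))%R /\
                                                (2^-1 < enorm (z - y))%R])
              (nu (x - z) * nu (z - y))%:E <= (C3 * nu (x - y))%:E)%E.

Lemma nu_gt0 x : 0 < enorm x -> 0 < nu x.
Proof.
move=> x0; apply: nu0; apply: contraTneq x0 => ->.
by rewrite enorm0 ltxx.
Qed.

Definition evec : 'rV[R]_d := delta_mx ord0 (Ordinal d0).

Lemma enorm_evec : enorm evec = 1.
Proof.
rewrite /enorm /dotp (bigD1 (Ordinal d0))//= !mxE !eqxx/= mulr1.
rewrite big1 ?addr0 ?sqrtr1// => i; rewrite !mxE eqxx/= => /negPf ->.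
by rewrite mulr0.
Qed.

(** Condition (1) of (A1) compares radii at distance at most 1, so it is iterated along the ray
    through [x]: a step of length at most 1 moves [x] inwards to radius max(|y|, |x| - 1). *)
Lemma nu_chain n x y : 2^-1 <= enorm y -> enorm y <= enorm x ->
  enorm x <= enorm y + n.+1%:R -> nu y <= C1 ^+ n.+1 * nu x /\ nu x <= C1 ^+ n.+1 * nu y.
Proof.
have C10 : 0 < C1 := lt_le_trans ltr01 C11.
elim: n x => [|n IH] x y2 yx xy.
  by have [/= ] := nu1 y2 yx xy; rewrite ler_pdivrMl.
have x0 : 0 < enorm x by apply: lt_le_trans (le_trans y2 yx); rewrite invr_gt0.
pose s := Num.max (enorm y) (enorm x - 1).
pose x' := (s / enorm x) *: x.
have s0 : 0 <= s by rewrite le_max enorm_ge0.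
have x's : enorm x' = s.
  by rewrite enormZ ger0_norm ?divr_ge0 ?enorm_ge0// divfK// gt_eqF.
have [||h1 h2] := IH x' y2.
- by rewrite x's le_max lexx.
- rewrite x's ge_max lerDl ler0n/= lerBlDr -addrA natr1//.
have [||| h3 h4] := @nu1 x x'.
- by rewrite x's le_max y2.
- by rewrite x's ge_max yx/= lerBlDr lerDl.
- by rewrite x's -lerBlDr le_max lexx orbT.
rewrite ler_pdivrMl// in h3; rewrite !exprS.
have e0 : 0 <= C1 ^+ n by rewrite exprn_ge0// ltW.
split.
  apply: (le_trans h1); rewrite -exprS mulrAC [leRHS]mulrC ler_wpM2l// exprn_ge0// ltW//.
rewrite -mulrA; apply: (le_trans h4); rewrite -exprS ler_wpM2l//; exact: ltW.
Qed.

Let a := ln C1.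

Lemma ln_C1_ge0 : 0 <= a. Proof. exact: ln_ge0. Qed.

(** With n the integer part of the gap between the radii, C1^(n+1) <= C1 e^(a gap) for a = ln C1. An
    exponential loss is harmless because every later use has a Gaussian factor to absorb it. *)
Lemma nu_exp x y : 2^-1 <= enorm y -> enorm y <= enorm x ->
  nu y <= C1 * expR (a * (enorm x - enorm y)) * nu x /\
  nu x <= C1 * expR (a * (enorm x - enorm y)) * nu y.
Proof.
move=> y2 yx; pose n := Num.truncn (enorm x - enorm y).
have C10 : 0 < C1 := lt_le_trans ltr01 C11.
have := @truncn_itv R (enorm x - enorm y); rewrite subr_ge0 => /(_ yx) /andP[n1 n2].
have xn : enorm x <= enorm y + n.+1%:R by rewrite -lerBlDl ltW.
have [h1 h2] := nu_chain y2 yx xn.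
have e : C1 ^+ n.+1 <= C1 * expR (a * (enorm x - enorm y)).
  rewrite exprS ler_pM2l// -[in leLHS](lnK C10) -expRM_natl ler_expR.
  by rewrite mulrC ler_wpM2l// ln_C1_ge0.
have x0 : 0 < enorm x by apply: lt_le_trans (le_trans y2 yx); rewrite invr_gt0.
have y0 : 0 < enorm y by apply: lt_le_trans y2; rewrite invr_gt0.
split; [apply: (le_trans h1)|apply: (le_trans h2)]; rewrite ler_wpM2r// ltW// nu_gt0//.
Qed.

Definition wt (x : 'rV[R]_d) : R := if enorm x < 1 then 1 else nu x.

Lemma wt_gt0 x : 0 < wt x.
Proof.
by rewrite /wt; case: (ltP (enorm x) 1) => // x1; apply: nu_gt0; apply: lt_le_trans x1.
Qed.

Lemma measurable_wt : measurable_fun setT wt.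
Proof.
apply: measurable_fun_ifT => //.
by apply: measurable_fun_ltr => //; exact: measurable_fun_enorm.
Qed.

Lemma wt_le : exists K, 0 < K /\ forall x, wt x <= K.
Proof.
have e0 : 0 < nu evec by apply: nu_gt0; rewrite enorm_evec.
exists (1 + C2 * nu evec); split.
  by rewrite addr_gt0// mulr_gt0// (lt_le_trans _ C21).
move=> x; rewrite /wt; case: ltP => x1.
  by rewrite lerDl mulr_ge0// ltW// (lt_le_trans _ C21).
apply: le_trans (_ : C2 * nu evec <= _); last by rewrite lerDr.
by apply: nu2; rewrite enorm_evec//; lra.
Qed.

(** The weight may jump across the unit sphere. A pair of points on different sides is compared
    through [evec], which lies on the sphere; hence the factors [nu evec] and its inverse in the
    constant. *)
Lemma wt_exp : exists K, 1 <= K /\ forall u v,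
  wt u <= K * expR (a * `|enorm u - enorm v|) * wt v.
Proof.
have e0 : 0 < nu evec by apply: nu_gt0; rewrite enorm_evec.
have C10 : 0 < C1 := lt_le_trans ltr01 C11.
have ei : 0 < (nu evec)^-1 by rewrite invr_gt0.
pose K := C1 * (1 + nu evec + (nu evec)^-1).
have Kl : C1 <= K by rewrite /K -[leLHS]mulr1 ler_pM2l//; lra.
have K1 : 1 <= K := le_trans C11 Kl.
exists K; split=> // u v.
have ex t : 0 <= t -> 1 <= expR (a * t).
  by move=> t0; rewrite -expR0 ler_expR mulr_ge0// ln_C1_ge0.
have E1 := ex _ (normr_ge0 (enorm u - enorm v)).
have := wt_gt0 v; rewrite /wt.
case: (ltP (enorm u) 1) => u1; case: (ltP (enorm v) 1) => v1 v0.
- by rewrite mulr1 -[leLHS]mulr1 ler_pM.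
- have ev2 : 2^-1 <= enorm evec by rewrite enorm_evec; lra.
  have [h _] := @nu_exp v evec ev2 (eq_rect_r (fun z => z <= enorm v) v1 enorm_evec).
  rewrite enorm_evec in h.
  have : 1 <= (nu evec)^-1 * (C1 * expR (a * (enorm v - 1)) * nu v).
    by rewrite ler_pdivlMl// mulr1.
  move/le_trans; apply.
  rewrite !mulrA ler_pM2r//; apply: ler_pM; rewrite ?mulr_ge0 ?expR_ge0 ?(ltW ei) ?(ltW C10)//.
    rewrite mulrC /K ler_pM2l//; lra.
  by rewrite ler_expR ler_wpM2l ?ln_C1_ge0// ler0_norm; lra.
- have ev2 : 2^-1 <= enorm evec by rewrite enorm_evec; lra.
  have [_ h] := @nu_exp u evec ev2 (eq_rect_r (fun z => z <= enorm u) u1 enorm_evec).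
  rewrite enorm_evec in h; rewrite mulr1; apply: (le_trans h).
  rewrite mulrAC; apply: ler_pM; rewrite ?mulr_ge0 ?expR_ge0 ?(ltW e0) ?(ltW C10)//.
    rewrite /K ler_pM2l//; lra.
  by rewrite ler_expR ler_wpM2l ?ln_C1_ge0// ger0_norm; lra.
- have [uv|vu] := leP (enorm u) (enorm v).
    have u2 : 2^-1 <= enorm u by lra.
    have [h _] := @nu_exp v u u2 uv.
    apply: (le_trans h); rewrite ler_pM2r// ler_pM// ?expR_ge0 ?(ltW C10)//.
    by rewrite ler_expR ler_wpM2l ?ln_C1_ge0// ler0_norm; lra.
  have v2 : 2^-1 <= enorm v by lra.
  have [_ h] := @nu_exp u v v2 (ltW vu).
  apply: (le_trans h); rewrite ler_pM2r// ler_pM// ?expR_ge0 ?(ltW C10)//.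
  by rewrite ler_expR ler_wpM2l ?ln_C1_ge0// ger0_norm; lra.
Qed.

Local Open Scope ereal_scope.

Lemma lebesgue_ball_lty (c : 'rV[R]_d) : lebesgue_rV R d (eball c 1) =
  lebesgue_rV R d (eball 0 1) /\ lebesgue_rV R d (eball 0 1) < +oo.
Proof.
have m1 (y : 'rV[R]_d) : measurable_fun setT (fun v => (\1_(eball y 1) v : R)%:E).
  by apply/measurable_EFinP; apply: measurable_indic; exact: measurable_eball.
split.
  have ii (y : 'rV[R]_d) : lebesgue_rV R d (eball y 1) =
      \int[lebesgue_rV R d]_v (\1_(eball y 1) v)%:E.
    by rewrite integral_indic ?setIT//; exact: measurable_eball.
  rewrite !ii.
  rewrite -[LHS](ge0_integral_rVD c); [|exact: m1|by move=> v; rewrite lee_fin].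
  apply: eq_integral => x _; congr (_%:E); rewrite !indicE; congr ((_ : bool)%:R).
  by apply/idP/idP; rewrite !inE /eball/= subr0 addrK.
rewrite -(setIT (eball 0 1)) -integral_indic//; last exact: measurable_eball.
apply: (@le_lt_trans _ _ (\int[lebesgue_rV R d]_x ((expR 1)%:E * (gsV 1 x)%:E))).
  apply: ge0_le_lower_integral => x _; rewrite ?lee_fin// indicE.
  case: (boolP (x \in _)) => [|_]; last by apply: mulr_ge0; exact: expR_ge0.
  rewrite inE /eball/= subr0 => x1; rewrite /gsV -expRD -[leLHS]expR0 ler_expR.
  rewrite -sqr_enorm subr_ge0 mul1r expr_le1 ?enorm_ge0//; exact: ltW.
rewrite ge0_intZl ?expR_ge0//; last 2 first.
- by apply/measurable_EFinP; exact: measurable_gsV.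
- by move=> x; rewrite lee_fin gsV_ge0.
by rewrite lte_mul_pinfty ?lee_fin ?expR_ge0//; apply: integrable_lty => //; exact: integrable_gsV.
Qed.

(** For |x| >= 1 the integral is split in three. Where v or x - v lies in the unit ball, one factor
    is 1 and the other is comparable to [wt x]; the rest lies in the domain of condition (3) of (A1)
    with y = 0. For |x| < 1 the boundedness and integrability of the weight suffice. *)
Lemma wt_conv (M : R) : (\int[lebesgue_rV R d]_v (wt v)%:E <= M%:E) ->
  exists K : R, (0 < K)%R /\ forall x,
  \int[lebesgue_rV R d]_v (wt (x - v) * wt v)%:E <= (K * wt x)%:E.
Proof.
move=> intM.
have [Ke [Ke1 wte]] := wt_exp.
have [Kb [Kb0 wtb]] := wt_le.
have [Bc Boo] := lebesgue_ball_lty 0.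
have B0 : 0 <= lebesgue_rV R d (eball 0 1) by [].
pose B := fine (lebesgue_rV R d (eball 0 1)).
have BE : lebesgue_rV R d (eball 0 1) = B%:E by rewrite fineK// ge0_fin_numE.
have {}B0 : (0 <= B)%R by rewrite -lee_fin -BE.
have M0 : (0 <= M)%R.
  rewrite -lee_fin; apply: le_trans intM; apply: integral_ge0 => x _; rewrite lee_fin ltW// wt_gt0//.
have a0 := ln_C1_ge0.
pose K1 := (Ke * expR a)%R.
have K10 : (0 < K1)%R by rewrite mulr_gt0 ?expR_gt0// (lt_le_trans _ Ke1).
have C30 : (0 < C3)%R := lt_le_trans ltr01 C31.
exists (2 * (K1 * B) + C3 + Kb * M + 1)%R; split.
  by have := mulr_ge0 (ltW K10) B0; have := mulr_ge0 (ltW Kb0) M0; lra.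
have mw := measurable_wt.
move=> x; have [x1|x1] := ltP (enorm x) 1%R.
  apply: (@le_trans _ _ (\int[lebesgue_rV R d]_v (Kb%:E * (wt v)%:E))).
    apply: ge0_le_lower_integral => v _; rewrite lee_fin ?ler_pM2r ?wt_gt0//.
    by rewrite mulr_ge0// ltW// wt_gt0.
  rewrite ge0_intZl//; [|exact: ltW|exact/measurable_EFinP|by move=> v; rewrite lee_fin ltW ?wt_gt0].
  apply: le_trans (_ : Kb%:E * M%:E <= _); first by rewrite lee_wpmul2l// lee_fin ltW.
  rewrite -EFinM lee_fin /wt x1 mulr1; have := mulr_ge0 (ltW K10) B0; lra.
have wB u v : (enorm v < 1)%R -> (wt (u - v) <= K1 * wt u)%R.
  move=> v1; apply: (le_trans (wte _ u)); rewrite ler_pM2r ?wt_gt0//.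
  rewrite ler_pM2l ?(lt_le_trans _ Ke1)// ler_expR -[leRHS]mulr1 ler_wpM2l//.
  apply: (le_trans (ler_dist_enorm _ _)); rewrite addrAC subrr add0r enormN; exact: ltW.
pose F (v : 'rV[R]_d) : R := (nu (x - v) * nu v)%R.
pose S := [set z : 'rV[R]_d | (2^-1 < enorm (z - x))%R /\ (2^-1 < enorm (z - 0))%R].
have mnux : measurable_fun setT F.
  apply: measurable_funM => //; apply: (measurableT_comp mnu).
  exact: measurable_fun_subrV.
apply: (@le_trans _ _ (\int[lebesgue_rV R d]_v ((K1 * wt x)%:E * (\1_(eball 0 1) v)%:E +
   ((K1 * wt x)%:E * (\1_(eball x 1) v)%:E + ((EFin \o F) \_ S) v)))).
  apply: ge0_le_lower_integral => v _; first by rewrite lee_fin mulr_ge0// ltW// wt_gt0.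
  have FS0 : 0 <= ((EFin \o F) \_ S) v.
    rewrite patchE; case: ifPn => // /set_mem[h1 h2]; rewrite /= lee_fin mulr_ge0// ltW// nu_gt0//.
      by rewrite enormC; apply: lt_trans h1; rewrite invr_gt0.
    by rewrite -[v]subr0; apply: lt_trans h2; rewrite invr_gt0.
  have K0 : (0 <= K1 * wt x)%R by rewrite mulr_ge0// ltW// wt_gt0.
  have [v1|v1] := ltP (enorm v) 1%R.
    rewrite [\1_(eball 0 1) v]indicE mem_set ?mule1/=; last by rewrite /eball/= subr0.
    rewrite -[leLHS]adde0; apply: leeD; last by rewrite adde_ge0// -EFinM lee_fin mulr_ge0.
    by rewrite lee_fin {2}/wt v1 mulr1; exact: wB.
  rewrite -[leLHS]add0e; apply: leeD; first by rewrite -EFinM lee_fin mulr_ge0.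
  have [xv|xv] := ltP (enorm (x - v)) 1%R.
    rewrite [\1_(eball x 1) v]indicE mem_set ?mule1/=; last by rewrite /eball/= enormC.
    rewrite -[leLHS]adde0; apply: leeD => //.
    rewrite lee_fin {1}/wt xv mul1r -{1}(subKr x v); exact: wB.
  rewrite -[leLHS]add0e; apply: leeD; first by rewrite -EFinM lee_fin mulr_ge0.
  rewrite patchE mem_set/=.
    by rewrite lee_fin /wt ltNge xv ltNge v1.
  rewrite /S/= subr0 enormC; split; [apply: lt_le_trans xv|apply: lt_le_trans v1]; lra.
have mi (y : 'rV[R]_d) : measurable_fun setT (fun v => (\1_(eball y 1) v : R)%:E).
  by apply/measurable_EFinP; apply: measurable_indic; exact: measurable_eball.
have K0 : (0 <= K1 * wt x)%R by rewrite mulr_ge0// ltW// wt_gt0.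
have mi2 (y : 'rV[R]_d) : measurable_fun setT (fun v => (K1 * wt x)%:E * (\1_(eball y 1) v : R)%:E).
  by apply: emeasurable_funM.
have i0 (y v : 'rV[R]_d) : 0 <= (K1 * wt x)%:E * (\1_(eball y 1) v : R)%:E.
  by rewrite -EFinM lee_fin mulr_ge0.
have mS : measurable S.
  rewrite (_ : S = ~` [set y | (enorm (y - x) <= 2^-1)%R] `&` ~` [set y | (enorm (y - 0) <= 2^-1)%R]).
    by apply: measurableI; apply: measurableC; exact: measurable_ecball.
  by apply/seteqP; split => v /=; rewrite /S/= => -[]; rewrite !ltNge => /negP ? /negP.
have FS0 v : 0 <= ((EFin \o F) \_ S) v.
  rewrite patchE; case: ifPn => // /set_mem[h1 h2]; rewrite /= lee_fin mulr_ge0// ltW// nu_gt0//.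
    by rewrite enormC; apply: lt_trans h1; rewrite invr_gt0.
  by rewrite -[v]subr0; apply: lt_trans h2; rewrite invr_gt0.
have mFS : measurable_fun setT ((EFin \o F) \_ S).
  by apply/(measurable_restrictT _ mS); apply: measurable_funTS; exact/measurable_EFinP.
rewrite ge0_intD//; last 2 first.
- exact: emeasurable_funD.
- by move=> v; rewrite adde_ge0.
have iB y : \int[lebesgue_rV R d]_v (\1_(eball y 1) v)%:E = B%:E.
  rewrite integral_indic ?setIT//; last exact: measurable_eball.
  have [bE _] := lebesgue_ball_lty y; exact: etrans bE BE.
rewrite ge0_intD// !ge0_intZl// !iB -integral_mkcond.
have h : \int[lebesgue_rV R d]_(z in S) (EFin \o F) z <= (C3 * nu x)%:E.
  have := @nu3 x 0; rewrite sub0r enormN => /(_ x1); rewrite subr0.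
  apply: le_trans; rewrite le_eqVlt; apply/orP; left; apply/eqP.
  by apply: eq_integral => z _; rewrite /F/= subr0.
apply: (@le_trans _ _ ((K1 * wt x)%:E * B%:E + ((K1 * wt x)%:E * B%:E + (C3 * nu x)%:E))).
  by rewrite leeD2l// leeD2l.
rewrite -!EFinM -!EFinD lee_fin.
have -> : nu x = wt x by rewrite /wt ltNge x1.
have := wt_gt0 x; have := mulr_ge0 (ltW Kb0) M0; nra.
Qed.

End weight.

(** * Gaussian bumps *)

Section Rfubini.
Context d1 d2 (T1 : measurableType d1) (T2 : measurableType d2) (R : realType).
Variables (m1 : {sigma_finite_measure set T1 -> \bar R})
          (m2 : {sigma_finite_measure set T2 -> \bar R}).
Variables (f : T1 -> T2 -> R) (h1 : T1 -> R) (h2 : T2 -> R).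
Hypothesis mf : measurable_fun setT (fun p : T1 * T2 => f p.1 p.2).
Hypothesis I1 : m1.-integrable setT (EFin \o h1).
Hypothesis I2 : m2.-integrable setT (EFin \o h2).
Hypothesis fh : forall x y, `|f x y| <= h1 x * h2 y.

Lemma integrable_prod_bounded :
  (m1 \x m2)%E.-integrable setT (fun p : T1 * T2 => (f p.1 p.2)%:E).
Proof.
have mh1 := measurable_int _ I1; have mh2 := measurable_int _ I2.
have mh1' : measurable_fun setT (fun x => `|h1 x|%:E).
  apply/measurable_EFinP; apply: (measurableT_comp (@normr_measurable R setT)).
  exact/measurable_EFinP.
have mh2' : measurable_fun setT (fun x => `|h2 x|%:E).
  apply/measurable_EFinP; apply: (measurableT_comp (@normr_measurable R setT)).
  exact/measurable_EFinP.
have mf' : measurable_fun setT (fun p : T1 * T2 => (f p.1 p.2)%:E) by exact/measurable_EFinP.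
apply/integrableP; split => //.
apply: (@le_lt_trans _ _ (\int[m1 \x m2]_p (`|h1 p.1|%:E * `|h2 p.2|%:E))%E).
  apply: ge0_le_lower_integral => [[x y] _|[x y] _] /=; first by rewrite lee_fin.
  rewrite -EFinM lee_fin (le_trans (fh x y))// -normrM; exact: ler_norm.
have mh : measurable_fun setT (fun p : T1 * T2 => (`|h1 p.1|%:E * `|h2 p.2|%:E)%E).
  by apply: emeasurable_funM;
    [exact: (measurableT_comp mh1' measurable_fst)|exact: (measurableT_comp mh2' measurable_snd)].
rewrite fubini_tonelli1; [|exact: mh|by move=> [x y]; rewrite -EFinM lee_fin mulr_ge0].
have E x : (fubini_F m2 (fun p : T1 * T2 => `|h1 p.1|%:E * `|h2 p.2|%:E) x =
   `|h1 x|%:E * \int[m2]_y `|h2 y|%:E)%E.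
  rewrite /fubini_F/= ge0_intZl//.
under eq_integral => x _ do rewrite E.
have F2 : (\int[m2]_y `|h2 y|%:E < +oo)%E.
  by move: I2 => /integrableP[_].
have F20 : (0 <= \int[m2]_y `|h2 y|%:E)%E by apply: integral_ge0 => y _; rewrite lee_fin.
rewrite ge0_integralZr//.
rewrite lte_mul_pinfty//.
- by apply: integral_ge0 => y _; rewrite lee_fin.
- rewrite ge0_fin_numE//; first by move: I1 => /integrableP[_].
  by apply: integral_ge0 => y _; rewrite lee_fin.
Qed.

Hypothesis h10' : forall x, 0 <= h1 x.
Hypothesis h20' : forall x, 0 <= h2 x.

Lemma integrable_intl x : m2.-integrable setT (EFin \o f x).
Proof.
apply: (le_integrable _ _ _ (integrableZl measurableT (h1 x) I2)) => //.
  apply/measurable_EFinP.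
  have mp : measurable_fun setT (fun y : T2 => (x, y)) by exact: measurable_fun_pair.
  exact: (measurableT_comp mf mp).
move=> y _ /=; rewrite lee_fin; apply: le_trans (fh x y) _; exact: ler_norm.
Qed.

Lemma integrable_intr y : m1.-integrable setT (EFin \o f^~ y).
Proof.
apply: (le_integrable _ _ _ (integrableZl measurableT (h2 y) I1)) => //.
  apply/measurable_EFinP.
  have mp : measurable_fun setT (fun x : T1 => (x, y)) by exact: measurable_fun_pair.
  exact: (measurableT_comp mf mp).
move=> x _ /=; rewrite lee_fin mulrC; apply: le_trans (fh x y) _; exact: ler_norm.
Qed.

(** Under a product bound every section is integrable, so the inner integrals are finite everywhere
    and the identity can be stated for real-valued integrals. *)
Lemma Rfubini :
  \int[m1]_x \int[m2]_y f x y = \int[m2]_y \int[m1]_x f x y.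
Proof.
have I := integrable_prod_bounded.
have := @Fubini _ _ _ _ _ m1 m2 _ I; rewrite /Rintegral => E.
congr fine; transitivity (\int[m1]_x \int[m2]_y (f x y)%:E)%E.
  apply: eq_integral => x _; rewrite fineK//.
  exact: (integrable_fin_num measurableT (integrable_intl x)).
rewrite E; apply: eq_integral => y _; rewrite fineK//.
exact: (integrable_fin_num measurableT (integrable_intr y)).
Qed.

Lemma measurable_Rintegral_l : measurable_fun setT (fun x => \int[m2]_y f x y).
Proof.
have I := integrable_prod_bounded.
have mF : measurable_fun setT (fun x => \int[m2]_y (f x y)%:E)%E.
  exact: (measurable_fubini_F I).
by apply: (measurableT_comp _ mF); exact: fine_measurable.
Qed.

Lemma normr_Rintegral_l x : `|\int[m2]_y f x y| <= h1 x * \int[m2]_y h2 y.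
Proof.
apply: (le_trans (le_normr_Rintegral measurableT (integrable_intl x))).
rewrite -RintegralZl//; apply: le_Rintegral => //.
- exact: (integrable_norm (integrable_intl x)).
- by have := integrableZl measurableT (h1 x) I2.
Qed.

End Rfubini.

(** * Elementary inequalities and quadratic forms *)

Section elementary.
Context {R : realType}.
Implicit Types x t p : R.

Lemma expR_taylor2 t : 0 <= t -> 0 <= expR (- t) - 1 + t /\ expR (- t) - 1 + t <= t ^+ 2 / 2.
Proof.
move=> t0; split; first by have := expR_ge1Dx (- t); lra.
have [->|tn0] := eqVneq t 0; first by rewrite oppr0 expR0 expr2; lra.
have {}t0 : 0 < t by rewrite lt_def tn0.
pose f (x : R) := expR (- x) - 1 + x - x ^+ 2 / 2.
have fD (x : R) : is_derive x (1 : R) f (- expR (- x) + 1 - x).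
  by rewrite /f; apply: is_derive_eq; rewrite /GRing.scale/=; field.
have [|c cI] := @MVT R f (fun x => - expR (- x) + 1 - x) 0 t t0 (fun x _ => fD x).
  apply: derivable_within_continuous => x _; exact: ex_derive.
have -> : f 0 = 0 by rewrite /f oppr0 expR0; ring.
rewrite /f !subr0.
have := expR_ge1Dx (- c); move: cI; rewrite in_itv/= => /andP[c0 _]; nra.
Qed.

Lemma sub1cos_ge0 t : 0 <= 1 - cos t.
Proof. by rewrite subr_ge0 cos_le1. Qed.

Lemma sub1cos_le2 t : 1 - cos t <= 2.
Proof. by have := @cos_geN1 R t; lra. Qed.

Lemma ler_sin t : 0 <= t -> sin t <= t.
Proof.
move=> t0; have [->|tn0] := eqVneq t 0; first by rewrite sin0.
have {}t0 : 0 < t by rewrite lt_def tn0.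
have [|c cI] := @MVT R (@sin R) (@cos R) 0 t t0 (fun x _ => is_derive_sin x).
  apply: derivable_within_continuous => x _; exact: ex_derive.
rewrite sin0 !subr0 => ->; by rewrite ler_piMl ?cos_le1// ltW.
Qed.

Lemma sub1cos_le t : 1 - cos t <= t ^+ 2 / 2.
Proof.
wlog t0 : t / 0 <= t.
  move=> H; have [|t0] := leP 0 t; first exact: H.
  by rewrite -cosN -sqrrN; apply: H; rewrite oppr_ge0 ltW.
have [->|tn0] := eqVneq t 0; first by rewrite cos0 expr2; lra.
have {}t0 : 0 < t by rewrite lt_def tn0.
pose f (x : R) := x ^+ 2 / 2 + cos x.
have fD (x : R) : is_derive x (1 : R) f (x - sin x).
  by rewrite /f; apply: is_derive_eq; rewrite /GRing.scale/=; field.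
have [|c cI] := @MVT R f (fun x => x - sin x) 0 t t0 (fun x _ => fD x).
  apply: derivable_within_continuous => x _; exact: ex_derive.
have -> : f 0 = 1 by rewrite /f cos0; ring.
rewrite /f subr0; move: cI; rewrite in_itv/= => /andP[c0 _].
have := ler_sin (ltW c0); nra.
Qed.

(** A crude cubic remainder, enough for [sqr_part_le]: at t = sD, division by s^2 leaves an error of
    order s. *)
Lemma sub1cos_ge t : t ^+ 2 / 2 - (1 - cos t) <= `|t| ^+ 3.
Proof.
wlog t0 : t / 0 <= t.
  move=> H; have [|t0] := leP 0 t; first exact: H.
  by rewrite -cosN -sqrrN -normrN; apply: H; rewrite oppr_ge0 ltW.
rewrite ger0_norm//.
have [->|tn0] := eqVneq t 0; first by rewrite cos0 !expr2 exprS; lra.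
have {}t0 : 0 < t by rewrite lt_def tn0.
pose h (x : R) := x - sin x.
have hD (x : R) : is_derive x (1 : R) h (1 - cos x).
  by rewrite /h; apply: is_derive_eq; rewrite /GRing.scale/=; field.
have h3 (x : R) : 0 < x -> h x <= x ^+ 3.
  move=> x0.
  have [|c cI] := @MVT R h (fun x => 1 - cos x) 0 x x0 (fun x _ => hD x).
    apply: derivable_within_continuous => y _; exact: ex_derive.
  rewrite {2}/h sin0 !subr0 => ->.
  move: cI; rewrite in_itv/= => /andP[c0 cx].
  have := sub1cos_le c; rewrite !exprS expr0 mulr1 => e.
  have : c * c <= x * x by rewrite ler_pM// ltW.
  nra.
pose f (x : R) := x ^+ 2 / 2 + cos x.
have fD (x : R) : is_derive x (1 : R) f (x - sin x).
  by rewrite /f; apply: is_derive_eq; rewrite /GRing.scale/=; field.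
have [|c cI] := @MVT R f (fun x => x - sin x) 0 t t0 (fun x _ => fD x).
  apply: derivable_within_continuous => x _; exact: ex_derive.
have -> : f 0 = 1 by rewrite /f cos0; ring.
rewrite /f subr0; move: cI; rewrite in_itv/= => /andP[c0 ct].
have := ler_sin (ltW c0).
have := h3 c c0; rewrite /h => a1 a2 e.
have [t1|t1] := leP t 1; last first.
  have := sub1cos_ge0 t.
  have : t ^+ 2 <= t ^+ 3 by rewrite [leRHS]exprS ler_peMl ?sqr_ge0// ltW.
  have := sqr_ge0 t; lra.
have : c ^+ 3 <= t ^+ 2.
  apply: (@le_trans _ _ (t ^+ 3)); first by rewrite lerXn2r ?nnegrE// ltW.
  by rewrite exprS ler_piMl// sqr_ge0.
rewrite [t ^+ 3]exprSr; nra.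
Qed.

Lemma cosh_sub1_le p : expR p + expR (- p) - 2 <= p ^+ 2 * expR `|p|.
Proof.
wlog p0 : p / 0 <= p.
  move=> H; have [|p0] := leP 0 p; first exact: H.
  by rewrite -sqrrN -normrN -{1}(opprK p) addrC [expR _ + _]addrC {1}opprK addrC;
   have := H (- p); rewrite oppr_ge0 ltW// opprK => /(_ isT); lra.
rewrite ger0_norm//.
have : expR p + expR (- p) - 2 = expR p * (1 - expR (- p)) ^+ 2.
  have e : expR p * expR (- p) = 1 by rewrite -expRD subrr expR0.
  have -> : (1 - expR (- p)) ^+ 2 = 1 - 2 * expR (- p) + expR (- p) ^+ 2 by ring.
  have -> : expR p * (1 - 2 * expR (- p) + expR (- p) ^+ 2) =
    expR p - 2 * (expR p * expR (- p)) + expR p * expR (- p) * expR (- p) by ring.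
  rewrite e; ring.
move=> ->; rewrite mulrC ler_wpM2r ?expR_ge0// lerXn2r ?nnegrE//.
  by rewrite subr_ge0 -expR0 ler_expR oppr_le0.
by have := expR_ge1Dx (- p); lra.
Qed.

Lemma sqr_le_expR t : 0 <= t -> t ^+ 2 <= 4 * expR t.
Proof.
move=> t0; have e := expR_ge1Dx (t / 2).
have -> : expR t = expR (t / 2) ^+ 2 by rewrite expr2 -expRD -splitr.
have : t <= 2 * expR (t / 2) by lra.
move=> h; rewrite -[4]/(2 * 2)%:R natrM -expr2 -exprMn lerXn2r ?nnegrE//.
Qed.

End elementary.

Section quadratic_form.
Context {R : realType} {d : nat} (Q : 'M[R]_d).

Definition qform (u : 'rV[R]_d) : R := dotp (u *m Q) u.

Definition qform_bound : R := \sum_i \sum_j `|Q i j|.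

Lemma qformE u : qform u = \sum_i \sum_j Q i j * (u ord0 i * u ord0 j).
Proof.
rewrite /qform /dotp exchange_big; apply: eq_bigr => j _.
by rewrite mxE big_distrl; apply: eq_bigr => i _ /=; rewrite mulrAC mulrC.
Qed.

Lemma qform_bound_ge0 : 0 <= qform_bound.
Proof. by apply: sumr_ge0 => i _; apply: sumr_ge0. Qed.

Lemma normr_qform u : `|qform u| <= qform_bound * enorm u ^+ 2.
Proof.
rewrite qformE (le_trans (ler_norm_sum _ _ _))// /qform_bound big_distrl/=.
apply: ler_sum => i _; rewrite (le_trans (ler_norm_sum _ _ _))// big_distrl/=.
apply: ler_sum => j _; rewrite !normrM ler_wpM2l// expr2.
by rewrite ler_pM ?coord_le_enorm.
Qed.

Definition bvec (i : 'I_d) : 'rV[R]_d := delta_mx ord0 i.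

Lemma dotp_bvec u i : dotp u (bvec i) = u ord0 i.
Proof.
rewrite /dotp (bigD1 i)//= !mxE !eqxx mulr1 big1 ?addr0// => j; rewrite !mxE eqxx/= => /negPf ->.
by rewrite mulr0.
Qed.

Lemma enorm_bvec i : enorm (bvec i) = 1.
Proof. by rewrite /enorm dotp_bvec !mxE !eqxx sqrtr1. Qed.

(** Polarisation reduces the Gaussian part of the symbol to squares of linear forms in directions of
    length at most 2, the case treated by [sqr_part_le]. *)
Lemma qform_polar u : qform u = \sum_i \sum_j
  Q i j / 4 * (dotp u (bvec i + bvec j) ^+ 2 - dotp u (bvec i - bvec j) ^+ 2).
Proof.
rewrite qformE; apply: eq_bigr => i _; apply: eq_bigr => j _.
by rewrite !dotpDr dotpNr !dotp_bvec; field.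
Qed.

End quadratic_form.

Section bump.
Context {R : realType} {d : nat}.
Implicit Types x y z v : 'rV[R]_d.
Local Notation b := (@gsV R d).

Lemma gsVN c x : b c (- x) = b c x.
Proof. by rewrite /gsV dotpNl dotpNr opprK. Qed.

Lemma gsV_le1 c x : 0 <= c -> b c x <= 1.
Proof. by move=> c0; rewrite /gsV -expR0 ler_expR oppr_le0 mulr_ge0// dotp_ge0. Qed.

Lemma gsVE c x : b c x = expR (- (c * enorm x ^+ 2)).
Proof. by rewrite sqr_enorm. Qed.

Lemma gsV_scale r x : b 2^-1 (r *: x) = b (r ^+ 2 / 2) x.
Proof. by rewrite /gsV dotpZl dotpZr; congr (expR (- _)); field. Qed.

(** Completing the square. Closure of the bumps under products is what keeps a bump multiplied by 1
    - bump within reach of the explicit generator. *)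
Lemma gsVM c c' x v : c + c' != 0 -> b c (x - v) * b c' x =
  b (c * c' / (c + c')) v * b (c + c') (x - (c / (c + c')) *: v).
Proof.
move=> cc; rewrite /gsV -!expRD; congr expR.
rewrite !dotpDl !dotpDr !dotpNl !dotpNr !dotpZl !dotpZr (dotpC v x); by field.
Qed.

Lemma gsV_exp_le c a x : 0 < c ->
  b c x * expR (a * enorm x) <= expR (a ^+ 2 / (2 * c)) * b (c / 2) x.
Proof.
move=> c0; rewrite !gsVE -!expRD ler_expR; set t := enorm x.
have -> : - (c * t ^+ 2) + a * t = a ^+ 2 / (2 * c) + - (c / 2 * t ^+ 2) - (2 * c)^-1 * (c * t - a) ^+ 2.
  by field; rewrite gt_eqF.
rewrite gerBl mulr_ge0 ?sqr_ge0// invr_ge0 mulr_ge0// ltW//.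
Qed.

(* [sup_{|z|<=1} |b(x+z)+b(x-z)-2b(x)|/|z|^2] is dominated by this. *)
Definition bump_env c x : R := 2 * (c + 32) * (b c x * expR (4 * c * enorm x)).

(** Put p = 2c x.z and q = c|z|^2. Then b(x + z) and b(x - z) are b(x) e^(-q) times e^(-p) and e^p,
    so the second difference is b(x) times e^(-q) (e^p + e^(-p) - 2) - 2 (1 - e^(-q)), and both
    terms are O(|z|^2). *)
Lemma bump_second_difference c x z : 0 < c -> enorm z <= 1 ->
  `|b c (x + z) + b c (x - z) - 2 * b c x| <= enorm z ^+ 2 * bump_env c x.
Proof.
move=> c0 z1; pose p := 2 * c * dotp x z; pose q := c * enorm z ^+ 2.
have q0 : 0 <= q by rewrite mulr_ge0 ?sqr_ge0// ltW.
have E1 : b c (x + z) = b c x * (expR (- q) * expR (- p)).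
  rewrite /gsV -!expRD /q /p sqr_enorm dotpDl !dotpDr (dotpC z x); congr expR; ring.
have E2 : b c (x - z) = b c x * (expR (- q) * expR p).
  rewrite /gsV -!expRD /q /p sqr_enorm dotpDl !dotpDr !dotpNl !dotpNr (dotpC z x); congr expR; ring.
have -> : b c (x + z) + b c (x - z) - 2 * b c x =
    b c x * (expR (- q) * (expR p + expR (- p) - 2) - 2 * (1 - expR (- q))).
  by rewrite E1 E2; ring.
rewrite normrM ger0_norm ?gsV_ge0//.
have -> : enorm z ^+ 2 * bump_env c x =
    b c x * (enorm z ^+ 2 * (2 * (c + 32) * expR (4 * c * enorm x))).
  by rewrite /bump_env; ring.
rewrite ler_wpM2l ?gsV_ge0//.
have x0 := enorm_ge0 x; have z0 := enorm_ge0 z.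
have h1 := cosh_sub1_le p; have h2 := expR_ge1Dx (- q).
have h3 : expR (- q) <= 1 by rewrite -expR0 ler_expR oppr_le0.
have h4 : 0 <= expR p + expR (- p) - 2.
  have := expR_ge1Dx p; have := expR_ge1Dx (- p); lra.
have pxz : `|p| <= 2 * c * enorm x * enorm z.
  rewrite /p normrM ger0_norm; last by rewrite mulr_ge0// ltW.
  by rewrite -[leRHS]mulrA ler_wpM2l ?normr_dotp// mulr_ge0// ltW.
(* One factor [e] bounds e^|p|, another bounds p^2 / |z|^2 up to a factor 4; their product is the
   exponential in [bump_env]. *)
set e := expR (2 * c * enorm x).
have e1 : 1 <= e by rewrite -expR0 ler_expR !mulr_ge0// ltW.
have h5 : expR `|p| <= e.
  by rewrite ler_expR; apply: (le_trans pxz); rewrite ler_piMr// !mulr_ge0// ltW.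
have h6 : p ^+ 2 <= 4 * e * enorm z ^+ 2.
  rewrite -(real_normK (num_real p)).
  apply: (@le_trans _ _ ((2 * c * enorm x) ^+ 2 * enorm z ^+ 2)).
    by rewrite -exprMn lerXn2r ?nnegrE// !mulr_ge0// ltW.
  by rewrite ler_wpM2r ?sqr_ge0// sqr_le_expR// !mulr_ge0// ltW.
have e2 : expR (4 * c * enorm x) = e * e by rewrite -expRD; congr expR; ring.
rewrite e2; set K := expR p + expR (- p) - 2 in h1 h4 *.
set E := expR (- q) in h2 h3 *.
have E0 : 0 <= E := expR_ge0 _.
have h7 : K <= 4 * e * enorm z ^+ 2 * e.
  by apply: (le_trans h1); rewrite ler_pM ?sqr_ge0 ?expR_ge0.
have h8 : E * K <= K by rewrite ler_piMl.
have h9 : 0 <= E * K by rewrite mulr_ge0.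
have ee : 1 <= e * e by rewrite -[leLHS]mulr1 ler_pM.
have zz := sqr_ge0 (enorm z).
apply: (@le_trans _ _ (4 * e * enorm z ^+ 2 * e + 2 * q)).
  rewrite ler_norml; apply/andP; split; lra.
rewrite /q; set Z := enorm z ^+ 2 in zz *; set ee' := e * e in ee *.
have -> : 4 * e * Z * e = 4 * ee' * Z by rewrite /ee'; ring.
have : 0 <= Z * ee' by rewrite mulr_ge0//; lra.
have : c * Z <= c * Z * ee' by rewrite ler_peMr// mulr_ge0// ltW.
lra.
Qed.

End bump.

Lemma integrable_bounded_prob d0 (T : measurableType d0) (R : realType)
    (P : probability T R) (f : T -> R) (M : R) :
  measurable_fun setT f -> (forall w, `|f w| <= M) -> P.-integrable setT (EFin \o f).
Proof.
move=> mf fM.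
have I : P.-integrable setT (EFin \o cst M) by apply: finite_measure_integrable_cst.
apply: (le_integrable _ _ _ I) => //; first exact/measurable_EFinP.
move=> w _ /=; rewrite lee_fin; apply: le_trans (fM w) _; exact: ler_norm.
Qed.

(** * The generator on Gaussian bumps *)

Lemma eighth_normB (R : realType) (u v e : R) : `|u| <= 4 * e -> `|v| <= 4 * e ->
  8^-1 * `|u - v| <= e.
Proof. by move=> hu hv; have := ler_normB u v; lra. Qed.

Lemma ge0_Rintegral_le d0 (T : measurableType d0) (R : realType)
    (mu : {measure set T -> \bar R}) (f : T -> R) (M : R) :
  (forall x, 0 <= f x) -> (\int[mu]_x (f x)%:E <= M%:E)%E -> \int[mu]_x f x <= M.
Proof.
move=> f0 fM; rewrite -lee_fin /Rintegral fineK// ge0_fin_numE.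
  exact: le_lt_trans fM (ltry _).
by apply: integral_ge0 => x _; rewrite lee_fin.
Qed.

Lemma second_difference_le (R : realType) (p q b e : R) :
  0 <= p -> 0 <= q -> 0 <= b -> 0 <= e -> `|(p + q) / 2 - b| <= e + b + (q + p).
Proof. by move=> p0 q0 b0 e0; rewrite ler_norml; apply/andP; split; lra. Qed.

(** The exponents follow from c c' / (c + c'): 1/4 and 1/2 give 1/6, and in the next lemma 1/8 and
    1/2 give 1/10. These products appear when [cutF] is expanded. *)
Lemma gsV_quarter_half (R : realType) d (x z : 'rV[R]_d) :
  gsV 4^-1 (z - x) * gsV 2^-1 z = gsV 6^-1 x * gsV (3 / 4) (z - 3^-1 *: x).
Proof.
have s : 4^-1 + 2^-1 = 3 / 4 :> R by field.
have s0 : 4^-1 + 2^-1 != 0 :> R by rewrite s mulf_neq0.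
by rewrite gsVM// s; congr (gsV _ x * gsV _ (z - _ *: x)); field.
Qed.

Lemma gsV_eighth_half (R : realType) d (x z : 'rV[R]_d) :
  gsV 8^-1 (z - x) * gsV 2^-1 z = gsV 10^-1 x * gsV (5 / 8) (z - 5^-1 *: x).
Proof.
have s : 8^-1 + 2^-1 = 5 / 8 :> R by field.
have s0 : 8^-1 + 2^-1 != 0 :> R by rewrite s mulf_neq0.
by rewrite gsVM// s; congr (gsV _ x * gsV _ (z - _ *: x)); field.
Qed.

(** This and the next scalar lemmas carry the arithmetic of the four-bump function [cutF], with
    integrals and bumps replaced by variables. *)
Lemma cutF_scalar (R : realType) (u v w p : R) :
  (u - p * v) * (1 - w) = u - p * v - u * w + p * (v * w).
Proof. by ring. Qed.

Lemma cut_sym_scalar (R : realType) (A B D m w kz u v p q : R) :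
  A - B <= u * w * kz -> w * kz <= m * kz -> 0 <= w * kz -> 0 <= D -> 0 <= v -> 0 <= p -> 0 <= q ->
  A - B - D * (p * (m * kz) + q * (m * kz)) <=
  ((u - D * p) * w + (v - D * q) * w) * kz.
Proof.
move=> H m1 w0 D0 v0 p0 q0.
have := ler_wpM2l (mulr_ge0 D0 p0) m1; have := ler_wpM2l (mulr_ge0 D0 q0) m1.
have := mulr_ge0 v0 w0; lra.
Qed.

Lemma cut_jump_scalar (R : realType) (kz a1 a2 a3 a4 b1 b2 b3 b4 c1 c2 c3 c4 p q r : R) :
  c1 - p * c2 - q * c3 + r * c4 = 0 ->
  ((a1 - p * a2 - q * a3 + r * a4) + (b1 - p * b2 - q * b3 + r * b4)) / 2 * kz =
  ((a1 + b1) / 2 - c1) * kz - p * (((a2 + b2) / 2 - c2) * kz) - q * (((a3 + b3) / 2 - c3) * kz)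
  + r * (((a4 + b4) / 2 - c4) * kz).
Proof.
move=> F; apply/eqP; rewrite -subr_eq0; apply/eqP.
transitivity ((c1 - p * c2 - q * c3 + r * c4) * kz); first by field.
by rewrite F mul0r.
Qed.

Lemma cutG_scalar (R : realType) (del p6 p10 q1 q2 q3 q5 qb E2 E3 e34 e58 D1 D4 D5 v K b8 Bg ms As I : R) :
  0 <= del -> del <= 1 -> 0 <= p6 -> 0 <= p10 -> 0 <= qb -> 0 <= e34 -> 0 <= e58 -> 0 <= K ->
  `|q1| <= qb * (E2 * v) -> `|q2| <= qb * (E3 * v) -> `|q3| <= qb * e34 -> `|q5| <= qb * e58 ->
  0 <= b8 -> b8 <= D1 * v -> p6 <= D4 * v -> p10 <= D5 * v -> ms <= As -> 0 <= As ->
  2^-1 * (Bg - K * b8 - del * ms) <= I ->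
  2^-1 * Bg - del * As <= - (q1 - del * q2 - p6 * q3 + del * p10 * q5) + I +
    (qb * (E2 + E3 + D4 * e34 + D5 * e58) + K * D1) * v.
Proof.
move=> d0 d1 p60 p100 qb0 e340 e580 K0 Q1 Q2 Q3 Q5 b80 b8D p6D p10D msA As0 HI.
have t1 : q1 <= qb * (E2 * v) := le_trans (ler_norm _) Q1.
have t2 : - (del * q2) <= qb * (E3 * v).
  apply: (le_trans (ler_norm _)); rewrite normrN normrM (ger0_norm d0).
  by apply: le_trans Q2; rewrite ler_piMl.
have t3 : - (p6 * q3) <= D4 * v * (qb * e34).
  apply: (le_trans (ler_norm _)); rewrite normrN normrM (ger0_norm p60).
  by apply: ler_pM.
have t5 : del * p10 * q5 <= D5 * v * (qb * e58).
  apply: (le_trans (ler_norm _)); rewrite !normrM (ger0_norm d0) (ger0_norm p100).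
  apply: ler_pM => //; first by rewrite mulr_ge0.
  by apply: le_trans p10D; rewrite ler_piMl.
have t6 := ler_wpM2l d0 msA; have t9 := mulr_ge0 d0 As0; have t7 := ler_wpM2l K0 b8D.
have t8 : 0 <= K * (D1 * v) by rewrite mulr_ge0// (le_trans b80).
lra.
Qed.

Lemma cut_step_scalar (R : realType) (a1 a2 a3 a4 b1 b2 b3 b4 g1 g2 g3 g4 k1 k2 k3 k4 p q r h : R) :
  0 <= p <= 1 -> 0 <= q <= 1 -> 0 <= r <= 1 ->
  0 <= k2 -> 0 <= k3 -> 0 <= k4 ->
  `|a1 - b1 - h * g1| <= h ^+ 2 * k1 -> `|a2 - b2 - h * g2| <= h ^+ 2 * k2 ->
  `|a3 - b3 - h * g3| <= h ^+ 2 * k3 -> `|a4 - b4 - h * g4| <= h ^+ 2 * k4 ->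
  b1 - p * b2 - q * b3 + r * b4 = 0 ->
  h * (g1 - p * g2 - q * g3 + r * g4) - h ^+ 2 * (k1 + k2 + k3 + k4) <=
  a1 - p * a2 - q * a3 + r * a4.
Proof.
have aux (a b g k p0 : R) : 0 <= p0 <= 1 -> 0 <= k -> `|a - b - h * g| <= h ^+ 2 * k ->
    `|p0 * a - p0 * b - h * (p0 * g)| <= h ^+ 2 * k.
  move=> /andP[p00 p01] k0 H.
  have -> : p0 * a - p0 * b - h * (p0 * g) = p0 * (a - b - h * g) by ring.
  rewrite normrM (ger0_norm p00); apply: le_trans (ler_wpM2l p00 H) _.
  by rewrite ler_piMl// mulr_ge0// sqr_ge0.
move=> p01 q01 r01 k20 k30 k40 H1 /(aux _ _ _ _ _ p01 k20) H2 /(aux _ _ _ _ _ q01 k30) H3 /(aux _ _ _ _ _ r01 k40) H4 F.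
move: H1 H2 H3 H4; rewrite !ler_norml => /andP[H1 _] /andP[_ H2] /andP[_ H3] /andP[H4 _].
lra.
Qed.

Section levy_kernel.
Context {R : realType} {dO : measure_display} {Omega : measurableType dO} {d : nat}.
Variables (P : probability Omega R) (X : R -> Omega -> 'rV[R]_d).
Variables (Q : 'M[R]_d) (k g : 'rV[R]_d -> R) (a Kg Ce Cc : R).
Local Notation la := (lebesgue_rV R d).
Hypothesis mk : measurable_fun setT k.
Hypothesis k0 : forall z, 0 <= k z.
Hypothesis kg : forall z, 1 <= enorm z -> k z = g z.
Hypothesis Ik : la.-integrable setT (EFin \o (fun z => Num.min 1 (enorm z ^+ 2) * k z)).
Hypothesis mg : measurable_fun setT g.
Hypothesis g_gt0 : forall x, 0 < g x.
Hypothesis g_le : forall x, g x <= Kg.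
Hypothesis a0 : 0 <= a.
Hypothesis Ce1 : 1 <= Ce.
Hypothesis g_exp : forall u v, g u <= Ce * expR (a * `|enorm u - enorm v|) * g v.
Hypothesis g00 : g 0 = 1.
Hypothesis Ig : la.-integrable setT (EFin \o g).
Hypothesis Cc0 : 0 < Cc.
Hypothesis g_conv : forall x, (\int[la]_v (g (x - v) * g v)%:E <= (Cc * g x)%:E)%E.
Hypothesis qpos : forall u, 0 <= qform Q u.

(** The characteristic exponent, which is real by symmetry. *)
Definition Psi (u : 'rV[R]_d) : R :=
  qform Q u / 2 + \int[la]_z ((1 - cos (dotp u z)) * k z).

Hypothesis mX : forall t, 0 <= t -> measurable_fun setT (X t).
Hypothesis cosX : forall t u, 0 <= t ->
  \int[P]_w cos (dotp u (X t w)) = expR (- (t * Psi u)).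
Hypothesis sinX : forall t u, 0 <= t -> \int[P]_w sin (dotp u (X t w)) = 0.

Definition Mk : R := \int[la]_z (Num.min 1 (enorm z ^+ 2) * k z).

Lemma Mk_ge0 : 0 <= Mk.
Proof.
apply: Rintegral_ge0 => z _; rewrite mulr_ge0// le_min ler01 sqr_ge0//.
Qed.

Lemma sub1cos_dotp_le (u z : 'rV[R]_d) :
  1 - cos (dotp u z) <= (2 + enorm u ^+ 2) * Num.min 1 (enorm z ^+ 2).
Proof.
have u0 := sqr_ge0 (enorm u).
have [z1|z1] := leP 1 (enorm z ^+ 2).
  by have := sub1cos_le2 (dotp u z); lra.
apply: (le_trans (sub1cos_le _)).
have : dotp u z ^+ 2 <= enorm u ^+ 2 * enorm z ^+ 2.
  by rewrite !sqr_enorm dotp_sqr_le.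
have := sqr_ge0 (enorm z); nra.
Qed.

Lemma measurable_sub1cos : measurable_fun setT
  (fun p : 'rV[R]_d * 'rV[R]_d => (1 - cos (dotp p.1 p.2)) * k p.2).
Proof.
apply: measurable_funM; last exact: (measurableT_comp mk measurable_snd).
apply: measurable_funB => //.
exact: (measurableT_comp measurable_cosR measurable_dotp).
Qed.

Lemma integrable_sub1cos u : la.-integrable setT (EFin \o (fun z => (1 - cos (dotp u z)) * k z)).
Proof.
apply: (le_integrable _ _ _ (integrableZl measurableT (2 + enorm u ^+ 2) Ik)) => //.
  apply/measurable_EFinP; apply: measurable_funM => //.
  apply: measurable_funB => //.
  by apply: (measurableT_comp measurable_cosR); exact: measurable_fun_dotp.
move=> z _ /=; rewrite lee_fin ger0_norm ?mulr_ge0 ?sub1cos_ge0//.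
apply: le_trans (ler_norm _); rewrite mulrA ler_wpM2r//; exact: sub1cos_dotp_le.
Qed.

Lemma measurable_qform : measurable_fun setT (qform Q).
Proof.
rewrite (_ : qform Q = fun u => \sum_i \sum_j Q i j * (u ord0 i * u ord0 j)); last first.
  by apply/funext => u; exact: qformE.
apply: measurable_sum => i; apply: measurable_sum => j.
apply: measurable_funM => //; apply: measurable_funM; exact: measurable_coord.
Qed.

Lemma measurable_Psi : measurable_fun setT Psi.
Proof.
apply: measurable_funD.
  by apply: measurable_funM => //; exact: measurable_qform.
apply: (measurableT_comp (f := fine)); first exact: fine_measurable.
apply: (@measurable_fun_intr _ _ _ _ _ la (fun u z => ((1 - cos (dotp u z)) * k z)%:E)).
  by apply/measurable_EFinP; exact: measurable_sub1cos.
by move=> u z; rewrite lee_fin mulr_ge0// sub1cos_ge0.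
Qed.

Lemma Psi_ge0 u : 0 <= Psi u.
Proof.
apply: addr_ge0; first by rewrite divr_ge0.
by apply: Rintegral_ge0 => z _; rewrite mulr_ge0// sub1cos_ge0.
Qed.

Definition CP : R := qform_bound Q + 2 * Mk.

Lemma CP_ge0 : 0 <= CP.
Proof. by apply: addr_ge0; [exact: qform_bound_ge0|rewrite mulr_ge0// Mk_ge0]. Qed.

Lemma Psi_le u : Psi u <= CP * (1 + enorm u ^+ 2).
Proof.
have u0 := sqr_ge0 (enorm u).
have h : \int[la]_z ((1 - cos (dotp u z)) * k z) <= (2 + enorm u ^+ 2) * Mk.
  rewrite /Mk -RintegralZl//; apply: le_Rintegral => //.
  - exact: integrable_sub1cos.
  - exact: (integrableZl measurableT (2 + enorm u ^+ 2) Ik).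
  - move=> z _; rewrite mulrA ler_wpM2r//; exact: sub1cos_dotp_le.
have := normr_qform Q u; have := ler_norm (qform Q u).
have := Mk_ge0; have := qform_bound_ge0 Q.
rewrite /Psi /CP; set q := qform_bound Q; set n := enorm u ^+ 2 in u0 h *; move=> q0 m0 h1 h2.
have : 0 <= Mk * n by rewrite mulr_ge0.
have : 0 <= q * n by rewrite mulr_ge0.
lra.
Qed.

Definition gmass : R := (@gauss_mass R) ^+ d.

Lemma gmass_gt0 : 0 < gmass.
Proof. by rewrite exprn_gt0// gauss_mass_gt0. Qed.

(** The standard normal density on the frequency side. Its characteristic function is [gsV 2^-1], so
    every bump is an average of cosines over [gam]. *)
Definition gam (x : 'rV[R]_d) : R := gsV 2^-1 x / gmass.

Lemma gam_ge0 x : 0 <= gam x.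
Proof. by rewrite divr_ge0 ?gsV_ge0// ltW// gmass_gt0. Qed.

Lemma measurable_gam : measurable_fun setT gam.
Proof. by apply: measurable_funM => //; exact: measurable_gsV. Qed.

(** Growth of degree four covers every integrand below: [Psi] grows quadratically, and the Taylor
    remainder in time contains its square. *)
Lemma integrable_gam (h : 'rV[R]_d -> R) M : measurable_fun setT h ->
  (forall x, `|h x| <= M * (1 + enorm x ^+ 2) ^+ 2) ->
  la.-integrable setT (EFin \o (fun x => h x * gam x)).
Proof.
move=> mh hM; apply: (@integrable_le_gsV _ _ _ (3 / 8) (`|M| * 256 / gmass)); first by lra.
  by apply: measurable_funM => //; exact: measurable_gam.
move=> x; rewrite normrM [`|gam x|]ger0_norm ?gam_ge0//.
have h1 : (1 + enorm x ^+ 2) ^+ 2 * gsV 2^-1 x <= 256 * gsV (3 / 8) x.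
  have e : 1 + enorm x ^+ 2 <= 16 * expR (enorm x ^+ 2 / 16).
    by have := expR_ge1Dx (enorm x ^+ 2 / 16); have := sqr_ge0 (enorm x); lra.
  have e2 : (1 + enorm x ^+ 2) ^+ 2 <= 256 * expR (enorm x ^+ 2 / 8).
    apply: (@le_trans _ _ ((16 * expR (enorm x ^+ 2 / 16)) ^+ 2)).
      by rewrite lerXn2r ?nnegrE ?addr_ge0 ?sqr_ge0 ?mulr_ge0 ?expR_ge0.
    rewrite exprMn -[expR _ ^+ 2]expRM_natl le_eqVlt; apply/orP; left; apply/eqP.
    by congr (_ * expR _); [rewrite -natrX|field].
  apply: (@le_trans _ _ (256 * expR (enorm x ^+ 2 / 8) * gsV 2^-1 x)).
    by rewrite ler_wpM2r ?gsV_ge0.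
  rewrite -mulrA ler_wpM2l// !gsVE -expRD ler_expR; lra.
apply: (@le_trans _ _ (`|M| * (1 + enorm x ^+ 2) ^+ 2 * gam x)).
  rewrite ler_wpM2r ?gam_ge0//; apply: (le_trans (hM x)).
  by rewrite ler_wpM2r ?sqr_ge0// ler_norm.
have -> : `|M| * (1 + enorm x ^+ 2) ^+ 2 * gam x =
    `|M| / gmass * ((1 + enorm x ^+ 2) ^+ 2 * gsV 2^-1 x) by rewrite /gam; ring.
have -> : `|M| * 256 / gmass * gsV (3 / 8) x = `|M| / gmass * (256 * gsV (3 / 8) x) by ring.
by rewrite ler_wpM2l// divr_ge0// ltW// gmass_gt0.
Qed.

Lemma gam_fourier (x : 'rV[R]_d) : \int[la]_y (cos (dotp y x) * gam y) = gsV 2^-1 x.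
Proof.
have [H _] := gauss_fourier x.
have -> : \int[la]_y (cos (dotp y x) * gam y) = \int[la]_y (gmass^-1 * (cos (dotp y x) * gsV 2^-1 y)).
  by apply: eq_Rintegral => y _; rewrite /gam; ring.
rewrite RintegralZl//; last first.
  apply: (integrable_bounded_gsV (M := 1)) => [|y]; last exact: normr_cos_le1.
  by apply: (measurableT_comp measurable_cosR); exact: measurable_fun_dotp.
by rewrite H mulrA mulVf ?mul1r// gt_eqF// gmass_gt0.
Qed.

Lemma measurable_cosd (y : 'rV[R]_d) : measurable_fun setT (fun x => cos (dotp x y)).
Proof. by apply: (measurableT_comp measurable_cosR); exact: measurable_fun_dotp. Qed.

Definition rt (c : R) : R := Num.sqrt (2 * c).

Lemma rt_bump c x : 0 < c -> \int[la]_y (cos (dotp y (rt c *: x)) * gam y) = gsV c x.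
Proof.
move=> c0; rewrite gam_fourier gsV_scale /rt sqr_sqrtr ?mulr_ge0 ?ltW//.
by rewrite mulrAC divff ?mul1r.
Qed.

Lemma trig_shift (t : R) (u y : 'rV[R]_d) : 0 <= t ->
  \int[P]_w cos (dotp u (y + X t w)) = cos (dotp u y) * expR (- (t * Psi u)).
Proof.
move=> t0; have mc : measurable_fun setT (fun w => cos (dotp u (X t w))).
  by apply: (measurableT_comp measurable_cosR); apply: measurable_fun_dotp => //; exact: mX.
have ms : measurable_fun setT (fun w => sin (dotp u (X t w))).
  by apply: (measurableT_comp measurable_sinR); apply: measurable_fun_dotp => //; exact: mX.
have Ic : P.-integrable setT (EFin \o (fun w => cos (dotp u (X t w)))).
  exact: (integrable_bounded_prob P mc (fun w => normr_cos_le1 _)).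
have Is : P.-integrable setT (EFin \o (fun w => sin (dotp u (X t w)))).
  exact: (integrable_bounded_prob P ms (fun w => normr_sin_le1 _)).
under eq_Rintegral do rewrite dotpDr cosD.
rewrite RintegralB//.
- by rewrite !RintegralZl// cosX// sinX// mulr0 subr0.
- exact: (integrableZl measurableT (cos (dotp u y)) Ic).
- exact: (integrableZl measurableT (sin (dotp u y)) Is).
Qed.

(** After Fubini the law of [X t] enters only through E cos(u.(y + X_t)) = cos(u.y) e^(-t Psi(u)).
    Applied with [h] constant it gives the expectation of a bump, with [h] the scaled exponent that
    of its generator. *)
Lemma trig_gam_shift (r t M : R) (y : 'rV[R]_d) (h : 'rV[R]_d -> R) : 0 <= t ->
  measurable_fun setT h -> (forall x, `|h x| <= M * (1 + enorm x ^+ 2) ^+ 2) ->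
  P.-integrable setT (EFin \o (fun w =>
    \int[la]_x (cos (dotp x (r *: (y + X t w))) * h x * gam x))) /\
  \int[P]_w \int[la]_x (cos (dotp x (r *: (y + X t w))) * h x * gam x) =
  \int[la]_x (cos (dotp x (r *: y)) * expR (- (t * Psi (r *: x))) * h x * gam x).
Proof.
move=> t0 mh hM; have mXt := mX t0.
have nh : measurable_fun setT (fun x => `|h x|).
  exact: (measurableT_comp (@normr_measurable R setT) mh).
have I2 := @integrable_gam (fun x => `|h x|) M nh (fun x => eq_rect_r (fun z => z <= _) (hM x) (normr_id (h x))).
have I1 : P.-integrable setT (EFin \o cst 1%R).
  by apply: finite_measure_integrable_cst.
have mf : measurable_fun setT (fun p : Omega * 'rV[R]_d =>
    cos (dotp p.2 (r *: (y + X t p.1))) * h p.2 * gam p.2).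
  apply: measurable_funM; last exact: (measurableT_comp measurable_gam measurable_snd).
  apply: measurable_funM; last exact: (measurableT_comp mh measurable_snd).
  apply: (measurableT_comp measurable_cosR); apply: measurable_fun_dotp; first exact: measurable_snd.
  apply: measurable_fun_scalerV; apply: measurable_fun_addrV => //.
  exact: (measurableT_comp mXt measurable_fst).
have fh (w : Omega) (x : 'rV[R]_d) :
    `|cos (dotp x (r *: (y + X t w))) * h x * gam x| <= cst 1 w * (`|h x| * gam x).
  rewrite normrM (ger0_norm (gam_ge0 x)) mul1r ler_wpM2r ?gam_ge0//.
  by rewrite normrM ler_piMl ?normr_cos_le1.
split.
  have mm := @measurable_Rintegral_l _ _ _ _ _ P la
    (fun w x => cos (dotp x (r *: (y + X t w))) * h x * gam x)
    (cst 1) (fun x => `|h x| * gam x) mf I1 I2 fh.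
  have nn w : `|\int[la]_x (cos (dotp x (r *: (y + X t w))) * h x * gam x)| <=
      \int[la]_x (`|h x| * gam x).
    rewrite -[leRHS]mul1r; exact: (@normr_Rintegral_l _ _ _ _ _ la
      (fun w x => cos (dotp x (r *: (y + X t w))) * h x * gam x)
      (cst 1) (fun x => `|h x| * gam x) mf I2 fh w).
  exact: (integrable_bounded_prob P mm nn).
rewrite (@Rfubini _ _ _ _ _ P la (fun w x => cos (dotp x (r *: (y + X t w))) * h x * gam x)
   (cst 1) (fun x => `|h x| * gam x) mf I1 I2 fh).
apply: eq_Rintegral => x _.
  have -> : \int[P]_w (cos (dotp x (r *: (y + X t w))) * h x * gam x) =
     \int[P]_w ((h x * gam x) * cos (dotp (r *: x) (y + X t w))).
    by apply: eq_Rintegral => w _; rewrite dotpZr dotpZl; ring.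
  rewrite RintegralZl ?trig_shift//; last first.
    have mc : measurable_fun setT (fun w => cos (dotp (r *: x) (y + X t w))).
      apply: (measurableT_comp measurable_cosR); apply: measurable_fun_dotp => //.
      exact: measurable_fun_addrV.
    exact: (integrable_bounded_prob P mc (fun w => normr_cos_le1 _)).
  by rewrite dotpZr dotpZl; ring.
Qed.

Lemma Psi_scale_le r u : Psi (r *: u) <= CP * (1 + r ^+ 2) * (1 + enorm u ^+ 2).
Proof.
apply: (le_trans (Psi_le _)); rewrite -mulrA ler_wpM2l ?CP_ge0//.
rewrite enormZ exprMn real_normK ?num_real//.
have := sqr_ge0 r; have := sqr_ge0 (enorm u); nra.
Qed.

Lemma measurable_Psi_scale r : measurable_fun setT (fun u : 'rV[R]_d => Psi (r *: u)).
Proof. exact: (measurableT_comp measurable_Psi (measurable_scalerV r)). Qed.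

Lemma sqr1D_ge (x : 'rV[R]_d) : 1 <= 1 + enorm x ^+ 2 /\ 1 + enorm x ^+ 2 <= (1 + enorm x ^+ 2) ^+ 2.
Proof.
have h : 1 <= 1 + enorm x ^+ 2 by rewrite lerDl sqr_ge0.
by split => //; rewrite expr2 ler_peMl// (le_trans ler01).
Qed.

(* The generator applied to the bump [gsV c], written on the Fourier side. *)
Definition gen c (x : 'rV[R]_d) : R :=
  - \int[la]_y (cos (dotp y (rt c *: x)) * Psi (rt c *: y) * gam y).

Definition K2 c : R := \int[la]_y (Psi (rt c *: y) ^+ 2 / 2 * gam y).

Lemma gN_le x : g (- x) <= Ce * g x.
Proof.
by have := g_exp (- x) x; rewrite enormN subrr normr0 mulr0 expR0 mulr1.
Qed.

Section one_bump.
Variable c : R.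
Hypothesis c0 : 0 < c.
Local Notation r := (rt c).

Lemma expE t (w : 'rV[R]_d) : 0 <= t -> 0 <= expR (- (t * Psi w)) <= 1.
Proof.
by move=> t0; rewrite expR_ge0 -expR0 ler_expR oppr_le0 mulr_ge0 ?Psi_ge0.
Qed.

Lemma measurable_expPsi t :
  measurable_fun setT (fun y : 'rV[R]_d => expR (- (t * Psi (r *: y)))).
Proof.
apply: measurableT_comp => //; apply: measurable_funN; apply: measurable_funM => //.
exact: measurable_Psi_scale.
Qed.

Lemma measurable_cosr (x : 'rV[R]_d) : measurable_fun setT (fun y => cos (dotp y (r *: x))).
Proof. exact: measurable_cosd. Qed.

Lemma bump_shift t y : 0 <= t ->
  \int[P]_w gsV c (y + X t w) =
  \int[la]_x (cos (dotp x (r *: y)) * expR (- (t * Psi (r *: x))) * gam x).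
Proof.
move=> t0; transitivity (\int[P]_w \int[la]_x (cos (dotp x (r *: (y + X t w))) * 1 * gam x)).
  apply: eq_Rintegral => w _; rewrite -rt_bump//.
  by apply: eq_Rintegral => x _; rewrite mulr1.
have [||_ ->] := @trig_gam_shift r t 1 y (cst 1) t0; first exact: measurable_cst.
  by move=> x; rewrite normr1 mul1r; have [h1 h2] := sqr1D_ge x; exact: le_trans h2.
by apply: eq_Rintegral => x _; rewrite mulr1.
Qed.

Lemma gen_shift t y : 0 <= t ->
  \int[P]_w gen c (y + X t w) =
  - \int[la]_x (cos (dotp x (r *: y)) * expR (- (t * Psi (r *: x))) * Psi (r *: x) * gam x).
Proof.
move=> t0.
have hM x : `|Psi (r *: x)| <= CP * (1 + r ^+ 2) * (1 + enorm x ^+ 2) ^+ 2.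
  rewrite ger0_norm ?Psi_ge0//; apply: (le_trans (Psi_scale_le _ _)).
  have [h1 h2] := sqr1D_ge x.
  by rewrite ler_wpM2l// mulr_ge0 ?CP_ge0// addr_ge0 ?sqr_ge0.
have [I <-] := trig_gam_shift r y t0 (measurable_Psi_scale r) hM.
rewrite -mulN1r -RintegralZl//.
by apply: eq_Rintegral => w _; rewrite /gen mulN1r.
Qed.

Lemma normr_PsiM x : `|Psi (r *: x)| <= CP * (1 + r ^+ 2) * (1 + enorm x ^+ 2) ^+ 2.
Proof.
rewrite ger0_norm ?Psi_ge0//; apply: (le_trans (Psi_scale_le _ _)).
have [h1 h2] := sqr1D_ge x.
by rewrite ler_wpM2l// mulr_ge0 ?CP_ge0// addr_ge0 ?sqr_ge0.
Qed.

Lemma integrable_trigM t x (h : 'rV[R]_d -> R) (M : R) : 0 <= t ->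
  measurable_fun setT h -> (forall x, `|h x| <= M * (1 + enorm x ^+ 2) ^+ 2) ->
  la.-integrable setT (EFin \o (fun y =>
    cos (dotp y (r *: x)) * expR (- (t * Psi (r *: y))) * h y * gam y)).
Proof.
move=> t0 mh hM; apply: (@integrable_gam _ M).
  apply: measurable_funM => //; apply: measurable_funM; first exact: measurable_cosr.
  exact: measurable_expPsi.
move=> y; apply: le_trans (hM y); rewrite normrM ler_piMl// normrM.
have /andP[e0 e1] := expE (r *: y) t0.
by rewrite (ger0_norm e0) mulr_ile1// normr_cos_le1.
Qed.

Lemma integrable_K2 : la.-integrable setT (EFin \o (fun y => Psi (r *: y) ^+ 2 / 2 * gam y)).
Proof.
apply: (@integrable_gam _ ((CP * (1 + r ^+ 2)) ^+ 2 / 2)).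
  by apply: measurable_funM => //; apply: measurable_funX; exact: measurable_Psi_scale.
move=> x; rewrite ger0_norm ?divr_ge0 ?sqr_ge0// [leRHS]mulrAC ler_wpM2r// -exprMn.
rewrite lerXn2r ?nnegrE ?Psi_ge0 ?Psi_scale_le//.
by rewrite !mulr_ge0 ?CP_ge0 ?addr_ge0 ?sqr_ge0.
Qed.

Lemma K2_ge0 : 0 <= K2 c.
Proof. by apply: Rintegral_ge0 => y _; rewrite mulr_ge0 ?gam_ge0// divr_ge0 ?sqr_ge0. Qed.

(** Taylor's formula under the Fourier integral: the integrand of the error is e^(-t Psi) (e^(-h
    Psi) - 1 + h Psi) up to a cosine, at most (h Psi)^2 / 2. The bound is uniform in both the time
    and the starting point. *)
Lemma bump_step t h y : 0 <= t -> 0 <= h ->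
  `|\int[P]_w gsV c (y + X (t + h) w) - \int[P]_w gsV c (y + X t w)
    - h * \int[P]_w gen c (y + X t w)| <= h ^+ 2 * K2 c.
Proof.
move=> t0 h0; have th0 : 0 <= t + h by rewrite addr_ge0.
rewrite !bump_shift// gen_shift//.
have hM1 (x : 'rV[R]_d) : `|cst (1 : R) x| <= 1 * (1 + enorm x ^+ 2) ^+ 2.
  by rewrite normr1 mul1r; have [h1 h2] := sqr1D_ge x; exact: le_trans h2.
have I1 := integrable_trigM y th0 (measurable_cst _) hM1.
have I2 := integrable_trigM y t0 (measurable_cst _) hM1.
have I3 := integrable_trigM y t0 (measurable_Psi_scale r) normr_PsiM.
under eq_Rintegral do rewrite -[cos _ * _]mulr1.
under [X in _ - X - _]eq_Rintegral do rewrite -[cos _ * _]mulr1.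
rewrite mulrN opprK -RintegralZl// -RintegralB// -RintegralD//; last 2 first.
- exact: (integrableB measurableT I1 I2).
- exact: (integrableZl measurableT h I3).
rewrite /K2 -RintegralZl//; last exact: integrable_K2.
apply: (le_trans (le_normr_Rintegral measurableT _)).
  have := integrableD measurableT (integrableB measurableT I1 I2) (integrableZl measurableT h I3).
  by [].
apply: le_Rintegral => //.
- apply: (@integrable_norm _ _ _ la setT (fun x => _ - _ + _)).
  exact: (integrableD measurableT (integrableB measurableT I1 I2) (integrableZl measurableT h I3)).
- exact: (integrableZl measurableT (h ^+ 2) integrable_K2).
move=> x _.
have -> : cos (dotp x (r *: y)) * expR (- ((t + h) * Psi (r *: x))) * 1 * gam x -
   cos (dotp x (r *: y)) * expR (- (t * Psi (r *: x))) * 1 * gam x +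
   h * (cos (dotp x (r *: y)) * expR (- (t * Psi (r *: x))) * Psi (r *: x) * gam x) =
   cos (dotp x (r *: y)) * expR (- (t * Psi (r *: x))) *
   (expR (- (h * Psi (r *: x))) - 1 + h * Psi (r *: x)) * gam x.
  by rewrite mulrDl opprD expRD; ring.
have [|e1 e2] := @expR_taylor2 R (h * Psi (r *: x)); first by rewrite mulr_ge0 ?Psi_ge0.
rewrite normrM (ger0_norm (gam_ge0 x)) mulrA ler_wpM2r ?gam_ge0//.
rewrite normrM (ger0_norm e1).
apply: (@le_trans _ _ ((h * Psi (r *: x)) ^+ 2 / 2)); last by rewrite exprMn mulrA.
rewrite -[leRHS]mul1r ler_pM// ?normr_ge0//.
have /andP[p0 p1] := expE (r *: x) t0.
by rewrite normrM (ger0_norm p0) mulr_ile1// normr_cos_le1.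
Qed.

Lemma bump_env_ge0 (x : 'rV[R]_d) : 0 <= bump_env c x.
Proof.
apply: mulr_ge0; last by apply: mulr_ge0; [exact: gsV_ge0|exact: expR_ge0].
by apply: mulr_ge0 => //; apply: addr_ge0 => //; exact: ltW.
Qed.

(* The part of the generator coming from the Gaussian covariance is a
   combination of terms [(xi.e)^2]; comparing them with [2(1-cos(eps xi.e))/eps^2]
   reduces it to second differences of the bump. *)
Lemma sqr_part_le e x : enorm e <= 2 ->
  `|\int[la]_y (cos (dotp y (r *: x)) * dotp (r *: y) e ^+ 2 * gam y)| <= 4 * bump_env c x.
Proof.
move=> e2.
pose M3 := \int[la]_y (`|dotp (r *: y) e| ^+ 3 * gam y).
have md : measurable_fun setT (fun y : 'rV[R]_d => dotp (r *: y) e).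
  by apply: measurable_fun_dotp => //; exact: measurable_scalerV.
have r0 : 0 <= r by exact: sqrtr_ge0.
have dle y : `|dotp (r *: y) e| <= (2 * r) * enorm y.
  apply: (le_trans (normr_dotp _ _)); rewrite enormZ (ger0_norm r0) mulrAC ler_wpM2r ?enorm_ge0//.
  by rewrite mulrC ler_wpM2r.
have n1 (y : 'rV[R]_d) : enorm y ^+ 2 <= (1 + enorm y ^+ 2) ^+ 2.
  by have [h1 h2] := sqr1D_ge y; lra.
have n3 (y : 'rV[R]_d) : enorm y ^+ 3 <= (1 + enorm y ^+ 2) ^+ 2.
  have y0 := enorm_ge0 y; have [h1 h2] := sqr1D_ge y.
  rewrite exprS; have : 2 * enorm y <= 1 + enorm y ^+ 2 by have := sqr_ge0 (enorm y - 1); rewrite sqrrB1; lra.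
  rewrite [(1 + _) ^+ 2]expr2 => h; apply: ler_pM => //; [exact: sqr_ge0|lra|lra].
have I3 : la.-integrable setT (EFin \o (fun y => `|dotp (r *: y) e| ^+ 3 * gam y)).
  apply: (@integrable_gam _ ((2 * r) ^+ 3)).
    by apply: measurable_funX; exact: (measurableT_comp (@normr_measurable R setT) md).
  move=> y; rewrite ger0_norm ?exprn_ge0//.
  apply: (@le_trans _ _ (((2 * r) * enorm y) ^+ 3)).
    by rewrite lerXn2r ?nnegrE ?mulr_ge0 ?enorm_ge0.
  by rewrite exprMn ler_wpM2l ?exprn_ge0 ?mulr_ge0.
have I2 : la.-integrable setT (EFin \o (fun y =>
    cos (dotp y (r *: x)) * dotp (r *: y) e ^+ 2 * gam y)).
  apply: (@integrable_gam _ ((2 * r) ^+ 2)).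
    by apply: measurable_funM; [exact: measurable_cosr|exact: measurable_funX].
  move=> y; rewrite normrM; apply: (@le_trans _ _ (dotp (r *: y) e ^+ 2)).
    by rewrite [`|_ ^+ 2|]ger0_norm ?sqr_ge0// ler_piMl ?sqr_ge0// normr_cos_le1.
  apply: (@le_trans _ _ (((2 * r) * enorm y) ^+ 2)).
    rewrite -(real_normK (num_real (dotp _ _))) lerXn2r ?nnegrE ?mulr_ge0 ?enorm_ge0//.
  by rewrite exprMn ler_wpM2l ?exprn_ge0 ?mulr_ge0.
have M30 : 0 <= M3 by apply: Rintegral_ge0 => y _; rewrite mulr_ge0 ?gam_ge0// exprn_ge0.
have key (s : R) : 0 < s -> s <= 2^-1 ->
  `|\int[la]_y (cos (dotp y (r *: x)) * dotp (r *: y) e ^+ 2 * gam y)| <= 4 * bump_env c x + 2 * M3 * s.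
  move=> s0 s1; have sn0 : s != 0 by rewrite gt_eqF.
  pose F y := cos (dotp y (r *: x)) * (2 * (1 - cos (dotp (r *: y) (s *: e))) / s ^+ 2) * gam y.
  have mcs (v : 'rV[R]_d) : measurable_fun setT (fun y : 'rV[R]_d => cos (dotp (r *: y) v)).
    apply: (measurableT_comp measurable_cosR); apply: measurable_fun_dotp => //.
    exact: measurable_scalerV.
  have IF : la.-integrable setT (EFin \o F).
    apply: (@integrable_gam _ (4 / s ^+ 2)).
      apply: measurable_funM; first exact: measurable_cosr.
      apply: measurable_funM => //; apply: measurable_funM => //.
      by apply: measurable_funB => //; exact: mcs.
    move=> y; rewrite normrM; apply: (@le_trans _ _ (4 / s ^+ 2)).
      rewrite -[leRHS]mul1r ler_pM ?normr_cos_le1// ger0_norm.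
        by rewrite ler_wpM2r ?invr_ge0 ?sqr_ge0//; have := sub1cos_le2 (dotp (r *: y) (s *: e)); lra.
      by rewrite divr_ge0 ?sqr_ge0// mulr_ge0// sub1cos_ge0.
    have [h1 h2] := sqr1D_ge y.
    by rewrite ler_peMr ?divr_ge0 ?sqr_ge0//; lra.
  have Icos (v : 'rV[R]_d) : la.-integrable setT (EFin \o (fun y => cos (dotp y (r *: v)) * gam y)).
    apply: (@integrable_gam _ 1); first exact: measurable_cosr.
    move=> y; rewrite mul1r; have [h1 h2] := sqr1D_ge y; have := normr_cos_le1 (dotp y (r *: v)); lra.
  (* From 2 cos A (1 - cos B) = 2 cos A - cos(A + B) - cos(A - B): multiplying by 1 - cos in
     frequency is minus a second difference in space. *)
  have FE : \int[la]_y F y = - (gsV c (x + s *: e) + gsV c (x - s *: e) - 2 * gsV c x) / s ^+ 2.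
    have I3' := integrableB measurableT (integrableD measurableT (Icos (x + s *: e)) (Icos (x - s *: e))) (integrableZl measurableT 2 (Icos x)).
    pose co v y := cos (dotp y (r *: v)) * gam y.
    transitivity (\int[la]_y (- (s ^+ 2)^-1 * (co (x + s *: e) y + co (x - s *: e) y - 2 * co x y))).
      apply: eq_Rintegral => y _; rewrite /F /co.
      have q1 : dotp (r *: y) (s *: e) = s * (r * dotp y e) by rewrite dotpZr dotpZl.
      have q2 : dotp y (r *: (x + s *: e)) = dotp y (r *: x) + s * (r * dotp y e).
        by rewrite scalerDr dotpDr scalerA (dotpZr (r * s)) mulrA [s * r]mulrC.
      have q3 : dotp y (r *: (x - s *: e)) = dotp y (r *: x) - s * (r * dotp y e).
        by rewrite scalerBr dotpDr dotpNr scalerA (dotpZr (r * s)) mulrA [s * r]mulrC.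
      by rewrite q1 q2 q3 cosD cosB; field.
    rewrite (@RintegralZl _ _ R la setT (fun y => co (x + s *: e) y + co (x - s *: e) y - 2 * co x y) (- (s ^+ 2)^-1) measurableT I3').
    rewrite RintegralB//; last 2 first.
    - exact: (integrableD measurableT (Icos _) (Icos _)).
    - exact: (integrableZl measurableT 2 (Icos _)).
    rewrite RintegralD//; [|exact: Icos|exact: Icos].
    rewrite RintegralZl//; last exact: Icos.
    by rewrite /co !rt_bump// mulNr mulrC mulNr.
  have h1 : `|\int[la]_y F y| <= 4 * bump_env c x.
    rewrite FE normrM normrN normfV [`|s ^+ 2|]ger0_norm ?sqr_ge0// ler_pdivrMr ?exprn_gt0//.
    apply: le_trans (bump_second_difference x c0 _) _.
      rewrite enormZ (ger0_norm (ltW s0)).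
      by apply: (@le_trans _ _ (2^-1 * 2)); [apply: ler_pM; rewrite ?enorm_ge0// ltW|rewrite mulVf].
    have be := bump_env_ge0 x.
    rewrite enormZ (ger0_norm (ltW s0)) exprMn.
    have e4 : enorm e ^+ 2 <= 4.
      have -> : (4 : R) = 2 ^+ 2 by rewrite -natrX.
      by rewrite lerXn2r ?nnegrE ?enorm_ge0.
    rewrite -mulrA [leRHS]mulrC ler_wpM2l ?sqr_ge0//.
    by rewrite ler_wpM2r.
  have h2 : `|\int[la]_y (cos (dotp y (r *: x)) * dotp (r *: y) e ^+ 2 * gam y) -
      \int[la]_y F y| <= 2 * M3 * s.
    rewrite -RintegralB//.
    apply: (le_trans (le_normr_Rintegral measurableT (integrableB measurableT I2 IF))).
    rewrite /M3 mulrAC -RintegralZl//; apply: le_Rintegral => //.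
    - exact: (integrable_norm (integrableB measurableT I2 IF)).
    - exact: (integrableZl measurableT (2 * s) I3).
    move=> y _; rewrite /F; set D := dotp (r *: y) e.
    have -> : dotp (r *: y) (s *: e) = s * D by rewrite dotpZr.
    rewrite -mulrBl -mulrBr normrM (ger0_norm (gam_ge0 y)) [leRHS]mulrA ler_wpM2r ?gam_ge0//.
    rewrite normrM -[leRHS]mul1r ler_pM ?normr_cos_le1//.
    have -> : D ^+ 2 - 2 * (1 - cos (s * D)) / s ^+ 2 =
        2 / s ^+ 2 * ((s * D) ^+ 2 / 2 - (1 - cos (s * D))) by field.
    have t1 := sub1cos_ge (s * D); have t2 := sub1cos_le (s * D).
    rewrite ger0_norm; last by rewrite mulr_ge0 ?divr_ge0 ?sqr_ge0//; lra.
    apply: (@le_trans _ _ (2 / s ^+ 2 * (`|s * D| ^+ 3))).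
      by rewrite ler_wpM2l// divr_ge0 ?sqr_ge0.
    rewrite normrM (ger0_norm (ltW s0)) exprMn le_eqVlt; apply/orP; left; apply/eqP.
    by field.
  have := ler_normD (\int[la]_y (cos (dotp y (r *: x)) * dotp (r *: y) e ^+ 2 * gam y) -
      \int[la]_y F y) (\int[la]_y F y).
  by rewrite subrK => /le_trans; apply; rewrite addrC; exact: lerD.
apply/ler_addgt0Pr => eps eps0.
have M1 : 0 < 2 * M3 + 1 by rewrite ltr_wpDl// mulr_ge0.
pose s := Num.min 2^-1 (eps / (2 * M3 + 1)).
have s0 : 0 < s by rewrite lt_min invr_gt0 ltr0n divr_gt0.
have s1 : s <= 2^-1 by rewrite ge_min lexx.
apply: (le_trans (key s s0 s1)); rewrite lerD2l.
apply: (@le_trans _ _ ((2 * M3 + 1) * (eps / (2 * M3 + 1)))).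
  apply: ler_pM; [by rewrite mulr_ge0|exact: ltW|by rewrite lerDl|by rewrite ge_min lexx orbT].
by rewrite mulrC divfK// gt_eqF.
Qed.

Definition qpart (x : 'rV[R]_d) : R :=
  \int[la]_y (cos (dotp y (r *: x)) * (qform Q (r *: y) / 2) * gam y).

Lemma qpart_le x : `|qpart x| <= qform_bound Q * bump_env c x.
Proof.
have md e : measurable_fun setT (fun y : 'rV[R]_d => dotp (r *: y) e).
  by apply: measurable_fun_dotp => //; exact: measurable_scalerV.
pose G e y := cos (dotp y (r *: x)) * dotp (r *: y) e ^+ 2 * gam y.
have IG e : la.-integrable setT (EFin \o G e).
  apply: (@integrable_gam _ (r ^+ 2 * enorm e ^+ 2)).
    by apply: measurable_funM; [exact: measurable_cosr|exact: measurable_funX].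
  move=> y; rewrite normrM; apply: (@le_trans _ _ (dotp (r *: y) e ^+ 2)).
    by rewrite [`|_ ^+ 2|]ger0_norm ?sqr_ge0// ler_piMl ?sqr_ge0// normr_cos_le1.
  have := dotp_sqr_le (r *: y) e; rewrite -!sqr_enorm enormZ exprMn real_normK ?num_real//.
  move=> /le_trans; apply; rewrite mulrAC; apply: ler_wpM2l.
    by apply: mulr_ge0; exact: sqr_ge0.
  by have [h1 h2] := sqr1D_ge y; lra.
have Isum (n : nat) (s : seq 'I_n) (H : 'I_n -> 'rV[R]_d -> R) :
    (forall i, la.-integrable setT (EFin \o H i)) ->
    la.-integrable setT (EFin \o (fun y => \sum_(i <- s) H i y)) /\
    \int[la]_y (\sum_(i <- s) H i y) = \sum_(i <- s) \int[la]_y H i y.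
  move=> IH; elim: s => [|i s [I1 I2]].
    split; last by under eq_Rintegral do rewrite big_nil; rewrite Rintegral_cst ?mul0r// big_nil.
    rewrite (_ : _ \o _ = cst 0%E); first exact: integrable0.
    by apply/funext => y /=; rewrite big_nil.
  split.
    rewrite (_ : _ \o _ = ((EFin \o H i) \+ (EFin \o (fun y => \sum_(i <- s) H i y)%R))%E).
      exact: (integrableD measurableT (IH i) I1).
    by apply/funext => y /=; rewrite big_cons EFinD.
  by under eq_Rintegral do rewrite big_cons; rewrite RintegralD// big_cons I2.
pose H i j y := Q i j / 8 * G (bvec i + bvec j) y - Q i j / 8 * G (bvec i - bvec j) y.
have IZ k0 e := integrableZl measurableT k0 (IG e).
have IH i j : la.-integrable setT (EFin \o H i j).
  exact: (integrableB measurableT (IZ _ _) (IZ _ _)).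
have E : qpart x = \sum_i \sum_j \int[la]_y H i j y.
  have I1 i := (Isum d (index_enum 'I_d) (H i) (IH i)).1.
  rewrite (eq_bigr (fun i => \int[la]_y (\sum_j H i j y))); last first.
    by move=> i _; rewrite (Isum d (index_enum 'I_d) (H i) (IH i)).2.
  rewrite -(Isum d (index_enum 'I_d) (fun i y => \sum_j H i j y) I1).2.
  apply: eq_Rintegral => y _; rewrite qform_polar.
  rewrite !(mulr_sumr, mulr_suml); apply: eq_bigr => i _.
  rewrite !(mulr_sumr, mulr_suml); apply: eq_bigr => j _.
  by rewrite /H /G; field.
have be := bump_env_ge0 x.
rewrite E (le_trans (ler_norm_sum _ _ _))// /qform_bound big_distrl/=.
apply: ler_sum => i _; rewrite (le_trans (ler_norm_sum _ _ _))// big_distrl/=.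
apply: ler_sum => j _; rewrite RintegralB//; [|exact: IZ|exact: IZ].
rewrite !RintegralZl// -mulrBr normrM normrM.
have e1 : enorm (bvec i + bvec j) <= 2 :> R.
  by apply: (le_trans (ler_enormD _ _)); rewrite !enorm_bvec; lra.
have e2 : enorm (bvec i - bvec j) <= 2 :> R.
  by apply: (le_trans (ler_enormB _ _)); rewrite !enorm_bvec; lra.
have s1 := sqr_part_le x e1; have s2 := sqr_part_le x e2.
rewrite -mulrA ler_wpM2l// normfV [`|8|]ger0_norm//.
exact: eighth_normB.
Qed.

Definition jump x z : R := ((gsV c (x + z) + gsV c (x - z)) / 2 - gsV c x) * k z.

Lemma measurable_bumpD x : measurable_fun setT (fun z : 'rV[R]_d => gsV c (x + z)).
Proof.
apply: (measurableT_comp (measurable_gsV c)); exact: measurable_fun_addrV.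
Qed.

Lemma measurable_bumpB x : measurable_fun setT (fun z : 'rV[R]_d => gsV c (x - z)).
Proof.
apply: (measurableT_comp (measurable_gsV c)); exact: measurable_fun_subrV.
Qed.

Lemma measurable_jump x : measurable_fun setT (jump x).
Proof.
apply: measurable_funM => //; apply: measurable_funB => //.
apply: measurable_funM => //; apply: measurable_funD; [exact: measurable_bumpD|exact: measurable_bumpB].
Qed.

Lemma normr_jump x z : `|jump x z| <= (bump_env c x + 2) * (Num.min 1 (enorm z ^+ 2) * k z).
Proof.
rewrite /jump normrM (ger0_norm (k0 z)) mulrA ler_wpM2r//.
have be := bump_env_ge0 x.
have [z1|z1] := leP (enorm z) 1.
  have mE : Num.min 1 (enorm z ^+ 2) = enorm z ^+ 2.
    by apply/min_idPr; rewrite expr_le1// enorm_ge0.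
  rewrite mE; have := bump_second_difference x c0 z1.
  have -> : (gsV c (x + z) + gsV c (x - z)) / 2 - gsV c x =
    2^-1 * (gsV c (x + z) + gsV c (x - z) - 2 * gsV c x) by field.
  rewrite normrM ger0_norm ?invr_ge0// => h.
  rewrite ler_pdivrMl//; apply: (le_trans h); rewrite mulrC.
  have z2 := sqr_ge0 (enorm z).
  have := mulr_ge0 be z2; set u := enorm z ^+ 2 in z2 *; set v := bump_env c x; nra.
have -> : Num.min 1 (enorm z ^+ 2) = 1 by apply/min_idPl; rewrite expr_ge1 ?enorm_ge0// ltW.
rewrite mulr1.
have h1 := gsV_le1 (x + z) (ltW c0); have h2 := gsV_le1 (x - z) (ltW c0).
have h3 := gsV_le1 x (ltW c0).
have h4 := gsV_ge0 c (x + z); have h5 := gsV_ge0 c (x - z); have h6 := gsV_ge0 c x.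
rewrite ler_norml; apply/andP; split; lra.
Qed.

Lemma integrable_jump x : la.-integrable setT (EFin \o jump x).
Proof.
apply: (le_integrable _ _ _ (integrableZl measurableT (bump_env c x + 2) Ik)) => //.
  by apply/measurable_EFinP; exact: measurable_jump.
move=> z _ /=; rewrite lee_fin; apply: le_trans (normr_jump x z) _; exact: ler_norm.
Qed.

(** The Fourier expression equals the usual integro-differential one. Fubini moves the frequency
    integral inside the jump integral, where the product of cos and 1 - cos becomes a symmetrised
    second difference of the bump. *)
Lemma gen_formula x : gen c x = - qpart x + \int[la]_z jump x z.
Proof.
pose f (y z : 'rV[R]_d) := cos (dotp y (r *: x)) * ((1 - cos (dotp (r *: y) z)) * k z) * gam y.
pose h1 (y : 'rV[R]_d) := (2 + enorm (r *: y) ^+ 2) * gam y.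
pose h2 (z : 'rV[R]_d) := Num.min 1 (enorm z ^+ 2) * k z.
have mf : measurable_fun setT (fun p : 'rV[R]_d * 'rV[R]_d => f p.1 p.2).
  apply: measurable_funM; last exact: (measurableT_comp measurable_gam measurable_fst).
  apply: measurable_funM; first exact: (measurableT_comp (measurable_cosr x) measurable_fst).
  apply: measurable_funM; last exact: (measurableT_comp mk measurable_snd).
  apply: measurable_funB => //; apply: (measurableT_comp measurable_cosR).
  apply: measurable_fun_dotp; last exact: measurable_snd.
  exact: (measurableT_comp (measurable_scalerV r) measurable_fst).
have Ih1 : la.-integrable setT (EFin \o h1).
  apply: (@integrable_gam _ (2 + r ^+ 2)).
    apply: measurable_funD => //; apply: measurable_funX; apply: measurable_fun_enorm.
    exact: measurable_scalerV.
  move=> y; rewrite ger0_norm ?addr_ge0 ?sqr_ge0// enormZ exprMn real_normK ?num_real//.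
  have [q1 q2] := sqr1D_ge y; have q3 := sqr_ge0 r; have q4 := sqr_ge0 (enorm y); nra.
have fh y z : `|f y z| <= h1 y * h2 z.
  rewrite /f /h1 /h2 normrM (ger0_norm (gam_ge0 y)) [leRHS]mulrAC ler_wpM2r ?gam_ge0//.
  rewrite normrM; apply: (@le_trans _ _ ((1 - cos (dotp (r *: y) z)) * k z)).
    have h0 : 0 <= (1 - cos (dotp (r *: y) z)) * k z by rewrite mulr_ge0// sub1cos_ge0.
    by rewrite (ger0_norm h0) ler_piMl// normr_cos_le1.
  rewrite mulrA ler_wpM2r//; exact: sub1cos_dotp_le.
have E1 : gen c x = - (qpart x + \int[la]_y \int[la]_z f y z).
  have IQ : la.-integrable setT (EFin \o (fun y => cos (dotp y (r *: x)) * (qform Q (r *: y) / 2) * gam y)).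
    apply: (@integrable_gam _ (qform_bound Q * r ^+ 2)).
      apply: measurable_funM; first exact: measurable_cosr.
      by apply: measurable_funM => //; exact: (measurableT_comp measurable_qform (measurable_scalerV r)).
    move=> y; rewrite normrM.
    apply: (@le_trans _ _ `|qform Q (r *: y) / 2|); first by rewrite ler_piMl// normr_cos_le1.
    rewrite normrM; apply: (@le_trans _ _ (`|qform Q (r *: y)|)).
      by rewrite ler_piMr// normfV ger0_norm//; lra.
    apply: (le_trans (normr_qform _ _)); rewrite -mulrA ler_wpM2l ?qform_bound_ge0//.
    rewrite enormZ exprMn real_normK ?num_real// ler_wpM2l ?sqr_ge0//.
    by have [q1 q2] := sqr1D_ge y; apply: le_trans q2; rewrite lerDr.
  have IJ : la.-integrable setT (EFin \o (fun y => \int[la]_z f y z)).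
    apply: (le_integrable _ _ _ (integrableZl measurableT Mk Ih1)) => //.
      apply/measurable_EFinP; exact: (measurable_Rintegral_l mf Ih1 Ik fh).
    move=> y _ /=; rewrite lee_fin; apply: le_trans (ler_norm _); rewrite mulrC.
    exact: (normr_Rintegral_l mf Ik fh y).
  rewrite /qpart -RintegralD// /gen; congr (- _); apply: eq_Rintegral => y _.
  rewrite /Psi mulrDr mulrDl; congr (_ + _).
  rewrite /f; under [RHS]eq_Rintegral do rewrite mulrAC mulrC.
  rewrite -[LHS]mulrA [_ * gam y]mulrC mulrA -RintegralZl//; last exact: integrable_sub1cos.
  by apply: eq_Rintegral => z _; ring.
rewrite E1 opprD; congr (_ + _).
rewrite (Rfubini mf Ih1 Ik fh) -mulN1r.
transitivity (-1 * \int[la]_z (- 1 * jump x z)); last first.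
  by rewrite RintegralZl ?mulrA ?mulrNN ?mul1r//; exact: integrable_jump.
congr (_ * _); apply: eq_Rintegral => z _.
have Icos (v : 'rV[R]_d) : la.-integrable setT (EFin \o (fun y => cos (dotp y (r *: v)) * gam y)).
  apply: (@integrable_gam _ 1); first exact: measurable_cosr.
  move=> y; rewrite mul1r; have [q1 q2] := sqr1D_ge y; have := normr_cos_le1 (dotp y (r *: v)); lra.
pose co v y := cos (dotp y (r *: v)) * gam y.
have I1 := integrableB measurableT (integrableD measurableT (Icos (x + z)) (Icos (x - z))) (integrableZl measurableT 2 (Icos x)).
transitivity (\int[la]_y (- (k z / 2) * (co (x + z) y + co (x - z) y - 2 * co x y))).
  apply: eq_Rintegral => y _; rewrite /f /co.
  have -> : dotp (r *: y) z = dotp y (r *: z) by rewrite dotpZl dotpZr.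
  by rewrite scalerBr scalerDr !dotpDr dotpNr cosD cosB; field.
rewrite (@RintegralZl _ _ R la setT (fun y => co (x + z) y + co (x - z) y - 2 * co x y) (- (k z / 2)) measurableT I1).
rewrite RintegralB//; last 2 first.
- exact: (integrableD measurableT (Icos _) (Icos _)).
- exact: (integrableZl measurableT 2 (Icos _)).
rewrite RintegralD//; [|exact: Icos|exact: Icos].
rewrite RintegralZl//; last exact: Icos.
by rewrite /co !rt_bump// /jump; field.
Qed.

(** By [g_exp] at 0, where g = 1, the weight decays at most exponentially; a Gaussian times any
    exponential is therefore dominated by it. *)
Lemma bump_exp_le (b : R) x :
  gsV c x * expR (b * enorm x) <= Ce * expR ((a + b) ^+ 2 / (2 * c)) * g x.
Proof.
have e0 := expR_ge0 (a * enorm x).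
have h : 1 <= Ce * expR (a * enorm x) * g x.
  have := g_exp 0 x; rewrite g00 enorm0 sub0r normrN ger0_norm ?enorm_ge0//.
apply: (@le_trans _ _ (gsV c x * expR (b * enorm x) * (Ce * expR (a * enorm x) * g x))).
  by apply: ler_peMr h; apply: mulr_ge0; [exact: gsV_ge0|exact: expR_ge0].
have -> : gsV c x * expR (b * enorm x) * (Ce * expR (a * enorm x) * g x) =
  Ce * (gsV c x * expR ((a + b) * enorm x)) * g x by rewrite mulrDl expRD; ring.
rewrite ler_wpM2r ?(ltW (g_gt0 _))// ler_wpM2l ?(le_trans ler01)//.
apply: (le_trans (gsV_exp_le (a + b) x c0)).
by rewrite ler_piMr ?expR_ge0// gsV_le1// divr_ge0// ltW.
Qed.

Lemma bump_le_g x : gsV c x <= Ce * expR (a ^+ 2 / (2 * c)) * g x.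
Proof. by have := bump_exp_le 0 x; rewrite mul0r expR0 mulr1 addr0. Qed.

Lemma bump_conv_le x :
  la.-integrable setT (EFin \o (fun z => gsV c (x - z) * g z)) /\
  \int[la]_z (gsV c (x - z) * g z) <= Ce * expR (a ^+ 2 / (2 * c)) * Cc * g x.
Proof.
split.
  apply: (le_integrable _ _ _ Ig) => //.
    by apply/measurable_EFinP; apply: measurable_funM => //; exact: measurable_bumpB.
  move=> z _ /=; rewrite lee_fin normrM [`|gsV _ _|]ger0_norm ?gsV_ge0//.
  by rewrite ler_piMl// gsV_le1// ltW.
apply: ge0_Rintegral_le => [z|]; first by rewrite mulr_ge0 ?gsV_ge0// ltW.
have D0 : 0 <= Ce * expR (a ^+ 2 / (2 * c)) by rewrite mulr_ge0 ?expR_ge0// (le_trans ler01).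
apply: (@le_trans _ _ (\int[la]_z ((Ce * expR (a ^+ 2 / (2 * c)))%:E * (g (x - z) * g z)%:E))%E).
  apply: ge0_le_lower_integral => z _; first by rewrite lee_fin mulr_ge0 ?gsV_ge0// ltW.
  by rewrite -EFinM lee_fin mulrA ler_wpM2r ?bump_le_g// ltW.
rewrite ge0_intZl//; last 2 first.
- apply/measurable_EFinP; apply: measurable_funM => //.
  by apply: (measurableT_comp mg); exact: measurable_fun_subrV.
- by move=> z; rewrite lee_fin mulr_ge0// ltW.
by rewrite -[(_ * Cc * _)%R]mulrA [in leRHS]EFinM; apply: lee_wpmul2l; rewrite ?lee_fin// g_conv.
Qed.

Lemma gen_le : exists2 C, 0 <= C & forall x, `|gen c x| <= C * g x.
Proof.
pose A := Ce * expR ((a + 4 * c) ^+ 2 / (2 * c)).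
pose B := Ce * expR (a ^+ 2 / (2 * c)).
have A0 : 0 <= A by rewrite mulr_ge0 ?expR_ge0// (le_trans ler01).
have B0 : 0 <= B by rewrite mulr_ge0 ?expR_ge0// (le_trans ler01).
have Ce0 : 0 <= Ce by rewrite (le_trans ler01).
have cp := ltW c0; have Mk0 := Mk_ge0; have qb := qform_bound_ge0 Q.
have q32 : 0 <= 2 * (c + 32) by rewrite mulr_ge0// addr_ge0.
pose E := 2 * (c + 32) * A.
have E0 : 0 <= E by exact: mulr_ge0.
exists (qform_bound Q * E + ((E + B) * Mk + B * Cc * (1 + Ce))).
  have := ltW Cc0; do ! [move=> ?|apply: addr_ge0|apply: mulr_ge0] => //.
move=> x; have gx := ltW (g_gt0 x).
have env : bump_env c x <= E * g x.
  rewrite /bump_env /E -[leRHS]mulrA ler_wpM2l//; exact: bump_exp_le.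
have bx : gsV c x <= B * g x := bump_le_g x.
have bx0 := gsV_ge0 c x; have be := bump_env_ge0 x.
have [I1 J1] := bump_conv_le x.
have [I2 J2] := bump_conv_le (- x).
(* Small jumps pay the second difference of the bump, large jumps the value of the bump at the
   landing point; the latter integrates to a convolution with [g]. *)
have ptw z : `|jump x z| <= (bump_env c x + gsV c x) * (Num.min 1 (enorm z ^+ 2) * k z) +
    (gsV c (x - z) * g z + gsV c (- x - z) * g z).
  have -> : gsV c (- x - z) = gsV c (x + z) by rewrite -gsVN opprD !opprK.
  have p1 := gsV_ge0 c (x + z); have p2 := gsV_ge0 c (x - z).
  rewrite /jump normrM (ger0_norm (k0 z)) mulrA.
  have [z1|z1] := leP 1 (enorm z).
    have -> : Num.min 1 (enorm z ^+ 2) = 1 by apply/min_idPl; rewrite expr_ge1 ?enorm_ge0.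
    rewrite mulr1 -(kg z1) -!mulrDl ler_wpM2r//; exact: second_difference_le.
  have mE : Num.min 1 (enorm z ^+ 2) = enorm z ^+ 2.
    by apply/min_idPr; rewrite expr_le1// ?enorm_ge0// ltW.
  rewrite mE; have := bump_second_difference x c0 (ltW z1).
  have -> : (gsV c (x + z) + gsV c (x - z)) / 2 - gsV c x =
    2^-1 * (gsV c (x + z) + gsV c (x - z) - 2 * gsV c x) by field.
  rewrite normrM [`|2^-1|]ger0_norm ?invr_ge0// => h.
  rewrite ler_wpDr ?addr_ge0 ?mulr_ge0//; try exact: ltW.
  rewrite ler_wpM2r// ler_pdivrMl//; apply: (le_trans h).
  rewrite [leLHS]mulrC [leRHS]mulrA ler_wpM2r ?sqr_ge0// -[leLHS]mul1r.
  by apply: ler_pM; rewrite ?lerDl ?ler1n.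
have J : `|\int[la]_z jump x z| <= ((E + B) * Mk + B * Cc * (1 + Ce)) * g x.
  apply: (le_trans (le_normr_Rintegral measurableT (integrable_jump x))).
  apply: (@le_trans _ _ (\int[la]_z ((bump_env c x + gsV c x) * (Num.min 1 (enorm z ^+ 2) * k z) +
    (gsV c (x - z) * g z + gsV c (- x - z) * g z)))).
    apply: le_Rintegral => //; first exact: (integrable_norm (integrable_jump x)).
    exact: (integrableD measurableT (integrableZl measurableT (bump_env c x + gsV c x) Ik) (integrableD measurableT I1 I2)).
  rewrite RintegralD//; last 2 first.
  - exact: (integrableZl measurableT (bump_env c x + gsV c x) Ik).
  - exact: (integrableD measurableT I1 I2).
  rewrite RintegralD// RintegralZl// -/Mk.
  have J3 : B * Cc * g (- x) <= B * Cc * (Ce * g x).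
    by rewrite ler_wpM2l ?gN_le// mulr_ge0// ltW.
  have J4 : (bump_env c x + gsV c x) * Mk <= (E * g x + B * g x) * Mk.
    by rewrite ler_wpM2r// lerD.
  have -> : ((E + B) * Mk + B * Cc * (1 + Ce)) * g x =
    (E * g x + B * g x) * Mk + (B * Cc * g x + B * Cc * (Ce * g x)) by ring.
  by rewrite lerD// lerD// (le_trans J2).
rewrite gen_formula [leRHS]mulrDl (le_trans (ler_normD _ _))// normrN lerD//.
apply: (le_trans (qpart_le x)); rewrite -mulrA ler_wpM2l//.
Qed.

(** Telescoping of [bump_step]. The expectations of [g] on the right have no bound yet: integrating
    the centres of the bumps against [g] will turn the inequality into a closed one for [w0], to
    which Gronwall's lemma applies. *)
Lemma bump_iter : exists C K : R, [/\ 0 <= C, 0 <= K & forall (h : R) n y, 0 <= h ->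
  `|\int[P]_w gsV c (y + X (h *+ n) w) - gsV c y| <=
  h * \sum_(i < n) (C * \int[P]_w g (y + X (h *+ i) w)) + h ^+ 2 * K *+ n].
Proof.
have [C C0 gC] := gen_le.
exists C, (K2 c); split => //; first exact: K2_ge0.
move=> h n y h0; elim: n => [|n IH].
  rewrite bump_shift// big_ord0 mulr0 mulr0n addr0.
  under eq_Rintegral do rewrite mul0r oppr0 expR0 mulr1.
  by rewrite rt_bump// subrr normr0.
have hn : 0 <= h *+ n by rewrite mulrn_wge0.
have S := bump_step y hn h0.
have G : `|\int[P]_w gen c (y + X (h *+ n) w)| <= C * \int[P]_w g (y + X (h *+ n) w).
  have mXn : measurable_fun setT (fun w => y + X (h *+ n) w).
    by apply: measurable_fun_addrV => //; exact: mX.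
  have mg' : measurable_fun setT (fun w => g (y + X (h *+ n) w)) by exact: (measurableT_comp mg mXn).
  have Igx : P.-integrable setT (EFin \o (fun w => g (y + X (h *+ n) w))).
    apply: (integrable_bounded_prob P mg' (M := Kg)) => w.
    by rewrite ger0_norm// ltW.
  have hM x : `|Psi (r *: x)| <= CP * (1 + r ^+ 2) * (1 + enorm x ^+ 2) ^+ 2 := normr_PsiM x.
  have [I _] := trig_gam_shift r y hn (measurable_Psi_scale r) hM.
  have Ig' : P.-integrable setT (EFin \o (fun w => gen c (y + X (h *+ n) w))).
    rewrite (_ : _ \o _ = EFin \o (fun w => -1 * \int[la]_x (cos (dotp x (r *: (y + X (h *+ n) w))) * Psi (r *: x) * gam x))).
      exact: (integrableZl measurableT (-1) I).
    by apply/funext => w /=; rewrite mulN1r.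
  apply: (le_trans (le_normr_Rintegral measurableT Ig')).
  rewrite -RintegralZl//; apply: le_Rintegral => //.
  - exact: (integrable_norm Ig').
  - exact: (integrableZl measurableT C Igx).
rewrite big_ord_recr/= mulrDr !mulrSr [in leRHS]addrACA.
set A := \int[P]_w gsV c (y + X (h *+ n + h) w).
set B := \int[P]_w gsV c (y + X (h *+ n) w) in S IH *.
set D := \int[P]_w gen c (y + X (h *+ n) w) in S G *.
have -> : A - gsV c y = (B - gsV c y) + ((A - B - h * D) + h * D) by ring.
apply: (le_trans (ler_normD _ _)); apply: lerD => //.
apply: (le_trans (ler_normD _ _)); rewrite addrC; apply: lerD => //.
by rewrite normrM (ger0_norm h0) ler_wpM2l.
Qed.

End one_bump.

Lemma bump_step0 c h y : 0 < c -> 0 <= h ->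
  `|\int[P]_w gsV c (y + X h w) - gsV c y - h * gen c y| <= h ^+ 2 * K2 c.
Proof.
move=> c0 h0; have := bump_step c0 y (lexx 0) h0; rewrite add0r.
rewrite (bump_shift c0 y (lexx 0)) (gen_shift c y (lexx 0)).
under [X in _ - X - _]eq_Rintegral do rewrite mul0r oppr0 expR0 mulr1.
under [X in h * - X]eq_Rintegral do rewrite mul0r oppr0 expR0 mulr1.
by rewrite rt_bump.
Qed.

Lemma gmassE : \int[la]_y gsV 2^-1 y = gmass.
Proof.
have [H _] := gauss_fourier (0 : 'rV[R]_d).
transitivity (\int[la]_y (cos (dotp y 0) * gsV 2^-1 y)).
  by apply: eq_Rintegral => y _; rewrite dotpC dotp0l cos0 mul1r.
by rewrite H /gsV dotp0l mulr0 oppr0 expR0 mulr1.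
Qed.

Lemma integrable_bump_shift c (x : 'rV[R]_d) : 0 < c ->
  la.-integrable setT (EFin \o (fun z => gsV c (z - x))).
Proof.
move=> c0; have mg0 : measurable_fun setT (fun z : 'rV[R]_d => (gsV c z)%:E).
  by apply/measurable_EFinP; exact: measurable_gsV.
apply/integrableP; split.
  apply/measurable_EFinP; apply: (measurableT_comp (measurable_gsV c)).
  exact: measurable_fun_subrV.
under eq_integral do rewrite /= ger0_norm ?gsV_ge0//.
rewrite (ge0_integral_rVB x mg0); last by move=> z; rewrite lee_fin gsV_ge0.
have /integrableP[_] := integrable_gsV d c0.
by under eq_integral do rewrite /= ger0_norm ?gsV_ge0//.
Qed.

Lemma Rintegral_bump_shift c x : \int[la]_z gsV c (z - x) = \int[la]_z gsV c z.
Proof.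
rewrite /Rintegral; congr fine.
rewrite (ge0_integral_rVB x (f := fun z => (gsV c z)%:E))//.
  by apply/measurable_EFinP; exact: measurable_gsV.
by move=> z; rewrite lee_fin gsV_ge0.
Qed.

(* The lower bound comes from a combination [F] of four bumps with [F 0 = 0],
   [F <= \1_(B(x, rho))], vanishing to second order at [0], whose generator at
   [0] is thus of the order of its integral against [k]. *)
Section ball_lower.
Variables (rho : R) (x : 'rV[R]_d).
Hypothesis rho0 : 0 < rho.

(** The value for which [gsV 4^-1 v <= del * gsV 8^-1 v] holds exactly when |v| >= rho. It makes
    [cutF] nonpositive off the ball, while its second factor vanishes to second order at the
    origin. *)
Let del : R := expR (- (rho ^+ 2 / 8)).

Definition cutF (z : 'rV[R]_d) : R :=
  (gsV 4^-1 (z - x) - del * gsV 8^-1 (z - x)) * (1 - gsV 2^-1 z).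

Lemma cutF0 : cutF 0 = 0.
Proof. by rewrite /cutF /gsV !dotp0l mulr0 oppr0 expR0 subrr mulr0. Qed.

Lemma cutF_le z : cutF z <= 1 /\ (rho <= enorm (z - x) -> cutF z <= 0).
Proof.
have q : 0 <= (4^-1 : R) by rewrite invr_ge0.
have q2 : 0 <= (2^-1 : R) by rewrite invr_ge0.
have h1 := gsV_le1 (z - x) q; have h2 := gsV_ge0 8^-1 (z - x).
have h3 := gsV_ge0 2^-1 z; have h4 := gsV_le1 z q2.
have h5 : 0 <= del * gsV 8^-1 (z - x) by rewrite mulr_ge0 ?expR_ge0.
have h6 : 0 <= 1 - gsV 2^-1 z by rewrite subr_ge0.
split.
  apply: (@le_trans _ _ (1 * (1 - gsV 2^-1 z))); last by rewrite mul1r lerBlDr lerDl.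
  by apply: ler_wpM2r => //; apply: le_trans h1; rewrite lerBlDr lerDl.
move=> hr; rewrite /cutF mulr_le0_ge0// subr_le0 /del !gsVE -expRD ler_expR.
have : rho ^+ 2 <= enorm (z - x) ^+ 2 by rewrite lerXn2r ?nnegrE ?enorm_ge0// ltW.
lra.
Qed.

Lemma normr_cutF z : `|cutF z| <= 1.
Proof.
have q : 0 <= (4^-1 : R) by rewrite invr_ge0.
have q2 : 0 <= (2^-1 : R) by rewrite invr_ge0.
have q8 : 0 <= (8^-1 : R) by rewrite invr_ge0.
have h1 := gsV_le1 (z - x) q; have h2 := gsV_ge0 8^-1 (z - x); have h7 := gsV_le1 (z - x) q8.
have h3 := gsV_ge0 2^-1 z; have h4 := gsV_le1 z q2; have h8 := gsV_ge0 4^-1 (z - x).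
have d1 : del <= 1 by rewrite -expR0 ler_expR oppr_le0 divr_ge0// sqr_ge0.
have h5 : 0 <= del * gsV 8^-1 (z - x) by rewrite mulr_ge0 ?expR_ge0.
have h6 : del * gsV 8^-1 (z - x) <= 1 by rewrite mulr_ile1 ?expR_ge0.
rewrite /cutF normrM mulr_ile1// ler_norml; apply/andP; split; lra.
Qed.

Lemma cutFE z : cutF z = gsV 4^-1 (z - x) - del * gsV 8^-1 (z - x)
  - gsV 6^-1 x * gsV (3 / 4) (z - 3^-1 *: x)
  + del * gsV 10^-1 x * gsV (5 / 8) (z - 5^-1 *: x).
Proof.
by rewrite /cutF -mulrA -gsV_quarter_half -gsV_eighth_half cutF_scalar.
Qed.

Let ctr1 := - x.
Let ctr3 := - (3^-1 *: x).
Let ctr5 := - (5^-1 *: x).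

(** The generator of [cutF] at the origin. A bump centred at p and evaluated along a path from 0 is
    the centred bump along a path from -p, whence the points [ctr1], [ctr3] and [ctr5]. *)
Definition cutG : R := gen 4^-1 ctr1 - del * gen 8^-1 ctr1
  - gsV 6^-1 x * gen (3 / 4) ctr3 + del * gsV 10^-1 x * gen (5 / 8) ctr5.

Definition cutK : R := K2 4^-1 + K2 8^-1 + K2 (3 / 4) + K2 (5 / 8).

Let c4 : 0 < (4^-1 : R). Proof. by rewrite invr_gt0. Qed.
Let c8 : 0 < (8^-1 : R). Proof. by rewrite invr_gt0. Qed.
Let c34 : 0 < (3 / 4 : R). Proof. by rewrite divr_gt0. Qed.
Let c58 : 0 < (5 / 8 : R). Proof. by rewrite divr_gt0. Qed.
Let c6 : 0 < (6^-1 : R). Proof. by rewrite invr_gt0. Qed.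
Let c10 : 0 < (10^-1 : R). Proof. by rewrite invr_gt0. Qed.

Let del01 : 0 <= del <= 1.
Proof.
by rewrite expR_ge0/= -expR0 ler_expR oppr_le0 divr_ge0// sqr_ge0.
Qed.

Lemma cutK_ge0 : 0 <= cutK.
Proof.
exact: (addr_ge0 (addr_ge0 (addr_ge0 (K2_ge0 4^-1) (K2_ge0 8^-1)) (K2_ge0 (3 / 4))) (K2_ge0 (5 / 8))).
Qed.

Lemma cut_step h : 0 <= h -> h * cutG - h ^+ 2 * cutK <= \int[P]_w cutF (X h w).
Proof.
move=> h0; have mXh := mX h0; have /andP[dl0 dl1] := del01.
have Ib c y : 0 < c -> P.-integrable setT (EFin \o (fun w => gsV c (y + X h w))).
  move=> c0; apply: (integrable_bounded_prob P (M := 1)).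
    by apply: (measurableT_comp (measurable_gsV c)); exact: measurable_fun_addrV.
  by move=> w; rewrite ger0_norm ?gsV_ge0 ?gsV_le1// ltW.
pose A1 w := gsV 4^-1 (ctr1 + X h w); pose A2 w := gsV 8^-1 (ctr1 + X h w).
pose A3 w := gsV (3 / 4) (ctr3 + X h w); pose A4 w := gsV (5 / 8) (ctr5 + X h w).
have I1 := Ib 4^-1 ctr1 c4; have I2 := integrableZl measurableT del (Ib 8^-1 ctr1 c8).
have I3 := integrableZl measurableT (gsV 6^-1 x) (Ib _ ctr3 c34).
have I4 := integrableZl measurableT (del * gsV 10^-1 x) (Ib _ ctr5 c58).
have E : \int[P]_w cutF (X h w) = \int[P]_w A1 w - del * \int[P]_w A2 w -
    gsV 6^-1 x * \int[P]_w A3 w + del * gsV 10^-1 x * \int[P]_w A4 w.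
  transitivity (\int[P]_w (A1 w - del * A2 w - gsV 6^-1 x * A3 w + del * gsV 10^-1 x * A4 w)).
    by apply: eq_Rintegral => w _; rewrite cutFE /A1 /A2 /A3 /A4 ![_ + X h w]addrC.
  rewrite RintegralD//; last exact: (integrableB measurableT (integrableB measurableT I1 I2) I3).
  rewrite (RintegralB measurableT (integrableB measurableT I1 I2) I3).
  rewrite (RintegralB measurableT I1 I2).
  rewrite (RintegralZl _ measurableT (Ib _ ctr1 c8)) (RintegralZl _ measurableT (Ib _ ctr3 c34)).
  by rewrite (RintegralZl _ measurableT (Ib _ ctr5 c58)).
have F0 : gsV 4^-1 ctr1 - del * gsV 8^-1 ctr1 - gsV 6^-1 x * gsV (3 / 4) ctr3 +
    del * gsV 10^-1 x * gsV (5 / 8) ctr5 = 0 by rewrite -cutF0 cutFE !sub0r.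
have s1 := bump_step0 ctr1 c4 h0; have s2 := bump_step0 ctr1 c8 h0.
have s3 := bump_step0 ctr3 c34 h0; have s4 := bump_step0 ctr5 c58 h0.
have k1 := K2_ge0 4^-1; have k2 := K2_ge0 8^-1; have k3 := K2_ge0 (3 / 4); have k4 := K2_ge0 (5 / 8).
have g6 := gsV_le1 x (ltW c6); have g10 := gsV_le1 x (ltW c10).
have g60 := gsV_ge0 6^-1 x; have g100 := gsV_ge0 10^-1 x.
have p0 : 0 <= del * gsV 10^-1 x by rewrite mulr_ge0.
have p1 : del * gsV 10^-1 x <= 1 by rewrite mulr_ile1.
rewrite E /cutG /cutK.
exact: (cut_step_scalar del01 (andb_true_intro (conj g60 g6)) (andb_true_intro (conj p0 p1)) k2 k3 k4 s1 s2 s3 s4 F0).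
Qed.

(** The losses in [cut_main_ge]: 1 - e^(-1/2) is the minimum of 1 - [gsV 2^-1] off the unit ball,
    while Ce and e^(-a^2) come from replacing g(x) by g(z), the exponential being absorbed through
    (t/2 - a)^2 >= 0. *)
Definition cutB : R := (1 - expR (- 2^-1)) * expR (- a ^+ 2) / Ce.

Lemma cutB_gt0 : 0 < cutB.
Proof.
apply: divr_gt0; last exact: lt_le_trans ltr01 Ce1.
by apply: mulr_gt0; rewrite ?expR_gt0// subr_gt0 -expR0 ltr_expR oppr_lt0 invr_gt0.
Qed.

Lemma one_sub_bump_le (z : 'rV[R]_d) : 1 - gsV 2^-1 z <= Num.min 1 (enorm z ^+ 2).
Proof.
have := expR_ge1Dx (- (2^-1 * enorm z ^+ 2)); have := sqr_ge0 (enorm z).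
have := gsV_ge0 2^-1 z; rewrite gsVE le_min; move=> p q r; apply/andP; split; lra.
Qed.

(** For |z| >= 1 the kernel is [g] and the subtracted bump is dropped. For |z| < 1 the kernel is
    only known to be nonnegative; there the subtracted bump exceeds the first one, because |x|^2 <=
    2|z - x|^2 + 2|z|^2, and the left side is at most 0. *)
Lemma cut_main_ge z : cutB * g x * gsV 2^-1 (z - x) - cutB * Kg * expR 1 * gsV 8^-1 x * gsV 2^-1 z <=
  gsV 4^-1 (z - x) * (1 - gsV 2^-1 z) * k z.
Proof.
have B0 := ltW cutB_gt0; have gx := ltW (g_gt0 x); have Kg0 : 0 <= Kg := le_trans gx (g_le x).
have q2 : 0 <= (2^-1 : R) by rewrite invr_ge0.
have w0 : 0 <= 1 - gsV 2^-1 z by rewrite subr_ge0 gsV_le1.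
have Ce0 : 0 < Ce by rewrite (lt_le_trans ltr01).
have [z1|z1] := leP 1 (enorm z).
  apply: (@le_trans _ _ (cutB * g x * gsV 2^-1 (z - x))).
    by rewrite gerBl; do ! apply: mulr_ge0 => //; rewrite ?expR_ge0 ?gsV_ge0.
  have w1 : 1 - expR (- 2^-1) <= 1 - gsV 2^-1 z.
    rewrite lerD2l lerN2 gsVE ler_expR lerN2 -[leLHS]mulr1 ler_wpM2l//.
    by rewrite expr_ge1 ?enorm_ge0.
  have e1 : expR (- a ^+ 2) * gsV 2^-1 (z - x) * g x <= Ce * (gsV 4^-1 (z - x) * g z).
    apply: (@le_trans _ _ (expR (- a ^+ 2) * gsV 2^-1 (z - x) * (Ce * expR (a * enorm (z - x)) * g z))).
      apply: ler_wpM2l; first by rewrite mulr_ge0 ?expR_ge0 ?gsV_ge0.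
      apply: (le_trans (g_exp x z)).
      rewrite ler_wpM2r ?(ltW (g_gt0 _))// ler_wpM2l ?(ltW Ce0)// ler_expR ler_wpM2l//.
      by rewrite distrC; exact: ler_dist_enorm.
    have -> : expR (- a ^+ 2) * gsV 2^-1 (z - x) * (Ce * expR (a * enorm (z - x)) * g z) =
      Ce * (expR (- a ^+ 2) * gsV 2^-1 (z - x) * expR (a * enorm (z - x)) * g z) by ring.
    rewrite ler_wpM2l ?(ltW Ce0)// ler_wpM2r ?(ltW (g_gt0 _))//.
    rewrite !gsVE -!expRD ler_expR; set t := enorm (z - x).
    by have := sqr_ge0 (t / 2 - a); rewrite sqrrB; lra.
  rewrite (kg z1).
  have -> : cutB * g x * gsV 2^-1 (z - x) =
    (1 - expR (- 2^-1)) * (Ce^-1 * (expR (- a ^+ 2) * gsV 2^-1 (z - x) * g x)).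
    by rewrite /cutB; ring.
  rewrite [_ * (1 - gsV 2^-1 z)]mulrC -[leRHS]mulrA; apply: ler_pM => //.
  - by rewrite mulr_ge0 ?invr_ge0 ?(ltW Ce0)// !mulr_ge0 ?expR_ge0 ?gsV_ge0.
  - by rewrite ler_pdivrMl.
apply: (@le_trans _ _ 0); last by rewrite !mulr_ge0 ?gsV_ge0.
rewrite subr_le0.
have -> : cutB * Kg * expR 1 * gsV 8^-1 x * gsV 2^-1 z =
  cutB * (Kg * (expR 1 * gsV 8^-1 x * gsV 2^-1 z)) by ring.
rewrite -mulrA ler_wpM2l// ler_pM ?gsV_ge0//.
rewrite !gsVE -!expRD ler_expR.
have zz : enorm z ^+ 2 <= 1 by rewrite expr_le1 ?enorm_ge0// ltW.
have xx : enorm x ^+ 2 <= 2 * enorm (z - x) ^+ 2 + 2 * enorm z ^+ 2.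
  have := ler_enormD z (x - z); rewrite addrC subrK -(enormN (x - z)) opprB.
  have := enorm_ge0 x; have := enorm_ge0 z; have := enorm_ge0 (z - x).
  set t1 := enorm x; set t2 := enorm z; set t3 := enorm (z - x) => p1 p2 p3 p4.
  have : t1 ^+ 2 <= (t2 + t3) ^+ 2 by rewrite lerXn2r ?nnegrE// addr_ge0.
  have := sqr_ge0 (t2 - t3); rewrite sqrrB sqrrD; lra.
have := sqr_ge0 (enorm (z - x)); lra.
Qed.

Lemma cutF_sym_ge z :
  cutB * g x * gsV 2^-1 (z - x) - cutB * Kg * expR 1 * gsV 8^-1 x * gsV 2^-1 z -
  del * (gsV 8^-1 (x - z) * (Num.min 1 (enorm z ^+ 2) * k z) +
         gsV 8^-1 (- x - z) * (Num.min 1 (enorm z ^+ 2) * k z)) <=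
  (cutF z + cutF (- z)) * k z.
Proof.
have q2 : 0 <= (2^-1 : R) by rewrite invr_ge0.
have w0 : 0 <= 1 - gsV 2^-1 z by rewrite subr_ge0 gsV_le1.
have /andP[d0 _] := del01.
have m1 := ler_wpM2r (k0 z) (one_sub_bump_le z).
have m2 : 0 <= (1 - gsV 2^-1 z) * k z by rewrite mulr_ge0.
have H := cut_main_ge z.
have s1 : gsV 8^-1 (x - z) = gsV 8^-1 (z - x) by rewrite -gsVN opprB.
have s2 c : gsV c (- z - x) = gsV c (- x - z) by rewrite addrC.
rewrite /cutF gsVN !s2 s1.
have p1 := gsV_ge0 4^-1 (- x - z); have p2 := gsV_ge0 8^-1 (z - x); have p3 := gsV_ge0 8^-1 (- x - z).
move: H m1 m2; set A := cutB * g x * _; set B := cutB * Kg * _ * _ * _.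
set w := 1 - gsV 2^-1 z; set m := Num.min _ _ => H m1 m2.
exact: cut_sym_scalar.
Qed.

Lemma cutG_formula : cutG = - (qpart 4^-1 ctr1 - del * qpart 8^-1 ctr1
  - gsV 6^-1 x * qpart (3 / 4) ctr3 + del * gsV 10^-1 x * qpart (5 / 8) ctr5) +
  \int[la]_z ((cutF z + cutF (- z)) / 2 * k z) /\
  la.-integrable setT (EFin \o (fun z => (cutF z + cutF (- z)) / 2 * k z)).
Proof.
have I1 := integrable_jump c4 ctr1; have I2 := integrable_jump c8 ctr1.
have I3 := integrable_jump c34 ctr3; have I4 := integrable_jump c58 ctr5.
have J2 := integrableZl measurableT del I2.
have J3 := integrableZl measurableT (gsV 6^-1 x) I3.
have J4 := integrableZl measurableT (del * gsV 10^-1 x) I4.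
have J12 := integrableB measurableT I1 J2.
have J123 := integrableB measurableT J12 J3.
have J := integrableD measurableT J123 J4.
have E : (fun z => (cutF z + cutF (- z)) / 2 * k z) =
    (fun z => jump 4^-1 ctr1 z - del * jump 8^-1 ctr1 z - gsV 6^-1 x * jump (3 / 4) ctr3 z
              + del * gsV 10^-1 x * jump (5 / 8) ctr5 z).
  apply/funext => z; have F0 := cutF0; rewrite cutFE !sub0r -/ctr1 -/ctr3 -/ctr5 in F0.
  rewrite !cutFE /jump ![z - _]addrC ![- z - _]addrC -/ctr1 -/ctr3 -/ctr5.
  move: F0; move: (k z) => kz; rewrite !(addrC (- (_ *: x))) !(addrC (- x)).
  rewrite ![_ + ctr1]addrC ![_ + ctr3]addrC ![_ + ctr5]addrC.
  exact: cut_jump_scalar.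
split; last by rewrite E; exact: J.
rewrite E (RintegralD measurableT J123 J4) (RintegralB measurableT J12 J3) (RintegralB measurableT I1 J2).
rewrite (RintegralZl _ measurableT I2) (RintegralZl _ measurableT I3) (RintegralZl _ measurableT I4).
rewrite /cutG !gen_formula//.
move: (qpart _ _) (qpart _ _) (qpart _ _) (qpart _ _) (gsV _ _) (gsV _ _) del.
move: (\int[la]_z _) (\int[la]_z _) (\int[la]_z _) (\int[la]_z _) => *; ring.
Qed.

End ball_lower.


Lemma bump_env_const c (x : 'rV[R]_d) : 0 < c -> bump_env c x <= 2 * (c + 32) * expR ((4 * c) ^+ 2 / (2 * c)).
Proof.
move=> c0; rewrite /bump_env ler_wpM2l//; first by rewrite mulr_ge0// addr_ge0// ltW.
apply: (le_trans (gsV_exp_le (4 * c) x c0)); rewrite ler_piMr ?expR_ge0// gsV_le1//.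
by rewrite divr_ge0// ltW.
Qed.

(** The extra factor |x| yields bounds by g(x)/|x|, negligible against g(x) far away. This is why
    the estimate on balls holds only beyond some radius. *)
Lemma bump_exp_decay c b : 0 < c -> exists2 D, 0 <= D &
  forall x, enorm x * (gsV c x * expR (b * enorm x)) <= D * g x.
Proof.
move=> c0; exists (Ce * expR ((a + (b + 1)) ^+ 2 / (2 * c))).
  by rewrite mulr_ge0 ?expR_ge0// (le_trans ler01).
move=> x; apply: le_trans (bump_exp_le c0 (b + 1) x).
rewrite mulrCA ler_wpM2l ?gsV_ge0// mulrDl mul1r expRD mulrC ler_wpM2l ?expR_ge0//.
by apply: le_trans (expR_ge1Dx _); rewrite lerDr.
Qed.

Definition mass8 x : R := \int[la]_z (gsV 8^-1 (x - z) * (Num.min 1 (enorm z ^+ 2) * k z)).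

Lemma integrable_mass8 x :
  la.-integrable setT (EFin \o (fun z => gsV 8^-1 (x - z) * (Num.min 1 (enorm z ^+ 2) * k z))).
Proof.
have q : 0 <= (8^-1 : R) by rewrite invr_ge0.
apply: (le_integrable _ _ _ Ik) => //.
  apply/measurable_EFinP; apply: measurable_funM; first exact: measurable_bumpB.
  by have /measurable_EFinP := measurable_int _ Ik.
move=> z _ /=; rewrite lee_fin normrM (ger0_norm (gsV_ge0 _ _)).
by rewrite ler_piMl// gsV_le1.
Qed.

Lemma mass8_le : exists2 A, 0 <= A & forall x, mass8 x <= A * g x.
Proof.
have c8 : 0 < (8^-1 : R) by rewrite invr_gt0.
pose Cb := Ce * expR (a ^+ 2 / (2 * 8^-1)).
have Ce0 : 0 <= Ce by rewrite (le_trans ler01).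
have Cb0 : 0 <= Cb by rewrite mulr_ge0 ?expR_ge0.
have Mk0 := Mk_ge0.
exists (Cb * Cc + Cb * Ce * expR a * Mk).
  by rewrite addr_ge0 ?mulr_ge0 ?expR_ge0// ltW.
move=> x; have [I1 J1] := bump_conv_le c8 x; have I2 := integrable_mass8 x.
have gx := ltW (g_gt0 x).
have I3 := integrableZl measurableT (Cb * Ce * expR a * g x) Ik.
have I4 := integrableD measurableT I1 I3.
apply: (@le_trans _ _ (\int[la]_z (gsV 8^-1 (x - z) * g z +
    Cb * Ce * expR a * g x * (Num.min 1 (enorm z ^+ 2) * k z)))).
  apply: le_Rintegral => // z _.
  have m0 : 0 <= Num.min 1 (enorm z ^+ 2) * k z.
    by rewrite mulr_ge0// le_min ler01 sqr_ge0.
  have n0 : 0 <= Cb * Ce * expR a * g x by rewrite !mulr_ge0 ?expR_ge0.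
  have [z1|z1] := leP 1 (enorm z).
    have -> : Num.min 1 (enorm z ^+ 2) = 1 by apply/min_idPl; rewrite expr_ge1 ?enorm_ge0.
    by rewrite mul1r (kg z1) lerDl mulr_ge0// ltW.
  rewrite ler_wpDl ?mulr_ge0 ?gsV_ge0 ?(ltW (g_gt0 _))// ler_wpM2r//.
  apply: (le_trans (bump_le_g c8 _)).
  have -> : Cb * Ce * expR a * g x = Cb * (Ce * expR a * g x) by ring.
  rewrite ler_wpM2l//; apply: (le_trans (g_exp (x - z) x)).
  rewrite ler_wpM2r// ler_wpM2l// ler_expR -[leRHS]mulr1 ler_wpM2l//.
  apply: (le_trans (ler_dist_enorm _ _)).
  by rewrite addrAC subrr sub0r enormN ltW.
rewrite (RintegralD measurableT I1 I3) (RintegralZl _ measurableT Ik).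
rewrite mulrDl lerD//.
by rewrite -/Mk mulrAC.
Qed.

(** The main term, of order g(x), is the integral of [cut_main_ge]. The correction with [del] is
    also of order g(x) but becomes small for large rho; the Gaussian covariance and the small jumps
    contribute only O(g(x)/|x|). *)
Lemma cutG_ge : exists A D : R, [/\ 0 <= A, 0 <= D & forall rho x,
  0 < enorm x ->
  2^-1 * cutB * gmass * g x - expR (- (rho ^+ 2 / 8)) * A * g x <= cutG rho x + D * g x / enorm x].
Proof.
have c4 : 0 < (4^-1 : R) by rewrite invr_gt0.
have c8 : 0 < (8^-1 : R) by rewrite invr_gt0.
have c34 : 0 < (3 / 4 : R) by rewrite divr_gt0.
have c58 : 0 < (5 / 8 : R) by rewrite divr_gt0.
have c6 : 0 < (6^-1 : R) by rewrite invr_gt0.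
have c10 : 0 < (10^-1 : R) by rewrite invr_gt0.
have c2 : 0 < (2^-1 : R) by rewrite invr_gt0.
have [A A0 HA] := mass8_le.
have Ce0 : 0 <= Ce by rewrite (le_trans ler01).
have [D1 D10 H1] := bump_exp_decay 0 c8.
have [D2 D20 H2] := bump_exp_decay (4 * 4^-1) c4.
have [D3 D30 H3] := bump_exp_decay (4 * 8^-1) c8.
have [D4 D40 H4] := bump_exp_decay 0 c6.
have [D5 D50 H5] := bump_exp_decay 0 c10.
have Kg0 : 0 <= Kg by apply: le_trans (g_le 0); exact: ltW.
have B0 := ltW cutB_gt0; have gm0 := ltW gmass_gt0; have qb := qform_bound_ge0 Q.
pose e34 : R := 2 * (3 / 4 + 32) * expR ((4 * (3 / 4)) ^+ 2 / (2 * (3 / 4))).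
pose e58 : R := 2 * (5 / 8 + 32) * expR ((4 * (5 / 8)) ^+ 2 / (2 * (5 / 8))).
have e340 : 0 <= e34 by rewrite !mulr_ge0 ?expR_ge0 ?addr_ge0 ?divr_ge0.
have e580 : 0 <= e58 by rewrite !mulr_ge0 ?expR_ge0 ?addr_ge0 ?divr_ge0.
pose DQ := qform_bound Q * (2 * (4^-1 + 32) * D2 + 2 * (8^-1 + 32) * D3 + D4 * e34 + D5 * e58).
pose DM := cutB * Kg * expR 1 * gmass * D1.
have DQ0 : 0 <= DQ.
  apply: (mulr_ge0 qb); apply: addr_ge0; last exact: mulr_ge0.
  apply: addr_ge0; last exact: mulr_ge0.
  by apply: addr_ge0; do 2 ! apply: mulr_ge0 => //; rewrite addr_ge0 ?invr_ge0.
have DM0 : 0 <= DM by do ! apply: mulr_ge0 => //; exact: expR_ge0.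
exists (A * (1 + Ce)), (DQ + DM); split.
- by rewrite mulr_ge0// addr_ge0.
- by rewrite addr_ge0.
move=> rho x x0; have gx := ltW (g_gt0 x).
have [-> II] := cutG_formula rho x.
set del := expR (- (rho ^+ 2 / 8)).
have d0 : 0 <= del by exact: expR_ge0.
have d1 : del <= 1 by rewrite -expR0 ler_expR oppr_le0 divr_ge0// sqr_ge0.
have I1 := integrable_bump_shift x c2.
have K1 := integrableZl measurableT (cutB * g x) I1.
have K2' := integrableZl measurableT (cutB * Kg * expR 1 * gsV 8^-1 x) (integrable_gsV d c2).
have M1 := integrable_mass8 x; have M2 := integrable_mass8 (- x).
have K3 := integrableZl measurableT del (integrableD measurableT M1 M2).
have K12 := integrableB measurableT K1 K2'.
have K123 := integrableB measurableT K12 K3.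
pose L z := cutB * g x * gsV 2^-1 (z - x) - cutB * Kg * expR 1 * gsV 8^-1 x * gsV 2^-1 z -
  del * (gsV 8^-1 (x - z) * (Num.min 1 (enorm z ^+ 2) * k z) +
         gsV 8^-1 (- x - z) * (Num.min 1 (enorm z ^+ 2) * k z)).
have IL : \int[la]_z L z = cutB * g x * gmass - cutB * Kg * expR 1 * gsV 8^-1 x * gmass -
    del * (mass8 x + mass8 (- x)).
  rewrite /L (RintegralB measurableT K12 K3) (RintegralB measurableT K1 K2').
  rewrite (RintegralZl _ measurableT I1) (RintegralZl _ measurableT (integrable_gsV d c2)).
  rewrite (RintegralZl _ measurableT (integrableD measurableT M1 M2)) (RintegralD measurableT M1 M2).
  by rewrite Rintegral_bump_shift gmassE.
have J : 2^-1 * (cutB * g x * gmass - cutB * Kg * expR 1 * gsV 8^-1 x * gmass -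
    del * (mass8 x + mass8 (- x))) <= \int[la]_z ((cutF rho x z + cutF rho x (- z)) / 2 * k z).
  rewrite -IL -RintegralZl//; apply: le_Rintegral => //.
    exact: (integrableZl measurableT 2^-1 K123).
  move=> z _; rewrite mulrAC [leRHS]mulrC ler_wpM2l ?invr_ge0//; exact: cutF_sym_ge.
have := HA x; have := HA (- x); have := gN_le x.
have h1 : enorm x * gsV 8^-1 x <= D1 * g x by have := H1 x; rewrite mul0r expR0 mulr1.
have h4 : enorm x * gsV 6^-1 x <= D4 * g x by have := H4 x; rewrite mul0r expR0 mulr1.
have h5 : enorm x * gsV 10^-1 x <= D5 * g x by have := H5 x; rewrite mul0r expR0 mulr1.
have q1 := qpart_le c4 (- x); have q2 := qpart_le c8 (- x).
have q3 := qpart_le c34 (- (3^-1 *: x)); have q5 := qpart_le c58 (- (5^-1 *: x)).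
pose v := g x / enorm x.
have v0 : 0 <= v by rewrite divr_ge0// ltW.
have dv D y : enorm x * y <= D * g x -> y <= D * v.
  by move=> H; rewrite /v mulrA ler_pdivlMr// mulrC.
have {}h1 := dv _ _ h1; have {}h4 := dv _ _ h4; have {}h5 := dv _ _ h5.
have {}H2 := dv _ _ (H2 x); have {}H3 := dv _ _ (H3 x).
have env c D : 0 < c -> gsV c x * expR (4 * c * enorm x) <= D * v ->
    bump_env c (- x) <= 2 * (c + 32) * D * v.
  move=> c0 H; rewrite /bump_env gsVN enormN -[leRHS]mulrA ler_wpM2l//.
  by rewrite mulr_ge0// addr_ge0// ltW.
have {}q1 : `|qpart 4^-1 (- x)| <= qform_bound Q * (2 * (4^-1 + 32) * D2 * v).
  apply: (le_trans q1); rewrite ler_wpM2l//; exact: env.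
have {}q2 : `|qpart 8^-1 (- x)| <= qform_bound Q * (2 * (8^-1 + 32) * D3 * v).
  apply: (le_trans q2); rewrite ler_wpM2l//; exact: env.
have {}q3 : `|qpart (3 / 4) (- (3^-1 *: x))| <= qform_bound Q * e34.
  apply: (le_trans q3); rewrite ler_wpM2l//; exact: bump_env_const.
have {}q5 : `|qpart (5 / 8) (- (5^-1 *: x))| <= qform_bound Q * e58.
  apply: (le_trans q5); rewrite ler_wpM2l//; exact: bump_env_const.
rewrite -[(DQ + DM) * _ / _]mulrA -/v.
move=> gN m2 m1.
have ms : mass8 x + mass8 (- x) <= A * (1 + Ce) * g x.
  apply: (le_trans (lerD m1 m2)); rewrite mulrDr mulr1 mulrDl lerD2l -mulrA ler_wpM2l//.
have p6 := gsV_ge0 6^-1 x; have p10 := gsV_ge0 10^-1 x.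
have K0 : 0 <= cutB * Kg * expR 1 * gmass by do ! apply: mulr_ge0 => //; exact: expR_ge0.
have p8 := gsV_ge0 8^-1 x.
have As0 : 0 <= A * (1 + Ce) * g x by rewrite !mulr_ge0 ?addr_ge0.
have {}J : 2^-1 * (cutB * g x * gmass - cutB * Kg * expR 1 * gmass * gsV 8^-1 x -
  del * (mass8 x + mass8 (- x))) <= \int[la]_z ((cutF rho x z + cutF rho x (- z)) / 2 * k z).
  by rewrite [_ * gmass * gsV _ _]mulrAC.
have := cutG_scalar d0 d1 p6 p10 qb e340 e580 K0 q1 q2 q3 q5 p8 h1 h4 h5 ms As0 J.
rewrite -/DQ -/DM -[2^-1 * cutB * _ * _]mulrA -[2^-1 * cutB * _]mulrA [gmass * g x]mulrC.
by rewrite !mulrA.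
Qed.

Lemma ball_lower : exists cl rho Rr Cl : R, [/\ 0 < cl, 0 < rho, 0 < Rr & 0 <= Cl] /\
  forall x h, Rr <= enorm x -> 0 <= h ->
    ((cl * h * g x - Cl * h ^+ 2)%:E <= P [set w | eball x rho (X h w)])%E.
Proof.
have [A [D [A0 D0 HG]]] := cutG_ge.
have B0 : 0 < cutB * gmass by rewrite mulr_gt0 ?cutB_gt0 ?gmass_gt0.
(* Since e^s >= s + 1, this [s] gives e^(-s) A <= B/4. With rho^2/8 = s and |x| so large that D/|x|
   <= B/8, there remains 1/2 - 1/4 - 1/8 = 1/8 of B. *)
pose B := cutB * gmass; pose s := 4 * (A + 1) / B.
have s0 : 0 < s by rewrite divr_gt0// mulr_gt0// ltr_wpDl.
pose rho := Num.sqrt (8 * s).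
have rho0 : 0 < rho by rewrite sqrtr_gt0 mulr_gt0.
have cK := cutK_ge0.
exists (B / 8), rho, (8 * (D + 1) / B), cutK; split.
  by split => //; apply: divr_gt0 => //; apply: mulr_gt0 => //; exact: ltr_wpDl.
move=> x h hx h0; have gx := g_gt0 x; have mXh := mX h0.
have x0 : 0 < enorm x by apply: lt_le_trans hx; rewrite divr_gt0// mulr_gt0// ltr_wpDl.
have dA : expR (- (rho ^+ 2 / 8)) * A <= B / 4.
  have -> : rho ^+ 2 / 8 = s.
    by rewrite sqr_sqrtr; [rewrite mulrC mulKf|rewrite mulr_ge0// ltW].
  rewrite expRN ler_pdivrMl ?expR_gt0//.
  apply: (@le_trans _ _ (s * (B / 4))).
    have -> : s * (B / 4) = A + 1 by rewrite /s; field; rewrite gt_eqF.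
    by rewrite lerDl.
  rewrite ler_wpM2r ?divr_ge0 ?(ltW B0)//; apply: le_trans (expR_ge1Dx _).
  by rewrite lerDr.
have Dx : D / enorm x <= B / 8.
  rewrite ler_pdivrMr//; apply: (@le_trans _ _ (B / 8 * (8 * (D + 1) / B))).
    have -> : B / 8 * (8 * (D + 1) / B) = D + 1 by field; rewrite gt_eqF.
    by rewrite lerDl.
  by rewrite ler_wpM2l// divr_ge0 ?(ltW B0).
have G1 : B / 8 * g x <= cutG rho x.
  have := HG rho x; rewrite -[D * g x / _]mulrAC.
  have := ler_wpM2r (ltW gx) dA; have := ler_wpM2r (ltW gx) Dx.
  have -> : 2^-1 * cutB * gmass * g x = 2^-1 * B * g x by rewrite /B; ring.
  lra.
have S := cut_step rho x h0.
have mF : measurable_fun setT (fun w => cutF rho x (X h w)).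
  apply: (measurableT_comp (f := cutF rho x)) => //.
  apply: measurable_funM.
    apply: measurable_funB; last apply: measurable_funM => //.
      by apply: (measurableT_comp (measurable_gsV _)); exact: measurable_fun_subrV.
    by apply: (measurableT_comp (measurable_gsV _)); exact: measurable_fun_subrV.
  by apply: measurable_funB => //; exact: measurable_gsV.
have mBall : measurable [set w | eball x rho (X h w)].
  by rewrite -[X in measurable X]setTI; apply: mXh => //; exact: measurable_eball.
apply: (@le_trans _ _ (\int[P]_w cutF rho x (X h w))%:E).
  rewrite lee_fin; apply: le_trans S; rewrite [cutK * _]mulrC lerB//.
  by rewrite mulrAC mulrC ler_wpM2l.
rewrite -[leRHS]fineK ?fin_num_measure// lee_fin.
have -> : fine (P [set w | eball x rho (X h w)]) = \int[P]_w (\1_[set w | eball x rho (X h w)] w).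
  by rewrite /Rintegral integral_indic// setIT.
apply: le_Rintegral => //.
- by apply: (integrable_bounded_prob P mF (M := 1)) => w; exact: normr_cutF.
- apply: (integrable_bounded_prob P (M := 1)); first exact: measurable_indic.
  by move=> w; rewrite ger0_norm ?indicE//; case: (_ \in _).
move=> w _; have [F1 F2] := cutF_le x rho0 (X h w).
rewrite indicE; case: (boolP (w \in _)) => //=; rewrite notin_setE/= => nw; apply: F2.
by rewrite leNgt; apply/negP.
Qed.

End levy_kernel.

(** * Semigroup estimates *)

(** Passage to the limit in estimates whose discretisation error is O(1/n). *)
Lemma le_add_inv_nat (R : realType) (x y D : R) : 0 <= D ->
  (forall n : nat, x <= y + D / n.+1%:R) -> x <= y.
Proof.
move=> D0 H; apply/ler_addgt0Pr => e e0.
have [n hn] : exists n : nat, D / e < n.+1%:R.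
  have := truncn_itv (divr_ge0 D0 (ltW e0)) => /andP[_ ?].
  by exists (Num.truncn (D / e)).
apply: (le_trans (H n)); rewrite lerD2l ler_pdivrMr//.
by move: hn; rewrite ltr_pdivrMr// => /ltW; rewrite mulrC.
Qed.

Lemma expR_sub1_le (R : realType) (C t : R) : 0 <= C -> 0 <= t <= 1 -> expR (C * t) - 1 <= C * expR C * t.
Proof.
move=> C0 /andP[t0 t1]; set s := C * t.
have s0 : 0 <= s by rewrite mulr_ge0.
have h1 : expR s - 1 <= s * expR s.
  have h := expR_ge1Dx (- s); have e0 := expR_gt0 s.
  have : (1 - s) * expR s <= 1.
    by rewrite -[leRHS](expRxMexpNx_1 s) [leRHS]mulrC ler_wpM2r ?(ltW e0).
  by rewrite mulrBl mul1r; lra.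
apply: (le_trans h1); rewrite /s mulrAC ler_wpM2r// ler_wpM2l// ler_expR.
by rewrite ler_piMr.
Qed.

Lemma discrete_gronwall (R : realType) (S : nat -> R) (A q : R) (N : nat) :
  0 <= A -> 0 <= q -> (forall n, (n <= N)%N -> S n <= A + q * \sum_(i < n) S i) ->
  S N <= A * expR (q *+ N).
Proof.
move=> A0 q0 H.
have K n : (n <= N)%N -> A + q * \sum_(i < n) S i <= A * (1 + q) ^+ n.
  elim: n => [|n IH] nN; first by rewrite big_ord0 mulr0 addr0 expr0 mulr1.
  have h := IH (ltnW nN); have hS := le_trans (H n (ltnW nN)) h.
  rewrite big_ord_recr/= mulrDr addrA exprSr mulrA mulrDr mulr1 lerD//.
  by rewrite [leRHS]mulrC ler_wpM2l.
apply: (le_trans (H N (leqnn N))); apply: (le_trans (K N (leqnn N))).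
rewrite ler_wpM2l// -mulr_natl expRM_natl lerXn2r ?nnegrE ?addr_ge0 ?expR_ge0//.
exact: expR_ge1Dx.
Qed.

Lemma gsV_quarter_one (R : realType) d (v x z : 'rV[R]_d) :
  gsV 4^-1 (z - v) * gsV 1 (z - x) =
  gsV 5^-1 (v - x) * gsV (5 / 4) (z - (x + 5^-1 *: (v - x))).
Proof.
have s : 4^-1 + 1 = 5 / 4 :> R by field.
have s0 : 4^-1 + 1 != 0 :> R by rewrite s mulf_neq0.
have -> : z - v = (z - x) - (v - x) by rewrite opprB addrA subrK.
have s2 : 4^-1 * 1 / (5 / 4) = 5^-1 :> R by field.
have s3 : 4^-1 / (5 / 4) = 5^-1 :> R by field.
by rewrite (gsVM (z - x) (v - x) s0) s s2 s3 opprD addrA.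
Qed.

Lemma gsV_one_one (R : realType) d (y z : 'rV[R]_d) :
  gsV 1 (y + z) * gsV 1 z = gsV 2^-1 y * gsV 2 (2^-1 *: y + z).
Proof.
have s : 1 + 1 = 2 :> R by [].
have s0 : 1 + 1 != 0 :> R by rewrite s.
have -> : y + z = z - (- y) by rewrite opprK addrC.
by rewrite gsVM// s gsVN scalerN opprK mul1r addrC; congr (gsV _ y * gsV _ (_ *: y + z)); field.
Qed.

Lemma annulus_scalar (R : realType) (A1 A2 b1 b2 p Cb B B2 t gy gh Kg : R) :
  A1 - b1 <= B * t * gy -> - (B2 * t * gh) <= A2 - b2 -> 0 <= p -> p <= Cb * gy ->
  b1 = p * b2 -> B2 * t * gh <= B2 * t * Kg -> 0 <= B2 * t * Kg ->
  A1 - p * A2 <= (B + Cb * (B2 * Kg)) * t * gy.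
Proof.
move=> h1 h2 p0 h4 E h6 h8.
have h7 : p * (b2 - B2 * t * Kg) <= p * A2 by rewrite ler_wpM2l//; lra.
have h9 : p * (B2 * t * Kg) <= Cb * gy * (B2 * t * Kg) by rewrite ler_wpM2r.
move: h7; rewrite mulrBr -E => h7; lra.
Qed.

Section levy_semigroup.
Context {R : realType} {dO : measure_display} {Omega : measurableType dO} {d : nat}.
Variables (P : probability Omega R) (X : R -> Omega -> 'rV[R]_d).
Variables (g : 'rV[R]_d -> R) (a Kg Ce Cc gm : R).
Local Notation la := (lebesgue_rV R d).
Hypothesis mX : forall t, 0 <= t -> measurable_fun setT (X t).
Hypothesis mg : measurable_fun setT g.
Hypothesis g_gt0 : forall x, 0 < g x.
Hypothesis g_le : forall x, g x <= Kg.
Hypothesis a0 : 0 <= a.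
Hypothesis Ce1 : 1 <= Ce.
Hypothesis g_exp : forall u v, g u <= Ce * expR (a * `|enorm u - enorm v|) * g v.
Hypothesis Ig : la.-integrable setT (EFin \o g).
Hypothesis Cc0 : 0 < Cc.
Hypothesis g_conv : forall x, (\int[la]_v (g (x - v) * g v)%:E <= (Cc * g x)%:E)%E.
Hypothesis gm0 : 0 < gm.
Hypothesis gmE : \int[la]_y gsV 2^-1 y = gm.
Hypothesis bump_le : forall c x, 0 < c -> gsV c x <= Ce * expR (a ^+ 2 / (2 * c)) * g x.
Hypothesis bump_iter : forall c, 0 < c -> exists C K : R, [/\ 0 <= C, 0 <= K &
  forall (h : R) n y, 0 <= h ->
  `|\int[P]_w gsV c (y + X (h *+ n) w) - gsV c y| <=
  h * \sum_(i < n) (C * \int[P]_w g (y + X (h *+ i) w)) + h ^+ 2 * K *+ n].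

Let g0 x : 0 <= g x. Proof. exact: ltW. Qed.
Let Kg0 : 0 <= Kg. Proof. exact: le_trans (g0 0) (g_le 0). Qed.
Let Ce0 : 0 <= Ce. Proof. exact: le_trans ler01 Ce1. Qed.

(** A superposition of bumps with centres distributed according to [g]: comparable to [g], yet built
    from functions whose generator is explicit. *)
Definition w0 (x : 'rV[R]_d) : R := \int[la]_v (gsV 4^-1 (x - v) * g v).

Definition mg1 : R := \int[la]_v g v.

Lemma mg1_ge0 : 0 <= mg1. Proof. by apply: Rintegral_ge0 => v _. Qed.

Lemma measurable_w0_kernel : measurable_fun setT
  (fun p : 'rV[R]_d * 'rV[R]_d => gsV 4^-1 (p.1 - p.2) * g p.2).
Proof.
apply: measurable_funM; last exact: (measurableT_comp mg measurable_snd).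
apply: (measurableT_comp (measurable_gsV _)).
apply: measurable_fun_subrV; [exact: measurable_fst|exact: measurable_snd].
Qed.

Let q4 : 0 < (4^-1 : R). Proof. by rewrite invr_gt0. Qed.

Lemma w0_kernel_le (x v : 'rV[R]_d) : `|gsV 4^-1 (x - v) * g v| <= g v.
Proof.
rewrite normrM !ger0_norm ?gsV_ge0 ?g0// ler_piMl ?g0// gsV_le1// ltW//.
Qed.

Lemma integrable_w0 x : la.-integrable setT (EFin \o (fun v => gsV 4^-1 (x - v) * g v)).
Proof.
apply: (le_integrable _ _ _ Ig) => //.
  apply/measurable_EFinP; apply: measurable_funM => //.
  by apply: (measurableT_comp (measurable_gsV _)); exact: measurable_fun_subrV.
by move=> v _ /=; rewrite lee_fin (le_trans (w0_kernel_le x v))// ler_norm.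
Qed.

Lemma w0_ge0 x : 0 <= w0 x.
Proof. by apply: Rintegral_ge0 => v _; rewrite mulr_ge0 ?gsV_ge0. Qed.

Lemma w0_le1 x : w0 x <= mg1.
Proof.
apply: le_Rintegral => //; first exact: integrable_w0.
by move=> v _; apply: le_trans (w0_kernel_le x v); exact: ler_norm.
Qed.

Lemma measurable_w0 : measurable_fun setT w0.
Proof.
have mF : measurable_fun setT (fun x : 'rV[R]_d => \int[la]_v (gsV 4^-1 (x - v) * g v)%:E)%E.
  apply: (@measurable_fun_intr _ _ _ _ _ la (fun x v : 'rV[R]_d => (gsV 4^-1 (x - v) * g v)%:E)).
    by apply/measurable_EFinP; exact: measurable_w0_kernel.
  by move=> x v; rewrite lee_fin mulr_ge0 ?gsV_ge0.
by apply: (measurableT_comp _ mF); exact: fine_measurable.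
Qed.

Lemma conv_le (f : 'rV[R]_d -> R) (C : R) x : 0 <= C -> measurable_fun setT f ->
  (forall v, 0 <= f v) -> (forall v, f v <= C * g (x - v)) ->
  \int[la]_v (f v * g v) <= C * Cc * g x.
Proof.
move=> C0 mf f0 fC; apply: ge0_Rintegral_le => [v|]; first by rewrite mulr_ge0.
apply: (@le_trans _ _ (\int[la]_v (C%:E * (g (x - v) * g v)%:E))%E).
  apply: ge0_le_lower_integral => v _; first by rewrite lee_fin mulr_ge0.
  by rewrite -EFinM lee_fin mulrA ler_wpM2r.
rewrite ge0_intZl//; last 2 first.
- apply/measurable_EFinP; apply: measurable_funM => //.
  by apply: (measurableT_comp mg); exact: measurable_fun_subrV.
- by move=> z; rewrite lee_fin mulr_ge0.
by rewrite -mulrA [in leRHS]EFinM; apply: lee_wpmul2l; rewrite ?lee_fin.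
Qed.

Lemma w0_le_g : exists2 C, 0 <= C & forall x, w0 x <= C * g x.
Proof.
exists (Ce * expR (a ^+ 2 / (2 * 4^-1)) * Cc).
  by rewrite !mulr_ge0 ?expR_ge0// ltW.
move=> x; apply: conv_le.
- by rewrite mulr_ge0 ?expR_ge0.
- by apply: (measurableT_comp (measurable_gsV _)); exact: measurable_fun_subrV.
- by move=> v; exact: gsV_ge0.
- by move=> v; exact: bump_le.
Qed.

Lemma g_le_w0 : exists2 C, 0 < C & forall x, g x <= C * w0 x.
Proof.
exists (Ce * expR (a ^+ 2) / gm).
  by rewrite divr_gt0// mulr_gt0 ?expR_gt0// (lt_le_trans ltr01).
move=> x; have c2 : 0 < (2^-1 : R) by rewrite invr_gt0.
have I1 := integrableZl measurableT (g x) (integrable_bump_shift x c2).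
have I2 := integrableZl measurableT (Ce * expR (a ^+ 2)) (integrable_w0 x).
have : g x * gm <= Ce * expR (a ^+ 2) * w0 x.
  rewrite -gmE -(Rintegral_bump_shift 2^-1 x) -(RintegralZl _ measurableT (integrable_bump_shift x c2)).
  rewrite /w0 -(RintegralZl _ measurableT (integrable_w0 x)).
  apply: le_Rintegral => // v _.
  rewrite -mulrA [gsV 4^-1 _ * _]mulrC.
  have -> : gsV 2^-1 (v - x) = gsV 2^-1 (x - v) by rewrite -gsVN opprB.
  apply: (@le_trans _ _ ((Ce * expR (a * enorm (x - v)) * g v) * gsV 2^-1 (x - v))).
    rewrite ler_wpM2r ?gsV_ge0//; apply: (le_trans (g_exp x v)).
    rewrite ler_wpM2r// ler_wpM2l// ler_expR ler_wpM2l//; exact: ler_dist_enorm.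
  have -> : (Ce * expR (a * enorm (x - v)) * g v) * gsV 2^-1 (x - v) =
    Ce * (g v * (expR (a * enorm (x - v)) * gsV 2^-1 (x - v))) by ring.
  rewrite ler_wpM2l// [leRHS]mulrCA ler_wpM2l// !gsVE -!expRD ler_expR.
  set t := enorm _; have := sqr_ge0 (t / 2 - a); rewrite sqrrB; lra.
by move=> H; rewrite mulrAC ler_pdivlMr.
Qed.

Lemma measurable_shift (f : 'rV[R]_d -> R) t x : 0 <= t -> measurable_fun setT f ->
  measurable_fun setT (fun w => f (x + X t w)).
Proof.
move=> t0 mf; apply: (measurableT_comp mf); apply: measurable_fun_addrV => //; exact: mX.
Qed.

Lemma integrable_shift (f : 'rV[R]_d -> R) t x M : 0 <= t -> measurable_fun setT f ->
  (forall z, 0 <= f z <= M) -> P.-integrable setT (EFin \o (fun w => f (x + X t w))).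
Proof.
move=> t0 mf fM; apply: (integrable_bounded_prob P (measurable_shift x t0 mf) (M := M)) => w.
by have /andP[f0 f1] := fM (x + X t w); rewrite ger0_norm.
Qed.

Lemma shift_superpose (f : 'rV[R]_d -> 'rV[R]_d -> R) (M : R) t x : 0 <= t ->
  measurable_fun setT (fun p : 'rV[R]_d * 'rV[R]_d => f p.1 p.2) ->
  (forall v z, 0 <= f v z <= M) ->
  [/\ P.-integrable setT (EFin \o (fun w => \int[la]_v (f v (x + X t w) * g v))),
      la.-integrable setT (EFin \o (fun v => (\int[P]_w f v (x + X t w)) * g v)) &
      \int[P]_w \int[la]_v (f v (x + X t w) * g v) = \int[la]_v ((\int[P]_w f v (x + X t w)) * g v)].
Proof.
move=> t0 mf fM; have mXt := mX t0.
have fz (v : 'rV[R]_d) : measurable_fun setT (f v).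
  have mp : measurable_fun setT (fun z : 'rV[R]_d => (v, z)) by exact: measurable_fun_pair.
  exact: (measurableT_comp mf mp).
have I1 : P.-integrable setT (EFin \o cst M) by apply: finite_measure_integrable_cst.
pose F (w : Omega) (v : 'rV[R]_d) := f v (x + X t w) * g v.
have mF : measurable_fun setT (fun p : Omega * 'rV[R]_d => F p.1 p.2).
  apply: measurable_funM; last exact: (measurableT_comp mg measurable_snd).
  have mp : measurable_fun setT (fun p : Omega * 'rV[R]_d => (p.2, x + X t p.1)).
    apply: measurable_fun_pair; first exact: measurable_snd.
    by apply: measurable_fun_addrV => //; exact: (measurableT_comp mXt measurable_fst).
  exact: (measurableT_comp mf mp).
have Fh (w : Omega) (v : 'rV[R]_d) : `|F w v| <= cst M w * g v.
  have /andP[f0 f1] := fM v (x + X t w).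
  by rewrite normrM !ger0_norm// ler_wpM2r.
have E (v : 'rV[R]_d) : \int[P]_w F w v = (\int[P]_w f v (x + X t w)) * g v.
  rewrite mulrC -RintegralZl//; last exact: integrable_shift (fM v).
  by apply: eq_Rintegral => w _; rewrite /F mulrC.
have mF' : measurable_fun setT (fun p : 'rV[R]_d * Omega => F p.2 p.1).
  have ms : measurable_fun setT (fun p : 'rV[R]_d * Omega => (p.2, p.1)).
    by apply: measurable_fun_pair; [exact: measurable_snd|exact: measurable_fst].
  exact: (measurableT_comp mF ms).
have Fh' (v : 'rV[R]_d) (w : Omega) : `|F w v| <= g v * cst M w by rewrite mulrC.
have Rb := normr_Rintegral_l mF Ig Fh.
split.
- apply: (integrable_bounded_prob P (measurable_Rintegral_l mF I1 Ig Fh) (M := M * mg1)) => w.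
  exact: Rb.
- have mR := measurable_Rintegral_l mF' Ig I1 Fh'.
  have Rb' := normr_Rintegral_l mF' I1 Fh'.
  apply: (le_integrable _ _ _ (integrableZl measurableT (\int[P]_w cst M w) Ig)) => //.
    apply/measurable_EFinP; under eq_fun do rewrite -E; exact: mR.
  by move=> v _ /=; rewrite -E lee_fin mulrC; apply: le_trans (Rb' v) _; exact: ler_norm.
- by rewrite (Rfubini mF I1 Ig Fh); apply: eq_Rintegral => v _.
Qed.


Let g_bnd z : 0 <= g z <= Kg. Proof. by rewrite g0 g_le. Qed.

Let b_bnd c (z : 'rV[R]_d) : 0 < c -> 0 <= gsV c z <= 1.
Proof. by move=> c0; rewrite gsV_ge0 gsV_le1// ltW. Qed.

(** Integrating [bump_iter] over the centres v with weight g(v) turns E g on the right into E (g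
    conv g), at most Cc E g, hence at most a constant times E w0. The same quantity now stands on
    both sides. *)
Lemma w0_iter : exists C K : R, [/\ 0 <= C, 0 <= K & forall (h : R) n x, 0 <= h ->
  \int[P]_w w0 (x + X (h *+ n) w) <=
  w0 x + h * \sum_(i < n) (C * \int[P]_w w0 (x + X (h *+ i) w)) + h ^+ 2 * K *+ n].
Proof.
have [C [K [C0 K0 H]]] := bump_iter q4.
have [C1 C10 gw] := g_le_w0.
exists (C * (Cc * C1)), (K * mg1); split.
- by rewrite !mulr_ge0// ltW.
- by rewrite mulr_ge0// mg1_ge0.
move=> h n x h0; have hn i : 0 <= h *+ i by rewrite mulrn_wge0.
have mf1 : measurable_fun setT (fun p : 'rV[R]_d * 'rV[R]_d => gsV 4^-1 (p.2 - p.1)).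
  apply: (measurableT_comp (measurable_gsV _)).
  by apply: measurable_fun_subrV; [exact: measurable_snd|exact: measurable_fst].
have mf2 : measurable_fun setT (fun p : 'rV[R]_d * 'rV[R]_d => g (p.2 - p.1)).
  apply: (measurableT_comp mg).
  by apply: measurable_fun_subrV; [exact: measurable_snd|exact: measurable_fst].
have [I1 J1 E1] := @shift_superpose (fun v z => gsV 4^-1 (z - v)) 1 (h *+ n) x (hn n) mf1
  (fun v z => b_bnd (z - v) q4).
have S2 i := @shift_superpose (fun v z => g (z - v)) Kg (h *+ i) x (hn i) mf2
  (fun v z => g_bnd (z - v)).
have Gi i : \int[la]_v ((\int[P]_w g (x + X (h *+ i) w - v)) * g v) <=
    Cc * C1 * \int[P]_w w0 (x + X (h *+ i) w).
  have [I2 J2 <-] := S2 i.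
  have Iw : P.-integrable setT (EFin \o (fun w => w0 (x + X (h *+ i) w))).
    apply: (@integrable_shift _ _ _ mg1); [exact: hn|exact: measurable_w0|].
    by move=> z; rewrite w0_ge0 w0_le1.
  rewrite -RintegralZl//; apply: le_Rintegral => //.
    exact: (integrableZl measurableT (Cc * C1) Iw).
  move=> w _; apply: (@le_trans _ _ (Cc * g (x + X (h *+ i) w))).
    rewrite -[Cc]mul1r; apply: conv_le => //.
    by apply: (measurableT_comp mg); exact: measurable_fun_subrV.
    by move=> v; rewrite mul1r.
  by rewrite -mulrA ler_wpM2l ?(ltW Cc0).
have EW : \int[P]_w w0 (x + X (h *+ n) w) =
  \int[la]_v ((\int[P]_w gsV 4^-1 (x + X (h *+ n) w - v)) * g v).
  transitivity (\int[P]_w \int[la]_v (gsV 4^-1 (x + X (h *+ n) w - v) * g v)); last exact: E1.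
  by apply: eq_Rintegral => w _.
rewrite [leLHS]EW.
pose B v := gsV 4^-1 (x - v) * g v +
  (h * (\sum_(i < n) C * ((\int[P]_w g (x + X (h *+ i) w - v)) * g v)) + h ^+ 2 * K *+ n * g v).
have IS (s : seq 'I_n) : la.-integrable setT (EFin \o (fun v =>
      \sum_(i <- s) C * ((\int[P]_w g (x + X (h *+ i) w - v)) * g v))) /\
    \int[la]_v (\sum_(i <- s) C * ((\int[P]_w g (x + X (h *+ i) w - v)) * g v)) <=
      \sum_(i <- s) C * (Cc * C1) * \int[P]_w w0 (x + X (h *+ i) w).
  elim: s => [|i s [IH1 IH2]].
    split; last by under eq_Rintegral do rewrite big_nil; rewrite Rintegral_cst ?mul0r// big_nil.
    rewrite (_ : _ \o _ = cst 0%E); first exact: integrable0.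
    by apply/funext => y /=; rewrite big_nil.
  have [_ J2 _] := S2 i; have CJ := integrableZl measurableT C J2.
  have E : (fun v => \sum_(j <- i :: s) C * ((\int[P]_w g (x + X (h *+ j) w - v)) * g v)) =
    (fun v => C * ((\int[P]_w g (x + X (h *+ i) w - v)) * g v) +
       \sum_(j <- s) C * ((\int[P]_w g (x + X (h *+ j) w - v)) * g v)).
    by apply/funext => v; rewrite big_cons.
  rewrite E; split; first exact: (integrableD measurableT CJ IH1).
  rewrite (RintegralD measurableT CJ IH1) big_cons lerD//.
  by rewrite (RintegralZl _ measurableT J2) -mulrA ler_wpM2l.
have [IS1 IS2] := IS (index_enum 'I_n).
have hIS := integrableZl measurableT h IS1.
have gI := integrableZl measurableT (h ^+ 2 * K *+ n) Ig.
have hgI := integrableD measurableT hIS gI.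
apply: (@le_trans _ _ (\int[la]_v B v)).
  apply: le_Rintegral => //; first exact: (integrableD measurableT (integrable_w0 x) hgI).
  move=> v _; rewrite /B.
  have := H h n (x - v) h0; rewrite ler_norml => /andP[_]; rewrite lerBlDl => Hv.
  have EE (f : 'rV[R]_d -> R) t : \int[P]_w f (x + X t w - v) = \int[P]_w f (x - v + X t w).
    by apply: eq_Rintegral => w _; rewrite addrAC.
  rewrite EE; apply: (le_trans (ler_wpM2r (g0 v) Hv)).
  rewrite !mulrDl lerD2l lerD2r -mulrA ler_wpM2l// big_distrl/=.
  by apply: ler_sum => i _; rewrite EE mulrA.
rewrite /B (RintegralD measurableT (integrable_w0 x) hgI) (RintegralD measurableT hIS gI).
rewrite (RintegralZl _ measurableT IS1) (RintegralZl _ measurableT Ig) -/(w0 x) -/mg1.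
rewrite -addrA lerD2l lerD//; first by rewrite ler_wpM2l.
by rewrite mulrnAl mulrA.
Qed.

Lemma w0_growth : exists2 C, 0 <= C & forall t x, 0 <= t ->
  \int[P]_w w0 (x + X t w) <= expR (C * t) * w0 x.
Proof.
have [C [K [C0 K0 H]]] := w0_iter.
exists C => // t x t0.
(* With n + 1 steps of length t/(n + 1) the quadratic errors add up to t^2 K/(n + 1). *)
apply: (@le_add_inv_nat _ _ _ (expR (C * t) * (t ^+ 2 * K))).
  by rewrite !mulr_ge0 ?expR_ge0 ?sqr_ge0.
move=> n; set N := n.+1; pose h : R := t / N%:R.
have N0 : 0 < N%:R :> R by rewrite ltr0n.
have h0 : 0 <= h by rewrite divr_ge0.
have hN : h *+ N = t by rewrite -mulr_natr divfK// gt_eqF.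
have := @discrete_gronwall R (fun i => \int[P]_w w0 (x + X (h *+ i) w))
  (w0 x + t ^+ 2 * K / N%:R) (h * C) N.
rewrite hN -mulrnAl hN [t * C]mulrC => G; apply: le_trans (G _ _ _) _.
- by rewrite addr_ge0 ?w0_ge0// divr_ge0// mulr_ge0 ?sqr_ge0.
- by rewrite mulr_ge0.
- move=> i iN; apply: (le_trans (H h i x h0)).
  rewrite -addrA [leLHS]addrCA [leRHS]addrC lerD//.
    by rewrite -mulrA ler_wpM2l// mulr_sumr.
  rewrite lerD2l -mulr_natr.
  apply: (@le_trans _ _ (h ^+ 2 * K * N%:R)).
    by rewrite ler_wpM2l ?ler_nat// mulr_ge0 ?sqr_ge0.
  rewrite /h le_eqVlt; apply/orP; left; apply/eqP; field; exact: lt0r_neq0.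
- by rewrite mulrDl [w0 x * _]mulrC lerD2l [leLHS]mulrC mulrA.
Qed.

Lemma g_growth : exists C D : R, [/\ 0 <= C, 0 <= D & forall t x, 0 <= t ->
  \int[P]_w g (x + X t w) <= D * expR (C * t) * g x].
Proof.
have [C C0 H] := w0_growth; have [C1 C10 gw] := g_le_w0; have [C2 C20 wg] := w0_le_g.
exists C, (C1 * C2); split => //; first by rewrite mulr_ge0// ltW.
move=> t x t0.
have Iw : P.-integrable setT (EFin \o (fun w => w0 (x + X t w))).
  by apply: (@integrable_shift _ _ _ mg1) => //; [exact: measurable_w0|move=> z; rewrite w0_ge0 w0_le1].
have Ig' : P.-integrable setT (EFin \o (fun w => g (x + X t w))) by exact: (@integrable_shift _ _ _ Kg).
apply: (@le_trans _ _ (\int[P]_w (C1 * w0 (x + X t w)))).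
  by apply: le_Rintegral => //; exact: (integrableZl measurableT C1 Iw).
rewrite (RintegralZl _ measurableT Iw).
apply: (@le_trans _ _ (C1 * (expR (C * t) * (C2 * g x)))); last first.
  by rewrite le_eqVlt; apply/orP; left; apply/eqP; ring.
rewrite ler_wpM2l ?(ltW C10)//; apply: (le_trans (H t x t0)).
by rewrite ler_wpM2l ?expR_ge0.
Qed.

(** Once E g is bounded by [g_growth], the right side of [bump_iter] is of order t g(y). *)
Lemma bump_growth c : 0 < c -> exists2 C, 0 <= C & forall t y, 0 <= t <= 1 ->
  `|\int[P]_w gsV c (y + X t w) - gsV c y| <= C * t * g y.
Proof.
move=> c0; have [B [K [B0 K0 H]]] := bump_iter c0.
have [C [D [C0 D0 G]]] := g_growth.
exists (B * (D * expR C)); first by rewrite !mulr_ge0 ?expR_ge0.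
move=> t y /andP[t0 t1]; apply: (@le_add_inv_nat _ _ _ (t ^+ 2 * K)).
  by rewrite mulr_ge0 ?sqr_ge0.
move=> n; set N := n.+1; pose h : R := t / N%:R.
have N0 : 0 < N%:R :> R by rewrite ltr0n.
have h0 : 0 <= h by rewrite divr_ge0.
have hN : h *+ N = t by rewrite -mulr_natr divfK// gt_eqF.
have := H h N y h0; rewrite hN => /le_trans; apply; apply: lerD; last first.
  by rewrite le_eqVlt; apply/orP; left; apply/eqP; rewrite /h -mulr_natr; field; exact: lt0r_neq0.
apply: (@le_trans _ _ (h * \sum_(i < N) (B * (D * expR C * g y)))).
  rewrite ler_wpM2l//; apply: ler_sum => i _; rewrite ler_wpM2l//.
  have hi : 0 <= h *+ i by rewrite mulrn_wge0.
  apply: (le_trans (G _ y hi)); rewrite ler_wpM2r// ler_wpM2l// ler_expR.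
  rewrite -[leRHS]mulr1 ler_wpM2l//; apply: le_trans t1; rewrite -hN.
  by apply: ler_wpMn2l => //; exact: ltnW.
rewrite sumr_const card_ord mulrnAr -mulrnAl hN.
by rewrite le_eqVlt; apply/orP; left; apply/eqP; ring.
Qed.


(* The barrier: it vanishes at [x0] and is comparable to [g] away from [x0]. *)
Definition w1 (x0 x : 'rV[R]_d) : R := w0 x * (1 - gsV 1 (x - x0)).

(** E w0 is bounded by [w0_growth], so a lower bound for E (w0 bump) is what is missing. Each bump
    of w0 times the cutoff is [ka v] times a bump of exponent 5/4, which loses at most B t Kg; this
    uniform loss is good enough because [ka] integrated against [g] is already O(g(x0)). *)
Lemma w1_growth : exists2 C, 0 <= C & forall x0 y t, enorm (y - x0) <= 1 -> 0 <= t <= 1 ->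
  \int[P]_w w1 x0 (y + X t w) <= w1 x0 y + C * t * g x0.
Proof.
have c54 : 0 < (5 / 4 : R) by rewrite divr_gt0.
have c15 : 0 < (5^-1 : R) by rewrite invr_gt0.
have c1 : 0 < (1 : R) := ltr01.
have [B B0 HB] := bump_growth c54.
have [C C0 HC] := w0_growth; have [C2 C20 wg] := w0_le_g.
pose Cb := Ce * expR (a ^+ 2 / (2 * 5^-1)).
have Cb0 : 0 <= Cb by rewrite mulr_ge0 ?expR_ge0.
pose D := C2 * (Ce * expR a).
have D0 : 0 <= D by rewrite !mulr_ge0 ?expR_ge0.
exists (C * expR C * D + B * Kg * (Cb * Cc)).
  by rewrite addr_ge0 ?mulr_ge0 ?expR_ge0// ltW.
move=> x0 y t yx t01; have /andP[t0 t1] := t01.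
pose f (v z : 'rV[R]_d) := gsV 4^-1 (z - v) * gsV 1 (z - x0).
have mf : measurable_fun setT (fun p : 'rV[R]_d * 'rV[R]_d => f p.1 p.2).
  apply: measurable_funM; apply: (measurableT_comp (measurable_gsV _)).
    by apply: measurable_fun_subrV; [exact: measurable_snd|exact: measurable_fst].
  by apply: measurable_fun_subrV => //; exact: measurable_snd.
have f_bnd v z : 0 <= f v z <= 1.
  have /andP[p1 p2] := b_bnd (z - v) q4; have /andP[p3 p4] := b_bnd (z - x0) c1.
  by rewrite mulr_ge0//= mulr_ile1.
pose m v := x0 + 5^-1 *: (v - x0).
pose ka v := gsV 5^-1 (v - x0).
have fE v z : f v z = ka v * gsV (5 / 4) (z - m v).
  exact: gsV_quarter_one.
have [I1 J1 E1] := shift_superpose y t0 mf f_bnd.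
have Iw0 : P.-integrable setT (EFin \o (fun w => w0 (y + X t w))).
  by apply: (@integrable_shift _ _ _ mg1) => //; [exact: measurable_w0|move=> z; rewrite w0_ge0 w0_le1].
have kaI : la.-integrable setT (EFin \o (fun v => ka v * g v)).
  apply: (le_integrable _ _ _ Ig) => //.
    apply/measurable_EFinP; apply: measurable_funM => //.
    by apply: (measurableT_comp (measurable_gsV _)); exact: measurable_fun_subrV.
  move=> v _ /=; rewrite lee_fin !ger0_norm ?mulr_ge0 ?gsV_ge0//.
  by have /andP[p1 p2] := b_bnd (v - x0) c15; rewrite ler_piMl.
have kaM : \int[la]_v (ka v * g v) <= Cb * Cc * g x0.
  apply: conv_le => //.
  - by apply: (measurableT_comp (measurable_gsV _)); exact: measurable_fun_subrV.
  - by move=> v; exact: gsV_ge0.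
  - by move=> v; rewrite /ka -gsVN opprB; exact: bump_le.
have low : w0 y * gsV 1 (y - x0) - B * t * Kg * (Cb * Cc * g x0) <=
    \int[P]_w (w0 (y + X t w) * gsV 1 (y + X t w - x0)).
  have -> : \int[P]_w (w0 (y + X t w) * gsV 1 (y + X t w - x0)) =
      \int[P]_w \int[la]_v (f v (y + X t w) * g v).
    apply: eq_Rintegral => w _; rewrite mulrC -(RintegralZl _ measurableT (integrable_w0 _)).
    by apply: eq_Rintegral => v _; rewrite /f; ring.
  rewrite E1.
  have If : la.-integrable setT (EFin \o (fun v => f v y * g v)).
    have := integrableZl measurableT (gsV 1 (y - x0)) (integrable_w0 y).
    by apply: eq_integrable => // v _; rewrite /f /= -EFinM; congr EFin; ring.
  have Ik := integrableZl measurableT (B * t * Kg) kaI.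
  apply: (@le_trans _ _ (\int[la]_v (f v y * g v - B * t * Kg * (ka v * g v)))).
    rewrite (RintegralB measurableT If Ik) (RintegralZl _ measurableT kaI) lerB//.
      rewrite mulrC -(RintegralZl _ measurableT (integrable_w0 _)) le_eqVlt; apply/orP; left; apply/eqP.
      by apply: eq_Rintegral => v _; rewrite /f; ring.
    by rewrite ler_wpM2l// !mulr_ge0.
  apply: le_Rintegral => //; first exact: (integrableB measurableT If Ik).
  move=> v _; rewrite mulrA -mulrBl ler_wpM2r//.
  have -> : \int[P]_w f v (y + X t w) = ka v * \int[P]_w gsV (5 / 4) (y - m v + X t w).
    have Ib : P.-integrable setT (EFin \o (fun w => gsV (5 / 4) (y - m v + X t w))).
      by apply: (@integrable_shift _ _ _ 1) => //; [exact: measurable_gsV|move=> z; exact: b_bnd].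
    rewrite -(RintegralZl _ measurableT Ib).
    by apply: eq_Rintegral => w _; rewrite fE addrAC.
  rewrite fE [B * t * Kg * _]mulrC -mulrBr ler_wpM2l ?gsV_ge0//.
  have := HB t (y - m v) t01; rewrite ler_norml => /andP[h _].
  have : B * t * g (y - m v) <= B * t * Kg by rewrite ler_wpM2l// mulr_ge0.
  lra.
have Iw1 : P.-integrable setT (EFin \o (fun w => w0 (y + X t w) * gsV 1 (y + X t w - x0))).
  apply: (@integrable_shift (fun z => w0 z * gsV 1 (z - x0)) _ _ mg1) => //.
    apply: measurable_funM; first exact: measurable_w0.
    by apply: (measurableT_comp (measurable_gsV _)); exact: measurable_fun_subrV.
  move=> z; have /andP[p3 p4] := b_bnd (z - x0) c1; rewrite mulr_ge0 ?w0_ge0//=.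
  by apply: le_trans (w0_le1 z); rewrite ler_piMr ?w0_ge0.
have -> : \int[P]_w w1 x0 (y + X t w) =
    \int[P]_w w0 (y + X t w) - \int[P]_w (w0 (y + X t w) * gsV 1 (y + X t w - x0)).
  rewrite -(RintegralB measurableT Iw0 Iw1); apply: eq_Rintegral => w _.
  by rewrite /w1 mulrBr mulr1.
have gy : g y <= Ce * expR a * g x0.
  apply: (le_trans (g_exp y x0)); rewrite ler_wpM2r// ler_wpM2l// ler_expR.
  by rewrite -[leRHS]mulr1 ler_wpM2l//; apply: (le_trans (ler_dist_enorm _ _)).
have wy : w0 y <= D * g x0.
  by apply: (le_trans (wg y)); rewrite -mulrA ler_wpM2l.
have h1 := HC t y t0; have h2 := expR_sub1_le C0 t01.
have h3 : (expR (C * t) - 1) * w0 y <= C * expR C * t * (D * g x0).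
  apply: ler_pM => //; first by rewrite subr_ge0 -expR0 ler_expR mulr_ge0.
  exact: w0_ge0.
rewrite /w1; lra.
Qed.

(** The test function is large when the path from y ends near the origin after a displacement that
    is not small, and it vanishes at displacement 0. Hence reaching a neighbourhood of the origin
    from afar in time t has probability O(t g(y)). *)
Lemma annulus_growth : exists2 C, 0 <= C & forall y t, 0 <= t <= 1 ->
  \int[P]_w (gsV 1 (y + X t w) * (1 - gsV 1 (X t w))) <= C * t * g y.
Proof.
have c1 : 0 < (1 : R) := ltr01; have c2 : 0 < (2 : R) by [].
have ch : 0 < (2^-1 : R) by rewrite invr_gt0.
have [B B0 HB] := bump_growth c1; have [B2 B20 HB2] := bump_growth c2.
pose Cb := Ce * expR (a ^+ 2 / (2 * 2^-1)).
have Cb0 : 0 <= Cb by rewrite mulr_ge0 ?expR_ge0.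
exists (B + Cb * (B2 * Kg)); first by rewrite addr_ge0 ?mulr_ge0.
move=> y t t01; have /andP[t0 t1] := t01.
have I1 : P.-integrable setT (EFin \o (fun w => gsV 1 (y + X t w))).
  by apply: (@integrable_shift _ _ _ 1) => //; [exact: measurable_gsV|move=> z; exact: b_bnd].
have I2 : P.-integrable setT (EFin \o (fun w => gsV 2 (2^-1 *: y + X t w))).
  by apply: (@integrable_shift _ _ _ 1) => //; [exact: measurable_gsV|move=> z; exact: b_bnd].
have I3 := integrableZl measurableT (gsV 2^-1 y) I2.
have -> : \int[P]_w (gsV 1 (y + X t w) * (1 - gsV 1 (X t w))) =
   \int[P]_w gsV 1 (y + X t w) - gsV 2^-1 y * \int[P]_w gsV 2 (2^-1 *: y + X t w).
  rewrite -(RintegralZl _ measurableT I2) -(RintegralB measurableT I1 I3).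
  by apply: eq_Rintegral => w _; rewrite mulrBr mulr1 gsV_one_one.
have := HB t y t01; rewrite ler_norml => /andP[_ h1].
have := HB2 t (2^-1 *: y) t01; rewrite ler_norml => /andP[h2 _].
have h3 := gsV_ge0 2^-1 y; have h4 : gsV 2^-1 y <= Cb * g y := bump_le y ch.
have h5 : gsV 1 y = gsV 2^-1 y * gsV 2 (2^-1 *: y).
  have := gsV_one_one y 0; rewrite !addr0 => <-.
  by rewrite [gsV 1 0]/gsV dotp0l mulr0 oppr0 expR0 mulr1.
have h6 : B2 * t * g (2^-1 *: y) <= B2 * t * Kg by rewrite ler_wpM2l// mulr_ge0.
have h8 : 0 <= B2 * t * Kg by rewrite !mulr_ge0.
exact: annulus_scalar h1 h2 h3 h4 h5 h6 h8.
Qed.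

End levy_semigroup.

(** * The symbol of a symmetric process, and a summary of the fixed-time estimates *)

Lemma same_law_integral d1 d2 d3 (T1 : measurableType d1) (T2 : measurableType d2)
    (T : measurableType d3) (R : realType) (m1 : {measure set T1 -> \bar R})
    (m2 : {measure set T2 -> \bar R}) (Y : T1 -> T) (Z : T2 -> T) (f : T -> \bar R) :
  measurable_fun setT Y -> measurable_fun setT Z ->
  (forall A, measurable A -> m1 (Y @^-1` A) = m2 (Z @^-1` A)) ->
  measurable_fun setT f -> (forall x, 0 <= f x)%E ->
  (\int[m1]_x f (Y x) = \int[m2]_x f (Z x))%E.
Proof.
move=> mY mZ law mf f0.
have f0' : {in setT, forall x, (0 <= f x)%E} by [].
rewrite -[LHS](ge0_integral_pushforward mY _ measurableT mf f0')//.
rewrite -[RHS](ge0_integral_pushforward mZ _ measurableT mf f0')//.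
by apply: eq_measure_integral => // A mA _; exact: law.
Qed.

(** Removes the imaginary part of the exponent: by symmetry sin(t im) = 0 for all t >= 0, and t =
    pi/(2|im|) would give the value 1 or -1. *)
Lemma sin_scale_eq0 (R : realType) (s : R) : (forall t, 0 <= t -> sin (t * s) = 0) -> s = 0.
Proof.
move=> H; apply/eqP/negP => /negP s0.
have ns : 0 < `|s| by rewrite normr_gt0.
have p2 : 0 <= pi / 2 / `|s| by rewrite divr_ge0// divr_ge0// pi_ge0.
have := H _ p2; case: (ger0P s) => [sp|sn].
    by rewrite divfK// => /eqP; rewrite sin_pihalf oner_eq0.
rewrite invrN mulrN mulNr divfK// sinN sin_pihalf => /eqP.
by rewrite oppr_eq0 oner_eq0.
Qed.

Lemma expectationE d0 (T : measurableType d0) (R : realType) (P : probability T R) (f : T -> R) :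
  'E_P[f]%E = (\int[P]_w (f w)%:E)%E.
Proof. by rewrite unlock. Qed.

Section levy_symbol.
Context {R : realType} {dO : measure_display} {Omega : measurableType dO} {d : nat}.
Variables (P : probability Omega R) (X : R -> Omega -> 'rV[R]_d) (nu : 'rV[R]_d -> R).
Local Notation la := (lebesgue_rV R d).
Variable mu : {measure set 'rV[R]_d -> \bar R}.
Hypothesis mX : forall t, 0 <= t -> measurable_fun setT (X t).
Hypothesis symX : levy_symmetric P X.
Hypothesis mnu : measurable_fun setT nu.
Hypothesis nu0 : forall x, x != 0 -> 0 < nu x.
Hypothesis muE : forall A, measurable A -> mu A = (\int[la]_(z in A) (nu z)%:E)%E.

(** Setting the value 0 at the origin makes the density nonnegative everywhere, as the kernel [k] of
    the generator is assumed to be. *)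
Definition nu' (z : 'rV[R]_d) : R := if 0 < enorm z then nu z else 0.

Lemma nu'_ge0 z : 0 <= nu' z.
Proof.
rewrite /nu'; case: ltP => // z0; apply/ltW/nu0.
by apply: contraTneq z0 => ->; rewrite enorm0 ltxx.
Qed.

Lemma measurable_nu' : measurable_fun setT nu'.
Proof.
apply: measurable_fun_ifT => //.
by apply: measurable_fun_ltr => //; exact: measurable_fun_enorm.
Qed.

Let D : set 'rV[R]_d := [set z | 0 < enorm z].

Let mD : measurable D.
Proof.
have -> : D = ~` [set y | enorm (y - 0) <= 0].
  by apply/seteqP; split => z /=; rewrite subr0 /D/= ltNge => /negP.
by apply: measurableC; exact: measurable_ecball.
Qed.

Lemma levy_density_integral (f : 'rV[R]_d -> R) : measurable_fun setT f ->
  (forall z, 0 <= f z) -> f 0 = 0 ->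
  (\int[mu]_z (f z)%:E = \int[la]_z (f z * nu' z)%:E)%E.
Proof.
move=> mf f0 f00.
have fD z : ~ D z -> f z = 0.
  move/negP; rewrite -leNgt => z0; have z00 : enorm z = 0 by apply/eqP; rewrite eq_le z0 enorm_ge0.
  by move/enorm_eq0: z00 => ->.
have mk : measurable_fun D nu' by apply: measurable_funTS; exact: measurable_nu'.
have kE A : measurable A -> A `<=` D -> mu A = (\int[la]_(x in A) (nu' x)%:E)%E.
  move=> mA AD; rewrite muE//; apply: eq_integral => z; rewrite inE => /AD.
  by rewrite /D /nu'/= => ->.
have := @ge0_integral_density _ _ _ mu la D nu' mD mk (fun x _ => nu'_ge0 x) kE
  (fun z => (f z)%:E) _ _.
rewrite integral_mkcond [in RHS]integral_mkcond => H.
transitivity (\int[mu]_z (((fun z => (f z)%:E) \_ D) z))%E.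
  apply: eq_integral => z _; rewrite patchE; case: ifPn => //.
  by rewrite notin_setE => /fD ->.
rewrite H.
- apply: eq_integral => z _; rewrite patchE; case: ifPn => //.
  by rewrite notin_setE => /fD ->; rewrite mul0r.
- exact/measurable_EFinP.
- by move=> z; rewrite lee_fin.
Qed.

Variables (b : 'rV[R]_d) (Q : 'M[R]_d).
Hypothesis min_lty : (\int[mu]_z (Num.min 1 (enorm z ^+ 2))%:E < +oo)%E.
Hypothesis LK : forall (t : R) (u : 'rV[R]_d), 0 <= t ->
  let re := - (dotp (u *m Q) u / 2) + \int[mu]_z (cos (dotp u z) - 1) in
  let im := dotp u b + \int[mu]_z (sin (dotp u z) - dotp u z * \1_(eball 0 1) z) in
  'E_P[fun w => cos (dotp u (X t w))]%E = (expR (t * re) * cos (t * im))%:E /\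
  'E_P[fun w => sin (dotp u (X t w))]%E = (expR (t * re) * sin (t * im))%:E.

Lemma measurable_min1 : measurable_fun setT (fun z : 'rV[R]_d => Num.min 1 (enorm z ^+ 2)).
Proof.
by apply: measurable_minr => //; apply: measurable_funX; exact: measurable_fun_enorm.
Qed.

Lemma min1_ge0 (z : 'rV[R]_d) : 0 <= Num.min 1 (enorm z ^+ 2).
Proof. by rewrite le_min ler01 sqr_ge0. Qed.

Lemma integrable_min1 :
  la.-integrable setT (EFin \o (fun z => Num.min 1 (enorm z ^+ 2) * nu' z)).
Proof.
apply/integrableP; split.
  by apply/measurable_EFinP; apply: measurable_funM; [exact: measurable_min1|exact: measurable_nu'].
under eq_integral do rewrite /= ger0_norm ?mulr_ge0 ?min1_ge0 ?nu'_ge0//.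
rewrite -levy_density_integral//; first exact: measurable_min1.
  by move=> z; exact: min1_ge0.
by rewrite enorm0 expr0n/=; apply/min_idPr.
Qed.

Lemma jump_symbol u : \int[mu]_z (cos (dotp u z) - 1) = - \int[la]_z ((1 - cos (dotp u z)) * nu' z).
Proof.
have mc : measurable_fun setT (fun z : 'rV[R]_d => 1 - cos (dotp u z)).
  apply: measurable_funB => //.
  by apply: (measurableT_comp measurable_cosR); exact: measurable_fun_dotp.
rewrite /Rintegral -fineN -(@levy_density_integral (fun z => 1 - cos (dotp u z)) mc); last 2 first.
- by move=> z; exact: sub1cos_ge0.
- by rewrite dotpC dotp0l cos0 subrr.
rewrite -integral_ge0N; last by move=> z _; rewrite lee_fin sub1cos_ge0.
by congr fine; apply: eq_integral => z _; rewrite -EFinN opprB.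
Qed.

Lemma E_sin0 t u : 0 <= t -> \int[P]_w sin (dotp u (X t w)) = 0.
Proof.
move=> t0; have mXt := mX t0.
have ms : measurable_fun setT (fun z : 'rV[R]_d => sin (dotp u z)).
  by apply: (measurableT_comp measurable_sinR); exact: measurable_fun_dotp.
have Is : P.-integrable setT (EFin \o (fun w => sin (dotp u (X t w)))).
  by apply: (integrable_bounded_prob P (measurableT_comp ms mXt) (M := 1)) => w; exact: normr_sin_le1.
have I1 : P.-integrable setT (EFin \o cst 1%R) by apply: finite_measure_integrable_cst.
have mN : measurable_fun setT (fun w => - X t w) by exact: measurable_fun_opprV.
(* The shift by 1 makes the integrand nonnegative, as [same_law_integral] requires. *)
have E : (\int[P]_w (1 + sin (dotp u (- X t w)))%:E = \int[P]_w (1 + sin (dotp u (X t w)))%:E)%E.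
  apply: (@same_law_integral _ _ _ _ _ _ _ P P (fun w => - X t w) (X t) (fun z => (1 + sin (dotp u z))%:E)) => //.
  - by move=> A mA; exact: symX.
  - by apply/measurable_EFinP; exact: measurable_funD.
have : \int[P]_w (1 - sin (dotp u (X t w))) = \int[P]_w (1 + sin (dotp u (X t w))).
  rewrite /Rintegral -E; congr fine; apply: eq_integral => w _.
  by rewrite dotpNr sinN.
rewrite (RintegralB measurableT I1 Is) (RintegralD measurableT I1 Is).
lra.
Qed.

Lemma E_cosE t u : 0 <= t -> \int[P]_w cos (dotp u (X t w)) = expR (- (t * Psi Q nu' u)).
Proof.
move=> t0; pose re := - (dotp (u *m Q) u / 2) + \int[mu]_z (cos (dotp u z) - 1).
pose im := dotp u b + \int[mu]_z (sin (dotp u z) - dotp u z * \1_(eball 0 1) z).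
have im0 : im = 0.
  apply: sin_scale_eq0 => s s0; have [_ ] := LK u s0; rewrite -/re -/im.
  have := E_sin0 u s0; rewrite expectationE /Rintegral => E1 E2.
  move: E1; rewrite E2/= => /eqP; rewrite mulf_eq0 gt_eqF ?expR_gt0//= => /eqP.
  by [].
have [E _] := LK u t0; move: E; rewrite -/re -/im im0 mulr0 cos0 mulr1 => E.
have -> : \int[P]_w cos (dotp u (X t w)) = fine ('E_P[fun w => cos (dotp u (X t w))]%E).
  by rewrite /Rintegral expectationE.
rewrite E/= /re jump_symbol; congr expR; rewrite /Psi /qform; ring.
Qed.

End levy_symbol.

(** The interface between the Fourier analysis above and the path arguments below: what the latter
    use of the law of the process at a fixed time, with a single constant [K]. *)
Record levy_estimates (R : realType) (dO : measure_display) (Omega : measurableType dO)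
    (d : nat) (P : probability Omega R) (X : R -> Omega -> 'rV[R]_d)
    (nu g w : 'rV[R]_d -> R) (a K : R) : Prop := LevyEstimates {
  est_mX : forall t, 0 <= t -> measurable_fun setT (X t) ;
  est_mg : measurable_fun setT g ;
  est_g_gt0 : forall x, 0 < g x ;
  est_g_le : forall x, g x <= K ;
  est_nu : forall x, 1 <= enorm x -> g x = nu x ;
  est_a : 0 <= a ;
  est_K : 1 <= K ;
  est_exp : forall u v, g u <= K * expR (a * `|enorm u - enorm v|) * g v ;
  est_mw : measurable_fun setT w ;
  est_w_ge0 : forall x, 0 <= w x ;
  est_gw : forall x, g x <= K * w x ;
  est_wg : forall x, w x <= K * g x ;
  est_w_growth : forall t x, 0 <= t ->
    \int[P]_om w (x + X t om) <= expR (K * t) * w x ;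
  est_w1_growth : forall x0 y t, enorm (y - x0) <= 1 -> 0 <= t <= 1 ->
    \int[P]_om w1 g x0 (y + X t om) <= w1 g x0 y + K * t * g x0 ;
  est_wE : w = w0 g ;
  est_bump : forall c, 0 < c -> exists2 C, 0 <= C & forall t y, 0 <= t <= 1 ->
    `|\int[P]_om gsV c (y + X t om) - gsV c y| <= C * t * g y ;
  est_annulus : forall y t, 0 <= t <= 1 ->
    \int[P]_om (gsV 1 (y + X t om) * (1 - gsV 1 (X t om))) <= K * t * g y ;
  est_ball : exists cl rho Rr Cl : R, [/\ 0 < cl, 0 < rho, 0 < Rr & 0 <= Cl] /\
    forall x h, Rr <= enorm x -> 0 <= h ->
    ((cl * h * g x - Cl * h ^+ 2)%:E <= P [set om | eball x rho (X h om)])%E }.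

Lemma exists_levy_estimates (R : realType) (dO : measure_display) (Omega : measurableType dO)
    (d : nat) (P : probability Omega R) (X : R -> Omega -> 'rV[R]_d) (nu : 'rV[R]_d -> R) :
  (0 < d)%N -> (forall t, 0 <= t -> measurable_fun setT (X t)) -> assumption_A1 P X nu ->
  exists g w a K, levy_estimates P X nu g w a K.
Proof.
move=> d0 mX [symX [mnu [mu [lmu muE]]] nu0 [nu1 nu2 nu3]].
have [mu0 min_lty [b [Q [QT Qpos LK]]]] := lmu.
have h2 : 0 < (2^-1 : R) by rewrite invr_gt0.
have [C1 [C11 {}nu1]] := nu1 2^-1 h2 (lexx _).
have [C2 [C21 {}nu2]] := nu2; have [C3 [C31 {}nu3]] := nu3.
pose k := nu' nu; pose g := wt nu; pose a := ln C1.
have mk := measurable_nu' mnu; have k0 := nu'_ge0 nu0.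
have kg (z : 'rV[R]_d) : 1 <= enorm z -> k z = g z.
  by move=> z1; rewrite /k /g /nu' /wt (lt_le_trans ltr01 z1) ltNge z1.
have Ik := integrable_min1 mnu nu0 muE min_lty.
have mg := measurable_wt mnu.
have g_gt0 : forall x, 0 < g x := wt_gt0 nu0.
have [Kg [Kg0 g_le]] := wt_le d0 nu0 C21 nu2.
have a0 : 0 <= a := ln_C1_ge0 C11.
have [Ce [Ce1 g_exp]] := wt_exp d0 nu0 C11 nu1.
have g00 : g 0 = 1 by rewrite /g /wt enorm0 ltr01.
have Ig : (lebesgue_rV R d).-integrable setT (EFin \o g).
  have Ib : (lebesgue_rV R d).-integrable setT (EFin \o \1_(eball (0 : 'rV[R]_d) 1)).
    have mb := measurable_eball (0 : 'rV[R]_d) 1.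
    apply/integrableP; split; first by apply/measurable_EFinP; exact: measurable_indic.
    under eq_integral do rewrite /= ger0_norm//.
    by rewrite integral_indic// setIT; exact: (lebesgue_ball_lty (0 : 'rV[R]_d)).2.
  apply: (le_integrable _ _ _ (integrableD measurableT Ib Ik)) => //; first exact/measurable_EFinP.
  move=> z _ /=; rewrite lee_fin ger0_norm ?(ltW (g_gt0 z))//.
  apply: le_trans (ler_norm _); have [z1|z1] := leP 1 (enorm z).
    have -> : Num.min 1 (enorm z ^+ 2) = 1 by apply/min_idPl; rewrite expr_ge1 ?enorm_ge0.
    by rewrite mul1r -(kg z z1) lerDr indicE.
  rewrite indicE mem_set; last by rewrite /eball/= subr0.
  by rewrite /g /wt z1 lerDl; apply: mulr_ge0; [exact: min1_ge0|exact: k0].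
have [Cc [Cc0 g_conv]] : exists K : R, (0 < K)%R /\ forall x,
  (\int[lebesgue_rV R d]_v (g (x - v) * g v)%:E <= (K * g x)%:E)%E.
  apply: (wt_conv d0 nu0 mnu C11 nu1 C21 nu2 C31 nu3 (M := \int[lebesgue_rV R d]_v g v)).
  by rewrite /Rintegral fineK// (integrable_fin_num measurableT Ig).
have qpos u : 0 <= qform Q u := Qpos u.
have cosX := E_cosE mX symX mnu nu0 muE LK.
have sinX := E_sin0 mX symX.
have BI c (c0 : 0 < c) := bump_iter mk k0 kg Ik mg g_gt0 g_le Ce1 g_exp g00 Ig Cc0 g_conv qpos mX cosX sinX c0.
have BL := ball_lower mk k0 kg Ik mg g_gt0 g_le a0 Ce1 g_exp g00 Ig Cc0 g_conv qpos mX cosX sinX.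
have ble c x (c0 : 0 < c) : gsV c x <= Ce * expR (a ^+ 2 / (2 * c)) * g x.
  exact: (bump_le_g g_gt0 Ce1 g_exp g00 c0).
have gm0 := @gmass_gt0 R d; have gmE := @gmassE R d.
have [Ca Ca0 wgr] := w0_growth mX mg g_gt0 g_le a0 Ce1 g_exp Ig Cc0 g_conv gm0 gmE BI.
have [Cb Cb0 w1gr] := w1_growth mX mg g_gt0 g_le a0 Ce1 g_exp Ig Cc0 g_conv gm0 gmE ble BI.
have [Cd Cd0 ann] := annulus_growth mX mg g_gt0 g_le a0 Ce1 g_exp Ig Cc0 g_conv gm0 gmE ble BI.
have bgr c (c0 : 0 < c) := bump_growth mX mg g_gt0 g_le a0 Ce1 g_exp Ig Cc0 g_conv gm0 gmE ble BI c0.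
have [Cw Cw0 wg] := w0_le_g mg g_gt0 Ce1 Cc0 g_conv ble.
have [Cv Cv0 gw] := g_le_w0 mg g_gt0 a0 Ce1 g_exp Ig gm0 gmE.
pose K := Kg + Ce + Ca + Cb + Cd + Cw + Cv.
have Ce0 : 0 <= Ce := le_trans ler01 Ce1.
have [K1 K2 K3 K4] : [/\ Kg <= K, Ce <= K, Ca <= K & Cb <= K].
  by move: (ltW Kg0) (ltW Cv0); rewrite /K; split; lra.
have [K5 K6 K7] : [/\ Cd <= K, Cw <= K & Cv <= K].
  by move: (ltW Kg0) (ltW Cv0); rewrite /K; split; lra.
exists g, (w0 g), a, K; split => //.
- by move=> x; exact: le_trans K1.
- by move=> x x1; rewrite -kg// /k /nu' (lt_le_trans ltr01 x1).
- exact: le_trans K2.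
- move=> u v; apply: (le_trans (g_exp u v)).
  by rewrite ler_wpM2r ?(ltW (g_gt0 v))// ler_wpM2r ?expR_ge0.
- exact: measurable_w0.
- by move=> x; apply: w0_ge0.
- move=> x; apply: (le_trans (gw x)); rewrite ler_wpM2r//; exact: w0_ge0.
- move=> x; apply: (le_trans (wg x)); rewrite ler_wpM2r//; exact/ltW.
- move=> t x t0; apply: (le_trans (wgr t x t0)).
  by rewrite ler_wpM2r ?w0_ge0// ler_expR ler_wpM2r.
- move=> x0 y t yx t01; apply: (le_trans (w1gr x0 y t yx t01)).
  have /andP[t0 _] := t01.
  by rewrite lerD2l ler_wpM2r ?(ltW (g_gt0 _))// ler_wpM2r.
- move=> y t t01; apply: (le_trans (ann y t t01)).
  have /andP[t0 _] := t01.
  by rewrite ler_wpM2r ?(ltW (g_gt0 _))// ler_wpM2r.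
Qed.

(** * Paths and their dyadic skeletons *)

Lemma pi_lambda_unique d (R : realType) (T : measurableType d) (G : set (set T))
    (m1 m2 : {measure set T -> \bar R}) :
  G `<=` measurable -> setI_closed G -> G setT -> (m1 setT < +oo)%E ->
  (forall A, G A -> m1 A = m2 A) -> forall A, <<s G >> A -> m1 A = m2 A.
Proof.
move=> Gm GI GT m1oo m12.
apply: (@g_sigma_algebra_measure_unique _ R T G Gm (fun=> setT)) => //.
by apply/seteqP; split => // x _; exists 0%N.
Qed.

Section path_space.
Context (R : realType) (d : nat).
Local Notation rV := 'rV[R]_d.

Definition dy (m k : nat) : R := k%:R / 2 ^+ m.

Lemma dy_ge0 m k : 0 <= dy m k. Proof. by rewrite divr_ge0// exprn_ge0. Qed.

Lemma dyS m k : dy m.+1 k.*2 = dy m k.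
Proof.
by rewrite /dy -muln2 natrM exprS invfM mulrA mulfK.
Qed.

Lemma dyD m i j : dy m (i + j) = dy m i + dy m j.
Proof. by rewrite /dy natrD mulrDl. Qed.

Lemma ler_dy m i j : (i <= j)%N -> dy m i <= dy m j.
Proof. by move=> ij; rewrite /dy ler_wpM2r ?invr_ge0 ?exprn_ge0// ler_nat. Qed.

Definition dinc (m i : nat) (p : R -> rV) : rV := p (dy m i.+1) - p (dy m i).

(** Constraints are indexed by all of nat but trivial from some index on, so that cylinders of
    different lengths intersect without reindexing. *)
Definition dcyl (m : nat) : set (set (R -> rV)) :=
  [set C | exists n (A : nat -> set rV), [/\ forall i, measurable (A i),
     forall i, (n <= i)%N -> A i = setT & C = [set p | forall i, A i (dinc m i p)]]].

Definition dcyls : set (set (R -> rV)) := \bigcup_m dcyl m.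

(** Paths are observed through increments over dyadic intervals, whose joint law the definition of a
    Levy process prescribes. The starting value itself is invisible, hence the subtraction of [p 0]
    in measurable quantities. *)
Definition pathT := g_sigma_algebraType dcyls.

Definition lev (m : nat) := g_sigma_algebraType (dcyl m).

Lemma measurable_dinc_lev m i : measurable_fun setT (fun p : lev m => dinc m i p).
Proof.
move=> _ B mB; rewrite setTI; apply: sub_sigma_algebra.
exists i.+1, (fun j => if j == i then B else setT); split.
- by move=> j; case: ifP.
- by move=> j; rewrite ltnNge; case: eqVneq => // ->; rewrite leqnn.
- apply/seteqP; split => p /=.
    by move=> h j; case: eqVneq => [->|].
  by move=> /(_ i); rewrite eqxx.
Qed.

Lemma dcyl_measurable d' (T : measurableType d') (f : T -> R -> rV) m C :
  (forall i, measurable_fun setT (fun x => dinc m i (f x))) ->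
  dcyl m C -> measurable [set x | C (f x)].
Proof.
move=> mf [n [A [mA An ->]]].
rewrite (_ : [set x | _] = \bigcap_i [set x | A i (dinc m i (f x))]); last first.
  by apply/seteqP; split => x /= h i => [_|]; apply: h.
apply: bigcapT_measurable => i; rewrite -[X in measurable X]setTI; exact: mf.
Qed.

Lemma measurable_dinc_levS m i : measurable_fun setT (fun p : lev m.+1 => dinc m i p).
Proof.
have -> : (fun p : lev m.+1 => dinc m i p) =
    (fun p => dinc m.+1 i.*2.+1 p + dinc m.+1 i.*2 p).
  apply/funext => p; rewrite /dinc -doubleS dyS dyS addrA subrK//.
by apply: measurable_fun_addrV; exact: measurable_dinc_lev.
Qed.

Lemma lev_subS m : <<s dcyl m >> `<=` <<s dcyl m.+1 >>.
Proof.
apply: smallest_sub; first exact: smallest_sigma_algebra.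
move=> C mC; have := @dcyl_measurable _ (lev m.+1) (fun p => p) m C (fun i => @measurable_dinc_levS m i) mC.
by [].
Qed.

Lemma lev_sub m n : (m <= n)%N -> <<s dcyl m >> `<=` <<s dcyl n >>.
Proof.
move=> /subnK <-; elim: (n - m)%N => // k IH C /IH; exact: lev_subS.
Qed.

Lemma dcyl_sub_path m : dcyl m `<=` (@measurable _ pathT).
Proof. by move=> C mC; apply: sub_sigma_algebra; exists m. Qed.

Lemma lev_sub_path m : <<s dcyl m >> `<=` (@measurable _ pathT).
Proof. by apply: smallest_sub; [exact: smallest_sigma_algebra|exact: dcyl_sub_path]. Qed.

Lemma measurable_dinc m i : measurable_fun setT (fun p : pathT => dinc m i p).
Proof.
move=> _ B mB; have := @measurable_dinc_lev m i measurableT B mB.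
exact: lev_sub_path.
Qed.

Lemma measurable_pathP d' (T : measurableType d') (f : T -> R -> rV) :
  (forall m i, measurable_fun setT (fun x => dinc m i (f x))) ->
  measurable_fun setT (f : T -> pathT).
Proof.
move=> mf; apply: (@measurability _ _ _ _ setT (f : T -> pathT) dcyls) => //.
move=> _ [C [m _ mC] <-]; rewrite setTI; exact: (dcyl_measurable (mf m) mC).
Qed.

Lemma dcyl_setI m : setI_closed (dcyl m).
Proof.
move=> _ _ [n [A [mA An ->]]] [n' [A' [mA' An' ->]]].
exists (maxn n n'), (fun i => A i `&` A' i); split.
- by move=> i; exact: measurableI.
- by move=> i; rewrite geq_max => /andP[ni n'i]; rewrite An// An'// setTI.
- by apply/seteqP; split => p /= => [[h h'] i|h]; [split|split=> i; have [] := h i].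
Qed.

Lemma dcyl_setT m : dcyl m setT.
Proof. by exists 0%N, (fun=> setT); split => //; apply/seteqP; split. Qed.

(* Two finite measures on paths agree as soon as they do on the cylinders of all
   sufficiently fine dyadic levels: first on the sigma-algebra of each level,
   then on their increasing union. *)
Lemma path_measure_unique (m1 m2 : {measure set pathT -> \bar R}) m0 :
  (m1 setT < +oo)%E ->
  (forall m A, (m0 <= m)%N -> dcyl m A -> m1 A = m2 A) ->
  forall A, measurable A -> m1 A = m2 A.
Proof.
move=> m1oo H.
have H1 m A : (m0 <= m)%N -> <<s dcyl m >> A -> m1 A = m2 A.
  move=> mm; apply: (@pi_lambda_unique _ R pathT (dcyl m)) => //.
  - exact: dcyl_sub_path.
  - exact: dcyl_setI.
  - exact: dcyl_setT.
  - by move=> B; exact: H.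
pose G : set (set pathT) := \bigcup_m <<s dcyl m >>.
move=> A mA; apply: (@pi_lambda_unique _ R pathT G) => //.
- by move=> B [m _]; exact: lev_sub_path.
- move=> B B' [m _ hB] [m' _ hB']; exists (maxn m m') => //.
  apply: (@measurableI _ (lev (maxn m m'))).
    exact: (lev_sub (leq_maxl m m')).
  exact: (lev_sub (leq_maxr m m')).
- by exists 0%N => //; exact: (@measurableT _ (lev 0)).
- move=> B [m _ hB]; apply: (H1 (maxn m m0)); first exact: leq_maxr.
  exact: (lev_sub (leq_maxl m m0)).
- move: A mA; apply: smallest_sub; first exact: smallest_sigma_algebra.
  by move=> B [m _ hB]; apply: sub_sigma_algebra; exists m => //; exact: sub_sigma_algebra.
Qed.

Lemma measurable_dval m k : measurable_fun setT (fun p : pathT => p (dy m k) - p 0).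
Proof.
elim: k => [|k IH].
  rewrite (_ : (fun p : pathT => _) = cst 0)//.
  by apply/funext => p; rewrite /dy mul0r subrr.
rewrite (_ : (fun p : pathT => _) = (fun p => dinc m k p + (p (dy m k) - p 0))).
  exact: (measurable_fun_addrV (measurable_dinc m k) IH).
by apply/funext => p; rewrite /dinc addrA subrK.
Qed.

Definition dyi (n : nat) (s : R) : nat := Num.truncn (s * 2 ^+ n).

Lemma measurable_dyi n k : measurable [set s | dyi n s = k].
Proof.
have mle j : measurable [set s | (j.+1 <= dyi n s)%N].
  rewrite (_ : [set s | _] = `[j.+1%:R / 2 ^+ n, +oo[%classic); first exact: measurable_itv.
  apply/seteqP; split => s /=; rewrite in_itv/= andbT /dyi truncn_gt_nat ler_pdivrMr// exprn_gt0//.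
case: k => [|k].
  rewrite (_ : [set s | _] = ~` [set s | (1 <= dyi n s)%N]); first exact: measurableC.
  by apply/seteqP; split => s /=; case: (dyi n s).
rewrite (_ : [set s | _] = [set s | (k.+1 <= dyi n s)%N] `\` [set s | (k.+2 <= dyi n s)%N]).
  exact: measurableD.
apply/seteqP; split => s /=; first by move=> ->; split => //; rewrite ltnn.
by move=> [h1 /negP h2]; apply/eqP; rewrite eqn_leq h1 andbT leqNgt.
Qed.

Lemma measurable_select d' (T : measurableType d') d2 (T2 : measurableType d2) (F : nat -> T -> T2) n :
  (forall k, measurable_fun setT (F k)) ->
  measurable_fun setT (fun q : T * R => F (dyi n q.2) q.1).
Proof.
move=> mF _ B mB; rewrite setTI.
rewrite (_ : _ @^-1` _ = \bigcup_k ((F k @^-1` B) `*` [set s | dyi n s = k])).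
  apply: bigcupT_measurable => k; apply: measurableX; last exact: measurable_dyi.
  by rewrite -[X in measurable X]setTI; exact: mF.
apply/seteqP; split => [[p s] /= h|[p s] [k _ [/= h sk]]].
  by exists (dyi n s).
by rewrite /= sk.
Qed.

(* For a right-continuous path this is [p s - p 0]; reading the path at dyadic
   times only makes it jointly measurable in the path and in time. *)
Definition rec (p : R -> rV) (s : R) : rV :=
  \row_i fine (limn_esup (fun n => ((p (dy n (dyi n s).+1) - p 0) ord0 i)%:E)).

Lemma measurable_rec : measurable_fun setT (fun q : pathT * R => rec q.1 q.2).
Proof.
apply/measurable_fun_coordP => i.
rewrite (_ : (fun q : pathT * R => _) = fine \o (fun q : pathT * R =>
   limn_esup (fun n => ((q.1 (dy n (dyi n q.2).+1) - q.1 0) ord0 i)%:E))); last first.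
  by apply/funext => q; rewrite /rec mxE.
apply: measurableT_comp; first exact: fine_measurable.
apply: (@measurable_fun_limn_esup _ _ _ setT (fun n (q : pathT * R) =>
   ((q.1 (dy n (dyi n q.2).+1) - q.1 0) ord0 i)%:E)) => n.
apply/measurable_EFinP; apply: (measurableT_comp (measurable_coord i)).
exact: (@measurable_select _ pathT _ _ (fun k p => p (dy n k.+1) - p 0) n (fun k => measurable_dval n k.+1)).
Qed.

Lemma dy_dyi_gt n s : 0 <= s -> s < dy n (dyi n s).+1.
Proof.
move=> s0; rewrite /dy ltr_pdivlMr ?exprn_gt0//.
have s2 : 0 <= s * 2 ^+ n by rewrite mulr_ge0// exprn_ge0.
by have /andP[] := truncn_itv s2.
Qed.

Lemma dy_dyi_le n s : 0 <= s -> dy n (dyi n s).+1 <= s + 2 ^- n.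
Proof.
move=> s0; rewrite /dy -natr1 mulrDl mul1r lerD2r ler_pdivrMr ?exprn_gt0//.
have s2 : 0 <= s * 2 ^+ n by rewrite mulr_ge0// exprn_ge0.
by have /andP[] := truncn_itv s2.
Qed.

(** The successor of the integer part keeps the grid points strictly to the right of s, so
    right-continuity of the path applies. *)
Lemma cvg_dy_dyi s : 0 <= s -> dy n (dyi n s).+1 @[n --> \oo] --> s^'+.
Proof.
move=> s0.
have c : dy n (dyi n s).+1 @[n --> \oo] --> s.
  have c2 : s + 2 ^- n @[n --> \oo] --> s.
    rewrite -[X in _ --> X]addr0; apply: cvgD; first exact: cvg_cst.
    have := @cvg_geometric R 1 2^-1; rewrite ger0_norm ?invr_ge0// invf_lt1// ltr1n => /(_ isT).
    rewrite (_ : geometric 1 2^-1 = (fun n => 2 ^- n))//.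
    by apply/funext => n; rewrite /geometric/= mul1r exprVn.
  apply: (squeeze_cvgr _ (cvg_cst s) c2).
  by near=> n; rewrite (ltW (dy_dyi_gt n s0)) dy_dyi_le.
move=> A hA.
have h : \forall n \near \oo, s < dy n (dyi n s).+1 -> A (dy n (dyi n s).+1) := c _ hA.
have : \forall n \near \oo, A (dy n (dyi n s).+1).
  by apply: filterS h => n /= hn; apply: hn; exact: dy_dyi_gt.
by [].
Unshelve. all: by end_near. Qed.

Definition rcont (p : R -> rV) : Prop := forall t, 0 <= t -> p s @[s --> t^'+] --> p t.

Lemma recE p s : rcont p -> p 0 = 0 -> 0 <= s -> rec p s = p s.
Proof.
move=> rp p0 s0; apply/rowP => i; rewrite mxE.
have c : p (dy n (dyi n s).+1) @[n --> \oo] --> p s.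
  exact: (cvg_comp _ _ (cvg_dy_dyi s0) (rp s s0)).
have ci : (p (dy n (dyi n s).+1) ord0 i)%:E @[n --> \oo] --> (p s ord0 i)%:E.
  apply: cvg_EFin; first by near=> n.
  have := cvg_comp _ _ c (@coord_continuous R 1 d ord0 i (p s)).
  by [].
rewrite (_ : (fun n => _) = (fun n => (p (dy n (dyi n s).+1) ord0 i)%:E)); last first.
  by apply/funext => n; rewrite p0 subr0.
rewrite is_cvg_limn_esupE; first by rewrite (cvg_lim _ ci).
by apply/cvg_ex; exists (p s ord0 i)%:E.
Unshelve. all: by end_near. Qed.

End path_space.

Definition path_cat (R : realType) (d : nat) (s : R) (p q : R -> 'rV[R]_d) (r : R) : 'rV[R]_d :=
  if r < s then p r else p s + q (r - s).

Section cat.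
Context (R : realType) (d : nat).
Implicit Types (p q : R -> 'rV[R]_d).

Lemma path_cat_left s p q r : q 0 = 0 -> r <= s -> path_cat s p q r = p r.
Proof.
move=> q0; rewrite /path_cat le_eqVlt => /orP[/eqP ->|->//].
by rewrite ltxx subrr q0 addr0.
Qed.

Lemma path_cat_right s p q r : s <= r -> path_cat s p q r = p s + q (r - s).
Proof. by move=> sr; rewrite /path_cat ltNge sr. Qed.

Lemma rcont_cat s p q : 0 <= s -> rcont p -> rcont q -> q 0 = 0 -> rcont (path_cat s p q).
Proof.
move=> s0 rp rq q0 t t0; have [ts|st] := ltP t s.
  rewrite path_cat_left ?(ltW ts)//.
  apply: cvg_trans (rp t t0); apply: near_eq_cvg; near=> r.
  by rewrite path_cat_left//; near: r; exact: nbhs_right_le.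
rewrite path_cat_right//.
have ts0 : 0 <= t - s by rewrite subr_ge0.
have c : p s + q (r - s) @[r --> t^'+] --> p s + q (t - s).
  apply: cvgD; first exact: cvg_cst.
  have cs : r - s @[r --> t^'+] --> (t - s)^'+.
    move=> A hA.
    have h1 : r - s @[r --> t^'+] --> t - s.
      by apply: cvgB; [exact: cvg_within|exact: cvg_cst].
    have h2 : \forall r \near t^'+, t - s < r - s -> A (r - s) := h1 _ hA.
    have : \forall r \near t^'+, A (r - s).
      near=> r; have : t - s < r - s -> A (r - s) by near: r.
      by apply; rewrite ltrD2r; near: r; exact: nbhs_right_gt.
    by [].
  exact: (cvg_comp _ _ cs (rq _ ts0)).
apply: cvg_trans c; apply: near_eq_cvg; near=> r.
by rewrite path_cat_right// (le_trans st)//; near: r; exact: nbhs_right_ge.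
Unshelve. all: by end_near. Qed.

Lemma dinc_cat_left m N p q i : q 0 = 0 -> (i < N)%N ->
  dinc m i (path_cat (dy R m N) p q) = dinc m i p.
Proof.
by move=> q0 iN; rewrite /dinc !path_cat_left// ler_dy// ltnW.
Qed.

Lemma dinc_cat_right m N p q i :
  dinc m (N + i) (path_cat (dy R m N) p q) = dinc m i q.
Proof.
rewrite /dinc -addnS !path_cat_right ?ler_dy ?leq_addr// !dyD.
by rewrite [dy _ _ N + _]addrC addrK [dy _ _ N + _]addrC addrK opprD addrACA subrr add0r.
Qed.

Lemma measurable_path_cat s p q : measurable_fun setT p -> measurable_fun setT q ->
  measurable_fun setT (path_cat s p q).
Proof.
move=> mp mq; apply: measurable_fun_ifT => //; first exact: measurable_fun_ltr.
apply: measurable_fun_addrV => //; apply: (measurableT_comp mq).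
exact: measurable_funB.
Qed.

End cat.

Section path_integral.
Local Open Scope ereal_scope.
Context (R : realType) (d : nat).
Implicit Types (p q : R -> 'rV[R]_d) (U : 'rV[R]_d -> R).
Local Notation leb := (@lebesgue_measure R).

Lemma path_integral_ext U t p q : (forall s, (0 <= s)%R -> p s = q s) ->
  path_integral U t p = path_integral U t q.
Proof.
move=> pq; apply: eq_integral => s; rewrite inE/= in_itv/= => /andP[s0 _].
by rewrite pq.
Qed.

Lemma path_integral_ge0 U t p : (forall x, (0 <= U x)%R) -> 0 <= path_integral U t p.
Proof. by move=> U0; apply: integral_ge0 => s _; rewrite lee_fin. Qed.

Lemma path_integral_itv U t p : path_integral U t p =
  \int[leb]_s (U (p s) * \1_(`[0%R, t]%classic) s)%:E.
Proof.
by rewrite /path_integral integral_mkcond; apply: eq_integral => s _; rewrite patchE indicE;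
  case: ifP => _; rewrite ?mulr1 ?mulr0.
Qed.

Lemma measurable_path_integral U t : measurable_fun setT U -> (forall x, (0 <= U x)%R) ->
  measurable_fun setT (fun z : 'rV[R]_d * pathT R d => path_integral U t (fun s => z.1 + rec z.2 s)%R).
Proof.
move=> mU U0.
rewrite (_ : (fun z => _) = (fun z : 'rV[R]_d * pathT R d =>
  \int[leb]_s (U (z.1 + rec z.2 s) * \1_(`[0%R, t]%classic) s)%:E)); last first.
  by apply/funext => z; rewrite path_integral_itv.
apply: (@measurable_fun_intr _ _ _ _ _ leb (fun (z : 'rV[R]_d * pathT R d) s =>
   (U (z.1 + rec z.2 s) * \1_(`[0%R, t]%classic) s)%:E)).
  apply/measurable_EFinP; apply: measurable_funM.
    apply: (measurableT_comp mU); apply: measurable_fun_addrV.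
      exact: (measurableT_comp measurable_fst measurable_fst).
    have mp : measurable_fun setT (fun q : ('rV[R]_d * pathT R d) * R => (q.1.2, q.2)).
      apply: measurable_fun_pair; last exact: measurable_snd.
      exact: (measurableT_comp measurable_snd measurable_fst).
    exact: (measurableT_comp (@measurable_rec R d) mp).
  apply: (measurableT_comp (f := \1_(`[0%R, t]%classic) : R -> R)); last exact: measurable_snd.
  exact: measurable_indic.
by move=> z s; rewrite lee_fin mulr_ge0.
Qed.

Lemma path_integral_cat U s t x p q : measurable_fun setT U -> (forall x, (0 <= U x)%R) ->
  measurable_fun setT p -> measurable_fun setT q -> q 0%R = 0%R -> (0 <= s)%R -> (0 <= t)%R ->
  path_integral U (s + t)%R (fun r => x + path_cat s p q r)%R =
  path_integral U s (fun r => x + p r)%R + path_integral U t (fun r => x + p s + q r)%R.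
Proof.
move=> mU U0 mp mq q0 s0 t0.
have mg (f : R -> 'rV[R]_d) y : measurable_fun setT f -> measurable_fun setT (fun r => (U (y + f r))%:E).
  move=> mf; apply/measurable_EFinP; apply: (measurableT_comp mU).
  exact: measurable_fun_addrV.
have mc := mg _ x (measurable_path_cat s mp mq).
have E : `[0%R, (s + t)%R]%classic = `[0%R, s]%classic `|` `]s, (s + t)%R]%classic.
  apply/seteqP; split => r /=; rewrite !in_itv/=.
    move=> /andP[r0 rst]; have [rs|sr] := leP r s; [left|right]; rewrite ?r0//=.
  case=> /andP[h1 h2]; first by rewrite h1 (le_trans h2)// lerDl.
  by rewrite h2 (le_trans s0 (ltW h1)).
rewrite /path_integral E ge0_integral_setU//; last 3 first.
- exact: measurable_funTS.
- by move=> r _; rewrite lee_fin.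
- rewrite disj_set2E; apply/eqP/seteqP; split => // r [/=].
  by rewrite !in_itv/= => /andP[_ rs] /andP[sr _]; move: (lt_le_trans sr rs); rewrite ltxx.
congr (_ + _).
  apply: eq_integral => r; rewrite inE/= in_itv/= => /andP[_ rs].
  by rewrite path_cat_left.
transitivity (\int[leb]_(r in `]s, (s + t)%R]) (U (x + p s + q (r - s)))%:E).
  apply: eq_integral => r; rewrite inE/= in_itv/= => /andP[sr _].
  by rewrite path_cat_right ?(ltW sr)// addrA.
pose f r := (U (x + p s + q r) * \1_(`[0%R, t]%classic) r)%:E.
rewrite (@integral_itv_obnd_cbnd R s); last first.
  apply: measurable_funTS; apply/measurable_EFinP; apply: (measurableT_comp mU).
  apply: measurable_fun_addrV => //; apply: (measurableT_comp mq); exact: measurable_funB.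
transitivity (\int[leb]_r f (r - s)%R).
  rewrite integral_mkcond; apply: eq_integral => r _; rewrite patchE /f indicE.
  have -> : (r \in `[s, (s + t)%R]%classic) = ((r - s)%R \in `[0%R, t]%classic).
    by apply/idP/idP; rewrite !inE/= !in_itv/= subr_ge0 lerBlDl.
  by case: ifP => _; rewrite ?mulr1 ?mulr0.
rewrite (ge0_integralDr (- s)); last 2 first.
- apply/measurable_EFinP; apply: measurable_funM; last exact: measurable_indic.
  by apply/measurable_EFinP; exact: mg.
- by move=> r; rewrite lee_fin mulr_ge0.
by rewrite -/(path_integral U t (fun r => x + p s + q r)%R) path_integral_itv.
Qed.

End path_integral.

(** * The Markov property at dyadic times *)

(** [er_map expR] differs from [expeR] at -oo only, where the maximum with 0 corrects it. *)
Lemma measurable_expeR (R : realType) : measurable_fun setT (@expeR R).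
Proof.
rewrite (_ : @expeR R = fun x => maxe 0%E (er_map expR x)).
  apply: measurable_maxe; first exact: measurable_cst.
  exact: (@measurable_er_map _ R R _ (@measurable_expR R)).
apply/funext => -[r| |]/=.
- by rewrite maxEle lee_fin expR_ge0.
- by rewrite maxEle leey.
- by rewrite maxEge leNye.
Qed.

(** Two nonnegative potentials are kept in separate exponentials, as the difference of their
    integrals could be oo - oo; each factor is multiplicative under concatenation of paths. *)
Definition eWU (R : realType) (d : nat) (W U : 'rV[R]_d -> R) (t : R) (p : R -> 'rV[R]_d) : \bar R :=
  (expeR (path_integral W t p) * expeR (- path_integral U t p))%E.

Section eWU.
Context (R : realType) (d : nat) (W U : 'rV[R]_d -> R).
Hypothesis mW : measurable_fun setT W.
Hypothesis mU : measurable_fun setT U.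
Hypothesis W0 : forall x, 0 <= W x.
Hypothesis U0 : forall x, 0 <= U x.
Implicit Types p q : R -> 'rV[R]_d.
Local Open Scope ereal_scope.

Lemma eWU_ge0 t p : 0 <= eWU W U t p.
Proof. by rewrite mule_ge0// expeR_ge0. Qed.

Lemma eWU_ext t p q : (forall s, (0 <= s)%R -> p s = q s) -> eWU W U t p = eWU W U t q.
Proof. by move=> pq; rewrite /eWU !(path_integral_ext _ _ pq). Qed.

Lemma eWU_cat s t x p q : measurable_fun setT p -> measurable_fun setT q -> q 0%R = 0%R ->
  (0 <= s)%R -> (0 <= t)%R ->
  eWU W U (s + t)%R (fun r => x + path_cat s p q r)%R =
  eWU W U s (fun r => x + p r)%R * eWU W U t (fun r => x + p s + q r)%R.
Proof.
move=> mp mq q0 s0 t0; rewrite /eWU !path_integral_cat// expeRD.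
rewrite oppeD; last by rewrite ge0_adde_def// inE path_integral_ge0.
by rewrite [expeR (- _ - _)]expeRD; exact: muleACA.
Qed.

Lemma measurable_eWU t : measurable_fun setT
  (fun z : 'rV[R]_d * pathT R d => eWU W U t (fun s => z.1 + rec z.2 s)%R).
Proof.
apply: emeasurable_funM.
  exact: (measurableT_comp (@measurable_expeR R) (measurable_path_integral t mW W0)).
apply: (measurableT_comp (@measurable_expeR R)); apply: measurableT_comp => //.
exact: measurable_path_integral.
Qed.

End eWU.

Section process.
Context {R : realType} {dO : measure_display} {Omega : measurableType dO} {d : nat}.
Variables (P : probability Omega R) (Y : R -> Omega -> 'rV[R]_d).
Local Notation rV := 'rV[R]_d.
Local Notation dyR := (@dy R).
Hypothesis LP : levy_process P Y.
Hypothesis Y0 : forall w, Y 0 w = 0.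
Hypothesis Yrc : forall w, rcont (Y ^~ w).

Definition pth (w : Omega) : pathT R d := fun t => Y t w.

Let mY := levy_measurable LP.

Lemma measurable_pth : measurable_fun setT pth.
Proof.
apply: measurable_pathP => m i; rewrite /dinc/pth.
by apply: measurable_fun_subrV; apply: mY; exact: dy_ge0.
Qed.

Lemma rec_pth w s : 0 <= s -> rec (pth w) s = Y s w.
Proof. by move=> s0; exact: (recE (@Yrc w) (Y0 w) s0). Qed.

Lemma measurable_rec_pth w : measurable_fun setT (rec (pth w)).
Proof.
have mp : measurable_fun setT (fun s : R => (pth w, s)) by exact: measurable_fun_pair.
exact: (measurableT_comp (@measurable_rec R d) mp).
Qed.

Definition step_law m (B : set rV) : \bar R := P [set w | B (Y (dyR m 1) w)].

Lemma cyl_prob m n (A : nat -> set rV) : (forall i, measurable (A i)) ->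
  (forall i, (n <= i)%N -> A i = setT) ->
  P [set w | forall i, A i (dinc m i (pth w))] = (\prod_(i < n) step_law m (A i))%E.
Proof.
move=> mA An.
rewrite (_ : [set w | _] = [set w | forall i, (i < n)%N ->
   A i (Y (dyR m i.+1) w - Y (dyR m i) w)]); last first.
  apply/seteqP; split => w /= h i; first by move=> _; exact: h.
  by have [ni|/h//] := leqP n i; rewrite An.
rewrite (levy_independent LP (t := dyR m))//; last 2 first.
- exact: dy_ge0.
- by move=> i _; exact: ler_dy.
apply: eq_bigr => i _.
rewrite (levy_stationary LP)//; last 2 first.
- exact: dy_ge0.
- exact: ler_dy.
by rewrite -addn1 dyD addrAC subrr add0r.
Qed.

Lemma measurable_cyl m (A : nat -> set rV) : (forall i, measurable (A i)) ->
  measurable [set w | forall i, A i (dinc m i (pth w))].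
Proof.
move=> mA; rewrite (_ : [set w | _] = \bigcap_i [set w | A i (dinc m i (pth w))]); last first.
  by apply/seteqP; split => x /= h i => [_|]; apply: h.
apply: bigcapT_measurable => i; rewrite -[X in measurable X]setTI.
by apply: measurable_fun_subrV => //; apply: mY; exact: dy_ge0.
Qed.

Definition catY (s : R) (z : Omega * Omega) : pathT R d := path_cat s (pth z.1) (pth z.2).

Lemma measurable_catY s : 0 <= s -> measurable_fun setT (catY s).
Proof.
move=> s0; apply: measurable_pathP => m i; rewrite /dinc.
have mc r : 0 <= r -> measurable_fun setT (fun z : Omega * Omega => catY s z r).
  move=> r0; rewrite /catY /path_cat; case: ltP => [rs|sr].
    exact: (measurableT_comp (mY r0) measurable_fst).
  have sr0 : 0 <= r - s by rewrite subr_ge0.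
  apply: measurable_fun_addrV; first exact: (measurableT_comp (mY s0) measurable_fst).
  exact: (measurableT_comp (mY sr0) measurable_snd).
by apply: measurable_fun_subrV; apply: mc; exact: dy_ge0.
Qed.

(** The Markov property as an identity of laws: a path is distributed like the concatenation of two
    independent copies at a dyadic time. Only cylinders have to be compared, and these factor by
    independence and stationarity of the increments. *)
Lemma path_law m0 j (A : set (pathT R d)) : measurable A ->
  P (pth @^-1` A) = (P \x P)%E (catY (dyR m0 j) @^-1` A).
Proof.
have mp := measurable_pth; have mc := measurable_catY (dy_ge0 R m0 j).
have [m1 m1E] : exists m1 : {measure set (pathT R d) -> \bar R},
    m1 = pushforward P pth :> (set (pathT R d) -> \bar R).
  by unshelve eexists (pushforward P pth); [exact: mp|].
have [m2 m2E] : exists m2 : {measure set (pathT R d) -> \bar R},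
    m2 = pushforward (P \x P)%E (catY (dyR m0 j)) :> (set (pathT R d) -> \bar R).
  by unshelve eexists (pushforward (P \x P)%E (catY (dyR m0 j))); [exact: mc|].
suff H : forall A, measurable A -> m1 A = m2 A.
  by move=> mA; have := H A mA; rewrite m1E m2E.
apply: (path_measure_unique (m0 := m0)).
  by rewrite m1E /pushforward preimage_setT probability_setT ltry.
move=> m C mm [n [B [mB Bn ->]]]; rewrite m1E m2E /pushforward.
(* At every level m >= m0 the splitting time is itself a grid point, of index [N], so no increment
   straddles it. *)
pose N := (j * 2 ^ (m - m0))%N.
have sN : dyR m0 j = dyR m N.
  have E2 : 2 ^+ m = 2 ^+ (m - m0) * 2 ^+ m0 :> R by rewrite -exprD subnK.
  by rewrite /dy E2 /N natrM natrX invfM mulrA mulfK// expf_neq0.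
have -> : pth @^-1` [set p | forall i, B i (dinc m i p)] = [set w | forall i, B i (dinc m i (pth w))].
  by [].
rewrite (@cyl_prob m (N + n) B)//; last by move=> i Ni; apply: Bn; apply: leq_trans Ni; exact: leq_addl.
pose B1 i := if (i < N)%N then B i else setT.
have mB1 i : measurable (B1 i) by rewrite /B1; case: ifP.
have -> : catY (dyR m0 j) @^-1` [set p | forall i, B i (dinc m i p)] =
   [set w | forall i, B1 i (dinc m i (pth w))] `*` [set w | forall i, B (N + i)%N (dinc m i (pth w))].
  rewrite sN; apply/seteqP; split => [[w w'] h|[w w'] [h1 h2] i].
    split => i /=; have := h i; have := h (N + i)%N; rewrite /catY/=.
      by rewrite /B1; case: ifP => // iN _; rewrite dinc_cat_left// /pth Y0.
    by rewrite dinc_cat_right.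
  have [iN|Ni] := ltnP i N.
    by have := h1 i; rewrite /B1 iN /catY dinc_cat_left// /pth Y0.
  by have := h2 (i - N)%N; rewrite subnKC// /catY/= => ?; rewrite -(subnKC Ni) dinc_cat_right subnKC.
rewrite product_measure1E; last 2 first.
- exact: measurable_cyl.
- exact: (@measurable_cyl m (fun i => B (N + i)%N) (fun i => mB _)).
have B1N i : (N <= i)%N -> B1 i = setT by rewrite /B1 ltnNge => ->.
have B2n i : (n <= i)%N -> B (N + i)%N = setT.
  by move=> ni; apply: Bn; apply: leq_trans ni _; exact: leq_addl.
have c1 := cyl_prob m mB1 B1N; have c2 := cyl_prob m (fun i => mB (N + i)%N) B2n.
transitivity ((\prod_(i < N) step_law m (B1 i)) * (\prod_(i < n) step_law m (B (N + i)%N)))%E.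
  rewrite big_split_ord/=; congr (_ * _)%E.
  by apply: eq_bigr => i _; rewrite /B1 ltn_ord.
by congr (_ * _)%E; [exact: esym c1|exact: esym c2].
Qed.

Lemma markov m0 j (K : pathT R d -> \bar R) : measurable_fun setT K ->
  (forall p, 0 <= K p)%E ->
  (\int[P]_w K (pth w) = \int[P]_w \int[P]_w' K (catY (dyR m0 j) (w, w')))%E.
Proof.
move=> mK K0; have mc := measurable_catY (dy_ge0 R m0 j).
rewrite (@same_law_integral _ _ _ _ _ _ _ P (P \x P)%E pth (catY (dyR m0 j)) K)//.
- rewrite (@fubini_tonelli1 _ _ _ _ _ P P (fun z => K (catY (dyR m0 j) z)))//.
  exact: (measurableT_comp mK mc).
- exact: measurable_pth.
- by move=> A mA; exact: path_law.
Qed.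

(** A Markov property at arbitrary real times, restricted to two increments. Occupation integrals
    run over all times s, for which [markov] at dyadic times would not do. *)
Lemma two_times (r h : R) (F : rV * rV -> \bar R) : 0 <= r -> r <= h ->
  measurable_fun setT F -> (forall z, 0 <= F z)%E ->
  (\int[P]_w F (Y r w, Y h w - Y r w)%R = \int[P]_w \int[P]_w' F (Y r w, Y (h - r)%R w'))%E.
Proof.
move=> r0 rh mF F0; have hr0 : 0 <= h - r by rewrite subr_ge0.
have mr := mY r0; have mh := mY (le_trans r0 rh); have mhr := mY hr0.
have mD : measurable_fun setT (fun w => Y h w - Y r w) by exact: measurable_fun_subrV.
have mp : measurable_fun setT (fun w => (Y r w, Y h w - Y r w)) by exact: measurable_fun_pair.
have mq : measurable_fun setT (fun z : Omega * Omega => (Y r z.1, Y (h - r) z.2)).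
  apply: measurable_fun_pair; first exact: (measurableT_comp mr measurable_fst).
  exact: (measurableT_comp mhr measurable_snd).
transitivity (\int[(P \x P)%E]_z F (Y r z.1, Y (h - r)%R z.2))%E; last first.
  rewrite (@fubini_tonelli1 _ _ _ _ _ P P (fun z => F (Y r z.1, Y (h - r) z.2)))//.
  exact: (measurableT_comp mF mq).
apply: (@same_law_integral _ _ _ _ _ _ _ P (P \x P)%E (fun w => (Y r w, Y h w - Y r w))
   (fun z => (Y r z.1, Y (h - r) z.2)) F) => //.
have [m2 m2E] : exists m2 : {measure set (rV * rV)%type -> \bar R},
    m2 = pushforward P (fun w => (Y r w, Y h w - Y r w)) :> (set (rV * rV)%type -> \bar R).
  by unshelve eexists (pushforward P (fun w => (Y r w, Y h w - Y r w))); [exact: mp|].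
have [q1 q1E] : exists q : probability rV R, q = pushforward P (Y r) :> (set rV -> \bar R).
  by exists (distribution P (mfun_Sub (mem_set mr))).
have [q2 q2E] : exists q : probability rV R, q = pushforward P (Y (h - r)) :> (set rV -> \bar R).
  by exists (distribution P (mfun_Sub (mem_set mhr))).
have [m3 m3E] : exists m3 : {measure set (rV * rV)%type -> \bar R},
    m3 = pushforward (P \x P)%E (fun z => (Y r z.1, Y (h - r) z.2)) :> (set (rV * rV)%type -> \bar R).
  by unshelve eexists (pushforward (P \x P)%E (fun z => (Y r z.1, Y (h - r) z.2))); [exact: mq|].
move=> A mA.
suff [H2 H3] : m2 A = (q1 \x q2)%E A /\ m3 A = (q1 \x q2)%E A.
  transitivity (m2 A); first by rewrite m2E.
  by rewrite H2 -H3 m3E.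
split; apply/esym/product_measure_unique => // B C mB mC.
all: have [e1 e2] : q1 B = P (Y r @^-1` B) /\ q2 C = P (Y (h - r) @^-1` C) by rewrite q1E q2E.
all: transitivity (P (Y r @^-1` B) * P (Y (h - r) @^-1` C))%E;
  last by (congr (_ * _)%E; [exact: esym e1|exact: esym e2]).
- rewrite m2E /pushforward.
  pose t (i : nat) : R := if i == 0%N then 0 else if i == 1%N then r else h.
  pose BC (i : nat) : set rV := if i == 0%N then B else C.
  have := levy_independent LP (n := 2) (t := t) (A := BC) (lexx 0).
  rewrite !big_ord_recl big_ord0 mule1 /bump/= => E.
  transitivity (P [set w | forall i : nat, (i < 2)%N -> BC i (Y (t i.+1) w - Y (t i) w)]).
    congr (P _); apply/seteqP; split => w /=.
      move=> [h1 h2] [|[|i]] //= _; first by rewrite /BC/= /t/= Y0 subr0.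
    by move=> hh; have := hh 0%N isT; have := hh 1%N isT; rewrite /BC/= /t/= Y0 subr0.
  rewrite E; last 2 first.
  + by move=> [|[|i]] //= _.
  + by move=> i; rewrite /BC; case: ifP.
  rewrite /BC/= /t/=; congr (_ * _)%E; first by congr (P _); apply/seteqP; split => w /=; rewrite Y0 subr0.
  by rewrite (levy_stationary LP).
- rewrite m3E /pushforward.
  rewrite (_ : _ @^-1` (B `*` C) = (Y r @^-1` B) `*` (Y (h - r) @^-1` C))//.
  rewrite product_measure1E//.
  + by rewrite -[X in measurable X]setTI; exact: mr.
  + by rewrite -[X in measurable X]setTI; exact: mhr.
Qed.

End process.

Section markov_operator.
Context {R : realType} {dO : measure_display} {Omega : measurableType dO} {d : nat}.
Variables (P : probability Omega R) (Y : R -> Omega -> 'rV[R]_d).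
Local Notation rV := 'rV[R]_d.
Local Notation dyR := (@dy R).
Hypothesis LP : levy_process P Y.
Hypothesis Y0 : forall w, Y 0 w = 0.
Hypothesis Yrc : forall w, rcont (Y ^~ w).
Local Open Scope ereal_scope.

Let mY := levy_measurable LP.

Lemma measurable_pair_pth : measurable_fun setT (fun z : rV * Omega => (z.1, pth Y z.2)).
Proof.
apply: measurable_fun_pair; first exact: measurable_fst.
exact: (measurableT_comp (measurable_pth LP) measurable_snd).
Qed.

Lemma measurable_path_integral_Y (U : rV -> R) (t : R) : measurable_fun setT U -> (forall x, (0 <= U x)%R) ->
  measurable_fun setT (fun z : rV * Omega => path_integral U t (fun s => z.1 + Y s z.2)%R).
Proof.
move=> mU U0; have m0 := measurableT_comp (measurable_path_integral t mU U0) measurable_pair_pth.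
apply: eq_measurable_fun m0 => z _ /=; apply: path_integral_ext => s s0.
by rewrite (rec_pth Y0 Yrc).
Qed.

Section operator.
Variables (W U : rV -> R) (f : rV -> R).
Hypothesis mW : measurable_fun setT W.
Hypothesis mU : measurable_fun setT U.
Hypothesis mf : measurable_fun setT f.
Hypothesis W0 : forall x, (0 <= W x)%R.
Hypothesis U0 : forall x, (0 <= U x)%R.
Hypothesis f0 : forall x, (0 <= f x)%R.
Local Notation e := (eWU W U).

Lemma measurable_eWU_Y t :
  measurable_fun setT (fun z : rV * Omega => e t (fun s => z.1 + Y s z.2)%R).
Proof.
have m0 := measurableT_comp (measurable_eWU mW mU W0 U0 t) measurable_pair_pth.
apply: eq_measurable_fun m0 => z _ /=; apply: eWU_ext => s s0.
by rewrite (rec_pth Y0 Yrc).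
Qed.

Lemma eWU_at0 p : e 0 p = 1.
Proof.
have E V : path_integral V 0 p = 0.
  by rewrite /path_integral set_itv1 integral_set1.
by rewrite /eWU !E oppe0 expeR0 mule1.
Qed.

Definition Sop (m : nat) (F : rV -> \bar R) (y : rV) : \bar R :=
  \int[P]_w ((f (y + Y (dyR m 1) w))%:E * e (dyR m 1) (fun s => y + Y s w)%R * F (y + Y (dyR m 1) w)%R).

Definition Qop m k y w : \bar R :=
  (\prod_(j < k) f (y + Y (dyR m j.+1) w))%R%:E * e (dyR m k) (fun s => y + Y s w)%R.

Lemma Qop_ge0 m k y w : 0 <= Qop m k y w.
Proof. by rewrite mule_ge0 ?eWU_ge0// lee_fin prodr_ge0. Qed.

Lemma measurable_shiftY t : (0 <= t)%R -> measurable_fun setT (fun z : rV * Omega => (z.1 + Y t z.2)%R).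
Proof.
by move=> t0; apply: measurable_fun_addrV; [exact: measurable_fst|exact: (measurableT_comp (mY t0) measurable_snd)].
Qed.

Lemma measurable_Sop m F : measurable_fun setT F -> (forall x, 0 <= F x) ->
  measurable_fun setT (Sop m F).
Proof.
move=> mF F0; apply: (@measurable_fun_intr _ _ _ _ _ P (fun (y : rV) w =>
  (f (y + Y (dyR m 1) w))%:E * e (dyR m 1) (fun s => y + Y s w)%R * F (y + Y (dyR m 1) w)%R)).
  have ms := measurable_shiftY (dy_ge0 R m 1).
  apply: emeasurable_funM; last exact: (measurableT_comp mF ms).
  apply: emeasurable_funM; last exact: measurable_eWU_Y.
  by apply/measurable_EFinP; exact: (measurableT_comp mf ms).
by move=> y w; apply: mule_ge0 => //; apply: mule_ge0; rewrite ?lee_fin ?eWU_ge0.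
Qed.

Lemma Sop_ge0 m F y : (forall x, 0 <= F x) -> 0 <= Sop m F y.
Proof.
move=> F0; apply: integral_ge0 => w _.
by apply: mule_ge0 => //; apply: mule_ge0; rewrite ?lee_fin ?eWU_ge0.
Qed.

Lemma iter_Sop_ge0 m k F y : (forall x, 0 <= F x) -> 0 <= iter k (Sop m) F y.
Proof. by move=> F0; elim: k y => //= k IH y; exact: Sop_ge0. Qed.

Lemma measurable_iter_Sop m k F : measurable_fun setT F -> (forall x, 0 <= F x) ->
  measurable_fun setT (iter k (Sop m) F).
Proof.
move=> mF F0; elim: k => //= k IH; apply: measurable_Sop => //.
by move=> y; exact: iter_Sop_ge0.
Qed.

Lemma measurable_prodf k d' (T : measurableType d') (h : nat -> T -> rV) :
  (forall j, measurable_fun setT (h j)) ->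
  measurable_fun setT (fun z => \prod_(j < k) f (h j z))%R.
Proof.
move=> mh; elim: k => [|n IHn].
  by rewrite (_ : (fun p => _) = cst 1%R)//; apply/funext => p; rewrite big_ord0.
rewrite (_ : (fun p : T => _) = (fun p => (\prod_(j < n) f (h j p)) * f (h n p)))%R.
  by apply: measurable_funM => //; exact: (measurableT_comp mf (mh _)).
by apply/funext => p; rewrite big_ord_recr.
Qed.

Lemma measurable_Qop m k y : measurable_fun setT (Qop m k y).
Proof.
have mp : measurable_fun setT (fun w : Omega => (y, w)) by exact: measurable_fun_pair.
apply: emeasurable_funM; last exact: (measurableT_comp (measurable_eWU_Y (dyR m k)) mp).
apply/measurable_EFinP; apply: (@measurable_prodf k _ _ (fun j w => y + Y (dyR m j.+1) w)%R) => j.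
by apply: measurable_fun_addrV => //; apply: mY; exact: dy_ge0.
Qed.

(** [markov] at the end of the first step, applied to the functional [K] of the whole path: the
    product of values of [f] and the exponential both factor along the concatenation. *)
Lemma iter_Sop m k F y : measurable_fun setT F -> (forall x, 0 <= F x) ->
  iter k (Sop m) F y = \int[P]_w (Qop m k y w * F (y + Y (dyR m k) w)%R).
Proof.
move=> mF F0; elim: k y => [|k IH] y.
  rewrite (_ : dyR m 0 = 0)%R; last by rewrite /dy mul0r.
  rewrite (eq_integral (cst (F y))); last first.
    move=> w _; rewrite /Qop big_ord0 mul1e (_ : dyR m 0 = 0)%R; last by rewrite /dy mul0r.
    by rewrite eWU_at0 mul1e Y0 addr0.
  by rewrite integral_cst//= probability_setT mule1.
rewrite iterS /Sop.
pose K (p : pathT R d) : \bar R := (\prod_(j < k.+1) f (y + rec p (dyR m j.+1)))%R%:E *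
  e (dyR m k.+1) (fun s => y + rec p s)%R * F (y + rec p (dyR m k.+1))%R.
have mrec t : measurable_fun setT (fun p : pathT R d => y + rec p t)%R.
  apply: measurable_fun_addrV => //.
  have mp : measurable_fun setT (fun p : pathT R d => (p, t)) by exact: measurable_fun_pair.
  exact: (measurableT_comp (@measurable_rec R d) mp).
have mK : measurable_fun setT K.
  apply: emeasurable_funM; last exact: (measurableT_comp mF (mrec _)).
  apply: emeasurable_funM.
    apply/measurable_EFinP.
    exact: (@measurable_prodf k.+1 _ _ (fun j (p : pathT R d) => y + rec p (dyR m j.+1))%R).
  have mp : measurable_fun setT (fun p : pathT R d => (y, p)) by exact: measurable_fun_pair.
  exact: (measurableT_comp (measurable_eWU mW mU W0 U0 (dyR m k.+1)) mp).
have K0 p : 0 <= K p.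
  by apply: mule_ge0 => //; apply: mule_ge0; rewrite ?eWU_ge0// lee_fin prodr_ge0.
have := markov LP Y0 m 1 mK K0.
have -> : \int[P]_w K (pth Y w) = \int[P]_w (Qop m k.+1 y w * F (y + Y (dyR m k.+1) w)%R).
  apply: eq_integral => w _; rewrite /K /Qop; congr (_ * _ * _).
  - by congr EFin; apply: eq_bigr => j _; rewrite (rec_pth Y0 Yrc) ?dy_ge0.
  - by apply: eWU_ext => s s0; rewrite (rec_pth Y0 Yrc).
  - by rewrite (rec_pth Y0 Yrc) ?dy_ge0.
move=> ->; apply: eq_integral => w _.
rewrite IH -ge0_integralZl//; last 3 first.
- apply: emeasurable_funM; last by apply: (measurableT_comp mF); apply: measurable_fun_addrV => //; apply: mY; exact: dy_ge0.
  exact: measurable_Qop.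
- by move=> w' _; apply: mule_ge0 => //; exact: Qop_ge0.
- by rewrite mule_ge0 ?lee_fin ?eWU_ge0.
apply: eq_integral => w' _.
have rc s : (0 <= s)%R -> rec (catY Y (dyR m 1) (w, w')) s =
    path_cat (dyR m 1) (rec (pth Y w)) (rec (pth Y w')) s.
  move=> s0; rewrite /catY recE//=; last first.
  - by rewrite path_cat_left ?dy_ge0// /pth Y0.
  - by apply: rcont_cat; [exact: dy_ge0|exact: Yrc|exact: Yrc|exact: Y0].
  rewrite /path_cat; case: ltP => s1; first by rewrite (rec_pth Y0 Yrc).
  by rewrite !(rec_pth Y0 Yrc) ?dy_ge0 ?subr_ge0.
have rq0 v : rec (pth Y v) 0%R = 0%R by rewrite (rec_pth Y0 Yrc).
have mr v := measurable_rec_pth Y v.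
have cat1 j : rec (catY Y (dyR m 1) (w, w')) (dyR m j.+1) = (Y (dyR m 1) w + Y (dyR m j) w')%R.
  rewrite rc ?dy_ge0// path_cat_right; last by apply: ler_dy.
  have -> : (dyR m j.+1 - dyR m 1)%R = dyR m j by rewrite -[j.+1]add1n dyD addrAC subrr add0r.
  by rewrite !(rec_pth Y0 Yrc) ?dy_ge0.
have fac : K (catY Y (dyR m 1) (w, w')) =
  ((f (y + Y (dyR m 1) w))%:E * (\prod_(j < k) f (y + Y (dyR m 1) w + Y (dyR m j.+1) w'))%R%:E) *
  (e (dyR m 1) (fun s => y + Y s w)%R * e (dyR m k) (fun s => y + Y (dyR m 1) w + Y s w')%R) *
  F (y + Y (dyR m 1) w + Y (dyR m k) w')%R.
  rewrite /K; congr (_ * _ * _).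
  - rewrite big_ord_recl cat1 -EFinM (_ : dyR m 0 = 0)%R; last by rewrite /dy mul0r.
    rewrite Y0 addr0; congr (_ * _)%:E; apply: eq_bigr => j _.
    by rewrite cat1 addrA.
  - rewrite -[k.+1]add1n dyD (eWU_ext _ _ _ (q := (fun s => y + path_cat (dyR m 1) (rec (pth Y w)) (rec (pth Y w')) s)%R)); last first.
      by move=> s s0; rewrite rc.
    rewrite eWU_cat ?dy_ge0//; congr (_ * _); apply: eWU_ext => s s0.
      by rewrite (rec_pth Y0 Yrc).
    by rewrite !(rec_pth Y0 Yrc) ?dy_ge0.
  - by rewrite cat1 addrA.
by rewrite fac /Qop [X in _ = X * _]muleACA -[RHS]muleA.
Qed.

End operator.
End markov_operator.

(** * Right-continuous modification *)

Lemma measure_eq_off_null d (T : measurableType d) (R : realType) (mu : {measure set T -> \bar R})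
    (N A B : set T) : measurable N -> mu N = 0%E -> measurable A -> measurable B ->
  A `&` ~` N = B `&` ~` N -> mu A = mu B.
Proof.
move=> mN N0 mA mB AB.
have E C : measurable C -> mu C = mu (C `&` ~` N).
  move=> mC; rewrite (measureDI mu mC mN) -setDE.
  have h : (mu (C `&` N) <= mu N)%E by apply: le_measure; rewrite ?inE//; exact: measurableI.
  rewrite N0 in h; have z : mu (C `&` N) = 0%E by apply/eqP; rewrite eq_le h/=.
  by transitivity (mu (C `\` N) + 0)%E; [congr (_ + _)%E; exact: z|exact: adde0].
by rewrite E// AB -E.
Qed.

Section modification.
Context {R : realType} {dO : measure_display} {Omega : measurableType dO} {d : nat}.
Variables (P : probability Omega R) (X : R -> Omega -> 'rV[R]_d) (nu : 'rV[R]_d -> R).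
Local Notation rV := 'rV[R]_d.

(** The paths are set to 0 on the null set where they fail to start at 0 or to be cadlag. Since
    [levyE] is unchanged for every functional [F], the eigenfunction equation, the Kato condition
    and the Green operator carry over. *)
Lemma regular_modification : levy_process P X -> assumption_A1 P X nu ->
  exists Y : R -> Omega -> rV, [/\ levy_process P Y, forall w, Y 0 w = 0,
    forall w, rcont (Y ^~ w), assumption_A1 P Y nu &
    forall x F, levyE P X x F = levyE P Y x F].
Proof.
move=> LP A1; have mX := levy_measurable LP.
have [N1 [mN1 N10 HN1]] := levy_start LP.
have [N2 [mN2 N20 HN2]] := levy_cadlag LP.
pose N := N1 `|` N2.
have mN : measurable N by exact: measurableU.
have N0 : P N = 0%E.
  apply/eqP; rewrite eq_le measure_ge0 andbT.
  have h := measureU2 P mN1 mN2; apply: (le_trans h).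
  rewrite le_eqVlt; apply/orP; left; apply/eqP; transitivity (0 + 0 : \bar R)%E; last exact: adde0.
  by congr (_ + _)%E; [exact: N10|exact: N20].
have X0 w : ~ N w -> X 0 w = 0.
  by move=> nN; apply: contrapT => h; apply: nN; left; exact: HN1.
have Xc w : ~ N w -> cadlag (X ^~ w).
  by move=> nN; apply: contrapT => h; apply: nN; right; exact: HN2.
pose Y (t : R) w : rV := if w \in N then 0 else X t w.
have YX w t : ~ N w -> Y t w = X t w by rewrite /Y => nN; rewrite memNset.
have Y0 w : Y 0 w = 0.
  by rewrite /Y; case: ifPn => // h; apply: X0; rewrite notin_setE in h.
have Yc w : cadlag (Y ^~ w).
  have [h|h] := pselect (N w).
    have -> : Y ^~ w = cst 0 by apply/funext => t; rewrite /Y mem_set.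
    by split=> t _; [exact: cvg_cst|exact: is_cvg_cst].
  by have -> : Y ^~ w = X ^~ w by [apply/funext => t; exact: YX]; exact: Xc.
have mY t : 0 <= t -> measurable_fun setT (Y t).
  move=> t0; apply: measurable_fun_ifT => //; last exact: mX.
  apply: (measurable_fun_bool true) => //; rewrite setTI.
  by rewrite (_ : _ @^-1` _ = N)//; apply/seteqP; split => w /= => [/set_mem|/mem_set].
have mset (Z : Omega -> rV) A : measurable_fun setT Z -> measurable A -> measurable [set w | A (Z w)].
  by move=> mZ mA; rewrite -[X in measurable X]setTI; exact: mZ.
have Peq (A B : set Omega) : measurable A -> measurable B ->
    (forall w, ~ N w -> A w <-> B w) -> P A = P B.
  move=> mA mB AB; apply: (measure_eq_off_null mN N0 mA mB).
  by apply/seteqP; split => w [/= h nN]; split => //; apply/AB.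
have PY t A : 0 <= t -> measurable A -> P [set w | A (Y t w)] = P [set w | A (X t w)].
  move=> t0 mA; apply: Peq; [exact: mset (mY _ t0) mA|exact: mset (mX _ t0) mA|].
  by move=> w nN /=; rewrite YX.
exists Y; split => //.
- split => //.
  + by apply: aeW => w; exact: Y0.
  + by apply: aeW => w; exact: Yc.
  + move=> s t A s0 st mA; have t0 := le_trans s0 st.
    have ts0 : 0 <= t - s by rewrite subr_ge0.
    rewrite PY// -(levy_stationary LP)//; apply: Peq.
    * by apply: mset => //; apply: measurable_fun_subrV; exact: mY.
    * by apply: mset => //; apply: measurable_fun_subrV; exact: mX.
    * by move=> w nN /=; rewrite !YX.
  + move=> n t A t0 tS mA.
    have tn i : (i <= n)%N -> 0 <= t i.
      by elim: i => // i IH iN; apply: (le_trans (IH (ltnW iN))); exact: tS.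
    have mset' (Z : R -> Omega -> rV) i : (forall t, 0 <= t -> measurable_fun setT (Z t)) ->
        (i < n)%N -> measurable [set w | A i (Z (t i.+1) w - Z (t i) w)].
      by move=> mZ iN; apply: mset => //; apply: measurable_fun_subrV; apply: mZ; apply: tn; rewrite // ltnW.
    have mset2 (Z : R -> Omega -> rV) : (forall t, 0 <= t -> measurable_fun setT (Z t)) ->
        measurable [set w | forall i, (i < n)%N -> A i (Z (t i.+1) w - Z (t i) w)].
      move=> mZ; rewrite (_ : [set w | _] = \bigcap_i [set w | (i < n)%N -> A i (Z (t i.+1) w - Z (t i) w)]).
        apply: bigcapT_measurable => i; have [iN|ni] := ltnP i n.
          rewrite (_ : [set w | _] = [set w | A i (Z (t i.+1) w - Z (t i) w)]); first exact: mset'.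
          by apply/seteqP; split => w /= h; [exact: h|move=> _].
        rewrite (_ : [set w | _] = setT)//.
        by apply/seteqP; split => w //= _; rewrite ltnNge ni.
      by apply/seteqP; split => w /= h i => [_|]; apply: h.
    rewrite (_ : P _ = P [set w | forall i, (i < n)%N -> A i (X (t i.+1) w - X (t i) w)]); last first.
      apply: Peq; [exact: mset2|exact: mset2|move=> w nN /=].
      by split => h i iN; have := h i iN; rewrite !YX.
    rewrite (levy_independent LP)//; apply: eq_bigr => i _.
    apply: Peq; [exact: mset'|exact: mset'|move=> w nN /=].
    by rewrite !YX.
- by move=> w t t0; exact: (Yc w).1.
- have [sX [mnu [mu [[mu0 min [b [Q [QT Qp LK]]]] muE]]] nu0 nn] := A1; split => //.
    move=> t A t0 mA; rewrite PY//.
    rewrite -sX//; apply: Peq.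
    + by apply: (mset (fun w => - Y t w)) => //; apply: measurable_fun_opprV; exact: mY.
    + by apply: (mset (fun w => - X t w)) => //; apply: measurable_fun_opprV; exact: mX.
    + by move=> w nN /=; rewrite !YX.
  split => //; exists mu; split => //; split => //; exists b, Q; split => // t u t0.
  have := LK t u t0; rewrite !expectationE.
  have H (f : rV -> R) : (\int[P]_w (f (Y t w))%:E = \int[P]_w (f (X t w))%:E)%E.
    by apply: (negligible_lower_integral_eq mN N0) => w nN; rewrite YX.
  by rewrite (H (fun z => cos (dotp u z))) (H (fun z => sin (dotp u z))).
- move=> x F; apply: (negligible_lower_integral_eq mN N0) => w nN.
  by congr F; apply/funext => t; rewrite YX.
Qed.

End modification.

(** * Occupation integrals and exponential moments *)

Section integral_sup.
Context d (T : measurableType d) (R : realType) (mu : {measure set T -> \bar R}).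
Local Open Scope ereal_scope.

(** Monotone convergence for an [f] of which one knows only that it lies below every upper bound of
    the sequence. Path integrals and truncated potentials come in this form. *)
Lemma ge0_integral_sup_le (D : set T) (h : nat -> T -> \bar R) (f : T -> \bar R) (B : \bar R) :
  measurable D -> (forall n, measurable_fun D (h n)) -> (forall n x, 0 <= h n x) ->
  (forall x, nondecreasing_seq (h^~ x)) -> (forall x, 0 <= f x) ->
  (forall x L, (forall n, h n x <= L) -> f x <= L) ->
  (forall n, \int[mu]_(x in D) h n x <= B) -> \int[mu]_(x in D) f x <= B.
Proof.
move=> mD mh h0 nh f0 fL hB.
have c x : h^~ x @ \oo --> ereal_sup (range (h^~ x)) by exact: ereal_nondecreasing_cvgn.
apply: (@le_trans _ _ (\int[mu]_(x in D) limn (h^~ x))).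
  apply: ge0_le_lower_integral => // x Dx; apply: fL => n; rewrite (cvg_lim _ (c x))//.
  by apply: ereal_sup_ubound; exists n.
have -> : \int[mu]_(x in D) limn (h^~ x) = limn (fun n => \int[mu]_(x in D) h n x).
  by apply: monotone_convergence.
apply: lime_le; last by apply: nearW.
apply: ereal_nondecreasing_is_cvgn => m n mn; apply: ge0_le_lower_integral => // x Dx.
exact: nh.
Qed.

End integral_sup.

Definition truncf (R : realType) (T : Type) (U : T -> R) (n : nat) (x : T) : R := Num.min (U x) n%:R.

Section truncf.
Context (R : realType) (d : nat).
Implicit Types (U : 'rV[R]_d -> R) (p : R -> 'rV[R]_d).

Lemma truncf_ge0 U n : (forall x, 0 <= U x) -> forall x, 0 <= truncf U n x.
Proof. by move=> U0 x; rewrite /truncf le_min U0 ler0n. Qed.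

Lemma truncf_le U n x : truncf U n x <= U x.
Proof. by rewrite /truncf ge_min lexx. Qed.

Lemma truncf_le_nat U n x : truncf U n x <= n%:R.
Proof. by rewrite /truncf ge_min lexx orbT. Qed.

Lemma measurable_truncf U n : measurable_fun setT U -> measurable_fun setT (truncf U n).
Proof. by move=> mU; apply: measurable_minr => //; exact: measurable_cst. Qed.

Lemma truncf_nd U x : nondecreasing_seq (truncf U ^~ x).
Proof. by move=> m n mn; rewrite /truncf le_min !ge_min lexx/= ler_nat mn orbT. Qed.

Lemma truncf_sup U x (L : \bar R) : (forall n, ((truncf U n x)%:E <= L)%E) -> ((U x)%:E <= L)%E.
Proof.
move=> H; have := H (Num.truncn `|U x|).+1; rewrite /truncf min_l//.
by apply: le_trans (ler_norm _) _; apply/ltW; exact: truncnS_gt.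
Qed.

Lemma path_integral_le U U' t p : (forall x, 0 <= U x) -> (forall x, U x <= U' x) ->
  (path_integral U t p <= path_integral U' t p)%E.
Proof.
by move=> U0 UU; apply: ge0_le_lower_integral => s _; rewrite lee_fin.
Qed.

Lemma path_integral_truncf_nd U t p : (forall x, 0 <= U x) ->
  nondecreasing_seq (fun n => path_integral (truncf U n) t p).
Proof. by move=> U0 m n mn; apply: path_integral_le => x; [exact: truncf_ge0|exact: truncf_nd]. Qed.

Lemma path_integral_truncf_sup U t p (L : \bar R) : measurable_fun setT U -> (forall x, 0 <= U x) ->
  measurable_fun setT p ->
  (forall n, path_integral (truncf U n) t p <= L)%E -> (path_integral U t p <= L)%E.
Proof.
move=> mU U0 mp H.
apply: (@ge0_integral_sup_le _ _ R lebesgue_measure `[0%R, t]%classic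
  (fun n s => (truncf U n (p s))%:E) (fun s => (U (p s))%:E)) => //.
- move=> n; apply: measurable_funTS; apply/measurable_EFinP.
  exact: (measurableT_comp (measurable_truncf n mU) mp).
- by move=> n s; rewrite lee_fin truncf_ge0.
- by move=> s m n mn; rewrite lee_fin truncf_nd.
- by move=> s; rewrite lee_fin.
- by move=> s M HM; exact: (truncf_sup HM).
Qed.

Lemma path_integral_bounded U t p (M : R) : (forall x, 0 <= U x) -> (forall x, U x <= M) -> 0 <= t ->
  (path_integral U t p <= (M * t)%:E)%E.
Proof.
move=> U0 UM t0; apply: (@le_trans _ _ (\int[lebesgue_measure]_(s in `[0%R, t]) M%:E)%E).
  by apply: ge0_le_lower_integral => s _; rewrite lee_fin.
rewrite integral_cst//= lebesgue_measure_itv/= lte_fin; case: ltP => h.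
  by rewrite oppr0 adde0 -EFinM.
by rewrite mule0 lee_fin mulr_ge0// (le_trans (U0 0) (UM 0)).
Qed.

Lemma path_integral_mono U s t p : (forall x, 0 <= U x) -> s <= t -> measurable_fun setT U ->
  measurable_fun setT p -> (path_integral U s p <= path_integral U t p)%E.
Proof.
move=> U0 st mU mp; apply: ge0_subset_integral => //.
- apply: measurable_funTS; apply/measurable_EFinP; exact: (measurableT_comp mU mp).
- by move=> r _; rewrite lee_fin.
- by apply: subset_itvl; rewrite bnd_simp.
Qed.

End truncf.

Lemma expeR_sup_le (R : realType) (a : nat -> \bar R) (b : \bar R) (L : \bar R) :
  (0 <= b)%E -> (forall M, (forall n, a n <= M)%E -> (b <= M)%E) ->
  (forall n, expeR (a n) <= L)%E -> (expeR b <= L)%E.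
Proof.
move=> b0 H Ha; have L0 : (0 <= L)%E := le_trans (expeR_ge0 _) (Ha 0%N).
have LE : expeR (lne L) = L by apply/eqP; rewrite lneK_eq.
by rewrite -LE lee_expeR; apply: H => n; rewrite -lee_expeR LE.
Qed.

Section occupation.
Context {R : realType} {dO : measure_display} {Omega : measurableType dO} {d : nat}.
Variables (P : probability Omega R) (Y : R -> Omega -> 'rV[R]_d).
Local Notation rV := 'rV[R]_d.
Local Notation dyR := (@dy R).
Hypothesis LP : levy_process P Y.
Hypothesis Y0 : forall w, Y 0 w = 0.
Hypothesis Yrc : forall w, rcont (Y ^~ w).
Local Open Scope ereal_scope.

Let mY := levy_measurable LP.

Definition occ (U : rV -> R) (t : R) (y : rV) : \bar R :=
  \int[P]_w path_integral U t (fun s => y + Y s w)%R.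

Definition eocc (U : rV -> R) (t : R) (y : rV) : \bar R :=
  \int[P]_w expeR (path_integral U t (fun s => y + Y s w)%R).

Lemma path_integral_rec U t y w :
  path_integral U t (fun s => y + Y s w)%R = path_integral U t (fun s => y + rec (pth Y w) s)%R.
Proof. by apply: path_integral_ext => s s0; rewrite (rec_pth Y0 Yrc). Qed.

Section potential.
Variable U : rV -> R.
Hypothesis mU : measurable_fun setT U.
Hypothesis U0 : forall x, (0 <= U x)%R.

Lemma measurable_pi_Y t y : measurable_fun setT (fun w => path_integral U t (fun s => y + Y s w)%R).
Proof.
have mp : measurable_fun setT (fun w : Omega => (y, w)) by exact: measurable_fun_pair.
exact: (measurableT_comp (measurable_path_integral_Y LP Y0 Yrc t mU U0) mp).
Qed.

Lemma measurable_occ t : measurable_fun setT (occ U t).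
Proof.
apply: (@measurable_fun_intr _ _ _ _ _ P (fun (y : rV) w => path_integral U t (fun s => y + Y s w)%R)).
  exact: (measurable_path_integral_Y LP Y0 Yrc t mU U0).
by move=> y w; exact: path_integral_ge0.
Qed.

Lemma occ_ge0 t y : 0 <= occ U t y.
Proof. by apply: integral_ge0 => w _; exact: path_integral_ge0. Qed.

Lemma measurable_rec_shift y w : measurable_fun setT (fun s => y + rec (pth Y w) s)%R.
Proof. by apply: measurable_fun_addrV => //; exact: measurable_rec_pth. Qed.

Lemma path_integral_catY m j t y w w' : (0 <= t)%R ->
  path_integral U (dyR m j + t)%R (fun r => y + rec (catY Y (dyR m j) (w, w')) r)%R =
  path_integral U (dyR m j) (fun r => y + Y r w)%R +
  path_integral U t (fun r => y + Y (dyR m j) w + Y r w')%R.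
Proof.
move=> t0.
have rc s : (0 <= s)%R -> rec (catY Y (dyR m j) (w, w')) s =
    path_cat (dyR m j) (rec (pth Y w)) (rec (pth Y w')) s.
  move=> s0; rewrite /catY recE//=; last first.
  - by rewrite path_cat_left ?dy_ge0// /pth Y0.
  - by apply: rcont_cat; [exact: dy_ge0|exact: Yrc|exact: Yrc|exact: Y0].
  rewrite /path_cat; case: ltP => s1; first by rewrite (rec_pth Y0 Yrc).
  by rewrite !(rec_pth Y0 Yrc) ?dy_ge0 ?subr_ge0.
rewrite (path_integral_ext _ _ (q := (fun s => y + path_cat (dyR m j) (rec (pth Y w)) (rec (pth Y w')) s)%R)); last first.
  by move=> s s0; rewrite rc.
rewrite path_integral_cat ?dy_ge0//; last 3 first.
- exact: measurable_rec_pth.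
- exact: measurable_rec_pth.
- by rewrite (rec_pth Y0 Yrc).
congr (_ + _); apply: path_integral_ext => s s0; first by rewrite (rec_pth Y0 Yrc).
by rewrite !(rec_pth Y0 Yrc) ?dy_ge0.
Qed.

Lemma occ_add m j t y : (0 <= t)%R ->
  occ U (dyR m j + t) y = occ U (dyR m j) y + \int[P]_w occ U t (y + Y (dyR m j) w)%R.
Proof.
move=> t0; pose K (p : pathT R d) := path_integral U (dyR m j + t) (fun r => y + rec p r)%R.
have mK : measurable_fun setT K.
  have mp : measurable_fun setT (fun p : pathT R d => (y, p)) by exact: measurable_fun_pair.
  exact: (measurableT_comp (measurable_path_integral (dyR m j + t)%R mU U0) mp).
have K0 p : 0 <= K p by exact: path_integral_ge0.
have E := markov LP Y0 m j mK K0.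
transitivity (\int[P]_w K (pth Y w)).
  by apply: eq_integral => w _; rewrite path_integral_rec.
rewrite {}E -ge0_intD; last 4 first.
- exact: measurable_pi_Y.
- by move=> w; exact: path_integral_ge0.
- apply: (measurableT_comp (measurable_occ t)); apply: measurable_fun_addrV => //.
  by apply: mY; exact: dy_ge0.
- by move=> w; exact: occ_ge0.
apply: eq_integral => w _.
under eq_integral do rewrite /K path_integral_catY//.
rewrite ge0_intD ?path_integral_ge0//; last 2 first.
- exact: measurable_pi_Y.
- by move=> w'; exact: path_integral_ge0.
by rewrite integral_cst//= probability_setT mule1.
Qed.

Lemma occ_mono s t y : (s <= t)%R -> occ U s y <= occ U t y.
Proof.
move=> st; apply: ge0_le_lower_integral => w _; first exact: path_integral_ge0.
by rewrite !path_integral_rec; apply: path_integral_mono => //; exact: measurable_rec_shift.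
Qed.

Lemma eocc_mono s t y : (s <= t)%R -> eocc U s y <= eocc U t y.
Proof.
move=> st; apply: ge0_le_lower_integral => w _; first exact: expeR_ge0.
rewrite lee_expeR !path_integral_rec; apply: path_integral_mono => //.
exact: measurable_rec_shift.
Qed.

Lemma eoccS m k y : eocc U (dyR m k.+1) y =
  \int[P]_w (expeR (path_integral U (dyR m 1) (fun s => y + Y s w)%R) * eocc U (dyR m k) (y + Y (dyR m 1) w)%R).
Proof.
pose K (p : pathT R d) := expeR (path_integral U (dyR m 1 + dyR m k) (fun r => y + rec p r)%R).
have mK : measurable_fun setT K.
  have mp : measurable_fun setT (fun p : pathT R d => (y, p)) by exact: measurable_fun_pair.
  apply: (measurableT_comp (@measurable_expeR R)).
  exact: (measurableT_comp (measurable_path_integral _ mU U0) mp).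
have K0 p : 0 <= K p by exact: expeR_ge0.
have E := markov LP Y0 m 1 mK K0.
transitivity (\int[P]_w K (pth Y w)).
  by apply: eq_integral => w _; rewrite path_integral_rec /K -dyD.
rewrite {}E; apply: eq_integral => w _.
under eq_integral do rewrite /K path_integral_catY ?dy_ge0// expeRD.
rewrite ge0_integralZl ?expeR_ge0//.
- apply: (measurableT_comp (@measurable_expeR R)); exact: measurable_pi_Y.
- by move=> w' _; exact: expeR_ge0.
Qed.

(** A discrete form of e^(A_t) = 1 + int_0^t e^(A_t - A_s) dA_s with A the path integral of U: the
    exponential of the remaining time has conditional expectation at most S, and e^(M 2^-m) is the
    discretisation error. *)
Lemma eocc_le m k (M S : R) y : (forall x, (U x <= M)%R) -> (0 <= S)%R ->
  (forall i z, (i <= k)%N -> eocc U (dyR m i) z <= S%:E) ->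
  eocc U (dyR m k) y <= 1 + (S * expR (M * dyR m 1))%:E * occ U (dyR m k) y.
Proof.
move=> UM S0; have M0 : (0 <= M)%R := le_trans (U0 0%R) (UM 0%R).
have c0 : (0 <= S * expR (M * dyR m 1))%R by rewrite mulr_ge0 ?expR_ge0.
elim: k y => [|k IH] y HS.
  have -> : eocc U (dyR m 0) y = 1.
    rewrite /eocc (eq_integral (cst 1)); first by rewrite integral_cst//= probability_setT mule1.
    move=> w _; rewrite (_ : dyR m 0 = 0)%R; last by rewrite /dy mul0r.
    by rewrite /path_integral set_itv1 integral_set1 expeR0.
  by rewrite leeDl// mule_ge0 ?lee_fin ?occ_ge0.
rewrite eoccS -[in occ U _ _](add1n k) dyD occ_add ?dy_ge0//; set c := (S * _)%R.
have ms : measurable_fun setT (fun w => y + Y (dyR m 1) w)%R.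
  by apply: measurable_fun_addrV => //; apply: mY; exact: dy_ge0.
apply: (@le_trans _ _ (\int[P]_w (1 + c%:E * (path_integral U (dyR m 1) (fun s => y + Y s w)%R + occ U (dyR m k) (y + Y (dyR m 1) w)%R)))).
  apply: ge0_le_lower_integral => w _.
    by rewrite mule_ge0 ?expeR_ge0//; apply: integral_ge0 => ? _; exact: expeR_ge0.
  set a := path_integral _ _ _; set z := (y + Y _ w)%R.
  have a0 : 0 <= a by exact: path_integral_ge0.
  have aM : a <= (M * dyR m 1)%:E by apply: path_integral_bounded => //; exact: dy_ge0.
  have e0 : 0 <= eocc U (dyR m k) z by apply: integral_ge0 => ? _; exact: expeR_ge0.
  have eS : eocc U (dyR m k) z <= S%:E by apply: HS.
  have eI : eocc U (dyR m k) z <= 1 + c%:E * occ U (dyR m k) z.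
    by apply: IH => i x ik; apply: HS; exact: leqW.
  rewrite [c%:E * (a + _)]ge0_muleDr ?occ_ge0//; apply: (@le_trans _ _ (c%:E * a + eocc U (dyR m k) z)); last first.
    by rewrite [leRHS]addeCA; apply: leeD2l.
  move: a a0 aM e0 eS {eI} => [a| |]// a0 aM.
  case: (eocc _ _ _) => [e| |]// e0 eS; rewrite !lee_fin in a0 aM e0 eS *.
  have h1 : (expR a <= 1 + a * expR (M * dyR m 1))%R.
    apply: (@le_trans _ _ (1 + a * expR a)%R); last by rewrite lerD2l ler_wpM2l// ler_expR.
    have := ler_wpM2r (expR_ge0 a) (expR_ge1Dx (- a)); rewrite -[X in (_ <= X)%R]expRD addNr expR0.
    lra.
  apply: (le_trans (ler_wpM2r e0 h1)).
  have h2 := ler_wpM2l (mulr_ge0 a0 (expR_ge0 (M * dyR m 1))) eS.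
  have -> : (c * a + e = e + a * expR (M * dyR m 1) * S)%R by rewrite /c; ring.
  by rewrite mulrDl mul1r; apply: lerD.
have mo : measurable_fun setT (fun w => occ U (dyR m k) (y + Y (dyR m 1) w)%R).
  exact: (measurableT_comp (measurable_occ _) ms).
have mpi := measurable_pi_Y (dyR m 1) y.
rewrite ge0_intD//; last 2 first.
- by apply: emeasurable_funM => //; exact: emeasurable_funD.
- by move=> w; rewrite mule_ge0 ?lee_fin// adde_ge0 ?occ_ge0 ?path_integral_ge0.
rewrite integral_cst//= probability_setT mule1 leeD2l// ge0_intZl//; last 2 first.
- exact: emeasurable_funD.
- by move=> w; rewrite adde_ge0 ?occ_ge0 ?path_integral_ge0.
rewrite ge0_intD//.
- by move=> w; exact: path_integral_ge0.
- by move=> w; exact: occ_ge0.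
Qed.

Lemma dy_refine m n j : dyR m j = dyR (m + n) (j * 2 ^ n).
Proof.
elim: n => [|n IH]; first by rewrite addn0 expn0 muln1.
by rewrite IH addnS expnS mulnCA mul2n dyS.
Qed.

Lemma dy1_le m n : (dyR (m + n) 1 <= n.+1%:R^-1)%R.
Proof.
rewrite /dy mul1r lef_pV2 ?posrE ?exprn_gt0//.
apply: le_trans (_ : (2 ^+ n <= _)%R).
  by rewrite -natrX ler_nat; exact: ltn_expl.
by rewrite exprD ler_peMl ?exprn_ge0// exprn_ege1// ler1n.
Qed.

Lemma khasminskii_bounded m j (M q : R) : (forall x, (U x <= M)%R) -> (q < 1)%R ->
  (forall y, occ U (dyR m j) y <= q%:E) ->
  forall y, eocc U (dyR m j) y <= 1 + (1 - q)^-1%:E * occ U (dyR m j) y.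
Proof.
move=> UM q1 Hq; set h := dyR m j; have h0 : (0 <= h)%R by exact: dy_ge0.
have M0 : (0 <= M)%R := le_trans (U0 0%R) (UM 0%R).
have e0 t y : 0 <= eocc U t y by apply: integral_ge0 => ? _; exact: expeR_ge0.
have eM y : eocc U h y <= (expR (M * h))%:E.
  apply: (@le_trans _ _ (\int[P]_w (expR (M * h))%:E)).
    apply: ge0_le_lower_integral => w _; first exact: expeR_ge0.
    have -> : (expR (M * h))%:E = expeR (M * h)%:E by [].
    by rewrite lee_expeR path_integral_bounded.
  by rewrite integral_cst//= probability_setT mule1.
(* The supremum is finite because U is bounded; only then can s <= 1 + s q be solved for s. *)
have [s s0 sE] : exists2 s, (0 <= s)%R & ereal_sup (range (eocc U h)) = s%:E.
  have h1 : ereal_sup (range (eocc U h)) <= (expR (M * h))%:E.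
    by apply: ge_ereal_sup => _ [y _ <-].
  have h2 : 0 <= ereal_sup (range (eocc U h)).
    by apply: (le_trans (e0 h 0%R)); apply: ereal_sup_ubound; exists 0%R.
  by move: (ereal_sup _) h1 h2 => [s| |]// _ s0; exists s.
have es y : eocc U h y <= s%:E by rewrite -sE; apply: ereal_sup_ubound; exists y.
(* The discretisation factor tends to 1 as the mesh is refined with the total time fixed. *)
have es1 y : eocc U h y <= 1 + s%:E * occ U h y.
  have := e0 h y; have := es y; case ve : (eocc U h y) => [v| |]// _ _.
  have := occ_ge0 h y; have := Hq y; rewrite -/h; case oe : (occ U h y) => [r| |]//.
  move=> _; rewrite lee_fin => r0; rewrite -EFinM -EFinD lee_fin.
  apply: (@le_add_inv_nat _ _ _ (s * r * (M * expR M))) => [|n]; first by rewrite !mulr_ge0 ?expR_ge0.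
  have hE := dy_refine m n j; rewrite -/h in hE.
  have hi i z : (i <= j * 2 ^ n)%N -> eocc U (dyR (m + n) i) z <= s%:E.
    by move=> ij; apply: le_trans (es z); apply: eocc_mono; rewrite hE ler_dy.
  have := @eocc_le (m + n) (j * 2 ^ n) M s y UM s0 hi.
  rewrite -hE ve oe -EFinM -EFinD lee_fin => hv; apply: (le_trans hv).
  have d1 := dy1_le m n; have d0 := dy_ge0 R (m + n) 1; set dl := dyR _ _ in d1 d0 hv *.
  have n1 : ((n.+1)%:R^-1 <= 1 :> R)%R by rewrite invf_le1 ?ltr0n// ler1n.
  have := expR_sub1_le M0 (t := dl); rewrite d0 (le_trans d1 n1) => /(_ isT) he.
  have he2 : (expR (M * dl) <= 1 + M * expR M / n.+1%:R)%R.
    rewrite -lerBlDl; apply: (le_trans he); rewrite ler_wpM2l// mulr_ge0 ?expR_ge0//.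
  have sr0 : (0 <= s * r)%R by rewrite mulr_ge0.
  rewrite -[leRHS]addrA lerD2l [leLHS]mulrAC; apply: (le_trans (ler_wpM2l sr0 he2)).
  by rewrite mulrDr mulr1 mulrA.
have q10 : (0 < 1 - q)%R by rewrite subr_gt0.
have sq : (s <= (1 - q)^-1)%R.
  have : s%:E <= 1 + s%:E * q%:E.
    rewrite -[X in X <= _]sE; apply: ge_ereal_sup => _ [y _ <-].
    by apply: (le_trans (es1 y)); rewrite leeD2l// lee_wpmul2l ?lee_fin.
  rewrite -EFinM -EFinD lee_fin => ?.
  by rewrite -[leRHS]mul1r ler_pdivlMr//; lra.
move=> y; apply: (le_trans (es1 y)); rewrite leeD2l// lee_wpmul2r ?lee_fin ?occ_ge0//.
Qed.

End potential.

Lemma occ_truncf_sup (U : rV -> R) t y (L : \bar R) : measurable_fun setT U -> (forall x, (0 <= U x)%R) ->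
  (forall n, occ (truncf U n) t y <= L) -> occ U t y <= L.
Proof.
move=> mU U0; apply: ge0_integral_sup_le => //.
- by move=> n; apply: measurable_pi_Y; [exact: measurable_truncf|exact: truncf_ge0].
- by move=> n w; apply: path_integral_ge0; exact: truncf_ge0.
- by move=> w; exact: path_integral_truncf_nd.
- by move=> w; exact: path_integral_ge0.
- move=> w M; rewrite path_integral_rec => H; apply: path_integral_truncf_sup => //.
    exact: measurable_rec_shift.
  by move=> n; rewrite -path_integral_rec.
Qed.

(** The constant 1/(1 - q) does not depend on the bound of the potential, so the truncations can be
    removed by monotone convergence. *)
Lemma khasminskii (U : rV -> R) m j (q : R) : measurable_fun setT U -> (forall x, (0 <= U x)%R) -> (q < 1)%R ->
  (forall y, occ U (dyR m j) y <= q%:E) ->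
  forall y, eocc U (dyR m j) y <= 1 + (1 - q)^-1%:E * occ U (dyR m j) y.
Proof.
move=> mU U0 q1 Hq y.
have mt n := measurable_truncf n mU; have t0 n := truncf_ge0 n U0.
have oU n z : occ (truncf U n) (dyR m j) z <= occ U (dyR m j) z.
  apply: ge0_le_lower_integral => w _; first exact: path_integral_ge0.
  by apply: path_integral_le => // x; exact: truncf_le.
apply: (@ge0_integral_sup_le _ _ R P setT
  (fun n w => expeR (path_integral (truncf U n) (dyR m j) (fun s => y + Y s w)%R))) => //.
- move=> n; apply: (measurableT_comp (@measurable_expeR R)).
  by apply: measurable_pi_Y.
- by move=> n w; exact: expeR_ge0.
- by move=> w k l kl; rewrite lee_expeR; exact: path_integral_truncf_nd.
- by move=> w; exact: expeR_ge0.
- move=> w L; apply: expeR_sup_le; first exact: path_integral_ge0.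
  move=> M; rewrite path_integral_rec => H; apply: path_integral_truncf_sup => //.
    exact: measurable_rec_shift.
  by move=> n; rewrite -path_integral_rec.
- move=> n; have := @khasminskii_bounded _ (mt n) (t0 n) m j n%:R q (truncf_le_nat U n) q1.
  move=> /(_ (fun z => le_trans (oU n z) (Hq z)) y) h; apply: (le_trans h).
  by rewrite leeD2l// lee_wpmul2l ?lee_fin// invr_ge0 subr_ge0 ltW.
Qed.

End occupation.

Lemma expR1_gt2 (R : realType) : 2 <= expR (1 : R).
Proof. by have := expR_ge1Dx (1 : R); rewrite -natr1. Qed.

(** * Occupation of a bounded region, estimated through the end position *)

Section end_time.
Context {R : realType} {dO : measure_display} {Omega : measurableType dO} {d : nat}.
Variables (P : probability Omega R) (Y : R -> Omega -> 'rV[R]_d).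
Local Notation rV := 'rV[R]_d.
Local Notation dyR := (@dy R).
Hypothesis LP : levy_process P Y.
Hypothesis Y0 : forall w, Y 0 w = 0.
Hypothesis Yrc : forall w, rcont (Y ^~ w).
Local Open Scope ereal_scope.
Local Notation leb := (@lebesgue_measure R).

Let mY := levy_measurable LP.

Section weight.
Variables (U G : rV -> R).
Hypothesis mU : measurable_fun setT U.
Hypothesis U0 : forall x, (0 <= U x)%R.
Hypothesis mG : measurable_fun setT G.
Hypothesis G0 : forall x, (0 <= G x)%R.

Lemma measurable_U_rec t y : measurable_fun setT
  (fun q : Omega * R => (U (y + rec (pth Y q.1) q.2) * \1_(`[0%R, t]%classic) q.2)%:E).
Proof.
apply/measurable_EFinP; apply: measurable_funM.
  apply: (measurableT_comp mU); apply: measurable_fun_addrV => //.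
  have mp : measurable_fun setT (fun q : Omega * R => (pth Y q.1, q.2)).
    apply: measurable_fun_pair; last exact: measurable_snd.
    exact: (measurableT_comp (measurable_pth LP) measurable_fst).
  exact: (measurableT_comp (@measurable_rec R d) mp).
apply: (measurableT_comp (f := \1_(`[0%R, t]%classic) : R -> R)); last exact: measurable_snd.
exact: measurable_indic.
Qed.

Lemma integral_path_integral t y (Z : Omega -> R) : measurable_fun setT Z ->
  (forall w, (0 <= Z w)%R) ->
  \int[P]_w (path_integral U t (fun s => y + Y s w)%R * (Z w)%:E) =
  \int[leb]_s \int[P]_w ((U (y + rec (pth Y w) s) * \1_(`[0%R, t]%classic) s)%:E * (Z w)%:E).
Proof.
move=> mZ Z0; have mUr := measurable_U_rec t y.
rewrite -(@tonelli _ _ _ _ R P leb (fun w s =>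
  (U (y + rec (pth Y w) s) * \1_(`[0%R, t]%classic) s)%:E * (Z w)%:E)); last 2 first.
- apply: emeasurable_funM => //; apply/measurable_EFinP; exact: (measurableT_comp mZ measurable_fst).
- by move=> w s; rewrite -EFinM lee_fin !mulr_ge0.
apply: eq_integral => w _.
rewrite (path_integral_rec Y0 Yrc) path_integral_itv muleC -ge0_intZl//.
- by apply: eq_integral => s _; rewrite muleC.
- have mp : measurable_fun setT (fun s : R => (w, s)) by exact: measurable_fun_pair.
  exact: (measurableT_comp mUr mp).
- by move=> s; rewrite lee_fin mulr_ge0.
Qed.

Lemma integral_two_times s t y : (0 <= s)%R -> (s <= t)%R ->
  \int[P]_w ((U (y + Y s w))%:E * (G (y + Y t w))%:E) =
  \int[P]_w ((U (y + Y s w))%:E * \int[P]_w' (G (y + Y s w + Y (t - s) w')%R)%:E).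
Proof.
move=> s0 st.
pose F (z : rV * rV) : \bar R := (U (y + z.1))%:E * (G (y + z.1 + z.2))%:E.
have my1 : measurable_fun setT (fun z : rV * rV => y + z.1)%R.
  by apply: measurable_fun_addrV => //; exact: measurable_fst.
have mF : measurable_fun setT F.
  apply: emeasurable_funM; apply/measurable_EFinP.
    exact: (measurableT_comp mU my1).
  by apply: (measurableT_comp mG); apply: measurable_fun_addrV => //; exact: measurable_snd.
have F0 z : 0 <= F z by rewrite mule_ge0 ?lee_fin.
have E := two_times LP Y0 s0 st mF F0.
transitivity (\int[P]_w F (Y s w, Y t w - Y s w)%R).
  by apply: eq_integral => w _; rewrite /F/= -[(y + _ + _)%R]addrA [(Y s w + _)%R]addrC subrK.
rewrite {}E; apply: eq_integral => w _; rewrite /F/= ge0_intZl//.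
- apply/measurable_EFinP; apply: (measurableT_comp mG); apply: measurable_fun_addrV => //.
  by apply: mY; rewrite subr_ge0.
- by move=> w'; rewrite lee_fin.
Qed.

Lemma integral_weighted_eq s t y : (0 <= t)%R ->
  \int[P]_w ((U (y + rec (pth Y w) s) * \1_(`[0%R, t]%classic) s)%:E * (G (y + Y t w))%:E) =
  if (0 <= s <= t)%R then
    \int[P]_w ((U (y + Y s w))%:E * \int[P]_w' (G (y + Y s w + Y (t - s) w')%R)%:E) else 0.
Proof.
move=> t0; rewrite indicE mem_setE in_itv/=; case: ifPn => [/andP[s0 st]|nst].
  rewrite -integral_two_times//; apply: eq_integral => w _.
  by rewrite mulr1 (rec_pth Y0 Yrc).
by rewrite integral0_eq// => w _; rewrite mulr0 mul0e.
Qed.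

Lemma measurable_G_end t y : (0 <= t)%R -> measurable_fun setT (fun w => G (y + Y t w)).
Proof. by move=> t0; apply: (measurableT_comp mG); apply: measurable_fun_addrV => //; exact: mY. Qed.

Lemma occE t y : occ P Y U t y =
  \int[leb]_s \int[P]_w (U (y + rec (pth Y w) s) * \1_(`[0%R, t]%classic) s)%:E.
Proof.
have := @integral_path_integral t y (cst 1%R) (measurable_cst _) (fun=> ler01).
under eq_integral do rewrite mule1.
rewrite -/(occ P Y U t y) => ->; apply: eq_integral => s _.
by apply: eq_integral => w _; rewrite mule1.
Qed.

Lemma measurable_intU t y :
  measurable_fun setT (fun s => \int[P]_w (U (y + rec (pth Y w) s) * \1_(`[0%R, t]%classic) s)%:E).
Proof.
apply: (@measurable_fun_intl _ _ _ _ R P (fun w s => (U (y + rec (pth Y w) s) * \1_(`[0%R, t]%classic) s)%:E)).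
  exact: measurable_U_rec.
by move=> w s; rewrite lee_fin mulr_ge0.
Qed.



(** Tonelli and the Markov property at each time s at which the path meets the support of U: what
    remains is a path from such a point, run for a time at most t. The reverse bound [occ_end_ge] is
    the same computation. *)
Lemma occ_end_le t y (c : R) : (0 <= t)%R -> (0 <= c)%R ->
  (forall s z, (0 <= s <= t)%R -> U z != 0%R -> \int[P]_w' (G (z + Y s w'))%:E <= c%:E) ->
  \int[P]_w (path_integral U t (fun s => y + Y s w)%R * (G (y + Y t w))%:E) <= c%:E * occ P Y U t y.
Proof.
move=> t0 c0 Hc; rewrite integral_path_integral//; last exact: measurable_G_end.
rewrite occE -ge0_intZl//; last 2 first.
- exact: measurable_intU.
- by move=> s; apply: integral_ge0 => w _; rewrite lee_fin mulr_ge0.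
apply: ge0_le_lower_integral => s _.
  by apply: integral_ge0 => w _; rewrite mule_ge0 ?lee_fin ?mulr_ge0.
rewrite integral_weighted_eq//; case: ifPn => [/andP[s0 st]|nst]; last first.
  by apply: mule_ge0 => //; apply: integral_ge0 => w _; rewrite lee_fin mulr_ge0.
rewrite -ge0_intZl//; last 2 first.
- apply/measurable_EFinP; apply: measurable_funM => //.
  apply: (measurableT_comp mU); apply: measurable_fun_addrV => //.
  have mp : measurable_fun setT (fun w => (pth Y w, s)).
    by apply: measurable_fun_pair => //; exact: (measurable_pth LP).
  exact: (measurableT_comp (@measurable_rec R d) mp).
- by move=> w; rewrite lee_fin mulr_ge0.
apply: ge0_le_lower_integral => w _.
  by apply: mule_ge0; rewrite ?lee_fin//; apply: integral_ge0 => w' _; rewrite lee_fin.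
rewrite (rec_pth Y0 Yrc)// indicE mem_set ?mulr1; last by rewrite /= in_itv/= s0.
have [->|Un0] := eqVneq (U (y + Y s w)) 0%R; first by rewrite mul0e mule0.
rewrite [leRHS]muleC; apply: lee_wpmul2l; first by rewrite lee_fin.
by apply: Hc; rewrite // subr_ge0 st lerBlDr lerDl.
Qed.

Lemma occ_end_ge t y (c : R) : (0 <= t)%R -> (0 <= c)%R ->
  (forall s z, (0 <= s <= t)%R -> U z != 0%R -> c%:E <= \int[P]_w' (G (z + Y s w'))%:E) ->
  c%:E * occ P Y U t y <= \int[P]_w (path_integral U t (fun s => y + Y s w)%R * (G (y + Y t w))%:E).
Proof.
move=> t0 c0 Hc; rewrite integral_path_integral//; last exact: measurable_G_end.
rewrite occE -ge0_intZl//; last 2 first.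
- exact: measurable_intU.
- by move=> s; apply: integral_ge0 => w _; rewrite lee_fin mulr_ge0.
apply: ge0_le_lower_integral => s _.
  by apply: mule_ge0 => //; apply: integral_ge0 => w _; rewrite lee_fin mulr_ge0.
rewrite integral_weighted_eq//; case: ifPn => [/andP[s0 st]|nst]; last first.
  rewrite integral0_eq ?mule0// => w _.
  by rewrite indicE mem_setE in_itv/= (negbTE nst) mulr0.
rewrite -ge0_intZl//; last 2 first.
- apply/measurable_EFinP; apply: measurable_funM => //.
  apply: (measurableT_comp mU); apply: measurable_fun_addrV => //.
  have mp : measurable_fun setT (fun w => (pth Y w, s)).
    by apply: measurable_fun_pair => //; exact: (measurable_pth LP).
  exact: (measurableT_comp (@measurable_rec R d) mp).
- by move=> w; rewrite lee_fin mulr_ge0.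
apply: ge0_le_lower_integral => w _.
  by rewrite mule_ge0 ?lee_fin ?mulr_ge0.
rewrite (rec_pth Y0 Yrc)// indicE mem_set ?mulr1; last by rewrite /= in_itv/= s0.
have [->|Un0] := eqVneq (U (y + Y s w)) 0%R; first by rewrite mul0e mule0.
rewrite [leLHS]muleC; apply: lee_wpmul2l; first by rewrite lee_fin.
by apply: Hc; rewrite // subr_ge0 st lerBlDr lerDl.
Qed.

End weight.

Section small_time.
Variables (nu g w : rV -> R) (a K : R).
Hypothesis LE : levy_estimates P Y nu g w a K.

Lemma EFin_Rintegral (f : Omega -> R) B : measurable_fun setT f -> (forall x, (`|f x| <= B)%R) ->
  \int[P]_x (f x)%:E = (\int[P]_x f x)%:E.
Proof.
move=> mf fB; rewrite /Rintegral fineK//.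
by have /integrable_fin_num := integrable_bounded_prob P mf fB; apply.
Qed.

Lemma measurable_end t y : (0 <= t)%R -> measurable_fun setT (fun om => y + Y t om)%R.
Proof. by move=> t0; apply: measurable_fun_addrV => //; exact: mY. Qed.

Lemma gsV1_le_half (z : rV) : (1 <= enorm z)%R -> (gsV 1 z <= 2^-1)%R.
Proof.
move=> z1; rewrite gsVE mul1r expRN lef_pV2 ?posrE ?expR_gt0//.
apply: (le_trans (expR1_gt2 R)); rewrite ler_expR; exact: exprn_ege1.
Qed.

(** On the event the end point lies in the ball and the displacement is at least 1, so the test
    function of [est_annulus] is at least e^(-rho^2)/2; Markov's inequality does the rest. *)
Lemma hit_le (rho t : R) (z : rV) : (0 <= rho)%R -> (rho + 1 <= enorm z)%R -> (0 <= t <= 1)%R ->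
  \int[P]_om (\1_(eball (0 : rV) rho) (z + Y t om)%R)%:E <= (2 * expR (rho ^+ 2) * K * t * g z)%:E.
Proof.
move=> rho0 hz t01; have /andP[t0 _] := t01.
pose f om : R := (gsV 1 (z + Y t om) * (1 - gsV 1 (Y t om)))%R.
have mf : measurable_fun setT f.
  apply: measurable_funM.
    exact: (measurableT_comp (measurable_gsV 1) (measurable_end z t0)).
  by apply: measurable_funB => //; exact: (measurableT_comp (measurable_gsV 1) (mY t0)).
have f0 om : (0 <= f om)%R by rewrite mulr_ge0 ?gsV_ge0// subr_ge0 gsV_le1.
have c0 : (0 <= 2 * expR (rho ^+ 2) :> R)%R by rewrite mulr_ge0 ?expR_ge0.
apply: (@le_trans _ _ (\int[P]_om ((2 * expR (rho ^+ 2))%:E * (f om)%:E))).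
  apply: ge0_le_lower_integral => om _; first by rewrite lee_fin.
  rewrite -EFinM lee_fin indicE.
  have [zB|zB] := boolP (_ \in _); last by rewrite mulr_ge0.
  have zr : (enorm (z + Y t om) <= rho)%R by apply/ltW; move: zB; rewrite inE /eball/= subr0.
  have Y1 : (1 <= enorm (Y t om))%R.
    have := ler_enormB (z + Y t om)%R (Y t om); rewrite addrK => h.
    by rewrite -(lerD2l rho); apply: (le_trans hz); apply: (le_trans h); rewrite lerD2r.
  have h1 := gsV1_le_half Y1.
  have h2 : (expR (- rho ^+ 2) <= gsV 1 (z + Y t om))%R.
    by rewrite gsVE mul1r ler_expR lerN2 lerXn2r ?nnegrE ?enorm_ge0.
  have h3 : (2^-1 <= 1 - gsV 1 (Y t om))%R by lra.
  have h4 : (expR (- rho ^+ 2) * 2^-1 <= f om)%R by apply: ler_pM; rewrite ?expR_ge0.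
  apply: le_trans (ler_wpM2l c0 h4).
  by rewrite [(2 * expR _)%R]mulrC mulrACA -expRD subrr expR0 mul1r mulfV.
have mfE : measurable_fun setT (fun om => (f om)%:E) by apply/measurable_EFinP.
have f0E om : 0 <= (f om)%:E by rewrite lee_fin.
rewrite (ge0_intZl P c0 mfE f0E) (@EFin_Rintegral _ 1%R)//; last first.
  move=> om; rewrite ger0_norm// mulr_ile1 ?gsV_ge0 ?gsV_le1 ?subr_ge0 ?gsV_le1//.
  by rewrite lerBlDl lerDr gsV_ge0.
rewrite -EFinM lee_fin -!mulrA ler_wpM2l//  ler_wpM2l ?expR_ge0//.
by rewrite mulrA; exact: (est_annulus LE).
Qed.

Lemma stay_ge : exists2 t1 : R, (0 < t1 <= 1)%R & forall t (z : rV), (0 <= t <= t1)%R ->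
  (2^-1)%:E <= \int[P]_om (\1_(eball z 1) (z + Y t om)%R)%:E.
Proof.
have [C C0 HC] := est_bump LE (@ltr01 R).
have K0 : (0 <= K)%R := le_trans ler01 (est_K LE).
(* Up to this time the bump at the starting point keeps expectation at least 3/4; as twice the bump
   is at most 1 plus the indicator of staying within distance 1, the probability is at least 1/2. *)
exists (1 / (1 + 4 * C * K))%R.
  rewrite div1r invr_gt0 invf_le1; last by rewrite ltr_pwDl// !mulr_ge0.
  by rewrite ltr_pwDl ?lerDl ?mulr_ge0.
move=> t z /andP[t0 tt1].
have D0 : (0 < 1 + 4 * C * K)%R by rewrite ltr_pwDl// !mulr_ge0.
have t1 : (t <= 1)%R.
  by apply: (le_trans tt1); rewrite div1r invf_le1// lerDl !mulr_ge0.
have tb : (4 * (C * K * t) <= 1)%R.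
  move: tt1; rewrite ler_pdivlMr// => h; apply: le_trans h.
  by rewrite [leRHS]mulrDr mulr1 -[leLHS]add0r; apply: lerD => //; rewrite le_eqVlt; apply/orP; left; apply/eqP; ring.
have mg1 : measurable_fun setT (fun om => gsV 1 (Y t om)) := measurableT_comp (measurable_gsV 1) (mY t0).
have gE : \int[P]_om (gsV 1 (Y t om))%:E = (\int[P]_om gsV 1 (Y t om))%:E.
  by apply: (@EFin_Rintegral (fun om => gsV 1 (Y t om)) 1%R) => // om; rewrite ger0_norm ?gsV_ge0 ?gsV_le1.
have gl : (1 - C * K * t <= \int[P]_om gsV 1 (Y t om))%R.
  have := HC t 0%R; rewrite t0 t1 => /(_ isT).
  have -> : (\int[P]_om gsV 1 (0 + Y t om) = \int[P]_om gsV 1 (Y t om))%R.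
    by apply: eq_Rintegral => om _; rewrite add0r.
  have -> : gsV 1 (0 : rV) = 1%R by rewrite gsVE enorm0 expr0n mulr0 oppr0 expR0.
  move=> /ler_normlP[h _]; have := est_g_le LE 0%R => gK.
  have : (C * t * g 0 <= C * t * K)%R by apply: ler_wpM2l => //; rewrite mulr_ge0.
  rewrite [(C * t * K)%R]mulrAC; lra.
have mB : measurable_fun setT (fun om => (\1_(eball z 1) (z + Y t om)%R)%:E : \bar R).
  apply/measurable_EFinP; apply: (measurableT_comp _ (measurable_end z t0)).
  by apply: measurable_indic; exact: measurable_eball.
have h : \int[P]_om (2%:E * (gsV 1 (Y t om))%:E) <= \int[P]_om (1 + (\1_(eball z 1) (z + Y t om)%R)%:E).
  apply: ge0_le_lower_integral => om _; first by rewrite -EFinM lee_fin mulr_ge0 ?gsV_ge0.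
  rewrite -EFinM -EFinD lee_fin indicE.
  have [zB|zB] := boolP (_ \in _).
    by have := @gsV_le1 R d 1%R (Y t om) ler01; rewrite -[(true%:R)%R]/(1%R); lra.
  have Y1 : (1 <= enorm (Y t om))%R.
    rewrite leNgt; apply: contra zB => h; rewrite inE /eball/=.
    by rewrite addrAC subrr add0r.
  by have := gsV1_le_half Y1; rewrite -[(false%:R)%R]/(0%R); lra.
move: h; rewrite ge0_intZl//; last 2 first.
- exact/measurable_EFinP.
- by move=> om; rewrite lee_fin gsV_ge0.
rewrite gE ge0_intD//.
rewrite integral_cst//= probability_setT mule1.
set I := \int[P]_om _; case: I => [i| |]//; last by move=> _; rewrite leey.
rewrite -EFinM -EFinD !lee_fin; lra.
Qed.

Lemma measurable_ball1 c r : measurable_fun setT (\1_(eball (c : rV) r) : rV -> R).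
Proof. by apply: measurable_indic; exact: measurable_eball. Qed.

(** A path that meets the support of U before dl is within distance rho + 1 of the origin at time dl
    with probability at least 1/2. Hence half the occupation is carried by paths ending there, on
    each of which it is at most M dl. *)
Lemma occ_bounded_le (U : rV -> R) (M rho t1 dl : R) y : measurable_fun setT U ->
  (forall x, (0 <= U x <= M)%R) -> (forall z, (rho <= enorm z)%R -> U z = 0%R) ->
  (forall t (z : rV), (0 <= t <= t1)%R ->
     (2^-1)%:E <= \int[P]_om (\1_(eball z 1) (z + Y t om)%R)%:E) ->
  (0 <= dl <= t1)%R ->
  occ P Y U dl y <= (2 * M * dl)%:E * \int[P]_om (\1_(eball (0 : rV) (rho + 1)) (y + Y dl om)%R)%:E.
Proof.
move=> mU UM Us H /andP[dl0 dlt].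
have U0 x : (0 <= U x)%R by case/andP: (UM x).
have UM' x : (U x <= M)%R by case/andP: (UM x).
have M0 : (0 <= M)%R := le_trans (U0 0%R) (UM' 0%R).
have mB := measurable_ball1 0 (rho + 1).
have h : (2^-1)%:E * occ P Y U dl y <= \int[P]_om (path_integral U dl (fun s => y + Y s om)%R *
     (\1_(eball (0 : rV) (rho + 1)) (y + Y dl om)%R)%:E).
  apply: occ_end_ge => // s z /andP[s0 st] Uz.
  apply: (le_trans (H s z _)); first by rewrite s0 (le_trans st).
  apply: ge0_le_lower_integral => om _; first by rewrite lee_fin.
  rewrite lee_fin !indicE; have [zB|zB] := boolP (_ \in eball z 1); last by [].
  rewrite mem_set//= /eball/= subr0.
  have zr : (enorm z < rho)%R by rewrite ltNge; apply: contra Uz => /Us ->.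
  move: zB; rewrite inE /eball/= addrAC subrr add0r => Y1.
  by apply: (le_lt_trans (ler_enormD _ _)); exact: ltrD.
have {}h : (2^-1)%:E * occ P Y U dl y <=
    \int[P]_om ((M * dl)%:E * (\1_(eball (0 : rV) (rho + 1)) (y + Y dl om)%R)%:E).
  apply: (le_trans h); apply: ge0_le_lower_integral => om _.
    by rewrite mule_ge0 ?lee_fin// path_integral_ge0.
  by rewrite lee_wpmul2r ?lee_fin// path_integral_bounded.
rewrite ge0_intZl ?mulr_ge0// in h; last first.
  by apply/measurable_EFinP; exact: (measurableT_comp mB (measurable_end y dl0)).
have -> : (2 * M * dl)%:E = 2%:E * (M * dl)%:E by rewrite -EFinM mulrA.
rewrite -muleA; apply: le_trans (lee_wpmul2l _ h); last by rewrite lee_fin.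
by rewrite muleA -EFinM mulfV// mul1e.
Qed.

Lemma measurable_endE (f : rV -> R) t y : measurable_fun setT f -> (0 <= t)%R ->
  measurable_fun setT (fun om => (f (y + Y t om)%R)%:E).
Proof. by move=> mf t0; apply/measurable_EFinP; exact: (measurableT_comp mf (measurable_end y t0)). Qed.

Lemma markov_dy (F : rV -> \bar R) m i t y : measurable_fun setT F -> (forall x, 0 <= F x) -> (0 <= t)%R ->
  \int[P]_om F (y + Y (dyR m i + t) om)%R = \int[P]_om \int[P]_om' F (y + Y (dyR m i) om + Y t om')%R.
Proof.
move=> mF F0 t0; have dt : (dyR m i <= dyR m i + t)%R by rewrite lerDl.
pose G (z : rV * rV) := F (y + z.1 + z.2)%R.
have mG : measurable_fun setT G.
  apply: (measurableT_comp mF); apply: measurable_fun_addrV; last exact: measurable_snd.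
  by apply: measurable_fun_addrV => //; exact: measurable_fst.
have := two_times LP Y0 (dy_ge0 R m i) dt mG (fun z => F0 _).
rewrite addrAC subrr add0r /G/= => <-.
by apply: eq_integral => om _; rewrite -[(y + _ + _)%R]addrA [(Y (dyR m i) om + _)%R]addrC subrK.
Qed.

(** A first-entrance argument on the grid. After the ball of radius rho + 1 is entered at most q is
    collected, and entering is charged to the end position: from inside the ball [chi] has
    expectation at least 1 at any remaining time, so its overall expectation dominates the
    probability of entrance. The term [D] pays for the step during which the ball is entered. *)
Lemma occ_bounded_far (U : rV -> R) (M rho t1 q A : R) m j y (chi : rV -> R) : measurable_fun setT U ->
  (forall x, (0 <= U x <= M)%R) -> (forall z, (rho <= enorm z)%R -> U z = 0%R) ->
  (forall t (z : rV), (0 <= t <= t1)%R ->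
     (2^-1)%:E <= \int[P]_om (\1_(eball z 1) (z + Y t om)%R)%:E) ->
  (dyR m j <= t1)%R -> (0 <= q)%R -> (forall z, occ P Y U (dyR m j) z <= q%:E) ->
  measurable_fun setT chi -> (forall x, (0 <= chi x)%R) ->
  (forall t z, (0 <= t <= t1)%R -> (enorm z < rho + 1)%R -> 1 <= \int[P]_om (chi (z + Y t om)%R)%:E) ->
  \int[P]_om (chi (y + Y (dyR m j) om)%R)%:E <= A%:E ->
  occ P Y U (dyR m j) y <= ((q + 2 * M * dyR m 1) * A)%:E.
Proof.
move=> mU UM Us H ht q0 Hq mchi chi0 Hchi HA.
have U0 x : (0 <= U x)%R by case/andP: (UM x).
have M0 : (0 <= M)%R by case/andP: (UM 0%R) => h1 h2; exact: le_trans h2.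
set dl := dyR m 1; have dl0 : (0 <= dl)%R := dy_ge0 R m 1.
set c := (q + 2 * M * dl)%R.
have md0 : (0 <= 2 * M * dl)%R by rewrite !mulr_ge0.
have c0 : (0 <= c)%R by rewrite addr_ge0.
have mB := measurable_ball1 0 (rho + 1).
pose D (z : rV) : \bar R := (2 * M * dl)%:E * (\1_(eball (0 : rV) (rho + 1)) z)%:E.
pose psi k z := \int[P]_om (chi (z + Y (dyR m k) om)%R)%:E.
have psi0 k z : 0 <= psi k z by apply: integral_ge0 => om _; rewrite lee_fin.
have mpsi k : measurable_fun setT (psi k).
  apply: (@measurable_fun_intr _ _ _ _ R P (fun (z : rV) om => (chi (z + Y (dyR m k) om)%R)%:E)).
    apply/measurable_EFinP; apply: (measurableT_comp mchi).
    exact: (measurable_shiftY LP (dy_ge0 R m k)).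
  by move=> z om; rewrite lee_fin.
have mD : measurable_fun setT D.
  by apply: emeasurable_funM => //; apply/measurable_EFinP.
have D0 z : 0 <= D z by rewrite mule_ge0 ?lee_fin.
have dj i : (i <= j)%N -> (0 <= dyR m i <= t1)%R.
  by move=> ij; rewrite dy_ge0/= (le_trans (ler_dy _ _ ij)).
have claim k : (k <= j)%N -> forall z, occ P Y U (dyR m k) z + D z <= c%:E * psi k z.
  have near k' z : (k' <= j)%N -> (enorm z < rho + 1)%R -> occ P Y U (dyR m k') z + D z <= c%:E * psi k' z.
    move=> kj zB; apply: (@le_trans _ _ c%:E).
      rewrite /c EFinD; apply: leeD.
        apply: le_trans (Hq z); apply: occ_mono => //; exact: ler_dy.
      by rewrite /D indicE mem_set ?mule1// /eball/= subr0.
    rewrite -[leLHS]mule1; apply: lee_wpmul2l; first by rewrite lee_fin.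
    by apply: Hchi => //; exact: dj.
  have Dfar z : (rho + 1 <= enorm z)%R -> D z = 0.
    move=> zB; rewrite /D indicE memNset ?mule0// /eball/= subr0.
    by apply/negP; rewrite -leNgt.
  elim: k => [_ z|k IH kj z].
    have [zB|zB] := ltP (enorm z) (rho + 1)%R; first exact: near.
    have -> : occ P Y U (dyR m 0) z = 0.
      rewrite /occ integral0_eq// => om _.
      rewrite (_ : dyR m 0 = 0)%R; last by rewrite /dy mul0r.
      by rewrite /path_integral set_itv1 integral_set1.
    by rewrite Dfar// adde0 mule_ge0 ?lee_fin.
  have [zB|zB] := ltP (enorm z) (rho + 1)%R; first exact: near.
  rewrite Dfar// adde0 -add1n dyD occ_add ?dy_ge0// -/dl.
  have mz := measurable_end z dl0.
  have o1 : occ P Y U dl z <= \int[P]_om D (z + Y dl om)%R.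
    rewrite /D ge0_intZl//; last exact: measurable_endE.
    apply: (occ_bounded_le (t1 := t1)) => //.
    by apply: dj; apply: leq_trans kj.
  apply: (le_trans (leeD2r _ o1)).
  rewrite -ge0_intD//; last 3 first.
  - exact: (measurableT_comp mD mz).
  - by apply: (measurableT_comp _ mz); exact: measurable_occ.
  - by move=> om; exact: occ_ge0.
  have -> : psi (1 + k)%N z = \int[P]_om psi k (z + Y dl om)%R.
    rewrite /psi dyD; apply: (@markov_dy (fun x => (chi x)%:E)); last exact: dy_ge0.
      exact/measurable_EFinP.
    by move=> x; rewrite lee_fin.
  rewrite -ge0_intZl//; last exact: (measurableT_comp (mpsi k) mz).
  apply: ge0_le_lower_integral => om _; first by rewrite adde_ge0// occ_ge0.
  by rewrite addeC; apply: IH; exact: ltnW.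
have := claim j (leqnn j) y => h.
apply: (@le_trans _ _ (occ P Y U (dyR m j) y + D y)); first by rewrite leeDl.
by apply: (le_trans h); rewrite EFinM; apply: lee_wpmul2l.
Qed.

(** The factor h g(y) is the probability scale of a jump into the bounded region during time h; q is
    what can be collected once there. All errors caused by the potential near the origin are
    measured by this bound. *)
Lemma occ_far (rho : R) : (0 <= rho)%R -> exists C t1 : R, [/\ (0 <= C)%R, (0 < t1)%R, (t1 <= 1)%R &
  forall (U : rV -> R) m j q, measurable_fun setT U -> (forall x, (0 <= U x)%R) ->
   (forall z, (rho <= enorm z)%R -> U z = 0%R) -> (dyR m j <= t1)%R -> (0 <= q)%R ->
   (forall z, occ P Y U (dyR m j) z <= q%:E) ->
   forall y, (rho + 3 <= enorm y)%R -> occ P Y U (dyR m j) y <= (C * q * dyR m j * g y)%:E].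
Proof.
move=> rho0; have [t1 /andP[t10 t11] Hst] := stay_ge.
have K0 : (0 <= K)%R := le_trans ler01 (est_K LE).
set e := expR ((rho + 2) ^+ 2); have e0 : (0 < e)%R := expR_gt0 _.
exists (4 * e * K)%R, t1; split => //; first by rewrite !mulr_ge0// ltW.
move=> U m j q mU U0 Us ht q0 Hq y hy; set h := dyR m j; have h0 : (0 <= h)%R := dy_ge0 R m j.
(* From the ball of radius rho + 1 the path ends with probability at least 1/2 at norm at most rho +
   2, hence at distance at least 1 from y, where [chi] is at least 2. From y itself the expectation
   of [chi] is O(h g(y)), as the second factor vanishes at displacement 0. *)
pose chi z : R := (4 * e * (gsV 1 z * (1 - gsV 1 (z - y))))%R.
have mgs := @measurable_gsV R d 1.
have mchi : measurable_fun setT chi.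
  apply: measurable_funM => //; apply: measurable_funM => //.
  apply: measurable_funB => //; apply: (measurableT_comp mgs).
  exact: measurable_fun_subrV.
have c0 : (0 <= 4 * e)%R by rewrite mulr_ge0// ltW.
have chi0 z : (0 <= chi z)%R.
  by apply: mulr_ge0 => //; apply: mulr_ge0; rewrite ?gsV_ge0 ?subr_ge0 ?gsV_le1.
have Hchi t (z : rV) : (0 <= t <= t1)%R -> (enorm z < rho + 1)%R -> 1 <= \int[P]_om (chi (z + Y t om)%R)%:E.
  move=> tt zB; have /andP[t0 _] := tt.
  have mB := measurable_endE z (measurable_ball1 z 1) t0.
  apply: (@le_trans _ _ (\int[P]_om (2%:E * (\1_(eball z 1) (z + Y t om)%R)%:E))).
    rewrite ge0_intZl//; apply: le_trans (lee_wpmul2l _ (Hst t z tt)) => //.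
    by rewrite -EFinM mulfV.
  apply: ge0_le_lower_integral => om _; first by rewrite -EFinM lee_fin mulr_ge0.
  rewrite -EFinM lee_fin indicE; have [|_] := boolP (_ \in _); last by rewrite mulr0.
  rewrite inE /eball/= addrAC subrr add0r mulr1 => Y1.
  have z2 : (enorm (z + Y t om) <= rho + 2)%R.
    by apply: (le_trans (ler_enormD _ _)); move: zB Y1; lra.
  have z3 : (1 <= enorm (z + Y t om - y))%R.
    have := ler_enormB (z + Y t om)%R (z + Y t om - y)%R; rewrite subKr => hh.
    by move: hy; lra.
  have h1 := gsV1_le_half z3.
  have h2 : (expR (- (rho + 2) ^+ 2) <= gsV 1 (z + Y t om))%R.
    by rewrite gsVE mul1r ler_expR lerN2 lerXn2r ?nnegrE ?enorm_ge0// addr_ge0.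
  have h3 : (2^-1 <= 1 - gsV 1 (z + Y t om - y))%R by lra.
  have h4 : (expR (- (rho + 2) ^+ 2) * 2^-1 <= gsV 1 (z + Y t om) * (1 - gsV 1 (z + Y t om - y)))%R.
    by apply: ler_pM; rewrite ?expR_ge0.
  apply: le_trans (ler_wpM2l c0 h4).
  rewrite [(4 * e)%R]mulrC mulrACA -expRD subrr expR0 mul1r.
  by rewrite le_eqVlt; apply/orP; left; apply/eqP; field.
have h01 : (0 <= h <= 1)%R by rewrite h0 (le_trans ht).
have HA : \int[P]_om (chi (y + Y h om)%R)%:E <= (4 * e * (K * h * g y))%:E.
  rewrite (@EFin_Rintegral _ (4 * e)%R); last 2 first.
  - exact: (measurableT_comp mchi (measurable_end y h0)).
  - move=> om; rewrite ger0_norm// ler_piMr// mulr_ile1 ?gsV_ge0 ?gsV_le1 ?subr_ge0 ?gsV_le1//.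
    by rewrite lerBlDl lerDr gsV_ge0.
  pose f om : R := (gsV 1 (y + Y h om) * (1 - gsV 1 (Y h om)))%R.
  have -> : (\int[P]_om chi (y + Y h om) = \int[P]_om (4 * e * f om))%R.
    by apply: eq_Rintegral => om _; rewrite /chi /f [(_ + Y h om - y)%R]addrAC subrr add0r.
  have If : P.-integrable setT (EFin \o f).
    apply: (@integrable_bounded_prob _ _ _ _ _ 1%R).
      apply: measurable_funM.
        exact: (measurableT_comp mgs (measurable_end y h0)).
      by apply: measurable_funB => //; exact: (measurableT_comp mgs (mY h0)).
    move=> om; rewrite ger0_norm /f ?mulr_ge0 ?mulr_ile1 ?gsV_ge0 ?gsV_le1 ?subr_ge0 ?gsV_le1//.
    by rewrite lerBlDl lerDr gsV_ge0.
  rewrite (RintegralZl _ measurableT If) lee_fin ler_wpM2l//.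
  exact: (est_annulus LE).
have bnd (V : rV -> R) (M : R) : measurable_fun setT V -> (forall x, (0 <= V x <= M)%R) ->
    (forall z, (rho <= enorm z)%R -> V z = 0%R) -> (forall z, occ P Y V h z <= q%:E) ->
    occ P Y V h y <= (q * (4 * e * (K * h * g y)))%:E.
  move=> mV VM Vs HV; set A := (4 * e * (K * h * g y))%R.
  have A0 : (0 <= A)%R by rewrite !mulr_ge0// ltW// (est_g_gt0 LE).
  have M0 : (0 <= M)%R by case/andP: (VM 0%R) => v0 v1; exact: le_trans v1.
  have V0 x : (0 <= V x)%R by case/andP: (VM x).
  have := HV y; have := occ_ge0 P Y V0 h y; case ve : (occ P Y V h y) => [v| |]// _ _.
  rewrite lee_fin; apply: (@le_add_inv_nat _ _ _ (2 * M * A)) => [|n]; first by apply: mulr_ge0 => //; exact: mulr_ge0.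
  have hE := dy_refine m n j; rewrite -/h in hE.
  have := @occ_bounded_far V M rho t1 q A (m + n)%N (j * 2 ^ n)%N y chi mV VM Vs Hst.
  rewrite -hE ve => /(_ ht q0 HV mchi chi0 Hchi HA); rewrite lee_fin => hv.
  apply: (le_trans hv); rewrite mulrDl lerD2l [leRHS]mulrAC; apply: ler_wpM2r => //.
  by apply: ler_wpM2l; [exact: mulr_ge0|exact: dy1_le].
apply: occ_truncf_sup => // n.
have -> : (4 * e * K * q * h * g y = q * (4 * e * (K * h * g y)))%R by ring.
apply: (bnd _ n%:R).
- exact: measurable_truncf.
- by move=> x; rewrite truncf_ge0// truncf_le_nat.
- by move=> z hz; rewrite /truncf Us// min_l.
- move=> z; apply: le_trans (Hq z); apply: ge0_le_lower_integral => om _.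
    by apply: path_integral_ge0; exact: truncf_ge0.
  by apply: path_integral_le => x; [exact: truncf_ge0|exact: truncf_le].
Qed.

End small_time.
End end_time.

(** * Crude decay of eigenfunctions *)

Section crude.
Context {R : realType} {dO : measure_display} {Omega : measurableType dO} {d : nat}.
Variables (P : probability Omega R) (Y : R -> Omega -> 'rV[R]_d).
Local Notation rV := 'rV[R]_d.
Local Notation dyR := (@dy R).
Hypothesis LP : levy_process P Y.
Hypothesis Y0 : forall w, Y 0 w = 0.
Hypothesis Yrc : forall w, rcont (Y ^~ w).
Local Open Scope ereal_scope.

Let mY := levy_measurable LP.

Definition small_occ (U : rV -> R) : Prop := forall e : R, (0 < e)%R ->
  exists2 t0 : R, (0 < t0)%R & forall t y, (0 <= t <= t0)%R -> occ P Y U t y <= e%:E.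

Lemma dy1_small (t0 : R) : (0 < t0)%R -> exists m0, forall m, (m0 <= m)%N -> (dyR m 1 <= t0)%R.
Proof.
move=> t00; pose n := Num.truncn t0^-1; exists n => m nm.
apply: (@le_trans _ _ n.+1%:R^-1%R).
  by have := dy1_le (m - n) n; rewrite subnK//; exact.
rewrite invf_ple ?posrE ?ltr0n//; exact/ltW/truncnS_gt.
Qed.

(** A rearrangement of (e^X - 1)(M - Z) >= 0, free of subtraction so that infinite X is allowed. *)
Lemma expeR_weight (X : \bar R) (Z : \bar R) (M : R) : 0 <= X -> 0 <= Z <= M%:E ->
  expeR X * Z + M%:E <= Z + M%:E * expeR X.
Proof.
move=> X0 /andP[]; case: Z => [z| |]//; rewrite !lee_fin => z0 zM.
have [z1|z1] := eqVneq z 0%R.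
  rewrite z1 mule0 !add0e -[leLHS]mule1; apply: lee_wpmul2l; first by rewrite lee_fin -z1.
  by rewrite -expeR0 lee_expeR.
case: X X0 => [x| |]//= X0.
  rewrite -!EFinM -!EFinD lee_fin; rewrite lee_fin in X0.
  have h : (1 <= expR x)%R by rewrite -expR0 ler_expR.
  have h2 : (0 <= (expR x - 1) * (M - z))%R by rewrite mulr_ge0 ?subr_ge0.
  have -> : (z + M * expR x = expR x * z + M + (expR x - 1) * (M - z))%R by ring.
  by rewrite lerDl.
rewrite [M%:E * _]mulry gtr0_sg ?mul1e ?addey ?leey//.
by rewrite (lt_le_trans _ zM)// lt_neqAle eq_sym z1.
Qed.

(** Khasminskii's bound in additive form: weighting by the exponential costs at most M E(e^A - 1),
    which is of the order of the occupation and therefore small from far away. *)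
Lemma kato_weight (U : rV -> R) m j (q M : R) y (Z : Omega -> \bar R) :
  measurable_fun setT U -> (forall x, (0 <= U x)%R) -> (q < 1)%R ->
  (forall z, occ P Y U (dyR m j) z <= q%:E) ->
  measurable_fun setT Z -> (forall w, 0 <= Z w <= M%:E) ->
  \int[P]_w (expeR (path_integral U (dyR m j) (fun s => y + Y s w)%R) * Z w) <=
  \int[P]_w Z w + (M / (1 - q))%:E * occ P Y U (dyR m j) y.
Proof.
move=> mU U0 q1 Hq mZ ZM.
have Z0 w : 0 <= Z w by case/andP: (ZM w).
have M0 : (0 <= M)%R.
  have [w _] : exists w : Omega, True.
    apply: contrapT => h; have := @probability_setT _ _ _ P.
    rewrite (_ : setT = set0); first by rewrite measure0 => -[] /esym/eqP; rewrite oner_eq0.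
    by apply/seteqP; split => // w _; apply: h; exists w.
  by case/andP: (ZM w) => z0 z1; rewrite -lee_fin; exact: le_trans z1.
have mpi := measurable_pi_Y LP Y0 Yrc mU U0 (dyR m j) y.
have me : measurable_fun setT (fun w => expeR (path_integral U (dyR m j) (fun s => y + Y s w)%R)).
  exact: (measurableT_comp (@measurable_expeR R) mpi).
have h : \int[P]_w (expeR (path_integral U (dyR m j) (fun s => y + Y s w)%R) * Z w + M%:E) <=
   \int[P]_w (Z w + M%:E * expeR (path_integral U (dyR m j) (fun s => y + Y s w)%R)).
  apply: ge0_le_lower_integral => w _; first by rewrite adde_ge0 ?mule_ge0 ?expeR_ge0 ?lee_fin.
  by apply: expeR_weight; rewrite ?ZM// path_integral_ge0.
have ME : 0 <= M%:E by rewrite lee_fin.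
have mE : measurable_fun [set: Omega] (cst M%:E : Omega -> \bar R) := measurable_cst _.
have E0 w : 0 <= expeR (path_integral U (dyR m j) (fun s => y + Y s w)%R) by exact: expeR_ge0.
rewrite (ge0_intD P (emeasurable_funM me mZ) (fun w => mule_ge0 (E0 w) (Z0 w)) mE (fun=> ME)) in h.
rewrite integral_cst//= probability_setT mule1 in h.
rewrite (ge0_intD P mZ Z0 (emeasurable_funM mE me) (fun w => mule_ge0 ME (E0 w))) in h.
rewrite (ge0_intZl P M0 me E0) in h.
have k := khasminskii LP Y0 Yrc mU U0 q1 Hq y.
have {}h := le_trans h (leeD2l _ (lee_wpmul2l _ k)).
rewrite -(@leeD2rE _ M%:E)//; apply: (le_trans (h _)); first by rewrite lee_fin.
rewrite [X in _ + X <= _]ge0_muleDr ?mule_ge0 ?lee_fin ?invr_ge0 ?subr_ge0 ?(ltW q1) ?occ_ge0//.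
by rewrite mule1 muleA -EFinM addeA addeAC.
Qed.

Lemma path_integral_posneg (V : rV -> R) t p :
  path_integral V t p = path_integral (V^\+)%R t p - path_integral (V^\-)%R t p.
Proof.
rewrite /path_integral integralE; congr (_ - _); apply: eq_integral => s _.
  by rewrite funeposE/= /funrpos EFin_max.
by rewrite funenegE/= /funrneg EFin_max.
Qed.

Section eigen.
Variables (V : rV -> R) (lambda : R).
Hypothesis mV : measurable_fun setT V.
Local Notation Vp := (V^\+)%R.
Local Notation Vm := (V^\-)%R.

Lemma Vp_ge0 x : (0 <= Vp x)%R. Proof. by rewrite /funrpos le_max lexx orbT. Qed.
Lemma Vm_ge0 x : (0 <= Vm x)%R. Proof. by rewrite /funrneg le_max lexx orbT. Qed.
Lemma measurable_Vp : measurable_fun setT Vp. Proof. exact: measurable_funrpos. Qed.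
Lemma measurable_Vm : measurable_fun setT Vm. Proof. exact: measurable_funrneg. Qed.

(** Splitting exp(-int V) into two exponentials fails only where the integral of the negative part
    is infinite; finite occupation makes this a null set. *)
Lemma feynman_kac_abs_le (phi : rV -> R) t y : measurable_fun setT phi -> (0 <= t)%R ->
  occ P Y Vm t y < +oo ->
  `|feynman_kac P Y V t phi y| <=
  \int[P]_w (expeR (path_integral Vm t (fun s => y + Y s w)%R) *
    (expeR (- path_integral Vp t (fun s => y + Y s w)%R) * `|phi (y + Y t w)|%:E)).
Proof.
move=> mphi t0 oy.
pose b w := path_integral Vm t (fun s => y + Y s w)%R.
pose c w := path_integral Vp t (fun s => y + Y s w)%R.
have mb : measurable_fun setT b := measurable_pi_Y LP Y0 Yrc measurable_Vm Vm_ge0 t y.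
have mc : measurable_fun setT c := measurable_pi_Y LP Y0 Yrc measurable_Vp Vp_ge0 t y.
have b0 w : 0 <= b w := path_integral_ge0 _ _ Vm_ge0.
have c0 w : 0 <= c w := path_integral_ge0 _ _ Vp_ge0.
have my := measurable_end LP y t0.
have E : feynman_kac P Y V t phi y = \int[P]_w (expeR (- (c w - b w)) * (phi (y + Y t w)%R)%:E).
  by apply: eq_integral => w _; rewrite path_integral_posneg.
rewrite E; apply: (le_trans (le_abse_integral _ _ _)) => //.
  apply: emeasurable_funM; last by apply/measurable_EFinP; exact: (measurableT_comp mphi my).
  apply: (measurableT_comp (@measurable_expeR R)); apply: measurableT_comp => //.
  exact: emeasurable_funB.
rewrite (@negligible_lower_integral_eq _ _ _ P (b @^-1` [set +oo]) _
   (fun w => expeR (b w) * (expeR (- c w) * `|phi (y + Y t w)|%:E))) //.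
- by rewrite -[X in measurable X]setTI; exact: mb.
- have Ib : P.-integrable setT b.
    apply/integrableP; split => //.
    by rewrite (eq_integral b)// => w _; rewrite gee0_abs.
  have [N [mN PN NS]] := integrable_ae measurableT Ib.
  apply/eqP; rewrite -measure_le0 -PN; apply: le_measure; rewrite ?inE//.
    by rewrite -[X in measurable X]setTI; exact: mb.
  by move=> w /= bw; apply: NS => /= /(_ I); rewrite bw.
move=> w /= bw; rewrite abseM gee0_abs ?expeR_ge0// muleA; congr (_ * _).
have : b w \is a fin_num by rewrite ge0_fin_numE// lt_neqAle leey andbT; apply/eqP.
case: (b w) => // r _; rewrite -expeRD; congr expeR.
by case: (c w) => [s| |]//=; congr EFin; rewrite opprD opprK addrC.
Qed.

Lemma eigen_le (phi : rV -> R) t y : eigenfunction P Y V lambda phi -> (0 < t)%R ->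
  occ P Y Vm t y < +oo ->
  `|phi y|%:E <= (expR (lambda * t))%:E *
  \int[P]_w (expeR (path_integral Vm t (fun s => y + Y s w)%R) *
    (expeR (- path_integral Vp t (fun s => y + Y s w)%R) * `|phi (y + Y t w)|%:E)).
Proof.
move=> [mphi eig] t0 oy; rewrite -abse_EFin -(eig t y t0) abseM.
rewrite [`|(expR _)%:E|]gee0_abs ?lee_fin ?expR_ge0//; apply: lee_wpmul2l.
  by rewrite lee_fin expR_ge0.
exact: (feynman_kac_abs_le mphi (ltW t0)).
Qed.

Lemma path_integralD (U1 U2 : rV -> R) t p : measurable_fun setT U1 -> measurable_fun setT U2 ->
  (forall x, (0 <= U1 x)%R) -> (forall x, (0 <= U2 x)%R) -> measurable_fun setT p ->
  path_integral (fun x => U1 x + U2 x)%R t p = path_integral U1 t p + path_integral U2 t p.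
Proof.
move=> m1 m2 h1 h2 mp; rewrite /path_integral -ge0_integralD//.
- by move=> s _; rewrite lee_fin.
- by apply: measurable_funTS; apply/measurable_EFinP; exact: (measurableT_comp m1 mp).
- by move=> s _; rewrite lee_fin.
- by apply: measurable_funTS; apply/measurable_EFinP; exact: (measurableT_comp m2 mp).
Qed.

Lemma path_integral_cst (c t : R) (p : R -> rV) : (0 <= t)%R ->
  path_integral (fun=> c) t p = (c * t)%:E.
Proof.
move=> t0; rewrite /path_integral integral_cst//= lebesgue_measure_itv/= lte_fin; case: ltP => h.
  by rewrite oppr0 adde0 -EFinM.
have -> : t = 0%R by apply/eqP; rewrite eq_le h t0.
by rewrite mule0 mulr0.
Qed.

Lemma exp_compare (a b X : \bar R) (r : R) : 0 <= a -> r%:E + b <= a + X ->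
  expeR b * expeR (- a) <= (expR (- r))%:E * expeR X.
Proof.
case: a => [a| |]// a0 h; last by rewrite /= mule0 mule_ge0 ?lee_fin ?expR_ge0 ?expeR_ge0.
have -> : (expR (- r))%:E = expeR (- r)%:E by [].
rewrite -!expeRD lee_expeR.
have : - r%:E + (r%:E + b) + - a%:E <= - r%:E + (a%:E + X) + - a%:E by rewrite leeD2r// leeD2l.
rewrite addeA -EFinN -EFinD addNr add0e => h1; apply: (le_trans h1).
by rewrite addeCA addeAC -EFinN -EFinD subrr add0e.
Qed.

Section bound.
Variables (nu g w : rV -> R) (a K : R).
Hypothesis LE : levy_estimates P Y nu g w a K.
Hypothesis SVm : small_occ Vm.
Hypothesis conf : confining V.
Hypothesis lambda_gt0 : (0 < lambda)%R.

Let K0 : (0 <= K)%R. Proof. exact: le_trans ler01 (est_K LE). Qed.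

Lemma w_bounded x : (w x <= K * K)%R.
Proof. by apply: (le_trans (est_wg LE x)); apply: ler_wpM2l => //; exact: (est_g_le LE x). Qed.

Lemma int_w_le t y : (0 <= t)%R -> \int[P]_om (w (y + Y t om)%R)%:E <= (expR (K * t) * w y)%:E.
Proof.
move=> t0; rewrite (@EFin_Rintegral _ _ _ P _ (K * K)%R).
- by rewrite lee_fin; exact: (est_w_growth LE).
- exact: (measurableT_comp (est_mw LE) (measurable_end LP y t0)).
- by move=> om; rewrite ger0_norm ?w_bounded// (est_w_ge0 LE).
Qed.

Lemma g_lower (r : R) : exists2 c : R, (0 < c)%R & forall y, (enorm y <= r)%R -> (c <= g y)%R.
Proof.
have K1 : (0 < K)%R := lt_le_trans ltr01 (est_K LE).
have c0 : (0 < K * expR (a * r))%R by rewrite mulr_gt0 ?expR_gt0.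
exists (g 0 / (K * expR (a * r)))%R; first by rewrite divr_gt0// (est_g_gt0 LE).
move=> y yr; rewrite ler_pdivrMr// mulrC; apply: (le_trans (est_exp LE 0%R y)).
rewrite ler_wpM2r ?(ltW (est_g_gt0 LE y))// ler_wpM2l// ler_expR ler_wpM2l ?(est_a LE)//.
by rewrite enorm0 sub0r normrN ger0_norm ?enorm_ge0.
Qed.

Lemma occ_le_add (U : rV -> R) (c t : R) y : measurable_fun setT U -> (forall x, (0 <= U x)%R) ->
  (0 <= c)%R -> (0 <= t)%R -> (forall x, (U x <= c + Vm x)%R) ->
  occ P Y U t y <= (c * t)%:E + occ P Y Vm t y.
Proof.
move=> mU U0 c0 t0 UV.
have -> : (c * t)%:E + occ P Y Vm t y =
   \int[P]_om ((c * t)%:E + path_integral Vm t (fun s => y + Y s om)%R).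
  rewrite ge0_intD//; last 3 first.
  - by move=> om; rewrite lee_fin mulr_ge0.
  - exact: (measurable_pi_Y LP Y0 Yrc measurable_Vm Vm_ge0).
  - by move=> om; apply: path_integral_ge0; exact: Vm_ge0.
  by rewrite integral_cst//= probability_setT mule1.
apply: ge0_le_lower_integral => om _; first exact: path_integral_ge0.
rewrite -(path_integral_cst c (fun s => y + Y s om)%R t0).
rewrite !(path_integral_rec Y0 Yrc) -path_integralD//.
- by apply: path_integral_le => // x.
- exact: measurable_Vm.
- exact: measurable_rec_shift.
Qed.

(** One step of fixed length h contracts any bound by multiples of w up to a source term: |phi| <= L
    w + M th^n for every n. Both the near and the far source are bounded by C1 w, the former because
    g is bounded below on bounded sets. *)
Lemma crude_bound : exists2 C2 : R, (0 <= C2)%R & forall (phi : rV -> R) M,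
  eigenfunction P Y V lambda phi -> (forall x, (`|phi x| <= M)%R) ->
  forall y, (`|phi y| <= C2 * M * w y)%R.
Proof.
have K1 := est_K LE.
(* With this [c] a step contributes e^(lambda h - c h) = e^(-2Kh), which beats the growth e^(Kh) of
   E w and leaves the factor [kap] < 1. *)
pose c := (lambda + 2 * K)%R; have c0 : (0 < c)%R by rewrite /c; move: lambda_gt0 K1; lra.
have [r0 Hr0] := conf c; pose rho := Num.max r0 0%R.
have rho0 : (0 <= rho)%R by rewrite /rho le_max lexx orbT.
(* V >= c - U everywhere, and U vanishes off a bounded set because V is confining. U is at most c
   plus the negative part of V, so its occupation is small in small time. *)
pose U x := Num.max (c - V x)%R 0%R.
have mU : measurable_fun setT U by apply: measurable_maxr => //; exact: measurable_funB.
have U0 x : (0 <= U x)%R by rewrite /U le_max lexx orbT.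
have Us z : (rho <= enorm z)%R -> U z = 0%R.
  move=> hz; rewrite /U max_r// subr_le0; apply: Hr0.
  by apply: le_trans hz; rewrite /rho le_max lexx.
have UV x : (U x <= c + Vm x)%R.
  rewrite /U ge_max addr_ge0 ?Vm_ge0 ?(ltW c0)// andbT lerD2l /funrneg le_max lexx//.
have [C [t1 [C0 t10 t11 far]]] := occ_far LP Y0 Yrc LE rho0.
have q4 : (0 < 4^-1 :> R)%R by rewrite invr_gt0.
have [t0 t00 Ht0] := SVm q4.
have c40 : (0 < (4 * c)^-1)%R by rewrite invr_gt0 mulr_gt0.
have [m hm] : exists m, (dyR m 1 <= Num.min t1 (Num.min t0 (4 * c)^-1))%R.
  by have [|m0 H] := @dy1_small (Num.min t1 (Num.min t0 (4 * c)^-1))%R; [rewrite !lt_min t10 t00|exists m0; exact: H].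
move: hm; rewrite !le_min => /and3P[ht1 ht0 htc]; set h := dyR m 1 in ht1 ht0 htc.
have h0 : (0 < h)%R by rewrite /h /dy mul1r invr_gt0 exprn_gt0.
have Hq z : occ P Y U h z <= (2^-1)%:E.
  apply: (le_trans (occ_le_add z mU U0 (ltW c0) (ltW h0) UV)).
  have -> : (2^-1 = 4^-1 + 4^-1 :> R)%R by field.
  rewrite EFinD; apply: leeD; last by apply: Ht0; rewrite (ltW h0).
  by rewrite lee_fin mulrC -ler_pdivlMr//; apply: (le_trans htc); rewrite invfM.
have [cg cg0 Hcg] := g_lower (rho + 3)%R.
pose C1 := ((C + cg^-1) * K)%R; have C10 : (0 <= C1)%R by rewrite mulr_ge0// addr_ge0// invr_ge0 ltW.
have occU y : occ P Y U h y <= (C1 * w y)%:E.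
  have gw : (g y <= K * w y)%R := est_gw LE y.
  have g0 := est_g_gt0 LE y.
  apply: (@le_trans _ _ (((C + cg^-1) * g y)%:E)); last first.
    by rewrite lee_fin /C1 -mulrA; apply: ler_wpM2l => //; rewrite addr_ge0// invr_ge0 ltW.
  have [yn|yf] := leP (enorm y) (rho + 3)%R.
    apply: (le_trans (Hq y)); rewrite lee_fin mulrDl; apply: (@le_trans _ _ (cg^-1 * g y)%R).
      apply: (@le_trans _ _ 1%R); first by rewrite invf_le1// ler1n.
      by rewrite mulrC ler_pdivlMr// mul1r; exact: Hcg.
    by rewrite lerDr mulr_ge0// ltW.
  apply: (le_trans (far U m 1%N 2^-1%R mU U0 Us ht1 _ Hq y (ltW yf))) => //.
  rewrite lee_fin ler_wpM2r ?(ltW g0)//; apply: (@le_trans _ _ C).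
    rewrite -mulrA ler_piMr// mulr_ile1// ?invr_ge0//; first exact: ltW.
      by rewrite invf_le1// ler1n.
    exact: le_trans t11.
  by rewrite lerDl invr_ge0 ltW.
pose kap := expR (- (K * h)); have kap0 : (0 < kap)%R := expR_gt0 _.
have kap1 : (kap < 1)%R by rewrite /kap -expR0 ltr_expR oppr_lt0 mulr_gt0// (lt_le_trans ltr01).
pose th := expR (- (2 * K * h)).
have thE : (th * expR (K * h) = kap)%R by rewrite /th /kap -expRD; congr expR; ring.
have th0 : (0 <= th)%R := expR_ge0 _.
have th1 : (th < 1)%R.
  by rewrite /th -expR0 ltr_expR oppr_lt0 !mulr_gt0// (lt_le_trans ltr01).
clearbody C1 kap; have D0 : (0 <= 1 - kap)%R by rewrite subr_ge0 ltW.
exists (2 * C1 / (1 - kap))%R; first by apply: divr_ge0 => //; exact: mulr_ge0.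
move=> phi M eig phiM.
have M0 : (0 <= M)%R := le_trans (normr_ge0 _) (phiM 0%R).
have mphi : measurable_fun setT phi by case: eig.
have mnphi : measurable_fun setT (fun x => `|phi x|%R) by exact: measurableT_comp.
have oy y : occ P Y Vm h y < +oo.
  by apply: (@le_lt_trans _ _ (4^-1)%:E); [apply: Ht0; rewrite (ltW h0)|rewrite ltry].
have step y : `|phi y|%:E <= th%:E * (\int[P]_om `|phi (y + Y h om)|%:E + (2 * M * (C1 * w y))%:E).
  apply: (le_trans (eigen_le eig h0 (oy y))).
  pose X om := path_integral U h (fun s => y + Y s om)%R.
  have mX : measurable_fun setT X := measurable_pi_Y LP Y0 Yrc mU U0 h y.
  have mZ : measurable_fun setT (fun om => `|phi (y + Y h om)%R|%:E).
    by apply: (measurable_endE LP (f := fun x => `|phi x|%R)) => //; exact: ltW.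
  apply: (@le_trans _ _ ((expR (lambda * h))%:E *
     \int[P]_om ((expR (- (c * h)))%:E * (expeR (X om) * `|phi (y + Y h om)|%:E)))).
    apply: lee_wpmul2l; first by rewrite lee_fin expR_ge0.
    apply: ge0_le_lower_integral => om _.
      by rewrite !mule_ge0 ?expeR_ge0.
    rewrite !muleA; apply: lee_wpmul2r => //; apply: exp_compare.
      by apply: path_integral_ge0; exact: Vp_ge0.
    rewrite -(path_integral_cst c (fun s => y + Y s om)%R (ltW h0)) /X.
    rewrite !(path_integral_rec Y0 Yrc); have mr := measurable_rec_shift Y y om.
    have mc : measurable_fun setT (fun _ : rV => c) := measurable_cst _.
    rewrite -(path_integralD h mc measurable_Vm (fun=> ltW c0) Vm_ge0 mr).
    rewrite -(path_integralD h measurable_Vp mU Vp_ge0 U0 mr).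
    apply: path_integral_le => x; first by rewrite addr_ge0 ?Vm_ge0// ltW.
    have h1 : (c - V x <= U x)%R by rewrite /U le_max lexx.
    have h2 : (V x = Vp x - Vm x)%R.
      by rewrite /funrpos/= /funrneg/=; case: (leP 0%R (V x)) => hV; [rewrite max_r ?oppr_le0//|rewrite max_l ?oppr_ge0 ?(ltW hV)//]; lra.
    by move: h1; rewrite h2; lra.
  rewrite ge0_intZl ?expR_ge0//; last 2 first.
  - by apply: emeasurable_funM => //; exact: (measurableT_comp (@measurable_expeR R) mX).
  - by move=> om; rewrite mule_ge0 ?expeR_ge0.
  rewrite muleA -EFinM -expRD.
  have -> : (lambda * h + - (c * h) = - (2 * K * h))%R by rewrite /c; ring.
  apply: lee_wpmul2l; first by rewrite lee_fin.
  have h2 : (2^-1 < 1 :> R)%R by rewrite invf_lt1// ltr1n.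
  apply: (le_trans (@kato_weight U m 1%N 2^-1%R M y (fun om => `|phi (y + Y h om)|%:E) mU U0 h2 Hq mZ _)).
    by move=> om; rewrite !lee_fin normr_ge0 phiM.
  have -> : (M / (1 - 2^-1) = 2 * M)%R by field.
  apply: leeD2l; rewrite [leRHS]EFinM.
  by apply: lee_wpmul2l => //; rewrite lee_fin mulr_ge0.
(* The solution of L = [kap] L + 2 M C1, the fixed point of the iteration. *)
pose L := (2 * C1 / (1 - kap) * M)%R.
have L0 : (0 <= L)%R by apply: mulr_ge0 => //; apply: divr_ge0 => //; exact: mulr_ge0.
have iter n : forall y, (`|phi y| <= L * w y + M * th ^+ n)%R.
  elim: n => [y|n IH y].
    by rewrite expr0 mulr1 (le_trans (phiM y))// lerDr mulr_ge0// (est_w_ge0 LE).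
  rewrite -lee_fin; apply: (le_trans (step y)).
  have i1 : \int[P]_om `|phi (y + Y h om)|%:E <= (L * (expR (K * h) * w y) + M * th ^+ n)%:E.
    apply: (@le_trans _ _ (\int[P]_om (L%:E * (w (y + Y h om)%R)%:E + (M * th ^+ n)%:E))).
      by apply: ge0_le_lower_integral => om _; rewrite ?lee_fin// -EFinM -EFinD lee_fin.
    have mw := measurable_endE LP y (est_mw LE) (ltW h0).
    have w0 om : 0 <= (w (y + Y h om)%R)%:E by rewrite lee_fin (est_w_ge0 LE).
    rewrite ge0_intD//; last 3 first.
    - exact: emeasurable_funM.
    - by move=> om; rewrite mule_ge0.
    - by move=> om; rewrite lee_fin mulr_ge0// exprn_ge0.
    rewrite integral_cst//= probability_setT mule1 EFinD leeD2r// ge0_intZl// [leRHS]EFinM.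
    by apply: lee_wpmul2l => //; exact: int_w_le (ltW h0).
  apply: (le_trans (lee_wpmul2l _ (leeD2r _ i1))); first by rewrite lee_fin.
  rewrite -EFinD -EFinM lee_fin exprS.
  have -> : (th * (L * (expR (K * h) * w y) + M * th ^+ n + 2 * M * (C1 * w y)) =
     (L * (th * expR (K * h)) + th * (2 * M * C1)) * w y + M * (th * th ^+ n))%R by ring.
  rewrite lerD2r ler_wpM2r ?(est_w_ge0 LE)// thE.
  have LK : (L * kap + 2 * M * C1 = L)%R.
    by rewrite /L; field; rewrite subr_eq0 gt_eqF.
  rewrite -[leRHS]LK lerD2l; apply: ler_piMl; last exact: ltW.
  by rewrite !mulr_ge0.
move=> y; pose s := (2 * K * h)%R.
have s0 : (0 < s)%R by rewrite !mulr_gt0// (lt_le_trans ltr01).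
apply: (@le_add_inv_nat _ _ _ (M * (1 + s^-1))%R) => [|n].
  by rewrite mulr_ge0// addr_ge0// invr_ge0 ltW.
apply: (le_trans (iter n y)); rewrite /L mulrAC; apply: lerD.
  by rewrite le_eqVlt; apply/orP; left; apply/eqP; ring.
rewrite -mulrA; apply: ler_wpM2l => //.
rewrite /th -/s -expRM_natl mulrN expRN -[leLHS]mul1r ler_pdivrMr ?expR_gt0//.
rewrite mulrAC ler_pdivlMr ?ltr0n// mul1r.
have e1 : (1 + n%:R * s <= expR (n%:R * s))%R := expR_ge1Dx _.
have s1 : (0 <= 1 + s^-1)%R by rewrite addr_ge0// invr_ge0 ltW.
apply: le_trans (ler_wpM2l s1 e1).
have -> : ((1 + s^-1) * (1 + n%:R * s) = n.+1%:R + (s^-1 + n%:R * s))%R.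
  by rewrite -natr1; field; rewrite gt_eqF.
by rewrite lerDl addr_ge0 ?invr_ge0 ?mulr_ge0 ?(ltW s0).
Qed.

End bound.
End eigen.
End crude.

(** * The upper bound *)

Definition ecball (R : realType) (d : nat) (x : 'rV[R]_d) (r : R) : set 'rV[R]_d :=
  [set y | enorm (y - x) <= r].

(** The ball is closed, so that a right-continuous path staying in it at all dyadic times stays in
    it at all times; its radius is below 1, so such a path has not left the open unit ball. *)
Definition ballf (R : realType) (d : nat) (x : 'rV[R]_d) : 'rV[R]_d -> R := \1_(ecball x (7 / 8)).

Lemma upper_scalar (R : realType) (E el l z Z M C h gy G : R) : 0 <= z -> 0 <= l -> 0 <= E ->
  0 <= M * C * h -> 0 <= gy -> E - 1 <= l -> E <= el -> z <= Z -> gy <= G ->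
  E * (z + M * (2 * (C * 2^-1 * h * gy))) <= z + (l * Z + el * (M * C * h) * G).
Proof.
move=> z0 l0 E0 c0 gy0 El Ee zZ gG.
have h1 : (E - 1) * z <= l * z by exact: ler_wpM2r.
have h2 : l * z <= l * Z by exact: ler_wpM2l.
have h3 : E * (M * C * h) * gy <= el * (M * C * h) * G.
  by apply: ler_pM => //; [exact: mulr_ge0|exact: ler_wpM2r].
have -> : E * (z + M * (2 * (C * 2^-1 * h * gy))) = E * z + E * (M * C * h) * gy by field.
lra.
Qed.

Section upper.
Context {R : realType} {dO : measure_display} {Omega : measurableType dO} {d : nat}.
Variables (P : probability Omega R) (Y : R -> Omega -> 'rV[R]_d).
Local Notation rV := 'rV[R]_d.
Local Notation dyR := (@dy R).
Hypothesis LP : levy_process P Y.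
Hypothesis Y0 : forall w, Y 0 w = 0.
Hypothesis Yrc : forall w, rcont (Y ^~ w).
Local Open Scope ereal_scope.

Let mY := levy_measurable LP.

Section killed.
Variables (U f : rV -> R).
Hypothesis mU : measurable_fun setT U.
Hypothesis mf : measurable_fun setT f.
Hypothesis U0 : forall x, (0 <= U x)%R.
Hypothesis f0 : forall x, (0 <= f x)%R.
Hypothesis f1 : forall x, (f x <= 1)%R.

Local Notation S := (Sop P Y (fun=> 0%R) U f).

Definition decay t (p : R -> rV) : \bar R := expeR (- path_integral U t p).

Lemma eWU_decay t p : eWU (fun=> 0%R) U t p = decay t p.
Proof.
rewrite /eWU (_ : path_integral (fun=> 0%R) t p = 0) ?expeR0 ?mul1e//.
by rewrite /path_integral integral0_eq.
Qed.

Lemma decay_ge0 t p : 0 <= decay t p. Proof. exact: expeR_ge0. Qed.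

Lemma decay_le1 t p : decay t p <= 1.
Proof. by rewrite -expeR0 lee_expeR leeNl oppe0 path_integral_ge0. Qed.

Lemma measurable_decay t y : measurable_fun setT (fun w => decay t (fun s => y + Y s w)%R).
Proof.
apply: (measurableT_comp (@measurable_expeR R)); apply: measurableT_comp => //.
exact: (measurable_pi_Y LP Y0 Yrc mU U0).
Qed.

(** The weight exp(-int U) after i steps, multiplied by [f] at each grid point. For the indicator of
    a ball, 2^-m times the sum over i is a Riemann sum for the Green operator of that ball. *)
Definition occn m i y := iter i (S m) (fun=> 1) y.

Let m0 : measurable_fun setT (fun _ : rV => 0%R : R) := measurable_cst _.
Let z0 (x : rV) : (0 <= (fun=> 0%R) x :> R)%R := lexx _.
Let m1 : measurable_fun setT (fun _ : rV => 1 : \bar R) := measurable_cst _.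

Lemma occn_ge0 m i y : 0 <= occn m i y.
Proof. exact: (@iter_Sop_ge0 _ _ _ _ P Y (fun=> 0%R) U f f0 m i (fun=> 1) y (fun=> lee01)). Qed.

Lemma measurable_occn m i : measurable_fun setT (occn m i).
Proof. exact: (measurable_iter_Sop LP Y0 Yrc m0 mU mf z0 U0 f0 m i m1 (fun=> lee01)). Qed.

Lemma SopE m F y : S m F y =
  \int[P]_w ((f (y + Y (dyR m 1) w))%:E * decay (dyR m 1) (fun s => y + Y s w)%R * F (y + Y (dyR m 1) w)%R).
Proof. by apply: eq_integral => w _; rewrite eWU_decay. Qed.

Lemma measurable_Sop_integrand m F y : measurable_fun setT F ->
  measurable_fun setT (fun w => (f (y + Y (dyR m 1) w))%:E * decay (dyR m 1) (fun s => y + Y s w)%R * F (y + Y (dyR m 1) w)%R).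
Proof.
move=> mF; have my := measurable_end LP y (dy_ge0 R m 1).
apply: emeasurable_funM; last exact: (measurableT_comp mF my).
apply: emeasurable_funM; last exact: measurable_decay.
by apply/measurable_EFinP; exact: (measurableT_comp mf my).
Qed.

Lemma Sop_mono m F G y : (forall x, 0 <= F x) -> (forall x, F x <= G x) -> S m F y <= S m G y.
Proof.
move=> F0 FG; rewrite !SopE; apply: ge0_le_lower_integral => w _.
  by rewrite !mule_ge0 ?decay_ge0 ?lee_fin.
by apply: lee_wpmul2l => //; rewrite mule_ge0 ?decay_ge0 ?lee_fin.
Qed.

Lemma SopD m F G y : measurable_fun setT F -> measurable_fun setT G ->
  (forall x, 0 <= F x) -> (forall x, 0 <= G x) ->
  S m (fun x => F x + G x) y = S m F y + S m G y.
Proof.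
move=> mF mG F0 G0; rewrite !SopE -ge0_intD.
- by apply: eq_integral => w _; rewrite ge0_muleDr.
- exact: measurable_Sop_integrand.
- by move=> w; rewrite !mule_ge0 ?decay_ge0 ?lee_fin.
- exact: measurable_Sop_integrand.
- by move=> w; rewrite !mule_ge0 ?decay_ge0 ?lee_fin.
Qed.

Lemma SopZ m (c : R) F y : (0 <= c)%R -> measurable_fun setT F -> (forall x, 0 <= F x) ->
  S m (fun x => c%:E * F x) y = c%:E * S m F y.
Proof.
move=> c0 mF F0; rewrite !SopE -ge0_intZl//.
- by apply: eq_integral => w _; rewrite muleCA.
- exact: measurable_Sop_integrand.
- by move=> w; rewrite !mule_ge0 ?decay_ge0 ?lee_fin.
Qed.

Lemma Sop1_le m y : S m (fun=> 1) y <= 1.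
Proof.
rewrite SopE; apply: (@le_trans _ _ (\int[P]_w (cst 1 w))).
  apply: ge0_le_lower_integral => w _; first by rewrite !mule_ge0 ?decay_ge0 ?lee_fin.
  rewrite mule1 -[leRHS]mule1; apply: lee_pmul; rewrite ?lee_fin ?decay_ge0 ?decay_le1//.
by rewrite integral_cst//= probability_setT mule1.
Qed.

Lemma occn_nonincr m i y : occn m i.+1 y <= occn m i y.
Proof.
elim: i y => [|i IH] y; first exact: Sop1_le.
by apply: Sop_mono => // x; exact: (occn_ge0 m i.+1 x).
Qed.

(** The weights decrease, so the last one is at most their average. This disposes of the terminal
    term M [occn] in [upper_bound]. *)
Lemma occn_le_sum m k y : k%:R%:E * occn m k y <= \sum_(i < k) occn m i y.
Proof.
elim: k => [|k IH]; first by rewrite mul0e big_ord0.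
rewrite big_ord_recr/= -natr1 EFinD ge0_muleDl// mul1e; apply: leeD; last exact: occn_nonincr.
by apply: le_trans IH; apply: lee_wpmul2l => //; exact: occn_nonincr.
Qed.

Lemma Sop_sum_occn m (c M : R) k y : (0 <= c)%R -> (0 <= M)%R ->
  S m (fun z => c%:E * \sum_(i < k) occn m i z + M%:E * occn m k z) y =
  c%:E * \sum_(i < k) occn m i.+1 y + M%:E * occn m k.+1 y.
Proof.
move=> c0 M0.
have ms j : measurable_fun setT (fun z => \sum_(i < j) occn m i z).
  by apply: emeasurable_sum => i; exact: measurable_occn.
have s0 j z : 0 <= \sum_(i < j) occn m i z by apply: sume_ge0 => i _; exact: occn_ge0.
have mo := measurable_occn m k; have o0 := occn_ge0 m k.
have cE : 0 <= c%:E by rewrite lee_fin.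
have ME : 0 <= M%:E by rewrite lee_fin.
rewrite SopD; last 4 first.
- by apply: emeasurable_funM.
- by apply: emeasurable_funM.
- by move=> x; rewrite mule_ge0.
- by move=> x; rewrite mule_ge0.
rewrite !SopZ//; congr (_ * _ + _).
elim: k {mo o0} => [|k IH].
  rewrite big_ord0 SopE integral0_eq// => w _; by rewrite big_ord0 mule0.
rewrite big_ord_recr/= -IH -SopD//; last 2 first.
- exact: measurable_occn.
- exact: occn_ge0.
rewrite !SopE; apply: eq_integral => w _; congr (_ * _); by rewrite big_ord_recr.
Qed.

End killed.

Section bound.
Variables (V : rV -> R) (lambda : R).
Hypothesis mV : measurable_fun setT V.
Local Notation Vp := (V^\+)%R.
Local Notation Vm := (V^\-)%R.
Variables (nu g w : rV -> R) (a K : R).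
Hypothesis LE : levy_estimates P Y nu g w a K.
Hypothesis SVm : small_occ P Y Vm.
Hypothesis conf : confining V.
Hypothesis lambda_gt0 : (0 < lambda)%R.

Let K0 : (0 <= K)%R. Proof. exact: le_trans ler01 (est_K LE). Qed.

Lemma g_near y x0 : (enorm (y - x0) <= 1)%R -> (g y <= K * expR a * g x0)%R.
Proof.
move=> yx; apply: (le_trans (est_exp LE y x0)).
rewrite ler_wpM2r ?(ltW (est_g_gt0 LE x0))// ler_wpM2l// ler_expR ler_piMr ?(est_a LE)//.
exact: le_trans (ler_dist_enorm y x0) yx.
Qed.

(** Two losses occur: the factor e^(lambda h) costs O(h) times E |phi|, which is O(M g(x0)) only
    thanks to [crude_bound]; the negative part of V, supported in a bounded set, costs O(M h g(x0))
    by [occ_far]. Points within distance 1 of x0 stay beyond radius rho + 3 when |x0| >= rho + 4. *)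
Lemma upper_step : exists C2 C3 R0 : R, exists m0 : nat, [/\ (0 <= C2)%R, (0 <= C3)%R &
  forall (phi : rV -> R) M, eigenfunction P Y V lambda phi -> (forall x, (`|phi x| <= M)%R) ->
  (forall y, (`|phi y| <= C2 * M * w y)%R) /\
  forall m x0 y, (m0 <= m)%N -> (R0 <= enorm x0)%R -> (enorm (y - x0) <= 1)%R ->
  `|phi y|%:E <= \int[P]_om (decay Vp (dyR m 1) (fun s => y + Y s om)%R * `|phi (y + Y (dyR m 1) om)|%:E)
    + (C3 * M * dyR m 1 * g x0)%:E].
Proof.
have [C2 C20 HC2] := crude_bound LP Y0 Yrc mV LE SVm conf lambda_gt0.
have [r0 Hr0] := conf 0%R; pose rho := Num.max r0 0%R.
have rho0 : (0 <= rho)%R by rewrite /rho le_max lexx orbT.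
have [C [t1 [C0 t10 t11 far]]] := occ_far LP Y0 Yrc LE rho0.
have q2 : (0 < 2^-1 :> R)%R by rewrite invr_gt0.
have [t0 t00 Ht0] := SVm q2.
have mVm := measurable_Vm mV; have mVp := measurable_Vp mV.
have Vms z : (rho <= enorm z)%R -> Vm z = 0%R.
  move=> hz; rewrite /funrneg/= max_r// oppr_le0; apply: Hr0.
  by apply: le_trans hz; rewrite /rho le_max lexx.
have [|m0 Hm0] := @dy1_small R (Num.min t1 t0)%R; first by rewrite lt_min t10 t00.
pose D1 := (lambda * expR lambda * (C2 * (expR K * K)) * (K * expR a))%R.
pose D2 := (expR lambda * C * (K * expR a))%R.
have D10 : (0 <= D1)%R by rewrite !mulr_ge0 ?expR_ge0// ltW.
have D20 : (0 <= D2)%R by rewrite !mulr_ge0 ?expR_ge0.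
exists C2, (D1 + D2)%R, (rho + 4)%R, m0; split => //; first exact: addr_ge0.
move=> phi M eig phiM.
have M0 : (0 <= M)%R := le_trans (normr_ge0 _) (phiM 0%R).
split; first exact: HC2.
move=> m x0 y mm hx0 yx.
have := Hm0 m mm; rewrite le_min => /andP[ht1 ht0]; set h := dyR m 1 in ht1 ht0 *.
have h0 : (0 < h)%R by rewrite /h /dy mul1r invr_gt0 exprn_gt0.
have h1 : (h <= 1)%R := le_trans ht1 t11.
have Hq z : occ P Y Vm h z <= (2^-1)%:E by apply: Ht0; rewrite (ltW h0).
have q1 : (2^-1 < 1 :> R)%R by rewrite invf_lt1// ltr1n.
have mphi : measurable_fun setT phi by case: eig.
have mnphi : measurable_fun setT (fun x => `|phi x|%R) by exact: measurableT_comp.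
have oy : occ P Y Vm h y < +oo by apply: (le_lt_trans (Hq y)); rewrite ltry.
have hy : (rho + 3 <= enorm y)%R.
  by have := ler_dist_enorm y x0; move/ler_normlP => [h2 _]; move: hx0 yx h2; lra.
have ob := far Vm m 1%N 2^-1%R mVm (Vm_ge0 _) Vms ht1 (ltW q2) Hq y hy.
pose Z om := decay Vp h (fun s => y + Y s om)%R * `|phi (y + Y h om)|%:E.
have mu' := measurable_endE LP y mnphi (ltW h0).
have mZ : measurable_fun setT Z.
  by apply: emeasurable_funM => //; exact: measurable_decay (Vp_ge0 V) _ _.
have Zu om : Z om <= `|phi (y + Y h om)|%:E.
  rewrite /Z -[leRHS]mul1e; apply: lee_wpmul2r => //; exact: decay_le1 (Vp_ge0 V) _ _.
have Z0 om : 0 <= Z om by rewrite mule_ge0 ?decay_ge0.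
have ZM om : 0 <= Z om <= M%:E by rewrite Z0/= (le_trans (Zu om))// lee_fin.
have gy := g_near yx; have g0 := est_g_gt0 LE x0.
have IZ : \int[P]_om Z om <= (C2 * (expR K * K) * M * (K * expR a * g x0))%:E.
  apply: (@le_trans _ _ (\int[P]_om ((C2 * M)%:E * (w (y + Y h om)%R)%:E))).
    apply: ge0_le_lower_integral => om _; first exact: Z0.
    by apply: (le_trans (Zu om)); rewrite -EFinM lee_fin; exact: HC2.
  have w0 om : 0 <= (w (y + Y h om)%R)%:E by rewrite lee_fin (est_w_ge0 LE).
  have CM0 : (0 <= C2 * M)%R by exact: mulr_ge0.
  rewrite (ge0_intZl P CM0 (measurable_endE LP y (est_mw LE) (ltW h0)) w0).
  apply: (le_trans (lee_wpmul2l _ (int_w_le LP LE y (ltW h0)))); first by rewrite lee_fin.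
  rewrite -EFinM lee_fin.
  have -> : (C2 * (expR K * K) * M * (K * expR a * g x0) = (C2 * M) * (expR K * (K * (K * expR a * g x0))))%R.
    by ring.
  apply: ler_wpM2l => //; apply: ler_pM; rewrite ?expR_ge0 ?(est_w_ge0 LE)//.
    by rewrite ler_expR ler_piMr.
  by apply: (le_trans (est_wg LE y)); apply: ler_wpM2l.
have E : `|phi y|%:E <= (expR (lambda * h))%:E * (\int[P]_om Z om + (M * (2 * (C * 2^-1 * h * g y)))%:E).
  apply: (le_trans (eigen_le LP Y0 Yrc mV eig h0 oy)); apply: lee_wpmul2l; first by rewrite lee_fin expR_ge0.
  apply: (le_trans (kato_weight LP Y0 Yrc y mVm (Vm_ge0 _) q1 Hq mZ ZM)).
  have -> : (M / (1 - 2^-1) = M * 2)%R by field.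
  have -> : (M * (2 * (C / 2 * h * g y)) = (M * 2) * (C * 2^-1 * h * g y))%R by rewrite -[RHS]mulrA.
  by apply: leeD2l; rewrite [leRHS]EFinM; apply: lee_wpmul2l => //; rewrite lee_fin mulr_ge0.
apply: (le_trans E).
have [z zE] : exists z, \int[P]_om Z om = z%:E.
  move: IZ; have : 0 <= \int[P]_om Z om by exact: integral_ge0.
  by case: (\int[P]_om Z om) => [z| |]// _ _; exists z.
rewrite zE in IZ *; rewrite lee_fin in IZ.
have z00 : (0 <= z)%R by rewrite -lee_fin -zE; exact: integral_ge0.
rewrite -EFinD -EFinM -EFinD lee_fin.
have e1 : (expR (lambda * h) - 1 <= lambda * expR lambda * h)%R.
  by apply: expR_sub1_le; [exact: ltW|rewrite (ltW h0)].
have e2 : (expR (lambda * h) <= expR lambda)%R by rewrite ler_expR ler_piMr// ltW.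
have -> : ((D1 + D2) * M * h * g x0 = lambda * expR lambda * h * (C2 * (expR K * K) * M * (K * expR a * g x0))
    + expR lambda * (M * C * h) * (K * expR a * g x0))%R by rewrite /D1 /D2; ring.
apply: upper_scalar => //; rewrite ?mulr_ge0 ?expR_ge0 ?(ltW h0) ?(ltW lambda_gt0)//.
exact/ltW/(est_g_gt0 LE).
Qed.

Lemma upper_grid : exists C4 R0 : R, exists m0 : nat, (0 <= C4)%R /\
  forall (phi : rV -> R) M, eigenfunction P Y V lambda phi -> (forall x, (`|phi x| <= M)%R) ->
  forall m k x0, (m0 <= m)%N -> (R0 <= enorm x0)%R ->
  `|phi x0|%:E <= (C4 * M * g x0 * dyR m 1)%:E * \sum_(i < k) occn Vp (ballf x0) m i x0
    + M%:E * occn Vp (ballf x0) m k x0.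
Proof.
have [C2 [C3 [R0 [m0 [C20 C30 H]]]]] := upper_step.
exists (C3 + 3 * C2 * K)%R, R0, m0; split; first by rewrite addr_ge0// !mulr_ge0.
move=> phi M eig phiM m k x0 mm hx0; set f := ballf x0; have [crude {}H] := H phi M eig phiM.
have {}H y := H m x0 y mm hx0.
have M0 : (0 <= M)%R := le_trans (normr_ge0 _) (phiM 0%R).
have mphi : measurable_fun setT phi by case: eig.
have mnphi : measurable_fun setT (fun x => `|phi x|%R) by exact: measurableT_comp.
set h := dyR m 1 in H *; have h0 : (0 <= h)%R := dy_ge0 R m 1.
have h1 : (h <= 1)%R by rewrite /h /dy mul1r invf_le1 ?exprn_gt0// exprn_ege1// ler1n.
have g0 := ltW (est_g_gt0 LE x0).
have mf : measurable_fun setT f by apply: measurable_indic; exact: (@measurable_ecball R d).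
have f0 x : (0 <= f x)%R by [].
have f1 x : (f x <= 1)%R by rewrite /f /ballf indicE; case: (_ \in _).
have mVp := measurable_Vp mV; have Vp0 := Vp_ge0 V.
set c := ((C3 + 3 * C2 * K) * M * g x0 * h)%R.
have c0 : (0 <= c)%R by rewrite !mulr_ge0// addr_ge0// !mulr_ge0.
(* Off the ball of radius 7/8 the factor 1 - [gsV 1] is at least 49/113 > 1/3, so A times the
   barrier dominates the crude bound C2 M w. *)
pose A := (3 * C2 * M)%R; have A0 : (0 <= A)%R by rewrite !mulr_ge0.
pose w1x y := w1 g x0 y.
have w1E y : w1x y = (w y * (1 - gsV 1 (y - x0)))%R by rewrite /w1x /w1 (est_wE LE).
have w10 y : (0 <= w1x y)%R.
  by rewrite w1E mulr_ge0 ?(est_w_ge0 LE)// subr_ge0 gsV_le1.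
have mw1 : measurable_fun setT w1x.
  rewrite (_ : w1x = (fun y => w y * (1 - gsV 1 (y - x0)))%R); last by apply/funext => y; rewrite w1E.
  apply: measurable_funM; first exact: (est_mw LE).
  apply: measurable_funB => //; apply: (measurableT_comp (@measurable_gsV R d 1)).
  exact: measurable_fun_subrV.
have far z : (7 / 8 < enorm (z - x0))%R -> (`|phi z| <= A * w1x z)%R.
  move=> hz; apply: (le_trans (crude z)); rewrite w1E /A.
  have -> : (3 * C2 * M * (w z * (1 - gsV 1 (z - x0))) = (C2 * M * w z) * (3 * (1 - gsV 1 (z - x0))))%R by ring.
  apply: ler_peMr; first by rewrite !mulr_ge0// (est_w_ge0 LE).
  have e1 : (49 / 64 <= enorm (z - x0) ^+ 2)%R.
    have -> : (49 / 64 = (7 / 8) ^+ 2 :> R)%R by field.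
    by rewrite lerXn2r ?nnegrE ?enorm_ge0 ?divr_ge0// ltW.
  have e2 : (gsV 1 (z - x0) <= 64 / 113)%R.
    rewrite gsVE mul1r expRN -[leRHS]invrK lef_pV2 ?posrE ?expR_gt0 ?invr_gt0 ?divr_gt0//.
    rewrite invf_div; apply: le_trans (expR_ge1Dx _); move: e1; lra.
  by move: e2; lra.
have claim j : forall y, (enorm (y - x0) <= 7 / 8)%R ->
  `|phi y|%:E <= (A * w1x y)%:E + (c%:E * \sum_(i < j) occn Vp f m i y + M%:E * occn Vp f m j y).
  elim: j => [|j IH] y hy.
    rewrite big_ord0 mule0 add0e mule1; apply: (@le_trans _ _ M%:E); first by rewrite lee_fin.
    by rewrite leeDr// lee_fin mulr_ge0.
  have y1 : (enorm (y - x0) <= 1)%R by apply: (le_trans hy); lra.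
  apply: (le_trans (H y y1)).
  pose G z := c%:E * \sum_(i < j) occn Vp f m i z + M%:E * occn Vp f m j z.
  have mG : measurable_fun setT G.
    apply: emeasurable_funD; apply: emeasurable_funM => //; last exact: measurable_occn.
    by apply: emeasurable_sum => i; exact: measurable_occn.
  have G0 z : 0 <= G z.
    rewrite adde_ge0 ?mule_ge0 ?lee_fin//; last exact: occn_ge0.
    by apply: sume_ge0 => i _; exact: occn_ge0.
  have my := measurable_end LP y h0.
  have i1 : \int[P]_om (decay Vp h (fun s => y + Y s om)%R * `|phi (y + Y h om)|%:E) <=
     \int[P]_om (A%:E * (w1x (y + Y h om)%R)%:E +
       (f (y + Y h om))%:E * decay Vp h (fun s => y + Y s om)%R * G (y + Y h om)%R).
    apply: ge0_le_lower_integral => om _; first by rewrite mule_ge0 ?decay_ge0.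
    set z := (y + Y h om)%R; set e := decay _ _ _.
    have e0 : 0 <= e by exact: decay_ge0.
    have e1 : e <= 1 by exact: decay_le1.
    have ew x : 0 <= x -> e * x <= x by move=> x0'; rewrite -[leRHS]mul1e; exact: lee_wpmul2r.
    have [zD|zD] := leP (enorm (z - x0)) (7 / 8)%R.
      rewrite /f /ballf indicE mem_set//= mul1e; apply: (le_trans (lee_wpmul2l e0 (IH z zD))).
      have aw : 0 <= (A * w1x z)%:E by rewrite lee_fin mulr_ge0.
      rewrite -/(G z) [leLHS](ge0_muleDr _ aw (G0 z)); apply: leeD2r.
      by apply: ew; rewrite lee_fin mulr_ge0.
    rewrite /f /ballf indicE memNset ?mul0e ?adde0; last by apply/negP; rewrite -ltNge.
    apply: (@le_trans _ _ `|phi z|%:E); first exact: ew.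
    by rewrite -EFinM lee_fin; exact: far.
  have mw := measurable_endE LP y mw1 h0.
  have w0 om : 0 <= (w1x (y + Y h om)%R)%:E by rewrite lee_fin.
  rewrite ge0_intD in i1; last 4 first.
  - exact: emeasurable_funM.
  - by move=> om; rewrite mule_ge0.
  - exact: measurable_Sop_integrand.
  - by move=> om; rewrite !mule_ge0 ?decay_ge0 ?lee_fin.
  rewrite (ge0_intZl P A0 mw w0) in i1.
  have i2 : \int[P]_om (w1x (y + Y h om)%R)%:E <= (w1x y + K * h * g x0)%:E.
    rewrite (@EFin_Rintegral _ _ _ P _ (K * K)%R).
    - by rewrite lee_fin; apply: (est_w1_growth LE); rewrite ?h0.
    - exact: (measurableT_comp mw1 my).
    - move=> om; rewrite ger0_norm// w1E; apply: le_trans (w_bounded LE (y + Y h om)%R).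
      by rewrite ler_piMr ?(est_w_ge0 LE)// lerBlDl lerDr gsV_ge0.
  apply: (le_trans (leeD2r _ i1)); rewrite -SopE Sop_sum_occn//.
  apply: (le_trans (leeD2r _ (leeD2r _ (lee_wpmul2l _ i2)))); first by rewrite lee_fin.
  have bs : \sum_(i < j.+1) occn Vp f m i y = 1 + \sum_(i < j) occn Vp f m i.+1 y.
    by rewrite big_ord_recl.
  have s0 : 0 <= \sum_(i < j) occn Vp f m i.+1 y.
    by apply: sume_ge0 => i _; exact: occn_ge0.
  rewrite bs; move: (\sum_(i < j) occn Vp f m i.+1 y) s0 (occn Vp f m j.+1 y) => s s0 t.
  rewrite [c%:E * (1 + s)]ge0_muleDr// mule1.
  have cE : c%:E = (A * (K * h * g x0))%:E + (C3 * M * h * g x0)%:E.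
    by rewrite -EFinD; congr EFin; rewrite /c /A; ring.
  rewrite [X in _ <= _ + (X + _ + _)]cE -EFinM mulrDr EFinD -!addeA; apply: leeD2l; apply: leeD2l.
  by rewrite addeA addeC.
have c78 : (0 <= 7 / 8 :> R)%R by rewrite divr_ge0.
have := claim k x0; rewrite subrr enorm0 => /(_ c78).
rewrite w1E subrr gsVE enorm0 expr0n mulr0 oppr0 expR0 subrr mulr0 mulr0 add0e.
exact.
Qed.

End bound.
End upper.

(** * From sums over the grid to the Green operator *)

Section decreasing.
Context d (T : measurableType d) (R : realType) (mu : {measure set T -> \bar R}).
Local Open Scope ereal_scope.

(** Dominated convergence along a decreasing sequence; the integrable majorant [G] is what allows a
    lower bound to pass to the limit. *)
Lemma le_integral_inf (h : nat -> T -> \bar R) (G : T -> \bar R) (L : \bar R) :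
  (forall n, measurable_fun setT (h n)) -> (forall n x, 0 <= h n x <= G x) ->
  mu.-integrable setT G -> (forall x, nonincreasing_seq (h^~ x)) ->
  (forall n, L <= \int[mu]_x h n x) ->
  measurable_fun setT (fun x => ereal_inf (range (h^~ x))) /\
  L <= \int[mu]_x ereal_inf (range (h^~ x)).
Proof.
move=> mh hG iG nh hL.
have c x : h^~ x @ \oo --> ereal_inf (range (h^~ x)) by exact: ereal_nonincreasing_cvgn.
have mf : measurable_fun setT (fun x => ereal_inf (range (h^~ x))).
  by apply: (@emeasurable_fun_cvg _ _ _ setT h _ mh) => x _; exact: c.
split => //.
have h0 n x : 0 <= h n x by case/andP: (hG n x).
have [_ _ cv] : [/\ mu.-integrable setT (fun x => ereal_inf (range (h^~ x))),
    [sequence \int[mu]_x `|h n x - ereal_inf (range (h^~ x))|]_n @ \oo --> 0 &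
    [sequence \int[mu]_x h n x]_n @ \oo --> \int[mu]_x ereal_inf (range (h^~ x))].
  apply: (dominated_convergence measurableT mh mf _ iG).
    by apply/aeW => x _; exact: c.
  by apply/aeW => x n _; rewrite gee0_abs//; case/andP: (hG n x).
apply: (cvge_to_ge cv); apply: nearW => n; exact: hL.
Qed.

End decreasing.

Section dyadic_step.
Context (R : realType).
Local Open Scope ereal_scope.
Local Notation leb := (@lebesgue_measure R).
Local Notation dyR := (@dy R).

Lemma dyi_eq m k (s : R) : (dyR m k <= s < dyR m k.+1)%R -> dyi m s = k.
Proof.
move=> /andP[h1 h2]; have s0 : (0 <= s)%R := le_trans (dy_ge0 R m k) h1.
have p2 : (0 < 2 ^+ m :> R)%R by rewrite exprn_gt0.
apply/eqP; rewrite eqn_leq; apply/andP; split.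
  rewrite leqNgt; apply/negP => hk; rewrite /dyi in hk.
  have := lt_le_trans h2 (ler_dy R m hk).
  by rewrite /dy ltr_pdivlMr// -truncn_lt_nat ?mulr_ge0 ?exprn_ge0// ltnn.
by rewrite /dyi truncn_ge_nat ?mulr_ge0 ?exprn_ge0// -ler_pdivrMr.
Qed.

Lemma dy_dyi_lower m (s : R) : (0 <= s)%R -> (dyR m (dyi m s) <= s)%R.
Proof.
move=> s0; rewrite /dy ler_pdivrMr ?exprn_gt0//.
have s2 : (0 <= s * 2 ^+ m)%R by rewrite mulr_ge0// exprn_ge0.
by have /andP[] := truncn_itv s2.
Qed.



Lemma measurable_step (F : nat -> \bar R) m : measurable_fun setT (fun t : R => F (dyi m t)).
Proof.
move=> _ B mB; rewrite setTI.
rewrite (_ : _ @^-1` _ = \bigcup_(k in [set k | B (F k)]) [set s | dyi m s = k]).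
  by apply: bigcup_measurable => k _; exact: measurable_dyi.
apply/seteqP; split => [s /= h|s [k /= h sk]]; first by exists (dyi m s).
by rewrite /= sk.
Qed.

Lemma integral_step (F : nat -> \bar R) m k : (forall i, 0 <= F i) ->
  \int[leb]_(t in `[0%R, dyR m k[) F (dyi m t) = (dyR m 1)%:E * \sum_(i < k) F i.
Proof.
move=> F0; elim: k => [|k IH].
  by rewrite big_ord0 mule0 (_ : dyR m 0 = 0)%R ?set_itvco0 ?integral_set0// /dy mul0r.
have k0 := dy_ge0 R m k; have kS := ler_dy R m (leqnSn k).
have -> : `[0%R, dyR m k.+1[%classic = `[0%R, dyR m k[ `|` `[dyR m k, dyR m k.+1[.
  apply/seteqP; split => r /=; rewrite !in_itv/=.
    by move=> /andP[r0 rk]; have [rs|sr] := ltP r (dyR m k); [left|right]; rewrite ?r0.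
  case=> /andP[h1 h2]; first by rewrite h1 (lt_le_trans h2).
  by rewrite h2 (le_trans k0 h1).
rewrite ge0_integral_setU//; last 2 first.
- by apply: measurable_funTS; exact: measurable_step.
- rewrite disj_set2E; apply/eqP/seteqP; split => // r [/=].
  by rewrite !in_itv/= => /andP[_ rs] /andP[sr _]; move: (lt_le_trans rs sr); rewrite ltxx.
rewrite IH big_ord_recr/= ge0_muleDr ?sume_ge0//; congr (_ + _).
transitivity (\int[leb]_(t in `[dyR m k, dyR m k.+1[) cst (F k) t).
  by apply: eq_integral => t; rewrite inE/= in_itv/= => ht; rewrite (dyi_eq ht).
rewrite integral_cst//= lebesgue_measure_itv/= lte_fin muleC.
have E : (dyR m k.+1 - dyR m k = dyR m 1)%R by rewrite -addn1 dyD addrAC subrr add0r.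
case: ltP => h; first by rewrite -EFinB E.
have : (0 < dyR m 1)%R by rewrite /dy mul1r invr_gt0 exprn_gt0.
by rewrite -E subr_gt0 ltNge h.
Qed.

(** The grid points below t increase to t, so the truncated integrals exhaust the integral over [0,
    t), and one endpoint has measure 0. *)
Lemma dyi_lim (p : R -> \bar R) (t : R) (L : \bar R) : (0 <= t)%R -> measurable_fun setT p ->
  (forall s, 0 <= p s) ->
  (forall m, \int[leb]_(s in `[0%R, dyR m (dyi m t)]) p s <= L) -> \int[leb]_(s in `[0%R, t]) p s <= L.
Proof.
move=> t0 mp p0 H; rewrite -integral_itv_bndo_bndc; last exact: measurable_funTS.
have nd m : (dyR m (dyi m t) <= dyR m.+1 (dyi m.+1 t))%R.
  rewrite -dyS; apply: ler_dy; rewrite /dyi truncn_ge_nat ?mulr_ge0 ?exprn_ge0//.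
  have := dy_dyi_lower m t0; rewrite -dyS /dy ler_pdivrMr ?exprn_gt0//.
have ndm : {homo (fun m => dyR m (dyi m t)) : m n / (m <= n)%N >-> (m <= n)%R}.
  by apply: homo_leq => // ? ? ?; exact: le_trans.
have -> : \int[leb]_(s in `[0%R, t[) p s = \int[leb]_(s in `[0%R, t[) (if (s < t)%R then p s else 0).
  by apply: eq_integral => s; rewrite inE/= in_itv/= => /andP[_ ->].
apply: (@ge0_integral_sup_le _ _ _ leb `[0%R, t[%classic
   (fun m (s : R) => if (s <= dyR m (dyi m t))%R then p s else 0)) => //.
- move=> m; apply: measurable_funTS; apply: measurable_fun_ifT => //.
  exact: measurable_fun_ler.
- by move=> m s; case: ifP.
- move=> s m n mn; case: ifPn => h; last by case: ifP.
  by rewrite (le_trans h (ndm _ _ mn)).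
- by move=> s; case: ifP.
- move=> s M HM; case: ifPn => st; last first.
    by apply: le_trans (HM 0%N); case: ifP.
  have [|m0 Hm0] := @dy1_small R (t - s)%R; first by rewrite subr_gt0.
  have hm : (s <= dyR m0 (dyi m0 t))%R.
    have := dy_dyi_gt m0 t0; rewrite -addn1 dyD.
    by have := Hm0 m0 (leqnn _); lra.
  by have := HM m0; rewrite hm.
move=> m; apply: le_trans (H m); rewrite integral_mkcond [leRHS]integral_mkcond.
apply: ge0_le_lower_integral => s _; first by rewrite patchE; case: ifP => // _; case: ifP.
rewrite !patchE; case: ifPn => [|_]; last by case: ifP.
rewrite inE/= in_itv/= => /andP[s0 st]; case: ifPn => h; last by case: ifP.
by rewrite mem_set//= in_itv/= s0.
Qed.

End dyadic_step.

(** The path at s is the limit of its values at dyadic times to the right of s, and the ball is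
    closed. Times s < t leave room for those dyadic times to stay below t. *)
Lemma dyadic_ecball (R : realType) (T : Type) d (Y : R -> T -> 'rV[R]_d) c y r n0 t s w :
  rcont (Y ^~ w) -> (0 <= s < t)%R ->
  (forall n j, (n0 <= n)%N -> (dy R n j.+1 <= t)%R -> (enorm (y + Y (dy R n j.+1) w - c) <= r)%R) ->
  (enorm (y + Y s w - c) <= r)%R.
Proof.
move=> Yrc /andP[s0 st] H.
have cv : enorm (y + Y (dy R n (dyi n s).+1) w - c) @[n --> \oo] --> enorm (y + Y s w - c).
  have c1 : Y (dy R n (dyi n s).+1) w @[n --> \oo] --> Y s w.
    exact: (cvg_comp _ _ (cvg_dy_dyi s0) (@Yrc s s0)).
  have c2 : (y + Y (dy R n (dyi n s).+1) w - c)%R @[n --> \oo] --> (y + Y s w - c)%R.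
    by apply: cvgB; [apply: cvgD => //; exact: cvg_cst|exact: cvg_cst].
  exact: (cvg_comp _ _ c2 (@continuous_enorm R d _)).
apply: (cvgr_to_le cv).
have [|m1 Hm1] := @dy1_small R (t - s)%R; first by rewrite subr_gt0.
exists (maxn n0 m1) => // n /=; rewrite geq_max => /andP[nn0 n1]; apply: H => //.
by rewrite -addn1 dyD; have := dy_dyi_lower n s0; have := Hm1 n n1; lra.
Qed.

Section upper_limit.
Context {R : realType} {dO : measure_display} {Omega : measurableType dO} {d : nat}.
Variables (P : probability Omega R) (Y : R -> Omega -> 'rV[R]_d).
Local Notation rV := 'rV[R]_d.
Local Notation dyR := (@dy R).
Local Notation leb := (@lebesgue_measure R).
Hypothesis LP : levy_process P Y.
Hypothesis Y0 : forall w, Y 0 w = 0.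
Hypothesis Yrc : forall w, rcont (Y ^~ w).
Local Open Scope ereal_scope.

Let mY := levy_measurable LP.

Section killed.
Variables (U f : rV -> R).
Hypothesis mU : measurable_fun setT U.
Hypothesis mf : measurable_fun setT f.
Hypothesis U0 : forall x, (0 <= U x)%R.
Hypothesis f0 : forall x, (0 <= f x)%R.
Hypothesis f1 : forall x, (f x <= 1)%R.
Variable y : rV.

Definition kdecay m i w : \bar R :=
  (\prod_(j < i) f (y + Y (dyR m j.+1) w))%R%:E * decay U (dyR m i) (fun s => y + Y s w)%R.

Lemma kdecay_ge0 m i w : 0 <= kdecay m i w.
Proof. by rewrite mule_ge0 ?decay_ge0// lee_fin prodr_ge0. Qed.

Lemma prodf_le1 m i w : (\prod_(j < i) f (y + Y (dyR m j.+1) w) <= 1)%R.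
Proof. by apply: prodr_ile1 => j _; rewrite f0 f1. Qed.

Lemma kdecay_le_decay m i w : kdecay m i w <= decay U (dyR m i) (fun s => y + Y s w)%R.
Proof.
by rewrite /kdecay -[leRHS]mul1e; apply: lee_wpmul2r; rewrite ?decay_ge0// lee_fin prodf_le1.
Qed.

Lemma kdecay_le1 m i w : kdecay m i w <= 1.
Proof. exact: le_trans (kdecay_le_decay m i w) (decay_le1 U0 _ _). Qed.

Lemma measurable_kdecay m i : measurable_fun setT (kdecay m i).
Proof.
apply: emeasurable_funM; last exact: (measurable_decay LP Y0 Yrc).
apply/measurable_EFinP; apply: (@measurable_prodf _ _ f mf i _ _ (fun j w => y + Y (dyR m j.+1) w)%R) => j.
exact: (measurable_end LP y (dy_ge0 R m j.+1)).
Qed.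

Lemma occn_kdecay m i : occn P Y U f m i y = \int[P]_w kdecay m i w.
Proof.
rewrite /occn (iter_Sop LP Y0 Yrc)//.
by apply: eq_integral => w _; rewrite mule1 /Qop eWU_decay.
Qed.

Lemma measurable_kdecay_step m : measurable_fun setT (fun z : Omega * R => kdecay m (dyi m z.2) z.1).
Proof. exact: (@measurable_select R _ _ _ _ (fun i w => kdecay m i w) m (measurable_kdecay m)). Qed.

Lemma sum_occn m k : (dyR m 1)%:E * \sum_(i < k) occn P Y U f m i y =
  \int[P]_w \int[leb]_(t in `[0%R, dyR m k[) kdecay m (dyi m t) w.
Proof.
under [RHS]eq_integral do rewrite (@integral_step R (fun i => kdecay m i _) m k (fun i => kdecay_ge0 m i _)).
rewrite ge0_intZl ?dy_ge0//; last 2 first.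
- by apply: emeasurable_sum => i; exact: measurable_kdecay.
- by move=> w; apply: sume_ge0 => i _; exact: kdecay_ge0.
rewrite ge0_integral_sum//; last 2 first.
- by move=> i; exact: measurable_kdecay.
- by move=> i w _; exact: kdecay_ge0.
by congr (_ * _); apply: eq_bigr => i _; rewrite occn_kdecay.
Qed.

Lemma prodf_refine (h : R -> R) m i : (forall s, 0 <= h s <= 1)%R ->
  (\prod_(j < i.*2) h (dyR m.+1 j.+1) <= \prod_(j < i) h (dyR m j.+1))%R.
Proof.
move=> h01; elim: i => [|i IH]; first by rewrite !big_ord0.
rewrite doubleS !big_ord_recr/= -mulrA; apply: ler_pM.
- by apply: prodr_ge0 => j _; case/andP: (h01 (dyR m.+1 j.+1)).
- by case/andP: (h01 (dyR m.+1 i.*2.+1)) => ? _; case/andP: (h01 (dyR m.+1 i.*2.+2)) => ? _; exact: mulr_ge0.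
- exact: IH.
rewrite -[i.*2.+2]doubleS dyS; case/andP: (h01 (dyR m.+1 i.*2.+1)) => a0 a1.
by case/andP: (h01 (dyR m i.+1)) => b0 b1; rewrite ler_piMl.
Qed.

Lemma dyi_double m (t : R) : (0 <= t)%R -> ((dyi m t).*2 <= dyi m.+1 t)%N.
Proof.
move=> t0; rewrite /dyi truncn_ge_nat ?mulr_ge0 ?exprn_ge0//.
by have := dy_dyi_lower m t0; rewrite -dyS /dy ler_pdivrMr ?exprn_gt0.
Qed.

(** Refinement adds constraints at new grid points and moves the last grid point before t to the
    right; both can only decrease the weight. *)
Lemma kdecay_refine m (t : R) w : (0 <= t)%R -> kdecay m.+1 (dyi m.+1 t) w <= kdecay m (dyi m t) w.
Proof.
move=> t0; have hd := dyi_double m t0; apply: lee_pmul; rewrite ?decay_ge0 ?lee_fin ?prodr_ge0//.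
  have h01 s : (0 <= f (y + Y s w) <= 1)%R by rewrite f0 f1.
  apply: le_trans (prodf_refine m (dyi m t) h01).
  rewrite -(subnKC hd) big_split_ord/= ler_piMr//; first by apply: prodr_ge0.
  by apply: prodr_ile1 => j _; rewrite f0 f1.
rewrite lee_expeR leeN2 !(path_integral_rec Y0 Yrc); apply: path_integral_mono => //.
  by rewrite -dyS ler_dy.
exact: measurable_rec_shift.
Qed.

Lemma kdecay_in_ball c r m0 t w s : f = \1_(ecball c r) -> (0 <= s < t)%R ->
  (forall n, (m0 <= n)%N -> kdecay n (dyi n t) w != 0) -> (enorm (y + Y s w - c) <= r)%R.
Proof.
move=> fE /andP[s0 st] H.
apply: (dyadic_ecball (@Yrc w) (n0 := m0) (t := t)) => [|n j n0 ht]; first by rewrite s0.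
have jt : (j < dyi n t)%N.
  have t0 : (0 <= t)%R := le_trans s0 (ltW st).
  move: ht; rewrite /dy ler_pdivrMr ?exprn_gt0// => ht.
  by rewrite /dyi truncn_ge_nat ?mulr_ge0 ?exprn_ge0.
have := H n n0; rewrite /kdecay mule_eq0 negb_or => /andP[+ _].
rewrite eqe => /prodf_neq0 /(_ (Ordinal jt) isT); rewrite fE indicE.
by have [|_] := boolP (_ \in _); [rewrite inE|rewrite eqxx].
Qed.

Lemma kdecay_inf_le_decay t w (L : \bar R) : (0 <= t)%R -> 0 <= L ->
  (forall n, L <= kdecay n (dyi n t) w) -> L <= decay U t (fun s => y + Y s w)%R.
Proof.
move=> t0 L0 H; have LE : expeR (lne L) = L by apply/eqP; rewrite lneK_eq.
rewrite /decay -LE lee_expeR leeNr (path_integral_rec Y0 Yrc).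
apply: (@dyi_lim R (fun s => (U (y + rec (pth Y w) s))%:E)) => //.
- apply/measurable_EFinP; apply: (measurableT_comp mU); exact: measurable_rec_shift.
- by move=> s; rewrite lee_fin.
move=> n; rewrite -/(path_integral U _ (fun s => y + rec (pth Y w) s)%R) -(path_integral_rec Y0 Yrc).
rewrite leeNr -lee_expeR LE; apply: (le_trans (H n)); exact: kdecay_le_decay.
Qed.

End killed.

Section limit.
Variable V : rV -> R.
Hypothesis mV : measurable_fun setT V.
Variable x0 : rV.
Hypothesis V0 : forall z, (enorm (z - x0) <= 7 / 8)%R -> (0 <= V z)%R.
Local Notation Vp := (V^\+)%R.
Local Notation Vm := (V^\-)%R.
Local Notation f := (ballf x0).

Lemma measurable_ballf : measurable_fun setT (f : rV -> R).
Proof. by apply: measurable_indic; exact: (@measurable_ecball R d). Qed.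
Lemma ballf_ge0 x : (0 <= f x :> R)%R. Proof. by []. Qed.
Lemma ballf_le1 x : (f x <= 1 :> R)%R. Proof. by rewrite /ballf indicE; case: (_ \in _). Qed.

Definition Hstep (T : R) m (z : Omega * R) : \bar R :=
  kdecay Vp f x0 m (dyi m z.2) z.1 * (\1_(`[0%R, T[%classic) z.2 : R)%:E.

(** A positive lower bound at all levels forces every dyadic constraint, so the path stays in the
    closed ball before t. There V is nonnegative, and its path integral is that of the positive
    part. *)
Lemma expeR_path_ge T w t (L : \bar R) : (0 <= t < T)%R ->
  (forall m, L <= Hstep T m (w, t)) -> 0 < L ->
  t%:E <= exit_time (eball x0 1) (fun s => x0 + Y s w)%R /\
  L <= expeR (- path_integral V t (fun s => x0 + Y s w)%R).
Proof.
move=> /andP[t0 tT] H L0.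
have H1 m : L <= kdecay Vp f x0 m (dyi m t) w.
  by have := H m; rewrite /Hstep/= indicE mem_set ?mule1//= in_itv/= t0.
have inb s : (0 <= s < t)%R -> (enorm (Y s w) <= 7 / 8)%R.
  move=> hs; have := @kdecay_in_ball Vp f x0 x0 (7 / 8)%R 0%N t w s erefl hs.
  rewrite [(x0 + _)%R]addrC addrK; apply=> n _.
  by rewrite gt_eqF//; exact: lt_le_trans (H1 n).
split.
  apply: le_ereal_inf_tmp => _ [s [s0 sD] <-]; rewrite lee_fin leNgt; apply/negP => st.
  apply: sD; rewrite /eball/= addrAC subrr add0r.
  by apply: (le_lt_trans (inb s _)); [rewrite s0|lra].
have mVm := measurable_Vm mV; have mVp := measurable_Vp mV.
have Z : path_integral Vm t (fun s => x0 + Y s w)%R = 0.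
  rewrite (path_integral_rec Y0 Yrc) /path_integral -integral_itv_bndo_bndc; last first.
    apply: measurable_funTS; apply/measurable_EFinP; apply: (measurableT_comp mVm).
    exact: measurable_rec_shift.
  rewrite integral0_eq// => s; rewrite /= in_itv/= => hs; have /andP[s0 _] := hs.
  rewrite (rec_pth Y0 Yrc)// /funrneg/= max_r// oppr_le0; apply: V0.
  by rewrite addrAC subrr add0r; exact: inb.
rewrite path_integral_posneg Z oppe0 adde0.
apply: (kdecay_inf_le_decay mVp (Vp_ge0 V) ballf_ge0 ballf_le1 t0 (ltW L0)); exact: H1.
Qed.

Lemma Hstep_ge0 T m z : 0 <= Hstep T m z.
Proof. by rewrite mule_ge0 ?kdecay_ge0 ?lee_fin//; exact: ballf_ge0. Qed.

Lemma Hstep_inf_le T w : \int[leb]_t ereal_inf (range (fun m => Hstep T m (w, t))) <=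
  \int[leb]_(t in [set t : R | (0 <= t)%R /\ (t%:E < exit_time (eball x0 1) (fun s => x0 + Y s w)%R)])
    (expeR (- path_integral V t (fun s => x0 + Y s w)%R) * 1%:E).
Proof.
set tau := exit_time _ _.
have tau0 : 0 <= tau by apply: le_ereal_inf_tmp => _ [s [s0 _] <-]; rewrite lee_fin.
pose h t := ereal_inf (range (fun m => Hstep T m (w, t))).
rewrite [leRHS]integral_mkcond.
(* Only t <= tau is known, while the Green operator integrates over t < tau; the single time
   [fine tau] is removed as a null set. *)
rewrite -/h (@negligible_lower_integral_eq _ _ _ leb [set fine tau] _ (fun t => if t == fine tau then 0 else h t)) //.
- apply: ge0_le_lower_integral => t _.
    case: ifP => // _; apply: le_ereal_inf_tmp => _ [m _ <-]; exact: Hstep_ge0.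
  have r0 : 0 <= ((fun t => expeR (- path_integral V t (fun s => x0 + Y s w)%R) * 1%:E) \_
     [set t : R | (0 <= t)%R /\ (t%:E < tau)]) t.
    by rewrite patchE; case: ifP => // _; rewrite mule1 expeR_ge0.
  case: ifPn => // tt; have [|h0] := leP (h t) 0; first by move=> /le_trans; apply.
  have hm m : h t <= Hstep T m (w, t) by apply: ereal_inf_lbound; exists m.
  have [tT|tT] := boolP ((0 <= t)%R && (t < T)%R); last first.
    have := hm 0%N; rewrite /Hstep/= indicE memNset ?mule0; last by rewrite /= in_itv/=; apply/negP.
    by move=> /le_trans; apply.
  have [e1 e2] := expeR_path_ge tT hm h0.
  rewrite patchE mem_set ?mule1//; split; first by case/andP: tT.
  rewrite lt_neqAle e1 andbT; apply: contra tt => /eqP te.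
  by rewrite -/tau in te; rewrite -te.
- exact: lebesgue_measure_set1.
- by move=> t /eqP/negbTE ->.
Qed.

(** An integer horizon T is a grid point at every level, so the sums are integrals over the same
    interval [0, T), whose indicator dominates all of them. *)
Lemma occ_sum_limit (T L : R) (N m0 : nat) : T = N%:R ->
  (forall m, (m0 <= m)%N -> L%:E <= (dyR m 1)%:E * \sum_(i < N * 2 ^ m) occn P Y Vp f m i x0) ->
  L%:E <= V_green P Y V (eball x0 1) (fun=> 1%R) x0.
Proof.
move=> TN HL; have mVp := measurable_Vp mV.
have TE m : T = dyR m (N * 2 ^ m) by rewrite /dy natrM natrX mulfK// expf_neq0.
have mH m : measurable_fun setT (Hstep T m).
  apply: emeasurable_funM.
    exact: (measurable_kdecay_step mVp measurable_ballf (Vp_ge0 V) x0 m).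
  apply/measurable_EFinP.
  exact: (measurableT_comp (f := \1_(`[0%R, T[%classic) : R -> R)).
pose G (z : Omega * R) : \bar R := (\1_(`[0%R, T[%classic) z.2 : R)%:E.
have mG : measurable_fun setT G.
  apply/measurable_EFinP.
  exact: (measurableT_comp (f := \1_(`[0%R, T[%classic) : R -> R)).
have T0 : (0 <= T)%R by rewrite TN.
have HG n z : 0 <= Hstep T (m0 + n)%N z <= G z.
  rewrite Hstep_ge0/= /Hstep -[leRHS]mul1e; apply: lee_wpmul2r; first by rewrite lee_fin.
  exact: (kdecay_le1 (Vp_ge0 V) ballf_ge0 ballf_le1).
have iG : (P \x leb)%E.-integrable setT G.
  apply/integrableP; split => //.
  have -> : \int[(P \x leb)%E]_z `|G z| = \int[(P \x leb)%E]_z G z.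
    by apply: eq_integral => z _; rewrite gee0_abs// lee_fin.
  rewrite (@fubini_tonelli1 _ _ _ _ _ P leb G)//.
  rewrite (eq_integral (fun=> T%:E)); first by rewrite integral_cst//= probability_setT mule1 ltry.
    have E : lebesgue_measure (`[0%R, T[%classic : set R) = T%:E.
      rewrite lebesgue_measure_itv/= lte_fin; case: ltP => hT; first by rewrite oppr0 adde0.
      by have -> : T = 0%R by apply/eqP; rewrite eq_le hT T0.
    by move=> w _; rewrite /fubini_F /G/= integral_indic// setIT; exact: E.
  by move=> z; rewrite lee_fin.
have nH z : nonincreasing_seq (fun n => Hstep T n z).
  apply/nonincreasing_seqP => n; rewrite /Hstep indicE.
  have [|_] := boolP (_ \in _); last by rewrite !mule0.
  rewrite inE/= in_itv/= => /andP[z0 _]; rewrite !mule1.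
  exact: (kdecay_refine (measurable_Vp mV) (Vp_ge0 V) ballf_ge0 ballf_le1).
have LH n : L%:E <= \int[(P \x leb)%E]_z Hstep T (m0 + n)%N z.
  apply: (le_trans (HL _ (leq_addr n m0))).
  rewrite (sum_occn mVp measurable_ballf (Vp_ge0 V) ballf_ge0) -TE.
  rewrite (@fubini_tonelli1 _ _ _ _ _ P leb (Hstep T (m0 + n)%N)); [|exact: mH|exact: Hstep_ge0].
  rewrite le_eqVlt; apply/orP; left; apply/eqP; apply: eq_integral => w _.
  rewrite integral_mkcond; apply: eq_integral => t _; rewrite patchE /Hstep/= indicE.
  by case: ifP => _; rewrite ?mule1 ?mule0.
have nH' z : nonincreasing_seq (fun n => Hstep T (m0 + n)%N z).
  by move=> i j ij; apply: nH; rewrite leq_add2l.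
have [|mi] := @le_integral_inf _ _ _ (P \x leb)%E (fun n => Hstep T (m0 + n)%N) G L%:E _ HG iG nH' LH.
  by move=> n; exact: mH.
rewrite fubini_tonelli1//; last first.
  by move=> z; apply: le_ereal_inf_tmp => _ [n _ <-]; exact: Hstep_ge0.
move=> hL; apply: (le_trans hL); apply: ge0_le_lower_integral => w _.
  by apply: integral_ge0 => t _; apply: le_ereal_inf_tmp => _ [n _ <-]; exact: Hstep_ge0.
apply: le_trans (Hstep_inf_le T w); apply: ge0_le_lower_integral => t _.
  by apply: le_ereal_inf_tmp => _ [n _ <-]; exact: Hstep_ge0.
apply: le_ereal_inf_tmp => _ [m _ <-].
apply: (@le_trans _ _ (Hstep T (m0 + m)%N (w, t))); last by apply: nH; exact: leq_addl.
by apply: ereal_inf_lbound; exists m.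
Qed.

End limit.

Lemma upper_bound (V : rV -> R) (lambda : R) (nu g w : rV -> R) (a K : R) :
  measurable_fun setT V -> levy_estimates P Y nu g w a K ->
  small_occ P Y (V^\-)%R -> confining V -> (0 < lambda)%R ->
  exists C r : R, [/\ (0 < C)%R, (0 < r)%R & forall phi : rV -> R,
    (exists M : R, forall x, (`|phi x| <= M)%R) -> eigenfunction P Y V lambda phi ->
    forall x, (r <= enorm x)%R ->
      `|phi x|%:E <= (C * sup_norm phi)%:E * V_green P Y V (eball x 1) (fun=> 1%R) x * (nu x)%:E].
Proof.
move=> mV LE SVm conf l0.
have [C4 [R0 [m0 [C40 H]]]] := upper_grid LP Y0 Yrc mV LE SVm conf l0.
have [r0 Hr0] := conf 0%R.
pose r := Num.max R0 (Num.max (r0 + 1) 1)%R.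
have r1 : (1 <= r)%R by rewrite /r !le_max lexx !orbT.
exists (C4 + 1)%R, r; split; [by rewrite ltr_wpDl|exact: lt_le_trans r1|].
move=> phi [M0 phiM0] eig x hx.
have hR : (R0 <= enorm x)%R by apply: le_trans hx; rewrite /r le_max lexx.
have x1 : (1 <= enorm x)%R := le_trans r1 hx.
have gE := est_nu LE x1; have g0 := est_g_gt0 LE x.
set M := sup_norm phi.
have phiM z : (`|phi z| <= M)%R.
  apply: ub_le_sup; last by exists z.
  by exists M0 => _ [u _ <-].
have M00 : (0 <= M)%R := le_trans (normr_ge0 _) (phiM 0%R).
have Vg0 : 0 <= V_green P Y V (eball x 1) (fun=> 1%R) x.
  by apply: integral_ge0 => om _; apply: integral_ge0 => t _; rewrite mule1 expeR_ge0.
(* A vanishing sup norm is set apart, since the estimate is divided by [A] below. *)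
have [M1|M1] := eqVneq M 0%R.
  have -> : `|phi x|%R = 0%R by apply/eqP; rewrite eq_le normr_ge0 andbT -M1.
  by rewrite M1 mulr0 !mul0e.
have Mgt : (0 < M)%R by rewrite lt_neqAle eq_sym M1.
set A := ((C4 + 1) * M * g x)%R.
have A0 : (0 < A)%R by rewrite !mulr_gt0// ltr_wpDl.
(* A horizon of length at least 1/g(x): after k = N 2^m steps the terminal term M [occn] is at most
   (M/k) S <= M g(x) 2^-m S, the size of the main term. *)
pose N := (Num.truncn (g x)^-1).+1.
have Ng : ((g x)^-1 <= N%:R :> R)%R by apply/ltW/truncnS_gt.
suff h : (`|phi x| / A)%:E <= V_green P Y V (eball x 1) (fun=> 1%R) x.
  by rewrite -gE muleAC -EFinM -/A -lee_pdivrMl// -EFinM mulrC.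
have V0 z : (enorm (z - x) <= 7 / 8)%R -> (0 <= V z)%R.
  move=> hz; apply: Hr0; have h1 : (r0 + 1 <= enorm x)%R.
    by apply: le_trans hx; rewrite /r !le_max lexx orbT.
  by have := ler_dist_enorm z x; move/ler_normlP => [h2 _]; move: h1 hz h2; lra.
apply: (@occ_sum_limit V mV x V0 N%:R _ N m0) => // m mm.
have := H phi M eig phiM m (N * 2 ^ m)%N x mm hR.
set S := \sum_(i < _) _; set o := occn _ _ _ _ _ _ _ => hu.
have S0 : 0 <= S by apply: sume_ge0 => i _; apply: occn_ge0 => z; exact: ballf_ge0.
have oS : (N * 2 ^ m)%:R%:E * o <= S.
  exact: (occn_le_sum P Y (Vp_ge0 V) (ballf_ge0 x) (ballf_le1 x)).
have k0 : (0 < (N * 2 ^ m)%:R :> R)%R by rewrite ltr0n muln_gt0 expn_gt0.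
have o0 : M%:E * o <= (M * g x * dyR m 1)%:E * S.
  apply: (@le_trans _ _ ((M / (N * 2 ^ m)%:R)%:E * S)).
    rewrite EFinM -muleA; apply: lee_wpmul2l; first by rewrite lee_fin.
    by rewrite lee_pdivlMl.
  apply: lee_wpmul2r => //; rewrite lee_fin -mulrA; apply: ler_wpM2l => //.
  rewrite natrM invfM natrX /dy mul1r; apply: ler_wpM2r; first by rewrite invr_ge0 exprn_ge0.
  by rewrite -[leRHS]invrK lef_pV2 ?posrE ?invr_gt0// ltr0n.
have {}hu : `|phi x|%:E <= (A * dyR m 1)%:E * S.
  apply: (le_trans hu); apply: (le_trans (leeD2l _ o0)).
  rewrite -ge0_muleDl ?lee_fin ?mulr_ge0 ?dy_ge0 ?(ltW g0)// -EFinD.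
  by rewrite le_eqVlt; apply/orP; left; apply/eqP; congr (_%:E * _); rewrite /A; ring.
rewrite mulrC EFinM lee_pdivrMl// muleA -EFinM.
exact: hu.
Qed.

End upper_limit.

(** * The lower bound *)

Section lower.
Context {R : realType} {dO : measure_display} {Omega : measurableType dO} {d : nat}.
Variables (P : probability Omega R) (Y : R -> Omega -> 'rV[R]_d).
Local Notation rV := 'rV[R]_d.
Local Notation dyR := (@dy R).
Local Notation leb := (@lebesgue_measure R).
Hypothesis LP : levy_process P Y.
Hypothesis Y0 : forall w, Y 0 w = 0.
Hypothesis Yrc : forall w, rcont (Y ^~ w).
Local Open Scope ereal_scope.

Let mY := levy_measurable LP.

(** With j < 2^n the times run through all dyadic points of (0, 2^-m] as n varies. *)
Definition leaves m : set Omega :=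
  [set w | exists n j, (j < 2 ^ n)%N /\ (1 < enorm (Y (dyR (m + n) j.+1) w))%R].

Lemma measurable_leaves m : measurable (leaves m).
Proof.
rewrite (_ : leaves m = \bigcup_n \bigcup_j
   [set w | (j < 2 ^ n)%N /\ (1 < enorm (Y (dyR (m + n) j.+1) w))%R]); last first.
  apply/seteqP; split => w /=; first by move=> [n [j h]]; exists n => //; exists j.
  by move=> [n _ [j _ h]]; exists n, j.
apply: bigcupT_measurable => n; apply: bigcupT_measurable => j.
have [jn|jn] := boolP (j < 2 ^ n)%N; last first.
  by rewrite (_ : [set w | _] = set0)//; apply/seteqP; split => // w [].
rewrite (_ : [set w | _] = Y (dyR (m + n) j.+1) @^-1` (~` ecball 0 1)).
  rewrite -[X in measurable X]setTI; apply: mY; [exact: dy_ge0|exact: measurableT|].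
  apply: measurableC; exact: measurable_ecball.
apply/seteqP; split => w /=; rewrite /ecball/= subr0; first by move=> [_ h]; apply/negP; rewrite -ltNge.
by move=> /negP; rewrite -ltNge.
Qed.

(** The events decrease in m and their intersection is empty, because every path is right-continuous
    at 0. *)
Lemma leaves_prob (e : R) : (0 < e)%R -> exists m0, forall m, (m0 <= m)%N -> P (leaves m) <= e%:E.
Proof.
move=> e0.
have dec : nonincreasing_seq leaves.
  apply/nonincreasing_seqP => m; apply/subsetPset => w [n [j [jn h]]].
  exists n.+1, j; split; last by rewrite addnS -addSn.
  by rewrite expnS (leq_trans jn)// leq_pmull.
have cap0 : \bigcap_m leaves m = set0.
  apply/seteqP; split => // w H.
  have c : enorm (Y s w) @[s --> 0^'+] --> (0 : R)%R.
    have := cvg_comp _ _ (@Yrc w 0%R (lexx _)) (@continuous_enorm R d _).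
    by rewrite Y0 enorm0.
  have : \forall s \near 0^'+, (enorm (Y s w) < 1)%R.
    by apply: (cvgr_lt _ c).
  move=> [eps /= eps0 He].
  have [m1 Hm1] := @dy1_small R (eps / 2)%R (divr_gt0 eps0 (ltr0n _ 2)).
  have [n [j [jn]]] := H m1 I; apply/negP; rewrite -leNgt; apply/ltW.
  have d0 : (0 < dyR (m1 + n) j.+1)%R by rewrite /dy divr_gt0 ?exprn_gt0.
  apply: He => //=; rewrite sub0r normrN gtr0_norm//.
  apply: (@le_lt_trans _ _ (dyR m1 1)).
    by rewrite (dy_refine m1 n 1) mul1n ler_dy.
  by apply: (le_lt_trans (Hm1 m1 (leqnn _))); rewrite ltr_pdivrMr// ltr_pMr// ltr1n.
have cv : P (leaves m) @[m --> \oo] --> P (\bigcap_m leaves m).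
  apply: nonincreasing_cvg_mu => //.
  - by apply: (le_lt_trans (probability_le1 _ (measurable_leaves 0))); rewrite ltry.
  - exact: measurable_leaves.
  - by rewrite cap0.
rewrite cap0 measure0 in cv.
have : \forall m \near \oo, P (leaves m) < e%:E.
  have hn : nbhs (0%R : \bar R) [set x | x < e%:E].
    by apply: open_nbhs_nbhs; split; [exact: open_ereal_lt_ereal|rewrite /= lte_fin].
  exact: (cv _ hn).
move=> [m0 _ Hm0]; exists m0 => m mm; apply/ltW; exact: Hm0.
Qed.

Lemma stays_near m w s : ~ leaves m w -> (0 <= s < dyR m 1)%R -> (enorm (Y s w) <= 1)%R.
Proof.
move=> nl hs; have := @dyadic_ecball _ _ _ Y 0%R 0%R 1%R m (dyR m 1) s w (@Yrc w) hs.
rewrite add0r subr0; apply=> n j mn ht; rewrite add0r subr0 leNgt; apply/negP => h.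
apply: nl; exists (n - m)%N, j; rewrite subnKC//; split => //.
move: ht; rewrite (dy_refine m (n - m) 1) subnKC// mul1n /dy.
by rewrite ler_pM2r ?invr_gt0 ?exprn_gt0// ler_nat.
Qed.

Definition cutf (U : rV -> R) (r : R) (x : rV) : R := (U x * \1_(eball 0 r) x)%R.

(** From 1 - e^(-r) <= r. While the path stays in a ball, U may be cut off outside it; this matters
    because the positive part of V is only locally in the Kato class. *)
Lemma decay_loss (U : rV -> R) (h L : R) y w : measurable_fun setT U -> (forall x, (0 <= U x)%R) ->
  (0 <= h)%R -> (forall s, (0 <= s < h)%R -> (enorm (y + Y s w) < L)%R) ->
  1 <= decay U h (fun s => y + Y s w)%R + path_integral (cutf U L) h (fun s => y + Y s w)%R.
Proof.
move=> mU U0 h0 H; rewrite /decay.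
have mr := measurable_rec_shift Y y w.
have mc : measurable_fun setT (cutf U L).
  by apply: measurable_funM => //; apply: measurable_indic; exact: measurable_eball.
have -> : path_integral U h (fun s => y + Y s w)%R = path_integral (cutf U L) h (fun s => y + Y s w)%R.
  rewrite !(path_integral_rec Y0 Yrc) /path_integral -!integral_itv_bndo_bndc.
  - apply: eq_integral => s; rewrite inE/= in_itv/= => hs; have /andP[s0 _] := hs.
    by rewrite (rec_pth Y0 Yrc)// /cutf indicE mem_set ?mulr1// /eball/= subr0; exact: H.
  - by apply: measurable_funTS; apply/measurable_EFinP; exact: (measurableT_comp mc mr).
  - by apply: measurable_funTS; apply/measurable_EFinP; exact: (measurableT_comp mU mr).
have : 0 <= path_integral (cutf U L) h (fun s => y + Y s w)%R.
  by apply: path_integral_ge0 => x; rewrite mulr_ge0.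
case: path_integral => [r| |]//= r0; last by rewrite add0e leey.
by rewrite -EFinD lee_fin; have := expR_ge1Dx (- r); lra.
Qed.

Section grid_hit.
Variables (f G : rV -> R).
Hypothesis mf : measurable_fun setT f.
Hypothesis mG : measurable_fun setT G.
Hypothesis f01 : forall x, f x = 0%R \/ f x = 1%R.
Hypothesis G01 : forall x, (0 <= G x <= 1)%R.
Variables (y : rV).

Let f0 x : (0 <= f x)%R. Proof. by case: (f01 x) => ->. Qed.
Let G0 x : (0 <= G x)%R. Proof. by case/andP: (G01 x). Qed.
Let G1 x : (G x <= 1)%R. Proof. by case/andP: (G01 x). Qed.

Let S m := Sop P Y (fun=> 0%R) (fun=> 0%R) f m.

Let decay0 t (p : R -> rV) : decay (fun=> 0%R) t p = 1.
Proof. by rewrite /decay /path_integral integral0_eq// oppe0 expeR0. Qed.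

Let z0 (x : rV) : (0 <= (fun=> 0%R) x :> R)%R := lexx _.
Let mz : measurable_fun setT (fun _ : rV => 0%R : R) := measurable_cst _.
Let m1 : measurable_fun setT (fun _ : rV => 1 : \bar R) := measurable_cst _.
Let mGE : measurable_fun setT (fun x => (G x)%:E). Proof. exact/measurable_EFinP. Qed.
Let GE0 x : 0 <= (G x)%:E. Proof. by rewrite lee_fin. Qed.

Definition goodp m k w : R := \prod_(j < k) f (y + Y (dyR m j.+1) w).

Let SE m F z : S m F z = \int[P]_w ((f (z + Y (dyR m 1) w))%:E * F (z + Y (dyR m 1) w)%R).
Proof. by rewrite /S SopE; apply: eq_integral => w _; rewrite decay0 mule1. Qed.

(** The strong Markov property at the first grid time with f = 0, obtained by induction on the
    number of steps and arranged so that no extended reals are subtracted. *)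
Lemma grid_hit_ineq m k (c : R) : (0 <= c)%R ->
  (forall z i, (i <= k)%N -> f z = 0%R -> \int[P]_w (G (z + Y (dyR m i) w))%:E <= c%:E) ->
  forall z, \int[P]_w (G (z + Y (dyR m k) w))%:E + c%:E * iter k (S m) (fun=> 1) z <=
    iter k (S m) (fun x => (G x)%:E) z + c%:E.
Proof.
move=> c0; elim: k => [|k IH] H z.
  rewrite /= mule1 leeD2r//.
  rewrite (_ : dyR m 0 = 0)%R; last by rewrite /dy mul0r.
  rewrite (eq_integral (fun=> (G z)%:E)); first by rewrite integral_cst//= probability_setT mule1.
  by move=> w _; rewrite Y0 addr0.
have my := measurable_end LP z (dy_ge0 R m 1).
have o0 x : 0 <= iter k (S m) (fun=> 1) x.
  exact: (@iter_Sop_ge0 _ _ _ _ P Y (fun=> 0%R) (fun=> 0%R) f f0 m k (fun=> 1) x (fun=> lee01)).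
have mo : measurable_fun setT (iter k (S m) (fun=> 1)).
  exact: (measurable_iter_Sop LP Y0 Yrc mz mz mf z0 z0 f0 m k m1 (fun=> lee01)).
have og0 x : 0 <= iter k (S m) (fun x => (G x)%:E) x.
  exact: (@iter_Sop_ge0 _ _ _ _ P Y (fun=> 0%R) (fun=> 0%R) f f0 m k _ x GE0).
have mog : measurable_fun setT (iter k (S m) (fun x => (G x)%:E)).
  exact: (measurable_iter_Sop LP Y0 Yrc mz mz mf z0 z0 f0 m k mGE GE0).
have cE : 0 <= c%:E by rewrite lee_fin.
pose q x := \int[P]_w (G (x + Y (dyR m k) w))%:E.
have q0 x : 0 <= q x by apply: integral_ge0 => w _.
have mq : measurable_fun setT q.
  apply: (@measurable_fun_intr _ _ _ _ R P (fun (x : rV) w => (G (x + Y (dyR m k) w)%R)%:E)) => //.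
  apply/measurable_EFinP; apply: (measurableT_comp mG).
  exact: (measurable_shiftY LP (dy_ge0 R m k)).
have mfE : measurable_fun setT (fun w => (f (z + Y (dyR m 1) w))%:E).
  exact: (measurable_endE LP z mf (dy_ge0 R m 1)).
have f0E w : 0 <= (f (z + Y (dyR m 1) w))%:E by rewrite lee_fin.
have -> : \int[P]_w (G (z + Y (dyR m k.+1) w))%:E = \int[P]_w q (z + Y (dyR m 1) w)%R.
  rewrite -[k.+1]add1n dyD.
  exact: (markov_dy LP Y0 m 1 z mGE GE0 (dy_ge0 R m k)).
rewrite !iterS !SE.
have mA := emeasurable_funM mfE (measurableT_comp mo my).
have mB := emeasurable_funM mfE (measurableT_comp mog my).
have A0 w : 0 <= (f (z + Y (dyR m 1) w))%:E * iter k (S m) (fun=> 1) (z + Y (dyR m 1) w)%R by exact: mule_ge0.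
have B0 w : 0 <= (f (z + Y (dyR m 1) w))%:E * iter k (S m) (fun x => (G x)%:E) (z + Y (dyR m 1) w)%R by exact: mule_ge0.
rewrite -(ge0_intZl P c0 mA A0).
have mcA : measurable_fun setT (fun w => c%:E * ((f (z + Y (dyR m 1) w))%:E * iter k (S m) (fun=> 1) (z + Y (dyR m 1) w)%R)).
  exact: emeasurable_funM.
rewrite -(ge0_intD P (measurableT_comp mq my) (fun w => q0 _) mcA (fun w => mule_ge0 cE (A0 w))).
rewrite [X in _ <= _ + X](_ : c%:E = \int[P]_w cst c%:E w); last first.
  by rewrite integral_cst//= probability_setT mule1.
have mc : measurable_fun [set: Omega] (cst c%:E : Omega -> \bar R) := measurable_cst _.
rewrite -(ge0_intD P mB B0 mc (fun=> cE)).
apply: ge0_le_lower_integral => w _.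
  by rewrite adde_ge0 ?q0// mule_ge0.
rewrite /=; set x := (z + Y (dyR m 1) w)%R; case: (f01 x) => fx; rewrite fx.
  by rewrite !mul0e mule0 adde0 add0e; apply: H.
by rewrite !mul1e; apply: IH => u i ik; apply: H; exact: leqW.
Qed.

Lemma measurable_goodp m k : measurable_fun setT (goodp m k).
Proof.
apply: (@measurable_prodf _ _ f mf k _ _ (fun j w => y + Y (dyR m j.+1) w)%R) => j.
exact: (measurable_end LP y (dy_ge0 R m j.+1)).
Qed.

Lemma goodp01 m k w : goodp m k w = 0%R \/ goodp m k w = 1%R.
Proof.
rewrite /goodp; elim: k => [|k [IH|IH]]; first by rewrite big_ord0; right.
  by rewrite big_ord_recr/= IH mul0r; left.
by rewrite big_ord_recr/= IH mul1r.
Qed.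

Let iterE m k (F : rV -> \bar R) : measurable_fun setT F -> (forall x, 0 <= F x) ->
  iter k (S m) F y = \int[P]_w ((goodp m k w)%:E * F (y + Y (dyR m k) w)%R).
Proof.
move=> mF F0; rewrite /S (iter_Sop LP Y0 Yrc)//.
by apply: eq_integral => w _; rewrite /Qop eWU_decay decay0 mule1.
Qed.

(** Reaching the target after having left {f = 1} has probability at most c times the probability of
    leaving: a product of two small factors. *)
Lemma grid_hit m k (c : R) : (0 <= c)%R ->
  (forall z i, (i <= k)%N -> f z = 0%R -> \int[P]_w (G (z + Y (dyR m i) w))%:E <= c%:E) ->
  \int[P]_w ((G (y + Y (dyR m k) w)) * (1 - goodp m k w))%:E <=
  c%:E * \int[P]_w (1 - goodp m k w)%:E.
Proof.
move=> c0 H; have := grid_hit_ineq c0 H y; rewrite !iterE//.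
have mg := measurable_goodp m k.
have g01 w : (0 <= goodp m k w <= 1)%R by case: (goodp01 m k w) => ->; rewrite ?lexx ?ler01.
have g0 w : (0 <= goodp m k w)%R by case/andP: (g01 w).
have g1 w : (goodp m k w <= 1)%R by case/andP: (g01 w).
have mGy := measurableT_comp mG (measurable_end LP y (dy_ge0 R m k)).
have -> : \int[P]_w ((goodp m k w)%:E * 1) = \int[P]_w (goodp m k w)%:E.
  by apply: eq_integral => w _; rewrite mule1.
have -> : \int[P]_w (G (y + Y (dyR m k) w))%:E =
  \int[P]_w ((goodp m k w)%:E * (G (y + Y (dyR m k) w))%:E) + \int[P]_w ((G (y + Y (dyR m k) w)) * (1 - goodp m k w))%:E.
  rewrite -ge0_intD.
  - by apply: eq_integral => w _; rewrite -EFinM -EFinD; congr EFin; ring.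
  - by apply: emeasurable_funM; apply/measurable_EFinP.
  - by move=> w; rewrite mule_ge0 ?lee_fin.
  - by apply/measurable_EFinP; apply: measurable_funM => //; exact: measurable_funB.
  - by move=> w; rewrite lee_fin mulr_ge0// subr_ge0.
have E1 : \int[P]_w (goodp m k w)%:E + \int[P]_w (1 - goodp m k w)%:E = 1.
  rewrite -ge0_intD.
  - rewrite (eq_integral (fun=> 1)); first by rewrite integral_cst//= probability_setT mule1.
    by move=> w _; rewrite -EFinD addrC subrK.
  - exact/measurable_EFinP.
  - by move=> w; rewrite lee_fin.
  - by apply/measurable_EFinP; exact: measurable_funB.
  - by move=> w; rewrite lee_fin subr_ge0.
have bd (F : Omega -> R) : (forall w, (0 <= F w <= 1)%R) -> measurable_fun setT F ->
    exists2 r : R, (0 <= r)%R & \int[P]_w (F w)%:E = r%:E.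
  move=> F01 mF; exists (\int[P]_w F w)%R.
    by apply: Rintegral_ge0 => w _; case/andP: (F01 w).
  apply: (@EFin_Rintegral _ _ _ P F 1%R mF) => w.
  by case/andP: (F01 w) => h1 h2; rewrite ger0_norm.
have [p p0 pE] := bd (goodp m k) g01 mg.
have [|q q0 qE] := bd (fun w => 1 - goodp m k w)%R _ (measurable_funB (measurable_cst _) mg).
  by move=> w; rewrite subr_ge0 g1/= lerBlDr lerDl.
have [||r r0 rE] := bd (fun w => goodp m k w * G (y + Y (dyR m k) w))%R.
- by move=> w; rewrite mulr_ge0//= mulr_ile1.
- exact: measurable_funM.
have [||s s0 sE] := bd (fun w => G (y + Y (dyR m k) w) * (1 - goodp m k w))%R.
- by move=> w; rewrite mulr_ge0 ?subr_ge0//= mulr_ile1 ?subr_ge0// lerBlDr lerDl.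
- by apply: measurable_funM => //; exact: measurable_funB.
have -> : \int[P]_w ((goodp m k w)%:E * (G (y + Y (dyR m k) w))%:E) = r%:E.
  by rewrite -rE; apply: eq_integral => w _; rewrite EFinM.
rewrite sE pE qE; move: E1; rewrite pE qE -!EFinM -!EFinD => -[pq]; rewrite !lee_fin.
have -> : (p = 1 - q)%R by lra.
lra.
Qed.

End grid_hit.

Lemma cutf_ge0 (U : rV -> R) r : (forall x, (0 <= U x)%R) -> forall x, (0 <= cutf U r x)%R.
Proof. by move=> U0 x; rewrite mulr_ge0. Qed.

Lemma measurable_cutf (U : rV -> R) r : measurable_fun setT U -> measurable_fun setT (cutf U r).
Proof. by move=> mU; apply: measurable_funM => //; apply: measurable_indic; exact: measurable_eball. Qed.

Section hit.
Variables (nu g w : rV -> R) (a K : R).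
Hypothesis LE : levy_estimates P Y nu g w a K.

Let K0 : (0 <= K)%R. Proof. exact: le_trans ler01 (est_K LE). Qed.

Let B (rho : R) : rV -> R := \1_(eball 0 rho).

Let mB rho : measurable_fun setT (B rho).
Proof. by apply: measurable_indic; exact: measurable_eball. Qed.

Let B01 rho x : (0 <= B rho x <= 1)%R.
Proof. by rewrite /B indicE; case: (_ \in _); rewrite ?lexx ?ler01. Qed.

(** The killing that accompanies a jump into the target ball has three sources. Killing near the
    target costs p1, of the order allowed by [occ_far]. Killing elsewhere must be followed by a
    jump, which costs c p2 with c = O(h). So does wandering away from the start before the jump.
    Making p2 small thus makes the last two o(h). *)
Lemma hit_split (U : rV -> R) m y (rho rho1 L c1 c2 p1 p2 : R) :
  measurable_fun setT U -> (forall x, (0 <= U x)%R) ->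
  (0 <= rho)%R -> (rho + 1 <= rho1)%R -> (enorm y + 2 <= L)%R -> (rho1 <= L)%R ->
  (rho + 1 <= enorm y + 1)%R -> (dyR m 1 <= 1)%R ->
  occ P Y (cutf U rho1) (dyR m 1) y <= p1%:E ->
  occ P Y (cutf U L) (dyR m 1) y <= p2%:E -> P (leaves m) <= p2%:E -> (0 <= p2)%R ->
  \int[P]_om (B rho (y + Y (dyR m 1) om))%:E <=
  \int[P]_om (decay U (dyR m 1) (fun s => y + Y s om)%R * (B rho (y + Y (dyR m 1) om))%:E)
   + (p1 + 2 * (2 * expR (rho ^+ 2) * K * K * dyR m 1) * p2)%:E.
Proof.
move=> mU U0 rho0 r1 yL rL yr h1 H1 H2 H3 p20.
set h := dyR m 1 in h1 H1 H2 *; have h0 : (0 <= h)%R := dy_ge0 R m 1.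
set c := (2 * expR (rho ^+ 2) * K * K * h)%R.
have c0 : (0 <= c)%R by rewrite !mulr_ge0 ?expR_ge0.
have hit z t : (rho + 1 <= enorm z)%R -> (0 <= t <= h)%R ->
    \int[P]_om (B rho (z + Y t om))%:E <= c%:E.
  move=> hz /andP[t0 th]; apply: (le_trans (hit_le LP LE rho0 hz _)).
    by rewrite t0 (le_trans th).
  rewrite lee_fin /c -!mulrA ler_wpM2l// ler_wpM2l ?expR_ge0// ler_wpM2l//.
  by rewrite mulrC; apply: ler_pM => //; [exact/ltW/(est_g_gt0 LE)|exact: (est_g_le LE)].
(* The part of the potential away from the target: wherever it acts, a jump into the target is still
   to come. *)
pose U2 x := (cutf U L x * (1 - B rho1 x))%R.
have mU2 : measurable_fun setT U2.
  by apply: measurable_funM; [exact: measurable_cutf|exact: measurable_funB].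
have B1 r x : (B r x <= 1)%R by case/andP: (B01 r x).
have U20 x : (0 <= U2 x)%R by rewrite mulr_ge0 ?cutf_ge0// subr_ge0.
have mU1 := measurable_cutf rho1 mU; have U10 := cutf_ge0 rho1 U0.
have mUL := measurable_cutf L mU; have UL0 := cutf_ge0 L U0.
have UE x : (cutf U L x = cutf U rho1 x + U2 x)%R.
  rewrite /U2 /cutf /B mulrBr mulr1 -[(U x * _ * _)%R]mulrA.
  have -> : (\1_(eball 0 L) x * \1_(eball (0:rV) rho1) x = \1_(eball 0 rho1) x :> R)%R.
    rewrite !indicE; have [|_] := boolP (x \in eball 0 rho1); last by rewrite mulr0.
    by rewrite inE /eball/= => hx; rewrite mem_set ?mulr1//=; exact: lt_le_trans rL.
  by rewrite addrC subrK.
pose f : rV -> R := \1_(ecball 0 (enorm y + 1)).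
have mf : measurable_fun setT f by apply: measurable_indic; exact: (@measurable_ecball R d).
have f01 x : f x = 0%R \/ f x = 1%R by rewrite /f indicE; case: (_ \in _); [right|left].
have hE n : h = dyR (m + n) (2 ^ n)%N by rewrite /h (dy_refine m n 1) mul1n.
pose bad n om : R := (1 - goodp f y (m + n) (2 ^ n) om)%R.
have mbad n : measurable_fun setT (bad n) by apply: measurable_funB => //; exact: measurable_goodp.
have bad01 n om : (0 <= bad n om <= 1)%R.
  by rewrite /bad; case: (goodp01 f01 y (m + n) (2 ^ n) om) => ->; rewrite ?subrr ?subr0 ?lexx ?ler01.
have bad0 n om : (0 <= bad n om)%R by case/andP: (bad01 n om).
pose Z om := B rho (y + Y h om).
have mZ : measurable_fun setT Z := measurableT_comp (mB rho) (measurable_end LP y h0).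
have Z0 om : (0 <= Z om)%R by case/andP: (B01 rho (y + Y h om)).
have Z1 om : (Z om <= 1)%R by exact: B1.
have badI n : \int[P]_om (Z om * bad n om)%:E <= (c * p2)%:E.
  have f_c z i : (i <= 2 ^ n)%N -> f z = 0%R -> \int[P]_om (B rho (z + Y (dyR (m + n) i) om))%:E <= c%:E.
    move=> i2 fz; apply: hit; last by rewrite dy_ge0/= (hE n) ler_dy.
    move: fz; rewrite /f indicE; have [|hz _] := boolP (_ \in _); first by move=> _ /eqP; rewrite oner_eq0.
    apply: (le_trans yr); rewrite leNgt; apply: contra hz => hz.
    by rewrite inE /ecball/= subr0 ltW.
  have := grid_hit mf (mB rho) f01 (B01 rho) y c0 f_c; rewrite -(hE n) => /le_trans; apply.
  rewrite [leRHS]EFinM; apply: lee_wpmul2l; first by rewrite lee_fin.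
  apply: le_trans H3; rewrite -[X in P X]setIT -integral_indic//; last exact: measurable_leaves.
  apply: ge0_le_lower_integral => om _; first by rewrite lee_fin; exact: (bad0 n om).
  rewrite lee_fin indicE; have [lo|lo] := boolP (om \in leaves m).
    by have /andP[_] := bad01 n om.
  rewrite -/(bad n om) /bad /goodp big1 ?subrr// => j _; rewrite /f indicE mem_set//.
  rewrite /ecball/= subr0; apply: (le_trans (ler_enormD _ _)); rewrite lerD2l leNgt.
  apply: contra lo => lo; rewrite inE; exists n, j; split => //; exact: ltn_ord.
(* The supremum over levels detects an excursion at any dyadic time; on the remaining paths
   [decay_loss] applies within radius L. *)
pose badl om : \bar R := ereal_sup (range (fun n => (Z om * bad n om)%:E)).
have badnd om : nondecreasing_seq (fun n => (Z om * bad n om)%:E).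
  apply/nondecreasing_seqP => n; rewrite lee_fin; apply: ler_wpM2l => //.
  rewrite /bad lerD2l lerN2 addnS expnS mul2n.
  have fs01 s : (0 <= f (y + Y s om)%R <= 1)%R.
    by case: (f01 (y + Y s om)%R) => ->; rewrite ?lexx ?ler01.
  exact: (prodf_refine (m + n)%N (2 ^ n)%N fs01).
have mbadl : measurable_fun setT badl.
  apply: (@emeasurable_fun_cvg _ _ _ setT (fun n om => (Z om * bad n om)%:E)).
    by move=> n; apply/measurable_EFinP; exact: measurable_funM.
  by move=> om _; exact: (ereal_nondecreasing_cvgn (badnd om)).
have badl0 om : 0 <= badl om.
  apply: (@le_trans _ _ (Z om * bad 0%N om)%:E); first by rewrite lee_fin mulr_ge0.
  by apply: ereal_sup_ubound; exists 0%N.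
have badlI : \int[P]_om badl om <= (c * p2)%:E.
  apply: (@ge0_integral_sup_le _ _ R P setT (fun n om => (Z om * bad n om)%:E)) => //.
  - by move=> n; apply/measurable_EFinP; exact: measurable_funM.
  - by move=> n om; rewrite lee_fin mulr_ge0.
  - by move=> om M HM; apply: ge_ereal_sup => _ [n _ <-].
pose A1 om := path_integral (cutf U rho1) h (fun s => y + Y s om)%R.
pose A2 om := path_integral U2 h (fun s => y + Y s om)%R * (Z om)%:E.
pose A0 om := decay U h (fun s => y + Y s om)%R * (Z om)%:E.
have mA1 : measurable_fun setT A1 := measurable_pi_Y LP Y0 Yrc mU1 U10 h y.
have mZE : measurable_fun setT (fun om => (Z om)%:E) by apply/measurable_EFinP.
have mA2 : measurable_fun setT A2.
  by apply: emeasurable_funM => //; exact: (measurable_pi_Y LP Y0 Yrc mU2 U20 h y).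
have mA0 : measurable_fun setT A0.
  by apply: emeasurable_funM => //; exact: (measurable_decay LP Y0 Yrc mU U0).
have A10 om : 0 <= A1 om by exact: path_integral_ge0.
have A20 om : 0 <= A2 om by rewrite mule_ge0 ?lee_fin ?path_integral_ge0.
have A00 om : 0 <= A0 om by rewrite mule_ge0 ?lee_fin ?decay_ge0.
have key : \int[P]_om (Z om)%:E <= \int[P]_om (A0 om + (A1 om + (A2 om + badl om))).
  apply: ge0_le_lower_integral => om _; first by rewrite lee_fin.
  have [[n gn]|allg] := pselect (exists n, goodp f y (m + n) (2 ^ n) om = 0%R).
    apply: (@le_trans _ _ (badl om)).
      2: by rewrite addeA addeA; apply: leeDr; exact: (adde_ge0 (adde_ge0 (A00 om) (A10 om)) (A20 om)).
    apply: (@le_trans _ _ (Z om * bad n om)%:E); first by rewrite /bad gn subr0 mulr1.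
    by apply: ereal_sup_ubound; exists n.
  have near s : (0 <= s < h)%R -> (enorm (y + Y s om) < L)%R.
    move=> hs; apply: (@le_lt_trans _ _ (enorm y + 1)%R); last by move: yL; lra.
    have := @dyadic_ecball _ _ _ Y 0%R y (enorm y + 1)%R m h s om (@Yrc om) hs; rewrite subr0; apply=> n j mn hj.
    have jn : (j < 2 ^ (n - m))%N.
      move: hj; rewrite (hE (n - m)%N) subnKC// /dy ler_pM2r ?invr_gt0 ?exprn_gt0//.
      by rewrite ler_nat.
    rewrite leNgt; apply/negP => far; apply: allg; exists (n - m)%N; rewrite subnKC//.
    apply/eqP/prodf_eq0; exists (Ordinal jn) => //=.
    by rewrite /f indicE memNset// /ecball/=; apply/negP; rewrite -ltNge.
  have dl := @decay_loss U h L y om mU U0 h0 near.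
  have PE : path_integral (cutf U L) h (fun s => y + Y s om)%R =
      A1 om + path_integral U2 h (fun s => y + Y s om)%R.
    rewrite (_ : cutf U L = (fun x => cutf U rho1 x + U2 x)%R); last by apply/funext => x; exact: UE.
    rewrite /A1 !(path_integral_rec Y0 Yrc) path_integralD//.
    exact: measurable_rec_shift.
  rewrite PE in dl; have ZE : 0 <= (Z om)%:E by rewrite lee_fin.
  have p20' : 0 <= path_integral U2 h (fun s => y + Y s om)%R by exact: path_integral_ge0.
  rewrite -[leLHS]mul1e; apply: (le_trans (lee_wpmul2r ZE dl)).
  have de0 : 0 <= decay U h (fun s => y + Y s om)%R by exact: decay_ge0.
  rewrite [leLHS](ge0_muleDl _ de0 (adde_ge0 (A10 om) p20')); apply: leeD2l.
  rewrite [leLHS](ge0_muleDl _ (A10 om) p20'); apply: leeD.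
    by rewrite -[leRHS]mule1; apply: lee_wpmul2l => //; rewrite lee_fin.
  by rewrite leeDl.
have mB2 := emeasurable_funD mA2 mbadl.
have B20 om : 0 <= A2 om + badl om by rewrite adde_ge0.
have mB1 := emeasurable_funD mA1 mB2.
have B10 om : 0 <= A1 om + (A2 om + badl om) by rewrite adde_ge0.
rewrite (ge0_intD P mA0 A00 mB1 B10) (ge0_intD P mA1 A10 mB2 B20) (ge0_intD P mA2 A20 mbadl badl0) in key.
apply: (le_trans key); apply: leeD2l.
have -> : (p1 + 2 * c * p2 = p1 + (c * p2 + c * p2))%R by ring.
rewrite !EFinD; apply: leeD; first exact: H1.
apply: leeD; last exact: badlI.
have o2 : occ P Y U2 h y <= p2%:E.
  apply: le_trans H2; apply: ge0_le_lower_integral => om _; first exact: path_integral_ge0.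
  by apply: path_integral_le => // x; rewrite UE lerDr.
apply: (@le_trans _ _ (c%:E * occ P Y U2 h y)); last first.
  by rewrite [leRHS]EFinM; apply: lee_wpmul2l => //; rewrite lee_fin.
apply: (occ_end_le LP Y0 Yrc mU2 U20 (mB rho)) => //.
move=> s z hs Uz; apply: hit => //; apply: (le_trans r1); rewrite leNgt; apply: contra Uz => hz.
by rewrite /U2 /B indicE mem_set ?subrr ?mulr0// /eball/= subr0.
Qed.

(** The constants c, rho and R1 are fixed before U and x0, which affect only the level m0. This
    order of quantifiers makes the final constant independent of V and lambda. *)
Lemma lower_hit : exists c rho R1 : R, [/\ (0 < c)%R, (0 < rho)%R & (rho + 1 < R1)%R] /\
  forall U : rV -> R, measurable_fun setT U -> (forall x, (0 <= U x)%R) ->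
  (forall r, small_occ P Y (cutf U r)) -> forall x0, (R1 <= enorm x0)%R ->
  exists m0, forall m y, (m0 <= m)%N -> (enorm (y - x0) <= 1)%R ->
  (c * dyR m 1 * g x0)%:E <=
  \int[P]_om (decay U (dyR m 1) (fun s => y + Y s om)%R * (B rho (y + Y (dyR m 1) om))%:E).
Proof.
have [cl [rho [Rr [Cl [[cl0 rho0 Rr0 Cl0] ball]]]]] := est_ball LE.
have K1 : (0 < K)%R := lt_le_trans ltr01 (est_K LE).
have Ka : (0 < K * expR a)%R by rewrite mulr_gt0 ?expR_gt0.
pose c1 := (cl / (K * expR a))%R; have c10 : (0 < c1)%R by rewrite divr_gt0.
have rho10 : (0 <= rho + 1)%R by rewrite addr_ge0// ltW.
have [C [t1 [C0 t10 t11 far]]] := occ_far LP Y0 Yrc LE rho10.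
exists (c1 / 2)%R, rho, (Rr + rho + 6)%R; split.
  by split; [rewrite divr_gt0|exact: rho0|lra].
move=> U mU U0 SU x0 hx0.
have g0 := est_g_gt0 LE x0.
pose e := (c1 * g x0)%R; have e0 : (0 < e)%R by rewrite mulr_gt0.
have CK1 : (0 < C * (K * expR a) + 1)%R by rewrite ltr_wpDl// mulr_ge0// ltW.
(* With e = c1 g(x0), the jump has probability at least e h - Cl h^2. The choices of [q], of [p2]
   and of the mesh each limit one error to e h/8, which leaves more than e h/2. *)
pose q := (c1 / (8 * (C * (K * expR a) + 1)))%R.
have q0 : (0 < q)%R by rewrite divr_gt0// mulr_gt0.
pose D := (2 * (2 * expR (rho ^+ 2) * K * K))%R.
have D0 : (0 <= D)%R by rewrite !mulr_ge0 ?expR_ge0.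
have D1 : (0 < D + 1)%R by rewrite ltr_wpDl.
pose p2 := (e / (8 * (D + 1)))%R; have p20 : (0 < p2)%R by rewrite divr_gt0// mulr_gt0.
have Cl1 : (0 < 8 * (Cl + 1))%R by rewrite mulr_gt0// ltr_wpDl.
have h30 : (0 < e / (8 * (Cl + 1)))%R by rewrite divr_gt0.
pose L := (enorm x0 + 3)%R.
have [ta ta0 Hta] := SU (rho + 1)%R q q0.
have [tb tb0 Htb] := SU L p2 p20.
have [ml Hml] := leaves_prob p20.
have [|mt Hmt] := @dy1_small R (Num.min t1 (Num.min ta (Num.min tb (e / (8 * (Cl + 1))))))%R.
  by rewrite !lt_min t10 ta0 tb0 h30.
exists (maxn ml mt) => m y; rewrite geq_max => /andP[mml mmt] yx.
have := Hmt m mmt; rewrite !le_min => /and4P[ht1 hta htb hte].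
set h := dyR m 1 in ht1 hta htb hte *; have h0 : (0 <= h)%R := dy_ge0 R m 1.
have h1 : (h <= 1)%R := le_trans ht1 t11.
have [ny1 ny2] : (enorm y <= enorm x0 + 1 /\ enorm x0 - 1 <= enorm y)%R.
  by have := ler_dist_enorm y x0; move/ler_normlP => [u1 u2]; split; move: u1 u2 yx; lra.
have gy := g_near LE yx.
have pB : (c1 * h * g x0 - Cl * h ^+ 2)%:E <= \int[P]_om (B rho (y + Y h om))%:E.
  have ny : (Rr <= enorm (- y))%R by rewrite enormN; move: hx0 ny2 rho0; lra.
  have BE : \int[P]_om (B rho (y + Y h om))%:E = P [set om | eball (- y) rho (Y h om)].
    have mE : measurable [set om | eball (- y) rho (Y h om)].
      by rewrite -[X in measurable X]setTI; apply: mY => //; exact: measurable_eball.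
    transitivity (\int[P]_om (\1_([set om | eball (- y) rho (Y h om)]) om)%:E); last first.
      by rewrite integral_indic// setIT.
    apply: eq_integral => om _; congr EFin; rewrite /B !indicE; congr (_%:R); congr nat_of_bool.
    by apply/idP/idP; rewrite !inE /eball/= subr0 opprK addrC.
  rewrite BE; apply: le_trans (ball (- y)%R h ny h0).
  rewrite lee_fin lerD2r -[leLHS]mulrAC -[leRHS]mulrAC; apply: ler_wpM2r => //.
  rewrite /c1 mulrAC -mulrA; apply: ler_wpM2l; first exact: ltW.
  rewrite ler_pdivrMr// mulrC; apply: (le_trans (est_exp LE x0 (- y)%R)).
  rewrite ler_wpM2r ?(ltW (est_g_gt0 LE _))// ler_wpM2l// ler_expR ler_piMr ?(est_a LE)//.
  by rewrite enormN ler_norml; apply/andP; split; lra.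
have H1 : occ P Y (cutf U (rho + 1)) h y <= (c1 / 8 * h * g x0)%:E.
  apply: (@le_trans _ _ (C * q * h * g y)%:E).
    apply: (far _ m 1%N q); rewrite ?(ltW q0)//.
    - exact: measurable_cutf.
    - exact: cutf_ge0.
    - move=> z hz; rewrite /cutf indicE memNset ?mulr0// /eball/= subr0.
      by apply/negP; rewrite -leNgt.
    - by move=> z; apply: Hta; rewrite h0.
    - by move: hx0 ny2 Rr0; lra.
  rewrite lee_fin; apply: (@le_trans _ _ (C * q * h * (K * expR a * g x0))%R).
    by apply: ler_wpM2l => //; apply: mulr_ge0 => //; apply: mulr_ge0 => //; exact: ltW.
  have -> : (C * q * h * (K * expR a * g x0) = (C * (K * expR a) * q) * (h * g x0))%R by ring.
  rewrite -[leRHS]mulrA; apply: ler_wpM2r; first by rewrite mulr_ge0// ltW.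
  rewrite /q mulrA ler_pdivrMr ?mulr_gt0//.
  have -> : (c1 / 8 * (8 * (C * (K * expR a) + 1)) = C * (K * expR a) * c1 + c1)%R by field.
  by rewrite lerDl ltW.
have H2 : occ P Y (cutf U L) h y <= p2%:E by apply: Htb; rewrite h0.
have := @hit_split U m y rho (rho + 1)%R L 0%R 0%R (c1 / 8 * h * g x0)%R p2 mU U0 (ltW rho0) (lexx _).
rewrite -/h => /(_ _ _ _ h1 H1 H2 (Hml m mml) (ltW p20)) key.
have {key} : \int[P]_om (B rho (y + Y h om))%:E <=
  \int[P]_om (decay U h (fun s => y + Y s om)%R * (B rho (y + Y h om))%:E)
   + (c1 / 8 * h * g x0 + 2 * (2 * expR (rho ^+ 2) * K * K * h) * p2)%:E.
  by apply: key; rewrite /L; move: ny1 ny2 hx0 Rr0 rho0; lra.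
move=> key; have := le_trans pB key; rewrite -leeBlDr// => {}key.
apply: le_trans key; rewrite -EFinB lee_fin.
have e1 : (2 * (2 * expR (rho ^+ 2) * K * K * h) * p2 <= e / 8 * h)%R.
  have -> : (2 * (2 * expR (rho ^+ 2) * K * K * h) * p2 = (D * p2) * h)%R by rewrite /D; ring.
  apply: ler_wpM2r => //; rewrite /p2 mulrA ler_pdivrMr ?mulr_gt0//.
  have -> : (e / 8 * (8 * (D + 1)) = D * e + e)%R by field.
  by rewrite lerDl ltW.
have e2 : (Cl * h ^+ 2 <= e / 8 * h)%R.
  rewrite expr2 mulrA; apply: ler_wpM2r => //.
  apply: (@le_trans _ _ (Cl * (e / (8 * (Cl + 1))))%R); first exact: ler_wpM2l.
  rewrite mulrA ler_pdivrMr//.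
  have -> : (e / 8 * (8 * (Cl + 1)) = Cl * e + e)%R by field.
  by rewrite lerDl ltW.
have -> : (c1 / 2 * h * g x0 = e / 2 * h)%R by rewrite /e; ring.
have -> : (c1 * h * g x0 = e * h)%R by rewrite /e; ring.
have -> : (c1 / 8 * h * g x0 = e / 8 * h)%R by rewrite /e; ring.
have eh : (0 <= e * h)%R by rewrite mulr_ge0// ltW.
lra.
Qed.

End hit.
End lower.

Section lower2.
Context {R : realType} {dO : measure_display} {Omega : measurableType dO} {d : nat}.
Variables (P : probability Omega R) (Y : R -> Omega -> 'rV[R]_d).
Local Notation rV := 'rV[R]_d.
Local Notation dyR := (@dy R).
Local Notation leb := (@lebesgue_measure R).
Hypothesis LP : levy_process P Y.
Hypothesis Y0 : forall w, Y 0 w = 0.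
Hypothesis Yrc : forall w, rcont (Y ^~ w).
Local Open Scope ereal_scope.

Let mY := levy_measurable LP.

Section green.
Variable V : rV -> R.
Hypothesis mV : measurable_fun setT V.
Variable x0 : rV.
Hypothesis V0 : forall z, (enorm (z - x0) < 1)%R -> (0 <= V z)%R.
Local Notation Vp := (V^\+)%R.
Local Notation Vm := (V^\-)%R.
Local Notation f := (\1_(eball x0 1) : rV -> R).

(** For t before the exit time all grid points up to t lie in the ball, and the weight at t is at
    most the weight at the last grid point before t. A single level m thus bounds the Green
    operator. *)
Lemma V_green_le_sum m (B : R) :
  (forall k, (dyR m 1)%:E * \sum_(i < k) occn P Y Vp f m i x0 <= B%:E) ->
  V_green P Y V (eball x0 1) (fun=> 1%R) x0 <= B%:E.
Proof.
move=> H; have mVp := measurable_Vp mV; have mVm := measurable_Vm mV.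
have mf : measurable_fun setT f by apply: measurable_indic; exact: measurable_eball.
have f0 x : (0 <= f x)%R by [].
pose Q i om := kdecay Y Vp f x0 m i om.
have Q0 i om : 0 <= Q i om by exact: kdecay_ge0.
have mQ i : measurable_fun setT (Q i) := measurable_kdecay LP Y0 Yrc mVp mf (Vp_ge0 V) x0 m i.
apply: (@le_trans _ _ (\int[P]_om \int[leb]_(t in `[0%R, +oo[) Q (dyi m t) om)).
  apply: ge0_le_lower_integral => om _.
    by apply: integral_ge0 => t _; rewrite mule1 expeR_ge0.
  set tau := exit_time _ _.
  rewrite integral_mkcond [leRHS]integral_mkcond; apply: ge0_le_lower_integral => t _.
    by rewrite patchE; case: ifP => // _; rewrite mule1 expeR_ge0.
  rewrite !patchE; case: ifPn => [|_]; last by case: ifP.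
  rewrite inE/= => -[t0 tt]; rewrite mem_set; last by rewrite /= in_itv/= t0.
  have inD s : (0 <= s <= t)%R -> (enorm (Y s om) < 1)%R.
    move=> /andP[s0 st]; rewrite ltNge; apply/negP => h.
    have : tau <= s%:E.
      apply: ereal_inf_lbound; exists s => //; split => //.
      by rewrite /eball/= addrAC subrr add0r; apply/negP; rewrite -leNgt.
    by rewrite leNgt (le_lt_trans _ tt)// lee_fin.
  rewrite mule1 /Q /kdecay big1 ?mul1e; last first.
    move=> j _; rewrite indicE mem_set// /eball/= addrAC subrr add0r; apply: inD.
    rewrite dy_ge0/= (le_trans _ (dy_dyi_lower m t0))// ler_dy//; exact: ltn_ord.
  have Z : path_integral Vm t (fun s => x0 + Y s om)%R = 0.
    rewrite /path_integral integral0_eq// => s; rewrite /= in_itv/= => hs.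
    rewrite /funrneg/= max_r// oppr_le0; apply: V0.
    by rewrite addrAC subrr add0r; exact: inD.
  rewrite path_integral_posneg Z oppe0 adde0 /decay lee_expeR leeN2.
  rewrite !(path_integral_rec Y0 Yrc); apply: path_integral_mono => //.
  - exact: dy_dyi_lower.
  - exact: measurable_rec_shift.
have QI k om : \int[leb]_(t in `[0%R, dyR m k[) Q (dyi m t) om = (dyR m 1)%:E * \sum_(i < k) Q i om.
  by rewrite (@integral_step R (fun i => Q i om)).
have mS k : measurable_fun setT (fun om => (dyR m 1)%:E * \sum_(i < k) Q i om).
  by apply: emeasurable_funM => //; apply: emeasurable_sum => i.
have dE : 0 <= (dyR m 1)%:E by rewrite lee_fin dy_ge0.
apply: (@ge0_integral_sup_le _ _ R P setT (fun k om => (dyR m 1)%:E * \sum_(i < k) Q i om)) => //.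
- by move=> k om; rewrite mule_ge0// sume_ge0.
- move=> om; apply/nondecreasing_seqP => k; apply: lee_wpmul2l => //.
  by rewrite big_ord_recr/= leeDl.
- by move=> om; apply: integral_ge0.
- move=> om L HL.
  apply: (@ge0_integral_sup_le _ _ R leb `[0%R, +oo[%classic
    (fun k (t : R) => if (t < dyR m k)%R then Q (dyi m t) om else 0)) => //.
  + move=> k; apply: measurable_funTS; apply: measurable_fun_ifT => //.
      exact: measurable_fun_ltr.
    exact: (@measurable_step R (fun i => Q i om)).
  + by move=> k t; case: ifP.
  + move=> t i j ij; case: ifPn => h; last by case: ifP.
    by rewrite (lt_le_trans h)// ler_dy.
  + move=> t M HM; have := HM (dyi m t).+1; case: ifPn => // /negP ht _.
    have [t0|t0] := leP 0%R t; first by case: ht; exact: dy_dyi_gt.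
    by case: ht; apply: (lt_le_trans t0); exact: dy_ge0.
  + move=> k; apply: le_trans (HL k); rewrite -QI integral_mkcond [leRHS]integral_mkcond.
    apply: ge0_le_lower_integral => t _; first by rewrite patchE; case: ifP => // _; case: ifP.
    rewrite !patchE; case: ifPn => [|_]; last by case: ifP.
    rewrite inE/= in_itv/= andbT => t0; case: ifPn => h; last by case: ifP.
    by rewrite mem_set//= in_itv/= t0.
- move=> k; rewrite (le_trans _ (H k))//.
  rewrite (sum_occn LP Y0 Yrc mVp mf (Vp_ge0 V) f0).
  rewrite le_eqVlt; apply/orP; left; apply/eqP; apply: eq_integral => om _.
  by rewrite -QI.
Qed.

End green.

Section eigen.
Variables (V : rV -> R) (lambda : R) (phi : rV -> R).
Hypothesis mV : measurable_fun setT V.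
Hypothesis lambda_gt0 : (0 < lambda)%R.
Hypothesis eig : eigenfunction P Y V lambda phi.
Hypothesis phi_gt0 : forall x, (0 < phi x)%R.
Local Notation Vp := (V^\+)%R.
Local Notation Vm := (V^\-)%R.

Let mphi : measurable_fun setT phi. Proof. by case: eig. Qed.

Lemma eigen_ge t y : (0 < t)%R ->
  \int[P]_om (decay Vp t (fun s => y + Y s om)%R * (phi (y + Y t om))%:E) <= (phi y)%:E.
Proof.
move=> t0; case: eig => _ /(_ t y t0) <-.
have F0 : 0 <= feynman_kac P Y V t phi y.
  by apply: integral_ge0 => om _; rewrite mule_ge0 ?expeR_ge0// lee_fin ltW.
apply: (@le_trans _ _ (feynman_kac P Y V t phi y)); last first.
  rewrite -[leLHS]mul1e; apply: lee_wpmul2r => //.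
  by rewrite lee_fin -expR0 ler_expR mulr_ge0// ltW.
apply: ge0_le_lower_integral => om _; first by rewrite mule_ge0 ?decay_ge0// lee_fin ltW.
apply: lee_wpmul2r; first by rewrite lee_fin ltW.
rewrite /decay lee_expeR leeN2 path_integral_posneg -[leRHS]adde0; apply: leeD2l.
by rewrite oppe_le0; apply: path_integral_ge0; exact: Vm_ge0.
Qed.

(** Since |x0| >= rho + 1, the unit ball at x0 and the target ball are disjoint: at each step the
    contribution of staying and that of landing in the target add up. *)
Lemma lower_iter x0 m rho (i0 A : R) : (0 <= i0)%R -> (0 <= A)%R ->
  (rho + 1 <= enorm x0)%R ->
  (forall y, (enorm y < rho)%R -> (i0 <= phi y)%R) ->
  (forall y, (enorm (y - x0) < 1)%R -> A%:E <= i0%:E *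
     \int[P]_om (decay Vp (dyR m 1) (fun s => y + Y s om)%R * (\1_(eball (0 : rV) rho) (y + Y (dyR m 1) om)%R)%:E)) ->
  forall k y, (enorm (y - x0) < 1)%R ->
  A%:E * \sum_(i < k) occn P Y Vp (\1_(eball x0 1) : rV -> R) m i y <= (phi y)%:E.
Proof.
move=> i00 A0 hx0 Hi HA.
set f : rV -> R := \1_(eball x0 1).
have mVp := measurable_Vp mV; have Vp0 := Vp_ge0 V.
have mf : measurable_fun setT f by apply: measurable_indic; exact: measurable_eball.
have f0 x : (0 <= f x)%R by [].
have h0 : (0 < dyR m 1)%R by rewrite /dy mul1r invr_gt0 exprn_gt0.
elim=> [|k IH] y yx; first by rewrite big_ord0 mule0 lee_fin ltW.
have := eigen_ge y h0; set h := dyR m 1 in h0 HA *; apply: le_trans.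
pose de om := decay Vp h (fun s => y + Y s om)%R.
pose B om := (\1_(eball (0 : rV) rho) (y + Y h om)%R : R).
have mde : measurable_fun setT de := measurable_decay LP Y0 Yrc mVp Vp0 h y.
have my := measurable_end LP y (ltW h0).
have mB : measurable_fun setT B.
  by apply: (measurableT_comp _ my); apply: measurable_indic; exact: measurable_eball.
have mfy : measurable_fun setT (fun om => (f (y + Y h om))%:E) := measurable_endE LP y mf (ltW h0).
have mphiy : measurable_fun setT (fun om => (phi (y + Y h om))%:E) := measurable_endE LP y mphi (ltW h0).
have de0 om : 0 <= de om by exact: decay_ge0.
have p0 om : 0 <= (phi (y + Y h om))%:E by rewrite lee_fin ltW.
apply: (@le_trans _ _ (\int[P]_om ((f (y + Y h om))%:E * de om * (phi (y + Y h om))%:E +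
   i0%:E * (de om * (B om)%:E)))); last first.
  apply: ge0_le_lower_integral => om _.
    by rewrite adde_ge0 ?mule_ge0 ?lee_fin// ltW.
  rewrite -/(de om) /f /B !indicE; set z := (y + Y h om)%R.
  have [zD|zD] := boolP (z \in eball x0 1).
    rewrite memNset ?mule0 ?adde0 ?mul1e//; move: zD; rewrite inE /eball/= subr0 => zD zB.
    by have := ler_dist_enorm z x0; move/ler_normlP => [u1 _]; move: u1 zD zB hx0; lra.
  rewrite !mul0e add0e; have [zB|_] := boolP (z \in eball 0 rho); last first.
    by rewrite !mule0; apply: mule_ge0; [exact: de0|exact: p0].
  rewrite mule1 muleC; apply: lee_wpmul2l => //; rewrite lee_fin; apply: Hi.
  by move: zB; rewrite inE /eball/= subr0.
have m1 : measurable_fun setT (fun om => (f (y + Y h om))%:E * de om * (phi (y + Y h om))%:E).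
  by apply: emeasurable_funM => //; exact: emeasurable_funM.
have m2 : measurable_fun setT (fun om => de om * (B om)%:E).
  by apply: emeasurable_funM => //; apply/measurable_EFinP.
have n1 om : 0 <= (f (y + Y h om))%:E * de om * (phi (y + Y h om))%:E.
  by rewrite !mule_ge0// lee_fin.
have n2 om : 0 <= de om * (B om)%:E by rewrite mule_ge0// lee_fin.
have i0E : 0 <= i0%:E by rewrite lee_fin.
have m3 : measurable_fun setT (fun om => i0%:E * (de om * (B om)%:E)) by exact: emeasurable_funM.
rewrite (ge0_intD P m1 n1 m3 (fun om => mule_ge0 i0E (n2 om))) (ge0_intZl P i00 m2 n2) addeC.
have bs : \sum_(i < k.+1) occn P Y Vp f m i y = 1 + \sum_(i < k) occn P Y Vp f m i.+1 y.
  by rewrite big_ord_recl.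
have s0 : 0 <= \sum_(i < k) occn P Y Vp f m i.+1 y.
  by apply: sume_ge0 => i _; exact: occn_ge0.
rewrite bs [leLHS](ge0_muleDr _ _ s0)// mule1; apply: leeD; first exact: HA.
have := Sop_sum_occn LP Y0 Yrc mVp mf Vp0 f0 m k y A0 (lexx 0%R).
rewrite mul0e adde0 => <-; rewrite SopE; apply: ge0_le_lower_integral => om _.
  rewrite !mule_ge0 ?decay_ge0 ?adde_ge0 ?mule_ge0 ?lee_fin ?occn_ge0//.
  by apply: sume_ge0 => i _; exact: occn_ge0.
rewrite -/h -/(de om) mul0e adde0 /f indicE; have [zD|_] := boolP (_ \in _); last by rewrite !mul0e.
rewrite mul1e; apply: lee_wpmul2l => //; apply: IH.
by move: zD; rewrite inE.
Qed.

End eigen.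
End lower2.

(** * A positive lower bound for positive eigenfunctions on bounded sets *)

Section infimum.
Context {R : realType} {dO : measure_display} {Omega : measurableType dO} {d : nat}.
Variables (P : probability Omega R) (Y : R -> Omega -> 'rV[R]_d).
Local Notation rV := 'rV[R]_d.
Local Notation dyR := (@dy R).
Local Notation leb := (@lebesgue_measure R).
Hypothesis LP : levy_process P Y.
Hypothesis Y0 : forall w, Y 0 w = 0.
Hypothesis Yrc : forall w, rcont (Y ^~ w).
Local Open Scope ereal_scope.

Let mY := levy_measurable LP.

Lemma occ_fin (U : rV -> R) m k y : measurable_fun setT U -> (forall x, (0 <= U x)%R) ->
  small_occ P Y U -> occ P Y U (dyR m k) y < +oo.
Proof.
move=> mU U0 SU; have [t0 t00 Ht] := SU 1%R ltr01.
have [m1 Hm1] := dy1_small t00.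
rewrite (dy_refine m m1 k); have h1 := Hm1 (m + m1)%N (leq_addl _ _).
suff H j z : occ P Y U (dyR (m + m1) j) z <= j%:R%:E by apply: (le_lt_trans (H _ y)); rewrite ltry.
elim: j z => [|j IH] z.
  rewrite /occ integral0_eq// => om _; rewrite (_ : dyR (m + m1) 0 = 0)%R; last by rewrite /dy mul0r.
  by rewrite /path_integral set_itv1 integral_set1.
rewrite -[j.+1]add1n dyD (occ_add LP Y0 Yrc mU U0)// ?dy_ge0// natrD EFinD; apply: leeD.
  by apply: Ht; rewrite dy_ge0.
apply: (@le_trans _ _ (\int[P]_om j%:R%:E)).
  by apply: ge0_le_lower_integral => om _; [exact: occ_ge0|exact: IH].
by rewrite integral_cst//= probability_setT mule1.
Qed.

Variables (V : rV -> R) (lambda : R) (phi : rV -> R).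
Hypothesis mV : measurable_fun setT V.
Hypothesis lambda_gt0 : (0 < lambda)%R.
Hypothesis eig : eigenfunction P Y V lambda phi.
Hypothesis phi_gt0 : forall x, (0 < phi x)%R.
Hypothesis SF : strong_feller P Y.
Local Notation Vp := (V^\+)%R.
Local Notation Vm := (V^\-)%R.
Hypothesis SVm : small_occ P Y Vm.
Hypothesis SVp : forall r, small_occ P Y (cutf Vp r).

Let mphi : measurable_fun setT phi. Proof. by case: eig. Qed.
Let mVp := measurable_Vp mV.
Let Vp0 := Vp_ge0 V.
(** Truncated at 1 because the strong Feller property concerns bounded functions, while phi may be
    unbounded. *)
Let psi x := Num.min (phi x) 1%R.
Let mpsi : measurable_fun setT psi. Proof. by apply: measurable_minr. Qed.
Let psi1 x : (psi x <= 1)%R. Proof. by rewrite /psi ge_min lexx orbT. Qed.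
Let psi_gt0 x : (0 < psi x)%R. Proof. by rewrite /psi lt_min phi_gt0 ltr01. Qed.
Let psi0 x : (0 <= psi x)%R. Proof. exact: ltW. Qed.

Let dpsi y om : \bar R := decay Vp 1 (fun s => y + Y s om)%R * (psi (y + Y 1%R om))%:E.
Let mdpsi y : measurable_fun setT (dpsi y).
Proof.
apply: emeasurable_funM; first exact: (measurable_decay LP Y0 Yrc mVp Vp0).
exact: (measurable_endE LP y mpsi ler01).
Qed.
Let dpsi0 y om : 0 <= dpsi y om. Proof. by rewrite mule_ge0 ?decay_ge0// lee_fin. Qed.

Definition ksg y := \int[P]_om dpsi y om.

Lemma ksg_le_phi y : ksg y <= (phi y)%:E.
Proof.
apply: le_trans (eigen_ge lambda_gt0 eig phi_gt0 y ltr01).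
apply: ge0_le_lower_integral => om _; first exact: dpsi0.
by apply: lee_wpmul2l; rewrite ?decay_ge0// lee_fin /psi ge_min lexx.
Qed.

(** Otherwise the integral of the positive part of V over [0, 1] would be infinite almost surely, as
    psi > 0. That of the negative part is finite, so the Feynman-Kac integral would vanish,
    contradicting phi(y) > 0. *)
Lemma ksg_gt0 y : 0 < ksg y.
Proof.
rewrite lt_neqAle integral_ge0 ?andbT; last by move=> om _; exact: dpsi0.
apply/negP => /eqP /esym kz.
pose b om := path_integral Vm 1 (fun s => y + Y s om)%R.
have mb : measurable_fun setT b := measurable_pi_Y LP Y0 Yrc (measurable_Vm mV) (Vm_ge0 V) 1 y.
have b0 om : 0 <= b om by apply: path_integral_ge0; exact: Vm_ge0.
have [N1 [mN1 PN1 N1S]] : {ae P, forall om, setT om -> b om \is a fin_num}.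
  apply: integrable_ae => //; apply/integrableP; split => //.
  rewrite (eq_integral b); last by move=> om _; rewrite gee0_abs.
  have := @occ_fin Vm 0 1 y (measurable_Vm mV) (Vm_ge0 V) SVm.
  by rewrite (_ : dyR 0 1 = 1%R) ?/dy ?expr0 ?divr1.
have [N2 [mN2 PN2 N2S]] : {ae P, forall om, setT om -> dpsi y om = 0}.
  apply/ae_eq_integral_abs; [exact: measurableT|exact: mdpsi|].
  by rewrite (eq_integral (dpsi y))// => om _; rewrite gee0_abs.
have : (phi y)%:E = 0.
  case: eig => _ /(_ 1%R y ltr01) <-; rewrite /feynman_kac /levyE.
  rewrite (@negligible_lower_integral_eq _ _ _ P (N1 `|` N2) _ (fun=> 0)) ?integral0 ?mule0//.
  - exact: measurableU.
  - exact: null_set_setU.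
  move=> om /not_orP[n1 n2].
  have bf : b om \is a fin_num by apply: contrapT => h; apply: n1; apply: N1S => /(_ I).
  have dz : dpsi y om = 0 by apply: contrapT => h; apply: n2; apply: N2S => /(_ I).
  move: dz; rewrite /dpsi => /eqP; rewrite mule_eq0 => /orP[|/eqP[h]]; last first.
    by move: (psi_gt0 (y + Y 1%R om)%R); rewrite h ltxx.
  rewrite /decay expeR_eq0 => /eqP h.
  rewrite path_integral_posneg -/(b om).
  have -> : path_integral Vp 1 (fun s => y + Y s om)%R = +oo.
    by apply: oppe_inj; rewrite h.
  by move: bf; case: (b om) => // r _; rewrite /= mul0e.
by move=> [h]; move: (phi_gt0 y); rewrite h ltxx.
Qed.

Let one : rV -> R := fun=> 1%R.
Let S m := Sop P Y (fun=> 0%R) Vp one m.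
Let psiE x := (psi x)%:E.
Let mpsiE : measurable_fun setT psiE. Proof. exact/measurable_EFinP. Qed.
Let psiE0 x : 0 <= psiE x. Proof. by rewrite lee_fin. Qed.
Let m0 : measurable_fun setT (fun _ : rV => 0%R : R) := measurable_cst _.
Let mone : measurable_fun setT one := measurable_cst _.
Let z0 (x : rV) : (0 <= (fun=> 0%R) x :> R)%R := lexx _.
Let one0 (x : rV) : (0 <= one x)%R := ler01.

Let wn m x := iter (2 ^ m).-1 (S m) psiE x.

Let ksgE m y : ksg y = S m (wn m) y.
Proof.
have -> : S m (wn m) y = iter (2 ^ m) (S m) psiE y.
  by rewrite /wn -[in RHS](prednK (expn_gt0 2 m)).
rewrite /S (iter_Sop LP Y0 Yrc)//; apply: eq_integral => om _.
have -> : dyR m (2 ^ m) = 1%R by rewrite /dy natrX divff// expf_neq0.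
by rewrite /Qop eWU_decay big1 ?mul1e// (_ : dyR m (2 ^ m) = 1%R)// /dy natrX divff// expf_neq0.
Qed.

Let wn0 m x : 0 <= wn m x.
Proof. exact: (@iter_Sop_ge0 _ _ _ _ P Y (fun=> 0%R) Vp one one0 m _ psiE x psiE0). Qed.

Let mwn m : measurable_fun setT (wn m).
Proof. exact: (measurable_iter_Sop LP Y0 Yrc m0 mVp mone z0 Vp0 one0 m _ mpsiE psiE0). Qed.

Let wn1 m x : wn m x <= 1.
Proof.
rewrite /wn; move: (2 ^ m).-1 => k; elim: k x => [|k IH] x; first by rewrite lee_fin psi1.
have one1 (x : rV) : (one x <= 1)%R := lexx _.
apply: le_trans (Sop1_le P Y Vp0 one0 one1 m x); apply: Sop_mono => // z.
exact: (@iter_Sop_ge0 _ _ _ _ P Y (fun=> 0%R) Vp one one0 m _ psiE z psiE0).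
Qed.

Let ksgD m y : ksg y = \int[P]_om (decay Vp (dyR m 1) (fun s => y + Y s om)%R * wn m (y + Y (dyR m 1) om)%R).
Proof. by rewrite (ksgE m) /S SopE; apply: eq_integral => om _; rewrite mul1e. Qed.

(** [ksg] with the killing of the first grid step omitted: an expectation of a bounded function of
    one position, to which the strong Feller property applies. *)
Let un m y := \int[P]_om wn m (y + Y (dyR m 1) om)%R.

Lemma ksg_le_un m y : ksg y <= un m y.
Proof.
rewrite (ksgD m); apply: ge0_le_lower_integral => om _; first by rewrite mule_ge0 ?decay_ge0.
by rewrite -[leRHS]mul1e; apply: lee_wpmul2r => //; exact: decay_le1.
Qed.

(** Omitting the killing on a short first step costs the occupation of the cut-off potential plus
    the probability of a displacement beyond 1, both small uniformly over a ball of starting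
    points. *)
Lemma un_le_ksg (r e : R) : (0 < e)%R -> exists m, forall y, (enorm y <= r)%R -> un m y <= ksg y + e%:E.
Proof.
move=> e0; have e20 : (0 < e / 2)%R by rewrite divr_gt0.
have [ml Hml] := leaves_prob LP Y0 Yrc e20.
have [ta ta0 Hta] := SVp (r + 2)%R e20.
have [mt Hmt] := dy1_small ta0.
exists (maxn ml mt) => y yr; set m := maxn ml mt; set h := dyR m 1.
have h0 : (0 <= h)%R := dy_ge0 R m 1.
have mc := measurable_cutf (r + 2)%R mVp; have c0 := cutf_ge0 (r + 2)%R Vp0.
pose A om := decay Vp h (fun s => y + Y s om)%R * wn m (y + Y h om)%R.
pose B om := path_integral (cutf Vp (r + 2)) h (fun s => y + Y s om)%R.
pose C om : \bar R := (\1_(leaves Y m) om)%:E.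
have mw : measurable_fun setT (fun om => wn m (y + Y h om)%R).
  exact: (measurableT_comp (mwn m) (measurable_end LP y h0)).
have mA : measurable_fun setT A.
  by apply: emeasurable_funM => //; exact: (measurable_decay LP Y0 Yrc mVp Vp0).
have mB : measurable_fun setT B := measurable_pi_Y LP Y0 Yrc mc c0 h y.
have mC : measurable_fun setT C.
  by apply/measurable_EFinP; apply: measurable_indic; exact: (measurable_leaves LP m).
have A0 om : 0 <= A om by rewrite mule_ge0 ?decay_ge0.
have B0 om : 0 <= B om by exact: path_integral_ge0.
have C0 om : 0 <= C om by rewrite lee_fin.
have mBC := emeasurable_funD mB mC.
have BC0 om : 0 <= B om + C om by rewrite adde_ge0.
apply: (@le_trans _ _ (\int[P]_om (A om + (B om + C om)))).
  apply: ge0_le_lower_integral => om _; first exact: wn0.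
  have [lo|lo] := boolP (om \in leaves Y m).
    rewrite /C indicE lo; apply: (le_trans (wn1 m _)); rewrite addeA; apply: leeDr.
    exact: adde_ge0.
  have near s : (0 <= s < h)%R -> (enorm (y + Y s om) < r + 2)%R.
    move=> hs; apply: (le_lt_trans (ler_enormD _ _)).
    have nl : ~ leaves Y m om by move=> h'; move/negP: lo; apply; rewrite inE.
    by have := stays_near Yrc nl hs; move: yr; lra.
  have dl := decay_loss Y0 Yrc mVp Vp0 h0 near.
  rewrite -[leLHS]mul1e; apply: (le_trans (lee_wpmul2r (wn0 m _) dl)).
  have de0 : 0 <= decay Vp h (fun s => y + Y s om)%R by exact: decay_ge0.
  rewrite [leLHS](ge0_muleDl _ de0 (B0 om)); apply: leeD2l.
  apply: (@le_trans _ _ (B om)); last by rewrite leeDl.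
  by rewrite -[leRHS]mule1; apply: lee_wpmul2l => //; exact: wn1.
rewrite (ge0_intD P mA A0 mBC BC0) (ge0_intD P mB B0 mC C0) -(ksgD m); apply: leeD2l.
have -> : e = (e / 2 + e / 2)%R by field.
rewrite EFinD; apply: leeD.
  by apply: Hta; rewrite h0 Hmt// leq_maxr.
rewrite integral_indic ?setIT//; last exact: (measurable_leaves LP m).
by apply: Hml; rewrite leq_maxl.
Qed.

Lemma continuous_un m : continuous (un m).
Proof.
pose f x := fine (wn m x).
have wf x : wn m x = (f x)%:E.
  rewrite /f fineK// ge0_fin_numE//; apply: (le_lt_trans (wn1 m x)); by rewrite ltry.
have mf : measurable_fun setT f by apply: measurableT_comp => //; exact: mwn.
have h0 : (0 < dyR m 1)%R by rewrite /dy mul1r invr_gt0 exprn_gt0.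
have := @SF (dyR m 1) f h0 mf.
have -> : (fun x => levyE P Y x (fun w => (f (w (dyR m 1)))%:E)) = un m.
  by apply/funext => x; apply: eq_integral => om _; rewrite wf.
apply; exists 1%R => x.
by rewrite ger0_norm -lee_fin -wf.
Qed.

(** [ksg] need not be continuous, but the continuous [un m] exceed it by an error uniform on balls.
    Positivity at a point therefore gives a positive lower bound near it, and compactness of a cube
    concludes. *)
Lemma phi_bounded_below (r : R) : exists2 i0 : R, (0 < i0)%R & forall y, (enorm y <= r)%R -> (i0 <= phi y)%R.
Proof.
pose A : set rV := [set v | forall i, `[(- r)%R, r]%classic (v ord0 i)].
have cA : compact A.
  by apply: (@rV_compact _ d (fun=> `[(- r)%R, r]%classic)) => i; exact: segment_compact.
have [N _ HN] : \forall n \near \oo, A `<=` (fun y => (n.+1%:R^-1)%:E <= ksg y).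
  apply: (proj1 (compact_near_coveringP A) cA nat \oo (fun n y => (n.+1%:R^-1)%:E <= ksg y) _) => x _.
  have k0 := ksg_gt0 x.
  have [v vE] : exists v, ksg x = v%:E.
    have := ksg_le_phi x; move: k0; case: (ksg x) => [v| |]// _ _; by exists v.
  rewrite vE lte_fin in k0.
  (* Near x the continuous [un m] stays above v/2; subtracting the error v/4 leaves v/4 for
     [ksg]. *)
  have [m Hm] := @un_le_ksg (enorm x + 1)%R (v / 4)%R (divr_gt0 k0 (ltr0n _ 4)).
  have nb : \forall y \near x, (v / 2)%:E < un m y.
    have hn : nbhs (un m x) [set z | (v / 2)%:E < z].
      apply: open_nbhs_nbhs; split; first exact: open_ereal_gt_ereal.
      by apply: lt_le_trans (ksg_le_un m x); rewrite vE lte_fin ltr_pdivrMr// ltr_pMr// ltr1n.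
    exact: (@continuous_un m x _ hn).
  have ne : \forall y \near x, (enorm y < enorm x + 1)%R.
    by apply: (cvgr_lt _ (@continuous_enorm R d x)); rewrite ltrDl.
  have nn : \forall n \near \oo, (n.+1%:R^-1 <= v / 4 :> R)%R.
    exists (Num.truncn (v / 4)^-1) => // n /= hn.
    rewrite -[leRHS]invrK lef_pV2 ?posrE ?invr_gt0 ?divr_gt0//.
    apply: (le_trans (ltW (truncnS_gt _))); by rewrite ler_nat.
  near=> y n => /=.
  have h1 : (v / 2)%:E < un m y by near: y.
  have h2 : (enorm y <= enorm x + 1)%R by apply/ltW; near: y.
  have h3 : (n.+1%:R^-1 <= v / 4)%R by near: n.
  have := lt_le_trans h1 (Hm y h2); case: (ksg y) => [s| |]//; last by rewrite leey.
  rewrite -EFinD => hlt; rewrite lte_fin in hlt; rewrite lee_fin; apply: (le_trans h3).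
  have E : (v / 2 = v / 4 + v / 4)%R by field.
  by rewrite E ltrD2r in hlt; exact: ltW.
exists (N.+1%:R^-1)%R; first by rewrite invr_gt0.
move=> y yr; rewrite -lee_fin; apply: le_trans (ksg_le_phi y); apply: (HN N) => //= i.
rewrite /= in_itv/= -ler_norml; exact: le_trans (coord_le_enorm y i) yr.
Unshelve. all: by end_near. Qed.

End infimum.

(** * Transfer to the modification and conclusion *)

Section small_occ_kato.
Context {R : realType} {dO : measure_display} {Omega : measurableType dO} {d : nat}.
Variables (P : probability Omega R) (X Y : R -> Omega -> 'rV[R]_d).
Hypothesis XY : forall x F, levyE P X x F = levyE P Y x F.

Lemma kato_small_occ (U : 'rV[R]_d -> R) : (forall x, 0 <= U x) -> kato P X U -> small_occ P Y U.
Proof.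
move=> U0 [_ cv] e e0.
have hn : nbhs (0%E : \bar R) [set z | (z < e%:E)%E].
  by apply: open_nbhs_nbhs; split; [exact: open_ereal_lt_ereal|rewrite /= lte_fin].
have [t0 /= t00 Ht] := cv _ hn.
exists (t0 / 2); first by rewrite divr_gt0.
move=> t y /andP[]; rewrite le_eqVlt => /orP[/eqP <- _|t_gt0 tt].
  rewrite /occ integral0_eq ?lee_fin ?ltW// => om _.
  by rewrite /path_integral set_itv1 integral_set1.
apply/ltW; apply: le_lt_trans (Ht t _ t_gt0); last first.
  rewrite /= sub0r normrN gtr0_norm//; apply: (le_lt_trans tt).
  by rewrite ltr_pdivrMr// ltr_pMr// ltr1n.
apply: ereal_sup_ubound; exists y; first by [].
transitivity (levyE P Y y (path_integral (fun z => `|U z|) t)); first exact: XY.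
by apply: eq_integral => om _; apply: eq_integral => s _; rewrite ger0_norm.
Qed.

Lemma strong_feller_ext : strong_feller P X -> strong_feller P Y.
Proof.
move=> H t f t0 mf fM; have := H t f t0 mf fM.
by rewrite (_ : (fun x => levyE P X x _) = (fun x => levyE P Y x (fun w => (f (w t))%:E)))//; apply/funext.
Qed.

Lemma eigenfunction_ext V lambda phi : eigenfunction P X V lambda phi -> eigenfunction P Y V lambda phi.
Proof. by move=> [mphi H]; split => // t x t0; rewrite -(H t x t0) /feynman_kac XY. Qed.

Lemma V_green_ext V D f x : V_green P X V D f x = V_green P Y V D f x.
Proof. exact: XY. Qed.

End small_occ_kato.

Section lower_bound.
Context {R : realType} {dO : measure_display} {Omega : measurableType dO} {d : nat}.
Variables (P : probability Omega R) (Y : R -> Omega -> 'rV[R]_d).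
Hypothesis LP : levy_process P Y.
Hypothesis Y0 : forall w, Y 0 w = 0.
Hypothesis Yrc : forall w, rcont (Y ^~ w).
Hypothesis SF : strong_feller P Y.
Variables (nu g w : 'rV[R]_d -> R) (a K : R).
Hypothesis LE : levy_estimates P Y nu g w a K.
Local Notation rV := 'rV[R]_d.

Lemma lower_bound : exists C : (rV -> R) -> R, (forall phi, 0 < C phi) /\
  forall (V : rV -> R) (lambda : R), measurable_fun setT V ->
  small_occ P Y V^\- -> (forall r, small_occ P Y (cutf V^\+ r)) -> confining V -> 0 < lambda ->
  exists r : R, 0 < r /\ forall phi : rV -> R, (forall x, 0 < phi x) -> eigenfunction P Y V lambda phi ->
    forall x, r <= enorm x ->
      ((C phi)%:E * V_green P Y V (eball x 1) (fun=> 1%R) x * (nu x)%:E <= (phi x)%:E)%E.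
Proof.
have [c [rho [R1 [[c0 rho0 R1rho] hit]]]] := lower_hit LP Y0 Yrc LE.
(* The constant has to be a function of phi alone, defined before V and lambda are given. The
   default 1 covers functions whose infimum on the ball is not positive; eigenfunctions are never in
   that case. *)
pose iota (phi : rV -> R) := inf [set phi y | y in eball 0 rho].
pose C phi := if 0 < iota phi then c * iota phi else 1.
exists C; split; first by move=> phi; rewrite /C; case: ifPn => // h; rewrite mulr_gt0.
move=> V lambda mV SVm SVp conf l0.
have [r0 Hr0] := conf 0.
pose r := Num.max R1 (Num.max (r0 + 1) 1).
have r1 : 1 <= r by rewrite /r !le_max lexx !orbT.
exists r; split; first exact: lt_le_trans r1.
move=> phi phi0 eig x hx.
have hR : R1 <= enorm x by apply: le_trans hx; rewrite /r le_max lexx.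
have gE := est_nu LE (le_trans r1 hx); have g0 := est_g_gt0 LE x.
have [i1 i10 Hi1] := phi_bounded_below LP Y0 Yrc mV l0 eig phi0 SF SVm SVp rho.
have B0 : eball (0 : rV) rho 0 by rewrite /eball/= subrr enorm0.
have lb : has_lbound [set phi y | y in eball 0 rho].
  by exists 0 => _ [y _ <-]; exact: ltW.
have i0 : 0 < iota phi.
  apply: (lt_le_trans i10); apply: lb_le_inf; first by exists (phi 0); exists 0.
  by move=> _ [y yB <-]; apply: Hi1; move: yB; rewrite /eball/= subr0 => /ltW.
have Hi y : enorm y < rho -> iota phi <= phi y.
  by move=> hy; apply: ge_inf => //; exists y => //; rewrite /eball/= subr0.
have -> : C phi = c * iota phi by rewrite /C i0.
have [m0 Hm0] := hit V^\+ (measurable_Vp mV) (Vp_ge0 V) SVp x hR.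
have h0 : 0 < dy R m0 1 by rewrite /dy mul1r invr_gt0 exprn_gt0.
pose A := iota phi * (c * dy R m0 1 * g x).
have A0 : 0 <= A by rewrite !mulr_ge0// ltW.
have V0 z : enorm (z - x) < 1 -> 0 <= V z.
  move=> hz; apply: Hr0; have h1 : r0 + 1 <= enorm x.
    by apply: le_trans hx; rewrite /r !le_max lexx orbT.
  by have := ler_dist_enorm z x; move/ler_normlP => [h2 _]; move: h1 hz h2; lra.
have hrho : rho + 1 <= enorm x by apply: le_trans hR; exact: ltW.
have HA y : enorm (y - x) < 1 -> (A%:E <= (iota phi)%:E *
     \int[P]_om (decay (V^\+)%R (dy R m0 1) (fun s => y + Y s om)%R * (\1_(eball (0 : rV) rho) (y + Y (dy R m0 1) om)%R)%:E))%E.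
  move=> yx; rewrite EFinM; apply: lee_wpmul2l; first by rewrite lee_fin ltW.
  by apply: Hm0 => //; exact: ltW.
have it := lower_iter LP Y0 Yrc mV l0 eig phi0 (ltW i0) A0 hrho Hi HA.
set D := c * iota phi * g x.
have D0 : 0 < D by rewrite !mulr_gt0.
have h k : ((dy R m0 1)%:E * \sum_(i < k) occn P Y (V^\+)%R (\1_(eball x 1) : rV -> R) m0 i x <= (phi x / D)%:E)%E.
  have := it k x; rewrite subrr enorm0 => /(_ ltr01) hk.
  have -> : (phi x / D)%:E = (D^-1%:E * (phi x)%:E)%E by rewrite -EFinM mulrC.
  rewrite lee_pdivlMl//; apply: le_trans hk; rewrite muleA -EFinM.
  by rewrite le_eqVlt; apply/orP; left; apply/eqP; congr (_%:E * _)%E; rewrite /A /D; ring.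
have Vg := V_green_le_sum LP Y0 Yrc mV V0 h.
rewrite -gE muleAC -EFinM -/D.
apply: (le_trans (lee_wpmul2l _ Vg)); first by rewrite lee_fin ltW.
by rewrite -EFinM lee_fin mulrC divfK// gt_eqF.
Qed.

End lower_bound.

Theorem theorem2p2 (R : realType) (dO : measure_display)
    (Omega : measurableType dO) (P : probability Omega R) (d : nat)
    (X : R -> Omega -> 'rV[R]_d) (nu : 'rV[R]_d -> R)
    (d_gt0 : (0 < d)%N) (X_regular : regular_jump_levy P X nu) :
  (forall (V : 'rV[R]_d -> R) (lambda : R),
     kato_potential P X V -> confining V -> 0 < lambda ->
     exists C5 r : R, [/\ 0 < C5, 0 < r &
       forall phi : 'rV[R]_d -> R,
         (exists M : R, forall x, `|phi x| <= M) ->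
         eigenfunction P X V lambda phi ->
         forall x, r <= enorm x ->
           ((`|phi x|)%:E <= (C5 * sup_norm phi)%:E
              * V_green P X V (eball x 1) (fun=> 1%R) x * (nu x)%:E)%E])
  /\
  (exists C6 : ('rV[R]_d -> R) -> R, (forall phi, 0 < C6 phi) /\
     forall (V : 'rV[R]_d -> R) (lambda : R),
     kato_potential P X V -> confining V -> 0 < lambda ->
     exists r : R, 0 < r /\
       forall phi : 'rV[R]_d -> R,
         (forall x, 0 < phi x) ->
         eigenfunction P X V lambda phi ->
         forall x, r <= enorm x ->
           ((C6 phi)%:E * V_green P X V (eball x 1) (fun=> 1%R) x * (nu x)%:E
              <= (phi x)%:E)%E).
Proof.
have [LPX A1X [SFX _] _] := X_regular.
have [Y [LP Y0 Yrc A1 XY]] := regular_modification LPX A1X.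
have [g [w [a [K LE]]]] := exists_levy_estimates d_gt0 (levy_measurable LP) A1.
have SF := strong_feller_ext XY SFX.
split=> [V lambda [mV katoVm _] conf l0|].
  have SVm := kato_small_occ XY (Vm_ge0 V) katoVm.
  have [C [r [C0 r0 H]]] := upper_bound LP Y0 Yrc mV LE SVm conf l0.
  exists C, r; split => // phi phiM eig x hx; rewrite (V_green_ext XY).
  exact: (H phi phiM (eigenfunction_ext XY eig) x hx).
have [C [C0 H]] := lower_bound LP Y0 Yrc SF LE.
exists C; split => // V lambda [mV katoVm katoVp] conf l0.
have SVm := kato_small_occ XY (Vm_ge0 V) katoVm.
(* The local Kato condition speaks of balls of positive radius; for r <= 0 the ball is empty and the
   cut-off potential vanishes. *)
have SVp r : small_occ P Y (cutf V^\+ r).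
  have [r0|r0] := ltP 0 r.
    apply: (kato_small_occ XY (cutf_ge0 r (Vp_ge0 V))).
    by case: katoVp => _ /(_ 0 r r0).
  have -> : cutf V^\+ r = fun=> 0.
    apply/funext => x; rewrite /cutf indicE memNset ?mulr0// /eball/=.
    by apply/negP; rewrite -leNgt (le_trans r0)// enorm_ge0.
  move=> e e0; exists 1 => // t y _; rewrite /occ integral0_eq ?lee_fin ?ltW// => om _.
  by rewrite /path_integral integral0_eq.
have [r [r0 Hr]] := H V lambda mV SVm SVp conf l0.
exists r; split => // phi phi0 eig x hx; rewrite (V_green_ext XY).
exact: (Hr phi phi0 (eigenfunction_ext XY eig) x hx).
Qed.
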